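(* Assume the Riemann Hypothesis. Let $\mathcal{L}(T)$ and $\beta=\beta(T)$, defined for $T\ge 3$, be two non-decreasing continuous functions satisfying $1\le \beta(T)\ll \log^3 T$ and $\log T\ll \mathcal{L}(T)\ll \beta(T)\log^2 T$. Let $W=W(x)$ be an increasing function with $W(x)\gg (\log x)^A$ for a large constant $A$. Suppose that, with $\beta=\beta(T)$, $$F_{\beta}(x,T)\ll T\,\mathcal{L}(T)\qquad\text{uniformly for}\quad W(x)\ll T\ll x^{1/2}\log^2 x .$$ Then, as $x\to\infty$, $$\mathcal{R}(x)\ll x^{1/2}\left(\mathcal{M}(x)+(\log W(x))^2\right),\qquad\text{where}\quad \mathcal{M}(x):=\sum_{1\le k\ll \log x}\sqrt{\frac{\mathcal{L}(2^k)}{\beta(2^k)}} .$$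
   Context: $\Lambda$ is the von Mangoldt function, $\psi(x)=\sum_{n\le x}\Lambda(n)$, and $\mathcal{R}(x)$ is defined by $\psi(x)=x+\mathcal{R}(x)$. For $x>0$, $T\ge 3$, and $\beta\ge 1$, $$F_\beta(x,T):=\sum_{0<\gamma,\gamma'\le T}x^{i(\gamma-\gamma')}w_\beta(\gamma-\gamma'),\qquad w_\beta(u)=\frac{4\beta^2}{4\beta^2+u^2},$$ where $\gamma,\gamma'$ run over the imaginary parts of the nontrivial zeros of the Riemann zeta-function, counted with multiplicity. Conventions. $f\ll g$ means $|f|\le Kg$ for some constant $K$; $f\gg g$ means $g\ll f$; $\log^m T=(\log T)^m$. A bound ''uniformly for $W(x)\ll T\ll x^{1/2}\log^2x$'' means: for any fixed constants $c,C>0$ the bound holds, with an implied constant depending only on $c,C$, for all $x\ge 2$ and $T\ge 3$ with $cW(x)\le T\le Cx^{1/2}\log^2x$. The implied constant in the conclusion may depend on the implied constants in the hypotheses. ''For a large constant $A$'' means that $A$ is at least some absolute constant. The range $1\le k\ll\log x$ means $1\le k\le C_0\log x$ for a suitable absolute constant $C_0$. In the $k=1$ term set $\mathcal{L}(2):=\mathcal{L}(3)$ and $\beta(2):=\beta(3)$. *)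

(* Defs.v *)
From HB Require Import structures.
From mathcomp Require Import all_boot all_order all_algebra.
From mathcomp Require Import all_classical all_reals all_analysis.
From mathcomp.real_closed Require Export complex.

Set Implicit Arguments.
Unset Strict Implicit.
Unset Printing Implicit Defensive.

Import Order.TTheory GRing.Theory Num.Theory.
Import numFieldNormedType.Exports.

Local Open Scope classical_set_scope.
Local Open Scope complex_scope.
Local Open Scope ring_scope.

Section PrimeCounting.
Variable R : realType.
Implicit Types (n : nat) (x : R).

Definition vonMangoldt n : R :=
  if [pick p : 'I_n.+1 | prime p && [exists k : 'I_n.+1, (0 < k)%N && (n == p ^ k)%N]]
    is Some p then ln (p : nat)%:R else 0.

Definition chebyshev_psi x : R :=
  \sum_(1 <= n < (Num.truncn x).+1) vonMangoldt n.

Definition psi_remainder x : R := chebyshev_psi x - x.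

End PrimeCounting.

Section Zeta.
Variable R : realType.
(* the regular algebra R[i]^o carries the topology of the complex plane *)
Local Notation C := R[i]^o.
Implicit Types (s rho : C) (f g : C -> C).

(* x ^ s for x > 0 real and s complex, with the real determination of ln x *)
Definition rcpow (x : R) s : C :=
  let t := complex.Im s * ln x in
  (expR (complex.Re s * ln x))%:C * (cos t +i* sin t).

(* The half-plane 0 < Re s contains the critical strip and is connected once 1
   is removed, so it determines the analytic continuation used here; values
   of f outside of it (and at the pole) are unconstrained. *)
Definition continues_zeta f :=
  (forall s, 1 < complex.Re s ->
     [series rcpow n.+1%:R (- s)]_n @ \oo --> f s) /\
  (forall s, 0 < complex.Re s -> s != 1 -> derivable f s 1).

Definition zeta : C -> C := xget (fun=> 0) [set f | continues_zeta f].

Definition nontrivial_zero rho :=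
  0 < complex.Re rho < 1 /\ zeta rho = 0.

Definition riemann_hypothesis :=
  forall rho, nontrivial_zero rho -> complex.Re rho = 1 / 2.

Definition vanishing_order f rho (m : nat) :=
  exists g, [/\ \forall s \near rho, derivable g s 1, g rho != 0 &
    \forall s \near rho, f s = (s - rho) ^+ m * g s].

(* Zeros of a nonzero holomorphic function have exactly one vanishing order;
   0 is a dummy value. *)
Definition multiplicity rho : nat :=
  xget 0%N [set m | vanishing_order zeta rho m].

Definition zeros_upto (T : R) : set C :=
  [set rho | nontrivial_zero rho /\ 0 < complex.Im rho <= T].

Definition pair_weight (beta u : R) : R :=
  4 * beta ^+ 2 / (4 * beta ^+ 2 + u ^+ 2).

(* There are finitely many zeros up to height T, so these finitely supported
   sums range over all pairs; distinct zeros are weighted by multiplicity. *)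
Definition pair_correlation (beta x T : R) : C :=
  \sum_(rho \in zeros_upto T) \sum_(rho' \in zeros_upto T)
    let u := complex.Im rho - complex.Im rho' in
    (multiplicity rho * multiplicity rho')%:R *
      (rcpow x (0 +i* u) * (pair_weight beta u)%:C).

End Zeta.

Arguments riemann_hypothesis R : clear implicits.

Section Dyadic.
Variable R : realType.

(* The value at 2 ^ k; the maximum only affects k <= 1, where f is taken at 3
   because L and beta are defined on [3, +oo[ only. *)
Definition at_dyadic (f : R -> R) (k : nat) : R := f (Num.max 3 (2 ^+ k)).

Definition dyadic_sum (C0 : R) (L beta : R -> R) (x : R) : R :=
  \sum_(1 <= k < (Num.truncn (C0 * ln x)).+1)
    Num.sqrt (at_dyadic L k / at_dyadic beta k).

End Dyadic.

(* Main.v *)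
(* Averaging psi over an interval between x and x + h, |h| = sqrt x, costs O(sqrt x)
   and replaces x^rho / rho in the explicit formula by a kernel K(rho) that decays
   quadratically beyond the height sqrt x. Zeros up to W(x) are estimated by their
   number, which gives log^2 W(x); zeros beyond sqrt x log^2 x contribute O(sqrt x).
   In a dyadic block [P, 2P] partial summation reduces the sum of K(rho) to
   A(t) = sum_(0 < gamma <= t) x^(i gamma) / (2P + i gamma). With p_j = beta + i gamma_j,
   the matrix 1 / (p_j + conj p_k) is positive semidefinite and dominates the rank
   one matrix 2 q / ((p_j + q) (conj p_k + q)), q = 2P - beta, whence
   2 beta q |A(t)|^2 <= F_beta(x, t), and A(t) << sqrt (L(t) / beta(t)).
   The explicit formula rests on the residue theorem for rectangles and on bounds
   for the logarithmic derivative of Y(s) = (s - 1) zeta(s), obtained from finite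
   factorisations Y(s) = prod (s - rho) g(s) by the Borel-Caratheodory inequality. *)
Require Import Defs.
From mathcomp Require Import all_boot all_order all_algebra.
From mathcomp Require Import all_classical all_reals all_analysis.
From mathcomp.real_closed Require Import complex.
From mathcomp Require Import ring lra zify.

Set Implicit Arguments.
Unset Strict Implicit.
Unset Printing Implicit Defensive.

Import Order.TTheory GRing.Theory Num.Theory.
Import numFieldNormedType.Exports.

Local Open Scope classical_set_scope.
Local Open Scope ring_scope.
Local Open Scope complex_scope.
Local Notation Re := complex.Re.
Local Notation Im := complex.Im.


(** * Moduli, integrals and derivatives *)

(** The bound for [A(t)] is pointwise in [t] and involves [beta(t)], which varies with [t], whereas
    partial summation needs the same summands for every [t] in a block. This is why the rank one
    term is taken at [q = 2P - beta(t)]: the denominators [p_j + q] become [2P + i gamma_j] whatever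
    [beta(t)] is. It requires [beta(t) <= P], and here [beta(t) << log^3 t] enters together with a
    large lower bound for [W]. What comes out for the block [[2^k, 2^(k+1)]] has [L] at its right
    end and [beta] at its left end, so it is no term of [M(x)]; since [beta] may jump inside one
    block, it cannot be compared with such a term singly. Only the sums are comparable: the trivial
    bound [sqrt (L / beta) << log t] is used next to the block bound, and [log << L] and
    [beta << log^3] control the jumps on average. A boundary term of that summation is paid for by
    the terms with index between [k1] and [2 k1], so the range of [k] in the conclusion is twice as
    long as the range of heights demands. *)

Section Norm.
Variable R : realType.
Local Notation C := R[i].
(* The norm of [R[i]] is itself complex-valued; [nm] is the modulus in [R]. *)
Definition nm (z : C) : R := Normc.normc z.
Implicit Types (z w : C) (x y : R).

Lemma nm_ge0 z : 0 <= nm z.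
Proof. by case: z => a b; rewrite /nm /Normc.normc sqrtr_ge0. Qed.

Lemma nmD z w : nm (z + w) <= nm z + nm w. Proof. exact: le_normcD. Qed.
Lemma nmN z : nm (- z) = nm z. Proof. exact: normcN. Qed.
Lemma nmB z w : nm (z - w) <= nm z + nm w.
Proof. by rewrite -(nmN w) nmD. Qed.
Lemma nm_distC z w : nm (z - w) = nm (w - z).
Proof. by rewrite -nmN opprB. Qed.
Lemma nmM z w : nm (z * w) = nm z * nm w. Proof. exact: Normc.normcM. Qed.
Lemma nmV z : nm z^-1 = (nm z)^-1. Proof. exact: Normc.normcV. Qed.
Lemma nm0 : nm 0 = 0. Proof. exact: Normc.normc0. Qed.
Lemma nm1 : nm 1 = 1. Proof. exact: Normc.normc1. Qed.
Lemma nmX z n : nm (z ^+ n) = nm z ^+ n.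
Proof. by elim: n => [|n ih]; rewrite ?expr0 ?nm1// !exprS nmM ih. Qed.
Lemma nm_eq0 z : (nm z == 0) = (z == 0).
Proof.
by apply/eqP/eqP => [/Normc.eq0_normc//|->]; rewrite nm0.
Qed.
Lemma nm_gt0 z : (0 < nm z) = (z != 0).
Proof. by rewrite lt_def nm_ge0 andbT nm_eq0. Qed.
Lemma nm_real x : nm x%:C = `|x|.
Proof. by rewrite /nm /Normc.normc /= expr0n addr0 sqrtr_sqr. Qed.
Lemma nm_i : nm 'i = 1.
Proof. by rewrite /nm /Normc.normc /= expr0n expr1n add0r sqrtr1. Qed.
Lemma nm_sqr z : nm z ^+ 2 = Re z ^+ 2 + Im z ^+ 2.
Proof. by case: z => a b; rewrite /nm /Normc.normc sqr_sqrtr// addr_ge0 ?sqr_ge0. Qed.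
Lemma nm_sum I (s : seq I) (P : pred I) (F : I -> C) :
  nm (\sum_(i <- s | P i) F i) <= \sum_(i <- s | P i) nm (F i).
Proof.
elim/big_rec2: _ => [|i y x _ h]; first by rewrite nm0.
by apply: le_trans (nmD _ _) _; rewrite lerD2l.
Qed.
Lemma nm_prod I (s : seq I) (P : pred I) (F : I -> C) :
  nm (\prod_(i <- s | P i) F i) = \prod_(i <- s | P i) nm (F i).
Proof.
by elim/big_rec2: _ => [|i y x _ <-]; rewrite ?nm1 ?nmM.
Qed.
Lemma Re_le_nm z : `|Re z| <= nm z.
Proof.
rewrite -(@ler_pXn2r _ 2)// ?nnegrE ?nm_ge0//.
by rewrite nm_sqr real_normK ?num_real// lerDl sqr_ge0.
Qed.
Lemma Im_le_nm z : `|Im z| <= nm z.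
Proof.
rewrite -(@ler_pXn2r _ 2)// ?nnegrE ?nm_ge0//.
by rewrite nm_sqr real_normK ?num_real// lerDr sqr_ge0.
Qed.
Lemma nm_le_ReIm z : nm z <= `|Re z| + `|Im z|.
Proof.
rewrite -(@ler_pXn2r _ 2)// ?nnegrE ?nm_ge0 ?addr_ge0//.
rewrite nm_sqr sqrrD !real_normK ?num_real// lerD2r.
by rewrite lerDl mulrn_wge0 // mulr_ge0.
Qed.
Lemma nm_conj z : nm z^* = nm z.
Proof. by case: z => a b; rewrite /nm /Normc.normc /= sqrrN. Qed.
Lemma nm_nat n : nm n%:R = n%:R.
Proof. by rewrite -(rmorph_nat (real_complex R)) nm_real normr_nat. Qed.
Lemma nm_triB z w : nm z - nm w <= nm (z - w).
Proof. by rewrite lerBlDr -{1}(subrK w z) nmD. Qed.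

Lemma ReD z w : Re (z + w) = Re z + Re w. Proof. by case: z w => ? ? []. Qed.
Lemma ImD z w : Im (z + w) = Im z + Im w. Proof. by case: z w => ? ? []. Qed.
Lemma ReN z : Re (- z) = - Re z. Proof. by case: z. Qed.
Lemma ImN z : Im (- z) = - Im z. Proof. by case: z. Qed.
Lemma ReM z w : Re (z * w) = Re z * Re w - Im z * Im w. Proof. by case: z w => ? ? []. Qed.
Lemma ImM z w : Im (z * w) = Re z * Im w + Im z * Re w. Proof. by case: z w => ? ? []. Qed.
Lemma ceqP z w : Re z = Re w -> Im z = Im w -> z = w.
Proof. by case: z w => ? ? [] ? ? /= -> ->. Qed.
Lemma ReS I (s : seq I) (P : pred I) (F : I -> C) :
  Re (\sum_(i <- s | P i) F i) = \sum_(i <- s | P i) Re (F i).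
Proof. by elim/big_rec2: _ => // i y x _ <-; rewrite ReD. Qed.
End Norm.
Arguments nm : simpl never.

(** * Integrals of complex functions of a real variable *)

Section Cint.
Variable R : realType.
Local Notation C := R[i].
Local Notation nm := (@nm R).
Implicit Types (f g : R -> C) (a b c x y : R).

Definition ccont f a b := forall x, a <= x <= b -> forall e, 0 < e ->
  exists2 d, 0 < d & forall y, a <= y <= b -> `|y - x| < d -> nm (f y - f x) < e.

(* The integral over [a, b] of a complex function of a real variable is read off
   primitives of its real and imaginary parts. *)
Definition is_cint f a b (v : C) := exists F G : R -> R,
  [/\ forall x, a <= x <= b -> is_derive x 1 F (Re (f x)),
      forall x, a <= x <= b -> is_derive x 1 G (Im (f x)) &
      v = (F b - F a) +i* (G b - G a)].

Definition cint f a b : C := xget 0 [set v | is_cint f a b v].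

(** Composing with it extends a function that is continuous on [[a, b]] to a continuous function on
    the line, so that primitives have two-sided derivatives at the end points too. *)
Definition clamp a b x := Num.max a (Num.min b x).

Lemma clamp_in a b x : a <= b -> a <= clamp a b x <= b.
Proof.
move=> ab; rewrite /clamp le_max lexx/= ge_max ab/=.
by rewrite ge_min lexx.
Qed.
Lemma clamp_id a b x : a <= x <= b -> clamp a b x = x.
Proof. by move=> /andP[ax xb]; rewrite /clamp min_r// max_r. Qed.
Lemma clamp_lip a b x y : `|clamp a b x - clamp a b y| <= `|x - y|.
Proof.
have H (u v c : R) : `|Num.max c u - Num.max c v| <= `|u - v|.
  rewrite /Num.max; case: ltP => h1; case: ltP => h2; move: h1 h2; rewrite ?subrr ?normr0//.
  - move=> h1 h2; rewrite (gtr0_norm (_ : 0 < u - c)) ?subr_gt0//.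
    by rewrite (le_trans _ (ler_norm _))// lerB.
  - move=> h1 h2; rewrite (ltr0_norm (_ : c - v < 0)) ?subr_lt0//.
    by rewrite distrC (le_trans _ (ler_norm _))// opprB lerB.
have H' (u v c : R) : `|Num.min c u - Num.min c v| <= `|u - v|.
  rewrite /Num.min; case: ltP => h1; case: ltP => h2; move: h1 h2; rewrite ?subrr ?normr0//.
  - move=> h1 h2; rewrite (ger0_norm (_ : 0 <= c - v)) ?subr_ge0//.
    by rewrite (le_trans _ (ler_norm _))// lerB// ltW.
  - move=> h1 h2; rewrite (ler0_norm (_ : u - c <= 0)) ?subr_le0//.
    by rewrite distrC (le_trans _ (ler_norm _))// opprB lerB// ltW.
exact: le_trans (H _ _ _) (H' _ _ _).
Qed.

Lemma real_prim (g : R -> R) a b : a <= b -> continuous g ->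
  exists F : R -> R, forall x, a <= x <= b -> is_derive x 1 F (g x).
Proof.
move=> ab cg.
(* The interval is enlarged by 1 on both sides to keep [a] and [b] interior for the fundamental
   theorem of calculus. *)
exists (fun x => \int[lebesgue_measure]_(t in [set` `[a - 1, x]]) (g t))%R.
move=> x /andP[ax xb].
have [] := @continuous_FTC1_closed R g (a - 1) x (b + 1).
- by rewrite ltr_pwDr.
- apply: continuous_compact_integrable; first exact: segment_compact.
  exact: continuous_subspaceT.
- by rewrite ltrBlDr ltr_pwDr.
- exact: cg.
move=> d1 d2; rewrite -d2; rewrite derive1E; exact: derivableP.
Qed.

Lemma ccont_clamp f a b : a <= b -> ccont f a b ->
  continuous (fun x => Re (f (clamp a b x))) /\ continuous (fun x => Im (f (clamp a b x))).
Proof.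
move=> ab cf; split => x; apply/cvgrPdist_lt => e e0.
all: have [d d0 H] := cf _ (clamp_in x ab) e e0.
all: near=> y; apply: le_lt_trans (H (clamp a b y) (clamp_in y ab) _).
1,3: by rewrite nm_distC -?ReN -?ReD -?ImN -?ImD ?Re_le_nm ?Im_le_nm.
all: apply: le_lt_trans (clamp_lip _ _ _ _) _; rewrite distrC.
all: by near: y; apply: cvgr_dist_lt.
Unshelve. all: by end_near. Qed.

Lemma is_cint_ex f a b : a <= b -> ccont f a b -> exists v, is_cint f a b v.
Proof.
move=> ab cf; have [cr ci] := ccont_clamp ab cf.
have [F HF] := real_prim ab cr; have [G HG] := real_prim ab ci.
exists ((F b - F a) +i* (G b - G a)), F, G; split=> // x xab.
  by have := HF _ xab; rewrite clamp_id.
by have := HG _ xab; rewrite clamp_id.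
Qed.

Lemma real_deriv_le (F H df dh : R -> R) a b : a <= b ->
  (forall x, a <= x <= b -> is_derive x 1 F (df x)) ->
  (forall x, a <= x <= b -> is_derive x 1 H (dh x)) ->
  (forall x, a <= x <= b -> df x <= dh x) -> F b - F a <= H b - H a.
Proof.
move=> ab dF dH le.
have dd x : a <= x <= b -> is_derive x 1 (H - F) (dh x - df x).
  by move=> xab; have := dF _ xab; have := dH _ xab; move=> ? ?; exact: is_deriveB.
have [||c cab] := @MVT_segment R (H - F) (fun x => dh x - df x) a b ab.
- by move=> x; rewrite in_itv/= => /andP[? ?]; apply: dd; rewrite !ltW.
- apply: derivable_within_continuous => x; rewrite in_itv/= => xab.
  by have := dd _ xab; case.
rewrite /= => E; have : 0 <= (dh c - df c) * (b - a).
  by apply: mulr_ge0; rewrite subr_ge0//; apply: le; move: cab; rewrite in_itv.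
rewrite -E -subr_ge0.
have -> : (H - F) b - (H - F) a = H b - F b - (H a - F a) by [].
by lra.
Qed.

Lemma real_deriv_eq (F H df : R -> R) a b : a <= b ->
  (forall x, a <= x <= b -> is_derive x 1 F (df x)) ->
  (forall x, a <= x <= b -> is_derive x 1 H (df x)) -> F b - F a = H b - H a.
Proof.
by move=> ab dF dH; apply/eqP; rewrite eq_le (real_deriv_le ab dF dH)// (real_deriv_le ab dH dF).
Qed.

Lemma is_cint_unique f a b v w : a <= b -> is_cint f a b v -> is_cint f a b w -> v = w.
Proof.
move=> ab [F [G [dF dG ->]]] [F' [G' [dF' dG' ->]]].
by rewrite (real_deriv_eq ab dF dF') (real_deriv_eq ab dG dG').
Qed.

Lemma cintE f a b v : a <= b -> is_cint f a b v -> cint f a b = v.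
Proof.
move=> ab h; have : is_cint f a b (cint f a b).
  by rewrite /cint; have := @xgetPex _ 0 [set v | is_cint f a b v]; apply; exists v.
by move=> h'; exact: is_cint_unique h' h.
Qed.

Lemma cintP f a b : a <= b -> ccont f a b -> is_cint f a b (cint f a b).
Proof.
by move=> ab cf; have [v h] := is_cint_ex ab cf; rewrite (cintE ab h).
Qed.
End Cint.

Section CintTheory.
Variable R : realType.
Local Notation C := R[i].
Local Notation nm := (@nm R).
Implicit Types (f g : R -> C) (a b c x y : R).

Lemma ccontW f a b a' b' : a <= a' -> b' <= b -> ccont f a b -> ccont f a' b'.
Proof.
move=> aa bb cf x /andP[x1 x2] e e0.
have [|d d0 H] := cf x _ e e0; first by rewrite (le_trans aa)// (le_trans x2).
by exists d => // y /andP[y1 y2]; apply: H; rewrite (le_trans aa)// (le_trans y2).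
Qed.

Lemma cint_prim f a b (F G : R -> R) : a <= b ->
  (forall x, a <= x <= b -> is_derive x 1 F (Re (f x))) ->
  (forall x, a <= x <= b -> is_derive x 1 G (Im (f x))) ->
  cint f a b = (F b - F a) +i* (G b - G a).
Proof. by move=> ab dF dG; apply: cintE => //; exists F, G. Qed.

Lemma cint_ext f g a b : a <= b -> (forall x, a <= x <= b -> f x = g x) ->
  cint f a b = cint g a b.
Proof.
move=> ab fg; rewrite /cint; congr (xget _ _); rewrite predeqE => v.
split=> -[F [G [dF dG ->]]]; exists F, G; split=> // x xab.
- by rewrite -fg//; exact: dF.
- by rewrite -fg//; exact: dG.
- by rewrite fg//; exact: dF.
- by rewrite fg//; exact: dG.
Qed.

Lemma cintD f g a b : a <= b -> ccont f a b -> ccont g a b ->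
  cint (fun x => f x + g x) a b = cint f a b + cint g a b.
Proof.
move=> ab /(cintP ab)[F [G [dF dG ->]]] /(cintP ab)[F' [G' [dF' dG' ->]]].
apply: cintE => //; exists (F + F'), (G + G'); split.
- by move=> x xab; rewrite ReD; have := dF _ xab; have := dF' _ xab => *; exact: is_deriveD.
- by move=> x xab; rewrite ImD; have := dG _ xab; have := dG' _ xab => *; exact: is_deriveD.
- by apply: ceqP => /=; rewrite !fctE; ring.
Qed.

Lemma cintZ (k : C) f a b : a <= b -> ccont f a b ->
  cint (fun x => k * f x) a b = k * cint f a b.
Proof.
move=> ab /(cintP ab)[F [G [dF dG ->]]]; case: k => k l.
apply: cintE => //; exists (k *: F - l *: G), (k *: G + l *: F); split.
- move=> x xab; rewrite ReM /=; have := dF _ xab; have := dG _ xab => *.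
  by apply: is_deriveB.
- move=> x xab; rewrite ImM /=; have := dF _ xab; have := dG _ xab => *.
  by apply: is_deriveD.
- apply: ceqP => /=.
    have E t : (k *: F - l *: G) t = k * F t - l * G t by [].
    by rewrite !E; ring.
  have E t : (k *: G + l *: F) t = k * G t + l * F t by [].
  by rewrite !E; ring.
Qed.

Lemma cint_chasles f a b c : a <= b -> b <= c -> ccont f a c ->
  cint f a c = cint f a b + cint f b c.
Proof.
move=> ab bc /(cintP (le_trans ab bc))[F [G [dF dG ->]]].
have -> : cint f a b = (F b - F a) +i* (G b - G a).
  apply: cint_prim => // x /andP[? h]; first by apply: dF; rewrite (le_trans h bc) andbT.
  by apply: dG; rewrite (le_trans h bc) andbT.
have -> : cint f b c = (F c - F b) +i* (G c - G b).
  apply: cint_prim => // x /andP[h ?]; first by apply: dF; rewrite (le_trans ab h).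
  by apply: dG; rewrite (le_trans ab h).
by apply: ceqP => /=; ring.
Qed.

(* The factor 2 comes from bounding real and imaginary parts separately; it
   persists in the estimates derived from this one. *)
Lemma cint_le f a b (g G : R -> R) : a <= b -> ccont f a b ->
  (forall x, a <= x <= b -> is_derive x 1 G (g x)) ->
  (forall x, a <= x <= b -> nm (f x) <= g x) ->
  nm (cint f a b) <= 2 * (G b - G a).
Proof.
move=> ab /(cintP ab)[F [H [dF dH ->]]] dG fg.
have dGN x : a <= x <= b -> is_derive x 1 (- G) (- g x).
  by move=> xab; have := dG _ xab => ?; exact: is_deriveN.
apply: le_trans (nm_le_ReIm _) _ => /=.
have D : forall K dk : R -> R, (forall x, a <= x <= b -> is_derive x 1 K (dk x)) ->
   (forall x, a <= x <= b -> `|dk x| <= g x) -> `|K b - K a| <= G b - G a.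
  move=> K dk dK le; rewrite ler_norml; apply/andP; split.
    rewrite lerNl.
    have := real_deriv_le ab (fun x h => dGN x h) dK.
    have -> : (- G) b - (- G) a = - (G b - G a) by rewrite !fctE; ring.
    rewrite lerNl; apply=> x xab; have := le _ xab.
    by rewrite ler_norml => /andP[].
  apply: (real_deriv_le ab dK dG) => x xab; have := le _ xab.
  exact: le_trans (ler_norm _).
have := D _ _ dF (fun x h => le_trans (Re_le_nm _) (fg x h)).
have := D _ _ dH (fun x h => le_trans (Im_le_nm _) (fg x h)).
lra.
Qed.

Lemma cint_bound f a b M : a <= b -> ccont f a b ->
  (forall x, a <= x <= b -> nm (f x) <= M) -> nm (cint f a b) <= 2 * M * (b - a).
Proof.
move=> ab cf fM.
have := @cint_le f a b (fun=> M) (M *: id) ab cf.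
have -> : (M *: id) b - (M *: id) a = M * (b - a) by rewrite mulrBr.
rewrite mulrA; apply => // x xab.
by have := is_deriveZ M (is_derive_id x 1); rewrite /GRing.scale /= mulr1.
Qed.
End CintTheory.

(** * Complex differentiability *)

Section Cderiv.
Variable R : realType.
Local Notation C := R[i].
Local Notation nm := (@nm R).
Implicit Types (f g : C -> C) (z w d : C).

Definition ccontat f z := forall e, 0 < e -> exists2 d, 0 < d &
  forall w, nm (w - z) < d -> nm (f w - f z) < e.

(** The increment form avoids division and the punctured neighbourhood, and is real-valued
    throughout; [cderivP] identifies it with the derivative of the topological library. *)
Definition cderiv f z d := forall e, 0 < e -> exists2 r, 0 < r &
  forall w, nm (w - z) < r -> nm (f w - f z - d * (w - z)) <= e * nm (w - z).

Definition hol f z := exists d, cderiv f z d.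

Lemma cltP (e : C) : 0 < e -> exists2 r : R, 0 < r & e = r%:C.
Proof.
case: e => x y; rewrite ltcE /= => /andP[/eqP -> x0]; by exists x.
Qed.

Lemma nmE z : `|z| = (nm z)%:C. Proof. by []. Qed.

Let quotE (h x d : C) : h != 0 -> (h^-1 * x - d) * h = x - d * h.
Proof. by move=> h0; rewrite mulrBl mulrAC mulVf// mul1r. Qed.

Lemma cderivP f z d :
  cderiv f z d <-> is_derive (z : C^o) (1 : C^o) (f : C^o -> C^o) (d : C^o).
Proof.
have E : cderiv f z d <->
   (fun h : C^o => h^-1 *: ((f : C^o -> C^o) (h *: 1 + z) - f z)) @ (0 : C^o)^' --> (d : C^o).
  split=> [H|/cvgrPdist_lt H e e0].
    apply/cvgrPdist_lt => _/cltP[e e0 ->].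
    have [r r0 Hr] := H (e / 2) (divr_gt0 e0 (ltr0Sn _ 1)).
    rewrite near_withinE; exists r%:C; first by rewrite /= ltcR.
    move=> h; rewrite /ball /= sub0r normrN nmE ltcR => hr h0.
    rewrite nmE ltcR.
    have hn0 : 0 < nm h by rewrite nm_gt0.
    have := Hr (h + z); rewrite addrK => /(_ hr) {}Hr.
    rewrite nm_distC -(ltr_pM2r hn0) -nmM.
    have -> : h *: (1 : C^o) = h by rewrite [LHS]mulr1.
    have -> : (h^-1 *: (f (h + z) - f z : C^o) - d) * h = f (h + z) - f z - d * h.
      exact: quotE.
    apply: le_lt_trans Hr _; rewrite ltr_pM2r//; lra.
  have e0' : (0 : C) < e%:C by rewrite ltcR.
  have := H _ e0'; rewrite near_withinE => -[_/cltP[r r0 ->] Hr].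
  exists r => // w wr.
  have [->|wz] := eqVneq w z; first by rewrite !subrr mulr0 subr0 nm0 mulr0.
  have wz0 : w - z != 0 by rewrite subr_eq0.
  have hn0 : 0 < nm (w - z) by rewrite nm_gt0.
  have := Hr (w - z).
  rewrite /ball /= sub0r normrN nmE ltcR => /(_ wr wz0).
  have -> : (w - z) *: (1 : C^o) = w - z by rewrite [LHS]mulr1.
  rewrite subrK nmE ltcR -(ltr_pM2r hn0) -nmM.
  by move=> /ltW; rewrite -nmN -mulNr opprB -(quotE (f w - f z) d wz0).
split=> [/E H|[H dE]].
  have dv : derivable (f : C^o -> C^o) (z : C^o) (1 : C^o).
    by apply/cvg_ex; exists (d : C^o).
  by split; [exact: dv|exact: (cvg_lim (@norm_hausdorff _ _) H)].
by apply: (proj2 E); rewrite -dE; exact: H.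
Qed.

Lemma holP f z : hol f z <-> derivable (f : C^o -> C^o) (z : C^o) (1 : C^o).
Proof.
split=> [[d /cderivP[]]//|/derivableP h]; exists ('D_1 (f : C^o -> C^o) z).
exact/cderivP.
Qed.
End Cderiv.

(** * Rules of complex differentiation *)

Section CderivTheory.
Variable R : realType.
Local Notation C := R[i].
Local Notation nm := (@nm R).
Implicit Types (f g : C -> C) (z w d k : C).

Lemma rderivP (F : R -> R) (x d : R) : is_derive x 1 F d <->
  forall e, 0 < e -> exists2 r, 0 < r & forall y, `|y - x| < r ->
    `|F y - F x - d * (y - x)| <= e * `|y - x|.
Proof.
have quotE (h u v : R) : h != 0 -> (h^-1 * u - v) * h = u - v * h.
  by move=> h0; rewrite mulrBl mulrAC mulVf// mul1r.
have E : (fun h : R => h^-1 *: (F (h *: 1 + x) - F x)) @ 0^' --> d <->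
  forall e, 0 < e -> exists2 r, 0 < r & forall y, `|y - x| < r ->
    `|F y - F x - d * (y - x)| <= e * `|y - x|.
  split=> [/cvgrPdist_lt H e e0|H].
    have := H _ e0; rewrite near_withinE => -[r r0 Hr].
    exists r => // y yr.
    have [->|yx] := eqVneq y x; first by rewrite !subrr mulr0 subr0 normr0 mulr0.
    have yx0 : y - x != 0 by rewrite subr_eq0.
    have n0 : 0 < `|y - x| by rewrite normr_gt0.
    have := Hr (y - x); rewrite /ball /= sub0r normrN => /(_ yr yx0).
    rewrite [_ *: 1]mulr1 subrK -(ltr_pM2r n0) -normrM.
    rewrite -normrN -mulNr opprB.
    have -> : (y - x)^-1 *: (F y - F x) = (y - x)^-1 * (F y - F x) by [].
    by rewrite quotE// => /ltW.
  apply/cvgrPdist_lt => e e0.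
  have [r r0 Hr] := H (e / 2) (divr_gt0 e0 (ltr0Sn _ 1)).
  rewrite near_withinE; exists r => // h; rewrite /ball /= sub0r normrN => hr h0.
  have n0 : 0 < `|h| by rewrite normr_gt0.
  have := Hr (h + x); rewrite addrK => /(_ hr) {}Hr.
  rewrite [_ *: 1]mulr1 -(ltr_pM2r n0) -normrM -(normrN ((d - _) * h)) -mulNr opprB.
  have -> : h^-1 *: (F (h + x) - F x) = h^-1 * (F (h + x) - F x) by [].
  by rewrite quotE//; apply: le_lt_trans Hr _; rewrite ltr_pM2r//; lra.
split=> [[h dE]|/E h].
  by apply: (proj1 E); rewrite -dE; exact: h.
have dv : derivable F x 1 by apply/cvg_ex; exists d.
by split=> //; apply: cvg_lim.
Qed.

Lemma cderiv_cont f z d : cderiv f z d -> ccontat f z.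
Proof.
move=> H e e0; have [r r0 Hr] := H 1 ltr01.
have D0 : 0 < 1 + nm d by have := nm_ge0 d; lra.
exists (Num.min r (e / (1 + nm d))); first by rewrite lt_min r0 divr_gt0.
move=> w; rewrite lt_min => /andP[/Hr h1 h2].
have -> : f w - f z = (f w - f z - d * (w - z)) + d * (w - z) by rewrite subrK.
apply: le_lt_trans (nmD _ _) _; rewrite nmM.
move: h2; rewrite ltr_pdivlMr// => h2; lra.
Qed.
Lemma hol_cont f z : hol f z -> ccontat f z.
Proof. by move=> [d /cderiv_cont]. Qed.

Lemma cderiv_unique f z d k : cderiv f z d -> cderiv f z k -> d = k.
Proof. by move=> /cderivP[_ <-] /cderivP[_ <-]. Qed.

Lemma cderiv_cst (c : C) z : cderiv (fun=> c) z 0.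
Proof.
by move=> e e0; exists 1 => // w _; rewrite subrr mul0r subr0 nm0 mulr_ge0 ?nm_ge0// ltW.
Qed.
Lemma cderiv_id z : cderiv id z 1.
Proof.
by move=> e e0; exists 1 => // w _; rewrite mul1r subrr nm0 mulr_ge0 ?nm_ge0// ltW.
Qed.
Lemma cderivD f g z d k : cderiv f z d -> cderiv g z k ->
  cderiv (fun w => f w + g w) z (d + k).
Proof. by move=> /cderivP ? /cderivP ?; apply/cderivP; exact: is_deriveD. Qed.
Lemma cderivN f z d : cderiv f z d -> cderiv (fun w => - f w) z (- d).
Proof. by move=> /cderivP ?; apply/cderivP; exact: is_deriveN. Qed.
Lemma cderivB f g z d k : cderiv f z d -> cderiv g z k ->
  cderiv (fun w => f w - g w) z (d - k).
Proof. by move=> ? ?; apply: cderivD => //; exact: cderivN. Qed.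
Lemma cderivM f g z d k : cderiv f z d -> cderiv g z k ->
  cderiv (fun w => f w * g w) z (f z * k + d * g z).
Proof.
move=> /cderivP df /cderivP dg; apply/cderivP.
have := @is_deriveM _ _ (f : C^o -> C^o) (g : C^o -> C^o) _ _ _ _ df dg.
by rewrite [X in is_derive _ _ _ (_ + X)](mulrC (g z) d).
Qed.
Lemma cderivZ (c : C) f z d : cderiv f z d -> cderiv (fun w => c * f w) z (c * d).
Proof. by move=> h; have := cderivM (cderiv_cst c z) h; rewrite mul0r addr0. Qed.
Lemma cderivV f z d : f z != 0 -> cderiv f z d ->
  cderiv (fun w => (f w)^-1) z (- d / f z ^+ 2).
Proof.
move=> f0 /cderivP[df <-]; apply/cderivP; split; first exact: derivableV.
have aux (x y : C) : - x^-1 * y = - y / x by rewrite !mulNr mulrC.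
by rewrite deriveV//; exact: aux.
Qed.
Lemma cderiv_near f g z d r : 0 < r -> (forall w, nm (w - z) < r -> f w = g w) ->
  cderiv f z d -> cderiv g z d.
Proof.
move=> r0 fg H e e0; have [s s0 Hs] := H e e0.
exists (Num.min r s); first by rewrite lt_min r0.
move=> w; rewrite lt_min => /andP[h1 h2]; rewrite -!fg ?subrr ?nm0//; exact: Hs.
Qed.
Lemma cderiv_comp f g z d k : cderiv g z d -> cderiv f (g z) k ->
  cderiv (fun w => f (g w)) z (k * d).
Proof.
(* With [e1 = e / D] the composed expansions lose [e1 * (nm d + e1 + nm k)], which is at most
   [e1 * D = e]. *)
move=> dg df e e0; set D := nm d + nm k + 1 + e.
have D1 : 1 <= D by rewrite /D; have := nm_ge0 d; have := nm_ge0 k; lra.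
have D0 : 0 < D by lra.
have e10 : 0 < e / D by rewrite divr_gt0.
have e1e : e / D * D = e by rewrite divfK// gt_eqF.
have e1le : e / D <= e by rewrite ler_pdivrMr// ler_peMr// ltW.
have [r r0 Hr] := df _ e10; have [s s0 Hs] := cderiv_cont dg r0.
have [t t0 Ht] := dg _ e10.
exists (Num.min s t); first by rewrite lt_min s0.
move=> w; rewrite lt_min => /andP[/Hs h1 /Ht h2].
have h3 := Hr _ h1.
have h4 : nm (g w - g z) <= (nm d + e / D) * nm (w - z).
  have -> : g w - g z = (g w - g z - d * (w - z)) + d * (w - z) by rewrite subrK.
  by apply: le_trans (nmD _ _) _; rewrite nmM; lra.
have -> : f (g w) - f (g z) - k * d * (w - z) =
  (f (g w) - f (g z) - k * (g w - g z)) + k * (g w - g z - d * (w - z)) by ring.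
apply: le_trans (nmD _ _) _; rewrite nmM.
have h5 : nm k * nm (g w - g z - d * (w - z)) <= nm k * (e / D * nm (w - z)).
  by rewrite ler_wpM2l ?nm_ge0.
have h6 : e / D * nm (g w - g z) <= e / D * ((nm d + e / D) * nm (w - z)).
  by rewrite ler_wpM2l// ltW.
apply: (@le_trans _ _ (e / D * (nm d + e / D + nm k) * nm (w - z))); first lra.
rewrite ler_wpM2r ?nm_ge0// -[leRHS]e1e ler_wpM2l ?ltW//.
by rewrite /D; lra.
Qed.

Lemma hol_cst c z : hol (fun=> c) z. Proof. by exists 0; exact: cderiv_cst. Qed.
Lemma hol_id z : hol id z. Proof. by exists 1; exact: cderiv_id. Qed.
Lemma holD f g z : hol f z -> hol g z -> hol (fun w => f w + g w) z.
Proof. by move=> [d df] [k dg]; exists (d + k); exact: cderivD. Qed.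
Lemma holN f z : hol f z -> hol (fun w => - f w) z.
Proof. by move=> [d df]; exists (- d); exact: cderivN. Qed.
Lemma holB f g z : hol f z -> hol g z -> hol (fun w => f w - g w) z.
Proof. by move=> [d df] [k dg]; exists (d - k); exact: cderivB. Qed.
Lemma holM f g z : hol f z -> hol g z -> hol (fun w => f w * g w) z.
Proof. by move=> [d df] [k dg]; eexists; exact: cderivM df dg. Qed.
Lemma holV f z : f z != 0 -> hol f z -> hol (fun w => (f w)^-1) z.
Proof. by move=> f0 [d df]; eexists; exact: cderivV f0 df. Qed.
Lemma hol_div f g z : hol f z -> hol g z -> g z != 0 -> hol (fun w => f w / g w) z.
Proof. by move=> hf hg g0; apply: holM => //; exact: holV. Qed.
Lemma holX f z n : hol f z -> hol (fun w => f w ^+ n) z.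
Proof.
move=> hf; elim: n => [|n ih]; first exact: hol_cst.
under eq_fun do rewrite exprS; exact: holM.
Qed.
Lemma hol_comp f g z : hol g z -> hol f (g z) -> hol (fun w => f (g w)) z.
Proof. by move=> [d dg] [k df]; eexists; exact: cderiv_comp dg df. Qed.
Lemma hol_near f g z r : 0 < r -> (forall w, nm (w - z) < r -> f w = g w) ->
  hol f z -> hol g z.
Proof. by move=> r0 fg [d df]; exists d; exact: cderiv_near fg df. Qed.
Lemma hol_sum (I : Type) (s : seq I) (F : I -> C -> C) z :
  (forall i, hol (F i) z) -> hol (fun w => \sum_(i <- s) F i w) z.
Proof.
move=> h; elim: s => [|i s ih].
  by under eq_fun do rewrite big_nil; exact: hol_cst.
by under eq_fun do rewrite big_cons; exact: holD.
Qed.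
Lemma hol_prod (I : Type) (s : seq I) (F : I -> C -> C) z :
  (forall i, hol (F i) z) -> hol (fun w => \prod_(i <- s) F i w) z.
Proof.
move=> h; elim: s => [|i s ih].
  by under eq_fun do rewrite big_nil; exact: hol_cst.
by under eq_fun do rewrite big_cons; exact: holM.
Qed.
Lemma hol_subC w z : hol (fun s => s - w) z.
Proof. by apply: holB; [exact: hol_id|exact: hol_cst]. Qed.
Lemma cderiv_subC w z : cderiv (fun s => s - w) z 1.
Proof. by rewrite -[1]subr0; apply: cderivB; [exact: cderiv_id|exact: cderiv_cst]. Qed.

(** Restriction to a line is the bridge from complex derivatives to the real mean value theorem and
    to primitives in the sense of [is_cint]. *)
Lemma path_deriv f z d k (t : R) : cderiv f (z + t%:C * k) d ->
  is_derive t 1 (fun u : R => Re (f (z + u%:C * k))) (Re (d * k)) /\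
  is_derive t 1 (fun u : R => Im (f (z + u%:C * k))) (Im (d * k)).
Proof.
move=> H.
have K1 : 0 < nm k + 1 by have := nm_ge0 k; lra.
have G e : 0 < e -> exists2 r, 0 < r & forall y : R, `|y - t| < r ->
  nm (f (z + y%:C * k) - f (z + t%:C * k) - (d * k) * (y - t)%:C) <= e * `|y - t|.
  move=> e0; have [r r0 Hr] := H _ (divr_gt0 e0 K1).
  exists (r / (nm k + 1)); first by rewrite divr_gt0.
  move=> y; rewrite ltr_pdivlMr// => yr.
  have E : z + y%:C * k - (z + t%:C * k) = (y - t)%:C * k by rewrite rmorphB; ring.
  have := Hr (z + y%:C * k); rewrite E nmM nm_real.
  have h0 : `|y - t| * nm k < r by apply: le_lt_trans yr; rewrite ler_wpM2l//; lra.
  move=> /(_ h0); have -> : d * ((y - t)%:C * k) = d * k * (y - t)%:C by ring.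
  move=> h; apply: le_trans h _.
  have qe : e / (nm k + 1) * (nm k + 1) = e by rewrite divfK// gt_eqF.
  move: qe h0; set q := e / _ => qe h0.
  have q0 : 0 <= q * `|y - t| by rewrite mulr_ge0 // divr_ge0 ?ltW.
  have -> : e * `|y - t| = q * (`|y - t| * nm k) + q * `|y - t| by rewrite -{1}qe; ring.
  by rewrite lerDl.
split; apply/rderivP => e e0; have [r r0 Hr] := G e e0; exists r => // y yr;
  apply: le_trans (Hr y yr).
- apply: le_trans (Re_le_nm _); rewrite !ReD !ReN [Re (d * k * _)]ReM /=.
  by rewrite mulr0 subr0.
- apply: le_trans (Im_le_nm _); rewrite !ImD !ImN [Im (d * k * _)]ImM /=.
  by rewrite mulr0 add0r.
Qed.

(** Mean value inequality for real and imaginary part separately, whence the factor 2. *)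
Lemma seg_bound f (df : C -> C) z w M :
  (forall t : R, 0 <= t <= 1 -> cderiv f (z + t%:C * (w - z)) (df (z + t%:C * (w - z)))) ->
  (forall t : R, 0 <= t <= 1 -> nm (df (z + t%:C * (w - z))) <= M) ->
  nm (f w - f z) <= 2 * M * nm (w - z).
Proof.
move=> dfH leM; set N := M * nm (w - z).
have D (t : R) (h : 0 <= t <= 1) := path_deriv (dfH t h).
have B (t : R) : 0 <= t <= 1 -> nm (df (z + t%:C * (w - z)) * (w - z)) <= N.
  by move=> h; rewrite nmM ler_wpM2r ?nm_ge0 ?leM.
have e1 : z + 1%:C * (w - z) = w by rewrite mul1r; ring.
have e0 : z + 0%:C * (w - z) = z by rewrite mul0r addr0.
have lin (c : R) (t : R) : is_derive t 1 (c *: (id : R -> R)) c.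
  by have := is_deriveZ c (is_derive_id t 1); rewrite [c *: 1]mulr1.
have K (F dF : R -> R) : (forall t : R, 0 <= t <= 1 -> is_derive t 1 F (dF t)) ->
  (forall t : R, 0 <= t <= 1 -> `|dF t| <= N) -> `|F 1 - F 0| <= N.
  move=> dF1 le; rewrite ler_norml; apply/andP; split.
    have := @real_deriv_le R (- N *: id) F (fun=> - N) dF 0 1 ler01 (fun t _ => lin _ t) dF1.
    rewrite -[(- N *: id) 1]/(- N * 1) -[(- N *: id) 0]/(- N * 0) mulr1 mulr0 subr0.
    by apply=> t ht; have := le t ht; rewrite ler_norml => /andP[].
  have := @real_deriv_le R F (N *: id) dF (fun=> N) 0 1 ler01 dF1 (fun t _ => lin _ t).
  rewrite -[(N *: id) 1]/(N * 1) -[(N *: id) 0]/(N * 0) mulr1 mulr0 subr0.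
  by apply=> t ht; exact: le_trans (ler_norm _) (le t ht).
have := K _ _ (fun t h => (D t h).1) (fun t h => le_trans (Re_le_nm _) (B t h)).
have := K _ _ (fun t h => (D t h).2) (fun t h => le_trans (Im_le_nm _) (B t h)).
rewrite e1 e0 -ReN -ImN -ReD -ImD => h1 h2.
apply: le_trans (nm_le_ReIm _) _; rewrite -mulrA -/N; lra.
Qed.
End CderivTheory.

(** * Cauchy's theorem on rectangles *)

Section Rectangle.
Variable R : realType.
Local Notation C := R[i].
Local Notation nm := (@nm R).
Implicit Types (f g phi : C -> C) (z w : C) (a b c d x y : R).

Definition inrect a b c d z := (a <= Re z <= b) && (c <= Im z <= d).

Definition onbd a b c d z :=
  inrect a b c d z && [|| Re z == a, Re z == b, Im z == c | Im z == d].

Lemma onbd_in a b c d z : onbd a b c d z -> inrect a b c d z.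
Proof. by case/andP. Qed.

(** The boundary of the rectangle is traversed counterclockwise. *)
Definition rint phi a b c d : C :=
  cint (fun x => phi (x +i* c)) a b - cint (fun x => phi (x +i* d)) a b +
  'i * (cint (fun y => phi (b +i* y)) c d - cint (fun y => phi (a +i* y)) c d).

Definition contH phi y a b := forall x, a <= x <= b -> ccontat phi (x +i* y).
Definition contV phi x c d := forall y, c <= y <= d -> ccontat phi (x +i* y).

Lemma contH_ccont phi y a b : contH phi y a b -> ccont (fun x => phi (x +i* y)) a b.
Proof.
move=> H x xab e e0; have [d d0 Hd] := H x xab e e0; exists d => // t _ tx.
apply: Hd; have -> : t +i* y - (x +i* y) = (t - x)%:C by apply: ceqP => /=; ring.
by rewrite nm_real.
Qed.
Lemma contV_ccont phi x c d : contV phi x c d -> ccont (fun y => phi (x +i* y)) c d.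
Proof.
move=> H y ycd e e0; have [s s0 Hs] := H y ycd e e0; exists s => // t _ ty.
apply: Hs; have -> : x +i* t - (x +i* y) = 'i * (t - y)%:C by apply: ceqP => /=; ring.
by rewrite nmM nm_i mul1r nm_real.
Qed.

Definition bdcont phi a b c d :=
  forall z, onbd a b c d z -> ccontat phi z.

Lemma bdcontE phi a b c d : a <= b -> c <= d -> bdcont phi a b c d ->
  [/\ contH phi c a b, contH phi d a b, contV phi a c d & contV phi b c d].
Proof.
move=> ab cd H; split=> x h; apply: H; rewrite /onbd /inrect /= h ?lexx ?ab ?cd ?eqxx ?orbT//.
Qed.

Lemma rint_ext f g a b c d : a <= b -> c <= d ->
  (forall z, onbd a b c d z -> f z = g z) -> rint f a b c d = rint g a b c d.
Proof.
move=> ab cd fg; rewrite /rint; congr (_ - _ + _ * (_ - _)); apply: cint_ext => // x h; apply: fg;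
 by rewrite /onbd /inrect /= h ?lexx ?ab ?cd ?eqxx ?orbT.
Qed.

Lemma rintD f g a b c d : a <= b -> c <= d -> bdcont f a b c d -> bdcont g a b c d ->
  rint (fun z => f z + g z) a b c d = rint f a b c d + rint g a b c d.
Proof.
move=> ab cd /(bdcontE ab cd)[? ? ? ?] /(bdcontE ab cd)[? ? ? ?]; rewrite /rint.
rewrite !cintD//; first ring.
all: by [apply: contH_ccont|apply: contV_ccont].
Qed.

Lemma rintZ (k : C) f a b c d : a <= b -> c <= d -> bdcont f a b c d ->
  rint (fun z => k * f z) a b c d = k * rint f a b c d.
Proof.
move=> ab cd /(bdcontE ab cd)[? ? ? ?]; rewrite /rint.
rewrite !cintZ//; first ring.
all: by [apply: contH_ccont|apply: contV_ccont].
Qed.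

Lemma rint_bound f a b c d M : a <= b -> c <= d -> bdcont f a b c d ->
  (forall z, onbd a b c d z -> nm (f z) <= M) ->
  nm (rint f a b c d) <= 4 * M * (b - a + (d - c)).
Proof.
move=> ab cd /(bdcontE ab cd)[h1 h2 h3 h4] le; rewrite /rint.
have B1 : nm (cint (fun x => f (x +i* c)) a b) <= 2 * M * (b - a).
  apply: cint_bound => //; first exact: contH_ccont.
  by move=> x h; apply: le; rewrite /onbd /inrect /= h ?lexx ?ab ?cd ?eqxx ?orbT.
have B2 : nm (cint (fun x => f (x +i* d)) a b) <= 2 * M * (b - a).
  apply: cint_bound => //; first exact: contH_ccont.
  by move=> x h; apply: le; rewrite /onbd /inrect /= h ?lexx ?ab ?cd ?eqxx ?orbT.
have B3 : nm (cint (fun x => f (a +i* x)) c d) <= 2 * M * (d - c).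
  apply: cint_bound => //; first exact: contV_ccont.
  by move=> x h; apply: le; rewrite /onbd /inrect /= h ?lexx ?ab ?cd ?eqxx ?orbT.
have B4 : nm (cint (fun x => f (b +i* x)) c d) <= 2 * M * (d - c).
  apply: cint_bound => //; first exact: contV_ccont.
  by move=> x h; apply: le; rewrite /onbd /inrect /= h ?lexx ?ab ?cd ?eqxx ?orbT.
apply: le_trans (nmD _ _) _; rewrite nmM nm_i mul1r.
have := nmB (cint (fun x => f (x +i* c)) a b) (cint (fun x => f (x +i* d)) a b).
have := nmB (cint (fun x => f (b +i* x)) c d) (cint (fun x => f (a +i* x)) c d).
lra.
Qed.

Lemma rint_hsplit f a b c d x : a <= x -> x <= b -> c <= d ->
  contH f c a b -> contH f d a b ->
  rint f a b c d = rint f a x c d + rint f x b c d.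
Proof.
move=> ax xb cd h1 h2; rewrite /rint.
rewrite (cint_chasles ax xb (contH_ccont h1)) (cint_chasles ax xb (contH_ccont h2)); ring.
Qed.
Lemma rint_vsplit f a b c d y : a <= b -> c <= y -> y <= d ->
  contV f a c d -> contV f b c d ->
  rint f a b c d = rint f a b c y + rint f a b y d.
Proof.
move=> ab cy yd h1 h2; rewrite /rint.
rewrite (cint_chasles cy yd (contV_ccont h1)) (cint_chasles cy yd (contV_ccont h2)); ring.
Qed.

Lemma cint_primH F f y a b : a <= b ->
  (forall x, a <= x <= b -> cderiv F (x +i* y) (f (x +i* y))) ->
  cint (fun x => f (x +i* y)) a b = F (b +i* y) - F (a +i* y).
Proof.
move=> ab H.
have E x : 0 +i* y + x%:C * 1 = x +i* y by apply: ceqP => /=; ring.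
have D x (h : a <= x <= b) := @path_deriv R F (0 +i* y) (f (x +i* y)) 1 x.
have -> : cint (fun x => f (x +i* y)) a b = (Re (F (b +i* y)) - Re (F (a +i* y))) +i*
    (Im (F (b +i* y)) - Im (F (a +i* y))).
  rewrite -(E a) -(E b); apply: (@cint_prim R _ a b (fun u => Re (F (0 +i* y + u%:C * 1)))
   (fun u => Im (F (0 +i* y + u%:C * 1)))) => // x h.
  - by have := D x h; rewrite E mulr1 => /(_ (H x h))[].
  - by have := D x h; rewrite E mulr1 => /(_ (H x h))[].
by case: (F (b +i* y)) (F (a +i* y)) => ? ? [? ?].
Qed.

Lemma cint_primV F f x c d : c <= d ->
  (forall y, c <= y <= d -> cderiv F (x +i* y) (f (x +i* y))) ->
  (forall y, c <= y <= d -> ccontat f (x +i* y)) ->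
  'i * cint (fun y => f (x +i* y)) c d = F (x +i* d) - F (x +i* c).
Proof.
move=> cd H cf; rewrite -cintZ//; last exact: contV_ccont.
have E y : x%:C + y%:C * 'i = x +i* y by apply: ceqP => /=; ring.
have D y (h : c <= y <= d) := @path_deriv R F x%:C (f (x +i* y)) 'i y.
have -> : cint (fun y => 'i * f (x +i* y)) c d = (Re (F (x +i* d)) - Re (F (x +i* c))) +i*
    (Im (F (x +i* d)) - Im (F (x +i* c))).
  rewrite -(E c) -(E d); apply: (@cint_prim R _ c d (fun u => Re (F (x%:C + u%:C * 'i)))
   (fun u => Im (F (x%:C + u%:C * 'i)))) => // y h.
  - by have := D y h; rewrite E => /(_ (H y h))[]; rewrite mulrC.
  - by have := D y h; rewrite E => /(_ (H y h))[]; rewrite mulrC.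
by case: (F (x +i* d)) (F (x +i* c)) => ? ? [? ?].
Qed.

Lemma rint_prim F f a b c d : a <= b -> c <= d ->
  (forall z, onbd a b c d z -> cderiv F z (f z)) -> bdcont f a b c d ->
  rint f a b c d = 0.
Proof.
move=> ab cd H cf; have [h1 h2 h3 h4] := bdcontE ab cd cf.
have K z : onbd a b c d z -> cderiv F z (f z) by exact: H.
rewrite /rint !(@cint_primH F f)// ?mulrBr ?(@cint_primV F f)//; first ring.
all: move=> x h; apply: K; rewrite /onbd /inrect /= h ?lexx ?ab ?cd ?eqxx ?orbT//.
Qed.

Lemma hol_affine (k l : C) z : hol (fun z => k * z + l) z.
Proof. exact: (holD (holM (hol_cst k z) (hol_id z)) (hol_cst l z)). Qed.

Lemma rint_affine (k l : C) a b c d : a <= b -> c <= d ->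
  rint (fun z => k * z + l) a b c d = 0.
Proof.
move=> ab cd; apply: (@rint_prim (fun z => k / 2 * (z * z) + l * z)) => // z _; last first.
  exact/hol_cont/hol_affine.
have := cderivD (cderivZ (k / 2) (cderivM (cderiv_id z) (cderiv_id z))) (cderivZ l (cderiv_id z)).
by congr cderiv; rewrite /=; field.
Qed.

Lemma nested (a b : nat -> R) : (forall n, a n <= a n.+1) -> (forall n, b n.+1 <= b n) ->
  (forall n, a n <= b n) -> exists x, forall n, a n <= x <= b n.
Proof.
move=> ha hb hab.
have am m n : (m <= n)%N -> a m <= a n.
  move=> /subnKC <-; elim: (n - m)%N => [|k ih]; rewrite ?addn0// addnS.
  exact: le_trans ih _.
have bm m n : (m <= n)%N -> b n <= b m.
  move=> /subnKC <-; elim: (n - m)%N => [|k ih]; rewrite ?addn0// addnS.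
  exact: le_trans ih.
have ab m n : a m <= b n.
  case: (leqP m n) => h; first exact: le_trans (am _ _ h) (hab n).
  exact: le_trans (hab m) (bm _ _ (ltnW h)).
have ub : has_ubound (range a) by exists (b 0%N) => _ [n _ <-]; exact: ab.
exists (sup (range a)) => n; apply/andP; split.
  by apply: ub_le_sup => //; exists n.
apply: ge_sup; first by exists (a 0%N); exists 0%N.
by move=> _ [m _ <-].
Qed.

Lemma small_pow2 (S e : R) : 0 < e -> exists n, S / 2 ^+ n < e.
Proof.
move=> e0; have [n hn] : exists n : nat, `|S| / e < n%:R.
  exists (Num.truncn (`|S| / e)).+1; apply: truncnS_gt.
exists n; apply: le_lt_trans (_ : `|S| / 2 ^+ n < _).
  by rewrite ler_pM2r ?ler_norm// invr_gt0 exprn_gt0.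
rewrite ltr_pdivrMr ?exprn_gt0// mulrC -ltr_pdivrMr//; apply: lt_le_trans hn _.
by rewrite -natrX ler_nat ltnW// ltn_expl.
Qed.

(** Repeated bisection. An integral larger than [e] times the squared half perimeter passes this
    property on to one of the four quarters. At the point common to all chosen rectangles [f] is too
    well approximated by an affine function, whose integral vanishes. *)
Theorem goursat f a b c d : a < b -> c < d ->
  (forall z, inrect a b c d z -> hol f z) -> rint f a b c d = 0.
Proof.
move=> ab cd H; apply/eqP; rewrite -nm_eq0; apply/eqP/le_anti; rewrite nm_ge0 andbT leNgt.
apply/negP => J0.
pose bad e (q : R * R * R * R) := [/\ q.1.1.1 < q.1.1.2, q.1.2 < q.2,
  a <= q.1.1.1 /\ q.1.1.2 <= b, c <= q.1.2 /\ q.2 <= d &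
  e * (q.1.1.2 - q.1.1.1 + (q.2 - q.1.2)) ^+ 2 < nm (rint f q.1.1.1 q.1.1.2 q.1.2 q.2)].
pose sub (q q' : R * R * R * R) := [/\ q.1.1.1 <= q'.1.1.1, q'.1.1.2 <= q.1.1.2,
  q.1.2 <= q'.1.2, q'.2 <= q.2 & q'.1.1.2 - q'.1.1.1 = (q.1.1.2 - q.1.1.1) / 2 /\
  q'.2 - q'.1.2 = (q.2 - q.1.2) / 2].
have step e q : 0 <= e -> bad e q -> exists q', sub q q' /\ bad e q'.
  case: q => [[[x1 x2] y1] y2] e0 [/= x12 y12 [ax xb] [cy yd] B].
  set m := (x1 + x2) / 2; set k := (y1 + y2) / 2.
  have [m1 m2 k1 k2] : [/\ x1 < m, m < x2, y1 < k & k < y2].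
    by split; rewrite /m /k; lra.
  have ct z : inrect x1 x2 y1 y2 z -> ccontat f z.
    move=> /andP[/andP[? ?] /andP[? ?]]; apply/hol_cont/H; rewrite /inrect; lra.
  have cH y : y1 <= y <= y2 -> contH f y x1 x2.
    by move=> h x h'; apply: ct; rewrite /inrect /= h h'.
  have cV x : x1 <= x <= x2 -> contV f x y1 y2.
    by move=> h y h'; apply: ct; rewrite /inrect /= h h'.
  have cV' x y y' : x1 <= x <= x2 -> y1 <= y -> y' <= y2 -> contV f x y y'.
    by move=> h h1 h2 z /andP[h3 h4]; apply: cV => //; rewrite (le_trans h1)// (le_trans h4).
  have E : rint f x1 x2 y1 y2 = rint f x1 m y1 k + rint f x1 m k y2 +
     (rint f m x2 y1 k + rint f m x2 k y2).
    rewrite (@rint_hsplit _ x1 x2 y1 y2 m) ?ltW//; last 2 first.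
    - by apply: cH; rewrite lexx ltW.
    - by apply: cH; rewrite lexx ltW.
    by congr (_ + _); apply: rint_vsplit; rewrite ?ltW//; apply: cV'; rewrite ?lexx ?(ltW m1) ?(ltW m2) ?(ltW x12).
  apply: contrapT => NB.
  have Q s t u v : s < t -> u < v -> x1 <= s -> t <= x2 -> y1 <= u -> v <= y2 ->
     t - s = (x2 - x1) / 2 -> v - u = (y2 - y1) / 2 ->
     nm (rint f s t u v) <= e * (x2 - x1 + (y2 - y1)) ^+ 2 / 4.
    move=> st uv ? ? ? ? E1 E2; rewrite leNgt; apply/negP => F; apply: NB.
    exists (s, t, u, v); split; first by split => /=.
    split => //=; [by split; [exact: le_trans ax _|exact: le_trans xb]|by split; [exact: le_trans cy _|exact: le_trans yd]|].
    apply: le_lt_trans F; rewrite E1 E2 -mulrDl expr_div_n.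
    have -> : (2 : R) ^+ 2 = 4 by rewrite -natrX.
    by rewrite mulrA.
  have [E1 E2 E3 E4] : [/\ m - x1 = (x2 - x1) / 2, x2 - m = (x2 - x1) / 2,
      k - y1 = (y2 - y1) / 2 & y2 - k = (y2 - y1) / 2].
    by rewrite /m /k; clear; split; lra.
  have Q1 : nm (rint f x1 m y1 k) <= e * (x2 - x1 + (y2 - y1)) ^+ 2 / 4.
    by apply: Q; rewrite ?lexx ?(ltW m1) ?(ltW m2) ?(ltW k1) ?(ltW k2).
  have Q2 : nm (rint f x1 m k y2) <= e * (x2 - x1 + (y2 - y1)) ^+ 2 / 4.
    by apply: Q; rewrite ?lexx ?(ltW m1) ?(ltW m2) ?(ltW k1) ?(ltW k2).
  have Q3 : nm (rint f m x2 y1 k) <= e * (x2 - x1 + (y2 - y1)) ^+ 2 / 4.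
    by apply: Q; rewrite ?lexx ?(ltW m1) ?(ltW m2) ?(ltW k1) ?(ltW k2).
  have Q4 : nm (rint f m x2 k y2) <= e * (x2 - x1 + (y2 - y1)) ^+ 2 / 4.
    by apply: Q; rewrite ?lexx ?(ltW m1) ?(ltW m2) ?(ltW k1) ?(ltW k2).
  have := nmD (rint f x1 m y1 k + rint f x1 m k y2) (rint f m x2 y1 k + rint f m x2 k y2).
  have := nmD (rint f x1 m y1 k) (rint f x1 m k y2).
  have := nmD (rint f m x2 y1 k) (rint f m x2 k y2).
  move: B; rewrite E; lra.
have S0 : 0 < b - a + (d - c) by lra.
(* The factor 2 makes the inequality in [bad] strict for the initial rectangle. *)
pose e := nm (rint f a b c d) / (2 * (b - a + (d - c)) ^+ 2).
have e0 : 0 < e by rewrite divr_gt0// mulr_gt0// exprn_gt0.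
pose q0 := (a, b, c, d).
have b0 : bad e q0.
  split=> //=; have -> : e * (b - a + (d - c)) ^+ 2 = nm (rint f a b c d) / 2.
    by rewrite /e; field; rewrite gt_eqF.
  by rewrite ltr_pdivrMr// ltr_pMr// ltr1n.
pose next q := xget q [set q' | sub q q' /\ bad e q'].
have nextP q : bad e q -> sub q (next q) /\ bad e (next q).
  move=> bq; rewrite /next; have [q' hq'] := step e q (ltW e0) bq.
  by have := @xgetPex _ q [set q' | sub q q' /\ bad e q']; apply; exists q'.
pose s n := iter n next q0.
have bs n : bad e (s n) by elim: n => [//|n ih]; exact: (nextP _ ih).2.
have ss n : sub (s n) (s n.+1) by exact: (nextP _ (bs n)).1.
have [x hx] : exists x, forall n, (s n).1.1.1 <= x <= (s n).1.1.2.
  by apply: nested => n; [case: (ss n)|case: (ss n)|case: (bs n) => /ltW].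
have [y hy] : exists y, forall n, (s n).1.2 <= y <= (s n).2.
  by apply: nested => n; [case: (ss n)|case: (ss n)|case: (bs n) => _ /ltW].
have [k dk] : hol f (x +i* y).
  by apply: H; have := hx 0%N; have := hy 0%N; rewrite /s /= /inrect /= => -> ->.
have wd n : (s n).1.1.2 - (s n).1.1.1 + ((s n).2 - (s n).1.2) = (b - a + (d - c)) / 2 ^+ n.
  elim: n => [|n ih]; first by rewrite expr0 divr1.
  have [_ _ _ _ [-> ->]] := ss n; rewrite -mulrDl ih exprS; field.
  by rewrite expf_neq0.
(* [rint_bound] turns the accuracy [e / 8] into [4 * (e / 8 * S) * S], half of the lower bound
   asserted by [bad]. *)
have e80 : 0 < e / 8 by lra.
have [r r0 Hr] := dk _ e80.
have [n hn] := small_pow2 (b - a + (d - c)) r0.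
have [h1 h2 [h3 h4] [h5 h6] B] := bs n.
move: (hx n) (hy n) h1 h2 h3 h4 h5 h6 B hn; rewrite -wd.
case: (s n) => [[[x1 x2] y1] y2] /= /andP[h1 h2] /andP[h3 h4] h5 h6 h7 h8 h9 h10 B hn.
set S := x2 - x1 + (y2 - y1) in B hn *.
have S1 : 0 < S by rewrite /S; lra.
pose g z := f z + - (k * z + (f (x +i* y) - k * (x +i* y))).
have cf : bdcont f x1 x2 y1 y2.
  by move=> z /onbd_in /andP[/andP[? ?] /andP[? ?]]; apply/hol_cont/H; rewrite /inrect; lra.
have ca (l m : C) : bdcont (fun z => l * z + m) x1 x2 y1 y2.
  by move=> z _; exact/hol_cont/hol_affine.
have Eg : rint f x1 x2 y1 y2 = rint g x1 x2 y1 y2.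
  rewrite -[LHS]addr0 -(@rint_affine (- k) (- (f (x +i* y) - k * (x +i* y))) x1 x2 y1 y2 (ltW h5) (ltW h6)).
  rewrite -rintD ?ltW//; apply: rint_ext; rewrite ?ltW// => z _; rewrite /g; ring.
have : nm (rint g x1 x2 y1 y2) <= 4 * (e / 8 * S) * S.
  apply: rint_bound; rewrite ?ltW//.
    move=> z hz; have [l dl] : hol f z.
      by move: hz => /onbd_in /andP[/andP[? ?] /andP[? ?]]; apply/H; rewrite /inrect; lra.
    apply/hol_cont/holD; first by exists l.
    exact/holN/hol_affine.
  move=> z /onbd_in /andP[/andP[z1 z2] /andP[z3 z4]].
  have zS : nm (z - (x +i* y)) <= S.
    apply: le_trans (nm_le_ReIm _) _; rewrite ReD ImD ReN ImN /= /S.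
    by apply: lerD; rewrite ler_norml; lra.
  have := Hr z (le_lt_trans zS hn); have -> : g z = f z - f (x +i* y) - k * (z - (x +i* y)).
    by rewrite /g; ring.
  by move=> h; apply: le_trans h _; rewrite ler_wpM2l// ltW.
have : 4 * (e / 8 * S) * S = e * S ^+ 2 / 2 by rewrite expr2; field.
have : 0 < e * S ^+ 2 by rewrite mulr_gt0 ?exprn_gt0.
rewrite -Eg; lra.
Qed.
End Rectangle.

(** * Cauchy's integral formula *)

Section Cauchy.
Variable R : realType.
Local Notation C := R[i].
Local Notation nm := (@nm R).
Implicit Types (f g phi : C -> C) (z w : C) (a b c d x y : R).

Definition twopii : C := 0 +i* (2 * pi).

Lemma twopii_neq0 : twopii != 0.
Proof.
rewrite eq_complex /= negb_and; apply/orP; right.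
by rewrite gt_eqF// mulr_gt0// pi_gt0.
Qed.

Lemma invCE (x y : R) : (x +i* y)^-1 = (x / (x ^+ 2 + y ^+ 2)) +i* (- y / (x ^+ 2 + y ^+ 2)) :> C.
Proof. by rewrite mulNr. Qed.

(** Together with [deriv_atan] this gives a primitive of [1 / (z - w)] along an edge, as logarithm
    of the modulus and angle, so that no branch of the complex logarithm has to be fixed. *)
Lemma deriv_halfln (x0 s x : R) : s != 0 ->
  is_derive x 1 (fun t => ln ((t - x0) ^+ 2 + s ^+ 2) / 2) ((x - x0) / ((x - x0) ^+ 2 + s ^+ 2)).
Proof.
move=> s0; have p : 0 < (x - x0) ^+ 2 + s ^+ 2.
  by rewrite ltr_wpDl ?sqr_ge0// lt_def sqr_ge0 sqrf_eq0 s0.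
have d1 : is_derive x 1 (fun t : R => (t - x0) ^+ 2 + s ^+ 2) (2 * (x - x0)).
  have h : is_derive x 1 (fun t : R => t - x0) 1.
    by have := is_deriveB (is_derive_id x 1) (is_derive_cst x0 x 1); rewrite subr0.
  have := is_deriveD (is_deriveX 2 h) (is_derive_cst (s ^+ 2) x 1).
  by rewrite addr0 expr1 /= [_ *: 1]mulr1.
have d2 := @is_derive1_comp R (@ln R) _ x _ _ (is_derive1_ln p) d1.
have := is_deriveZ (2^-1) d2.
have -> : 2^-1 *: (((x - x0) ^+ 2 + s ^+ 2)^-1 * (2 * (x - x0))) =
   (x - x0) / ((x - x0) ^+ 2 + s ^+ 2).
  have aux (u v : R) : u != 0 -> 2^-1 * (u^-1 * (2 * v)) = v / u by move=> u0; field.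
  by apply: aux; rewrite gt_eqF.
by congr is_derive; apply/funext => t; exact: mulrC.
Qed.

Lemma deriv_atan (x0 r s x : R) : 0 < r -> s ^+ 2 = r ^+ 2 ->
  is_derive x 1 (fun t => (s / r) * atan ((t - x0) / r)) (s / ((x - x0) ^+ 2 + s ^+ 2)).
Proof.
move=> r0 sr; have p : 0 < (x - x0) ^+ 2 + s ^+ 2.
  by rewrite ltr_wpDl ?sqr_ge0// sr exprn_gt0.
have d1 : is_derive x 1 (fun t : R => (t - x0) / r) (r^-1).
  have h : is_derive x 1 (fun t : R => t - x0) 1.
    by have := is_deriveB (is_derive_id x 1) (is_derive_cst x0 x 1); rewrite subr0.
  have := is_deriveZ (r^-1) h; rewrite [_ *: 1]mulr1; congr is_derive.
  by apply/funext => t; exact: mulrC.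
have d2 := @is_derive1_comp R (@atan R) _ x _ _ (is_derive1_atan _) d1.
have := is_deriveZ (s / r) d2; congr is_derive.
have aux (u v : R) : s ^+ 2 = v ^+ 2 -> v != 0 -> u ^+ 2 + v ^+ 2 != 0 ->
  s / v * ((1 + (u / v) ^+ 2)^-1 * v^-1) = s / (u ^+ 2 + s ^+ 2).
  by move=> -> v0 w0; field; rewrite v0 /= w0.
by apply: aux => //; rewrite -?sr gt_eqF.
Qed.

Lemma ker_hedge (x0 r s : R) : 0 < r -> s ^+ 2 = r ^+ 2 ->
  cint (fun x => ((x - x0) +i* s)^-1) (x0 - r) (x0 + r) = 0 +i* (- (s / r * (pi / 2))).
Proof.
move=> r0 sr; have s0 : s != 0 by rewrite -sqrf_eq0 sr sqrf_eq0 gt_eqF.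
apply: cintE; first lra.
exists (fun t => ln ((t - x0) ^+ 2 + s ^+ 2) / 2), (- (fun t => (s / r) * atan ((t - x0) / r))).
split.
- by move=> x _; rewrite invCE /=; exact: deriv_halfln.
- by move=> x _; rewrite invCE /= mulNr; apply: is_deriveN; exact: deriv_atan.
apply: ceqP => /=.
  have -> : (x0 + r - x0) = r by ring.
  have -> : (x0 - r - x0) = - r by ring.
  by rewrite sqrrN subrr.
rewrite !fctE.
have -> : (x0 + r - x0) = r by ring.
have -> : (x0 - r - x0) = - r by ring.
rewrite mulNr divff ?gt_eqF// atanN atan1.
by field; rewrite gt_eqF.
Qed.

Lemma ker_vedge (y0 r s : R) : 0 < r -> s ^+ 2 = r ^+ 2 ->
  cint (fun y => (s +i* (y - y0))^-1) (y0 - r) (y0 + r) = (s / r * (pi / 2))%:C.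
Proof.
move=> r0 sr; have s0 : s != 0 by rewrite -sqrf_eq0 sr sqrf_eq0 gt_eqF.
apply: cintE; first lra.
exists (fun t => (s / r) * atan ((t - y0) / r)), (- (fun t => ln ((t - y0) ^+ 2 + s ^+ 2) / 2)).
split.
- by move=> x _; rewrite invCE /= [s ^+ 2 + _]addrC; exact: deriv_atan.
- move=> x _; rewrite invCE /= mulNr [s ^+ 2 + _]addrC; apply: is_deriveN; exact: deriv_halfln.
apply: ceqP => /=; last first.
  rewrite !fctE.
  have -> : (y0 + r - y0) = r by ring.
  have -> : (y0 - r - y0) = - r by ring.
  by rewrite sqrrN subrr.
have -> : (y0 + r - y0) = r by ring.
have -> : (y0 - r - y0) = - r by ring.
rewrite mulNr divff ?gt_eqF// atanN atan1.
by field; rewrite gt_eqF.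
Qed.

(** Each edge contributes [i pi / 2]: the logarithm of the modulus cancels by symmetry, and on a
    square centred at [w] the arctangents are taken at 1 and -1. *)
Lemma ker_square w (r : R) : 0 < r ->
  rint (fun z => (z - w)^-1) (Re w - r) (Re w + r) (Im w - r) (Im w + r) = twopii.
Proof.
case: w => x0 y0 r0 /=; rewrite /rint.
have E1 s : cint (fun x => (x +i* s - (x0 +i* y0))^-1) (x0 - r) (x0 + r) =
  cint (fun x => ((x - x0) +i* (s - y0))^-1) (x0 - r) (x0 + r) by [].
have E2 s : cint (fun y => (s +i* y - (x0 +i* y0))^-1) (y0 - r) (y0 + r) =
  cint (fun y => ((s - x0) +i* (y - y0))^-1) (y0 - r) (y0 + r) by [].
have h1 : y0 - r - y0 = - r by ring.
have h2 : y0 + r - y0 = r by ring.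
have h3 : x0 - r - x0 = - r by ring.
have h4 : x0 + r - x0 = r by ring.
rewrite !E1 !E2 h1 h2 h3 h4 !ker_hedge ?sqrrN// !ker_vedge ?sqrrN//.
by apply: ceqP => /=; rewrite mulNr divff ?gt_eqF//; field.
Qed.

(** The frame between the two rectangles is cut into a left, a right, a lower and an upper
    rectangle, and [goursat] applies to each of them. *)
Lemma rint_shrink g a b c d x1 x2 y1 y2 : a < x1 -> x1 < x2 -> x2 < b ->
  c < y1 -> y1 < y2 -> y2 < d ->
  (forall z, inrect a b c d z -> ~~ ((x1 < Re z < x2) && (y1 < Im z < y2)) -> hol g z) ->
  rint g a b c d = rint g x1 x2 y1 y2.
Proof.
move=> ax xx xb cy yy yd H.
have x1b := lt_trans xx xb. have ax2 := lt_trans ax xx.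
have cy2 := lt_trans cy yy. have y1d := lt_trans yy yd.
have ab := lt_trans ax x1b. have cd := lt_trans cy y1d.
have HH y s t : c <= y <= d -> ~~ (y1 < y < y2) -> a <= s -> t <= b -> contH g y s t.
  move=> h h' as_ tb x /andP[sx xt]; apply/hol_cont/H; rewrite /inrect /= ?h ?(negPf h') ?andbF//.
  by rewrite (le_trans as_ sx) (le_trans xt tb).
have VV x s t : a <= x <= b -> ~~ (x1 < x < x2) -> c <= s -> t <= d -> contV g x s t.
  move=> h h' as_ tb y /andP[sy yt]; apply/hol_cont/H; rewrite /inrect /= ?h ?(negPf h') ?andbF//.
  by rewrite (le_trans as_ sy) (le_trans yt tb).
have G s t u v : s < t -> u < v -> a <= s -> t <= b -> c <= u -> v <= d ->
    (t <= x1) || (x2 <= s) || (v <= y1) || (y2 <= u) -> rint g s t u v = 0.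
  move=> st uv as_ tb cu vd K; apply: goursat => // z /andP[/andP[z1 z2] /andP[z3 z4]].
  apply: H.
    by rewrite /inrect (le_trans as_ z1) (le_trans z2 tb) (le_trans cu z3) (le_trans z4 vd).
  apply/negP => /andP[/andP[k1 k2] /andP[k3 k4]]; case/orP: K => [/orP[/orP[]|]|] K.
  - by have := lt_le_trans k1 (le_trans z2 K); rewrite ltxx.
  - by have := le_lt_trans (le_trans K z1) k2; rewrite ltxx.
  - by have := lt_le_trans k3 (le_trans z4 K); rewrite ltxx.
  - by have := le_lt_trans (le_trans K z3) k4; rewrite ltxx.
have nc : ~~ (y1 < c < y2) by rewrite ltNge (ltW cy).
have nd : ~~ (y1 < d < y2) by rewrite andbC ltNge (ltW yd).
have n1 : ~~ (x1 < x1 < x2) by rewrite ltxx.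
have n2 : ~~ (x1 < x2 < x2) by rewrite ltxx andbF.
have ca : c <= c <= d by rewrite lexx ltW.
have da : c <= d <= d by rewrite lexx ltW.
have a1 : a <= x1 <= b by rewrite !ltW.
have a2 : a <= x2 <= b by rewrite !ltW.
rewrite (@rint_hsplit _ _ a b c d x1) ?ltW//; try (by apply: HH).
rewrite (@rint_hsplit _ _ x1 b c d x2) ?ltW//; try (by apply: HH; rewrite ?(ltW ax)).
rewrite (G a x1) ?(ltW ax) ?lexx ?(ltW x1b)// add0r.
rewrite (G x2 b) ?lexx ?orbT ?(ltW ax2)// addr0.
rewrite (@rint_vsplit _ _ x1 x2 c d y1) ?ltW//; try (by apply: VV).
rewrite (G x1 x2 c y1) ?lexx ?orbT ?(ltW ax) ?(ltW xb) ?(ltW y1d)// add0r.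
rewrite (@rint_vsplit _ _ x1 x2 y1 d y2) ?ltW//; try (by apply: VV; rewrite ?(ltW cy)).
by rewrite (G x1 x2 y2 d) ?lexx ?orbT ?(ltW ax) ?(ltW xb) ?(ltW cy2)// addr0.
Qed.

Theorem cauchy f a b c d w : a < Re w < b -> c < Im w < d ->
  (forall z, inrect a b c d z -> hol f z) ->
  rint (fun z => f z / (z - w)) a b c d = twopii * f w.
Proof.
move=> /andP[aw wb] /andP[cw wd] H; apply/eqP; rewrite -subr_eq0 -nm_eq0; apply/eqP/le_anti.
rewrite nm_ge0 andbT; apply/ler_addgt0Pr => e e0; rewrite add0r.
have [k dk] : hol f w by apply: H; rewrite /inrect !ltW.
have [s s0 Hs] := dk 1 ltr01.
have K0 : 0 < nm k + 1 by have := nm_ge0 k; lra.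
pose m := Num.min (Num.min (Re w - a) (b - Re w)) (Num.min (Im w - c) (d - Im w)).
have m0 : 0 < m by rewrite !lt_min !subr_gt0 aw wb cw wd.
(* [m] keeps the small square inside the rectangle; within [s] of [w] the difference quotient is at
   most [nm k + 1]; the half perimeter [4 * r] and the factor 4 of [rint_bound] give 16. *)
pose r := Num.min (m / 2) (Num.min (s / 4) (e / (16 * (nm k + 1)))).
have r0 : 0 < r by rewrite !lt_min !divr_gt0 // mulr_gt0.
have rm : r < m by apply: (@le_lt_trans _ _ (m / 2)); rewrite ?ge_min ?lexx//; lra.
have rs : 2 * r < s.
  have : r <= s / 4 by rewrite !ge_min lexx ?orbT.
  lra.
have re : 16 * (nm k + 1) * r <= e.
  by rewrite mulrC -ler_pdivlMr ?mulr_gt0// !ge_min lexx ?orbT.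
move: rm; rewrite !lt_min => /andP[/andP[r1 r2] /andP[r3 r4]].
have hq z : z != w -> inrect a b c d z -> hol (fun z => f z / (z - w)) z.
  by move=> zw hz; apply: hol_div; [exact: H|exact: hol_subC|rewrite subr_eq0].
rewrite (@rint_shrink _ _ _ _ _ (Re w - r) (Re w + r) (Im w - r) (Im w + r)); try lra; last first.
  move=> z hz nz; apply: hq => //; apply: contraNneq nz => ->.
  by rewrite !ltrBlDr !ltrDl r0.
have bz z : onbd (Re w - r) (Re w + r) (Im w - r) (Im w + r) z ->
   [/\ z != w, inrect a b c d z & nm (z - w) < s].
  move=> /andP[/andP[/andP[z1 z2] /andP[z3 z4]] zb]; split.
  - apply: contraTneq zb => ->; rewrite !negb_or; apply/and4P.
    by split; [rewrite gt_eqF ?ltrBlDr ?ltrDl|rewrite lt_eqF ?ltrDl|rewrite gt_eqF ?ltrBlDr ?ltrDl|rewrite lt_eqF ?ltrDl].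
  - by rewrite /inrect; lra.
  - apply: le_lt_trans (nm_le_ReIm _) _; rewrite ReD ImD ReN ImN.
    apply: le_lt_trans rs; rewrite mulr_natl mulr2n lerD// ler_norml; lra.
have rr u : u - r <= u + r by lra.
have cc := cderiv_cont dk.
pose g z := (f z - f w) / (z - w).
have E : rint (fun z => f z / (z - w)) (Re w - r) (Re w + r) (Im w - r) (Im w + r) =
   rint (fun z => f w * (z - w)^-1 + g z) (Re w - r) (Re w + r) (Im w - r) (Im w + r).
  by apply: rint_ext => // z /bz[zw _ _]; rewrite /g; field; rewrite subr_eq0.
have holi z : z != w -> hol (fun z => (z - w)^-1) z.
  by move=> zw; apply: holV; [rewrite subr_eq0|exact: hol_subC].
have holg z : z != w -> inrect a b c d z -> hol g z.
  move=> zw hz; apply: hol_div; [|exact: hol_subC|by rewrite subr_eq0].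
  by apply: holB; [exact: H|exact: hol_cst].
rewrite E rintD//; last 2 first.
- by move=> z /bz[zw hz _]; apply/hol_cont/holM; [exact: hol_cst|exact: holi].
- by move=> z /bz[zw hz _]; apply/hol_cont/holg.
rewrite rintZ//; last by move=> z /bz[zw hz _]; exact/hol_cont/holi.
rewrite ker_square// [f w * _]mulrC addrAC subrr add0r.
apply: (@le_trans _ _ (4 * (nm k + 1) * (Re w + r - (Re w - r) + (Im w + r - (Im w - r))))).
  apply: rint_bound => // [z /bz[zw hz _]|z /bz[zw hz zs]]; first by apply/hol_cont/holg.
  have zn : 0 < nm (z - w) by rewrite nm_gt0 subr_eq0.
  rewrite /g nmM nmV ler_pdivrMr//.
  have -> : f z - f w = (f z - f w - k * (z - w)) + k * (z - w) by rewrite subrK.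
  by apply: le_trans (nmD _ _) _; rewrite nmM; have := Hs z zs; lra.
have -> : Re w + r - (Re w - r) + (Im w + r - (Im w - r)) = 4 * r by ring.
lra.
Qed.
End Cauchy.

(** * Consequences of Cauchy's formula: derivatives, removable singularities, uniform limits *)

Section CauchyConsequences.
Variable R : realType.
Local Notation C := R[i].
Local Notation nm := (@nm R).
Local Notation twopii := (@twopii R).
Implicit Types (f g phi : C -> C) (z w : C) (a b c d x y : R).

Lemma nm_twopii : 1 <= nm twopii.
Proof.
apply: le_trans (Im_le_nm _) => /=; rewrite ger0_norm ?mulr_ge0 ?pi_ge0//.
by have := pi_ge2 R; lra.
Qed.

Lemma ccont_bounded (f : R -> C) a b : a <= b -> ccont f a b ->
  exists M, forall x, a <= x <= b -> nm (f x) <= M.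
Proof.
move=> ab cf; have [cr ci] := ccont_clamp ab cf.
have B (g : R -> R) : continuous g -> exists M, forall x, a <= x <= b -> `|g x| <= M.
  move=> cg.
  have [u _ hu] := EVT_max ab (continuous_subspaceT cg).
  have [v _ hv] := EVT_min ab (continuous_subspaceT cg).
  exists (`|g u| + `|g v|) => x xab.
  have := hu x; have := hv x; rewrite in_itv /= xab => /(_ isT) h1 /(_ isT) h2.
  rewrite ler_norml; have := ler_norm (g u); have := ler_norm (- g v); rewrite normrN.
  by have := normr_ge0 (g u); have := normr_ge0 (g v); lra.
have [M HM] := B _ cr; have [N HN] := B _ ci.
exists (M + N) => x xab; apply: le_trans (nm_le_ReIm _) _.
by apply: lerD; [have := HM x xab|have := HN x xab]; rewrite clamp_id.
Qed.

Lemma bdcont_bounded phi a b c d : a <= b -> c <= d -> bdcont phi a b c d ->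
  exists2 M, 0 <= M & forall z, onbd a b c d z -> nm (phi z) <= M.
Proof.
move=> ab cd /(bdcontE ab cd)[h1 h2 h3 h4].
have [M1 H1] := ccont_bounded ab (contH_ccont h1).
have [M2 H2] := ccont_bounded ab (contH_ccont h2).
have [M3 H3] := ccont_bounded cd (contV_ccont h3).
have [M4 H4] := ccont_bounded cd (contV_ccont h4).
exists (`|M1| + `|M2| + `|M3| + `|M4|); first by rewrite !addr_ge0.
case=> x y /andP[/andP[/= hx hy]].
have := ler_norm M1; have := ler_norm M2; have := ler_norm M3; have := ler_norm M4.
have := normr_ge0 M1; have := normr_ge0 M2; have := normr_ge0 M3; have := normr_ge0 M4.
move=> ? ? ? ? ? ? ? ?.
move=> /or4P[] /eqP E; rewrite E.
- by have := H3 y hy; lra.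
- by have := H4 y hy; lra.
- by have := H1 x hx; lra.
- by have := H2 x hx; lra.
Qed.

Lemma bd_dist a b c d w : a < Re w < b -> c < Im w < d ->
  exists2 m, 0 < m & forall z, onbd a b c d z -> m <= nm (z - w).
Proof.
move=> /andP[aw wb] /andP[cw wd].
exists (Num.min (Num.min (Re w - a) (b - Re w)) (Num.min (Im w - c) (d - Im w))).
  by rewrite !lt_min !subr_gt0 aw wb cw wd.
move=> z /andP[_] /or4P[] /eqP E; rewrite !ge_min; apply/orP.
- left; apply/orP; left; apply: le_trans (Re_le_nm _); rewrite ReD ReN E distrC; exact: ler_norm.
- left; apply/orP; right; apply: le_trans (Re_le_nm _); rewrite ReD ReN E; exact: ler_norm.
- right; apply/orP; left; apply: le_trans (Im_le_nm _); rewrite ImD ImN E distrC; exact: ler_norm.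
- right; apply/orP; right; apply: le_trans (Im_le_nm _); rewrite ImD ImN E; exact: ler_norm.
Qed.

Lemma ccontM f g z : ccontat f z -> hol g z -> ccontat (fun w => f w * g w) z.
Proof.
move=> cf /hol_cont cg e e0.
pose A := nm (f z) + nm (g z) + 1.
have A0 : 0 < A by rewrite /A; have := nm_ge0 (f z); have := nm_ge0 (g z); lra.
have e1 : 0 < Num.min 1 (e / (2 * A)) by rewrite lt_min ltr01 divr_gt0// mulr_gt0.
have [r r0 Hr] := cf _ e1; have [s s0 Hs] := cg _ e1.
exists (Num.min r s); first by rewrite lt_min r0.
move=> w; rewrite lt_min => /andP[/Hr + /Hs]; rewrite !lt_min => /andP[h1 h2] /andP[h3 h4].
have -> : f w * g w - f z * g z = (f w - f z) * (g w - g z) + (f w - f z) * g z + f z * (g w - g z) by ring.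
set u := nm (f w - f z) in h1 h2; set v := nm (g w - g z) in h3 h4.
have u0 : 0 <= u := nm_ge0 _.
have v0 : 0 <= v := nm_ge0 _.
have E : e = 2 * (e / (2 * A) * A) by field; rewrite gt_eqF.
set t := e / (2 * A) in h2 h4 E.
apply: (@le_lt_trans _ _ (u * v + u * nm (g z) + nm (f z) * v)).
  by apply: le_trans (nmD _ _) _; apply: lerD; [apply: le_trans (nmD _ _) _|]; rewrite !nmM ?lerD.
have h5 : u * v <= u by rewrite ler_piMr// ltW.
have h6 : u * (1 + nm (g z)) <= t * (1 + nm (g z)).
  rewrite ler_wpM2r ?ltW//; have := nm_ge0 (g z); lra.
have h7 : nm (f z) * v <= nm (f z) * t by rewrite ler_wpM2l ?nm_ge0 ?ltW.
have t0 : 0 < t by rewrite /t divr_gt0// mulr_gt0.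
have h8 : 0 < t * A by rewrite mulr_gt0.
by rewrite E; move: h8; rewrite /A; lra.
Qed.

Lemma ccontD f g z : ccontat f z -> ccontat g z -> ccontat (fun w => f w + g w) z.
Proof.
move=> cf cg e e0; have e2 : 0 < e / 2 by rewrite divr_gt0.
have [r r0 Hr] := cf _ e2; have [s s0 Hs] := cg _ e2.
exists (Num.min r s); first by rewrite lt_min r0.
move=> w; rewrite lt_min => /andP[/Hr h1 /Hs h2].
have -> : f w + g w - (f z + g z) = (f w - f z) + (g w - g z) by ring.
by apply: le_lt_trans (nmD _ _) _; lra.
Qed.

Lemma hol_invsub w z n : z != w -> hol (fun u => (u - w)^-1 ^+ n) z.
Proof.
move=> zw; apply/holX/holV; [by rewrite subr_eq0|exact: hol_subC].
Qed.

Section CauchyType.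
Variables (phi : C -> C) (a b c d : R).
Hypothesis ab : a < b.
Hypothesis cd : c < d.
Hypothesis cphi : bdcont phi a b c d.

(** Cauchy type integral. The density [phi] is merely continuous on the boundary, which covers
    uniform limits as well as [f u / (u - w)] in the removal of a singularity. *)
Definition cauchyI n w := rint (fun z => phi z * (z - w)^-1 ^+ n) a b c d.

Lemma bd_neq w z : a < Re w < b -> c < Im w < d -> onbd a b c d z -> z != w.
Proof.
move=> h1 h2 hz; have [m m0 /(_ _ hz)] := bd_dist h1 h2.
by move=> /(lt_le_trans m0); rewrite nm_gt0 subr_eq0.
Qed.

Lemma bdcont_ker w n : a < Re w < b -> c < Im w < d ->
  bdcont (fun z => phi z * (z - w)^-1 ^+ n) a b c d.
Proof.
by move=> h1 h2 z hz; apply: ccontM; [exact: cphi|exact/hol_invsub/(bd_neq h1 h2)].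
Qed.


(** The second order remainder of the integrand is [D ^+ 2 * Q], and [Q] is bounded because [w] and
    [w'] keep the distances [m] and [m / 2] from the boundary. The case [n = 1] shows that the
    integral is holomorphic, [n = 2] that its derivative is. *)
Lemma cauchyI_deriv n w : (n = 1 \/ n = 2)%N -> a < Re w < b -> c < Im w < d ->
  cderiv (cauchyI n) w (n%:R * cauchyI n.+1 w).
Proof.
move=> n12 h1 h2; have [m m0 Hm] := bd_dist h1 h2.
have [M M0 HM] := bdcont_bounded (ltW ab) (ltW cd) cphi.
set S := b - a + (d - c); have S0 : 0 < S by rewrite /S; lra.
pose K := 4 * (M * (16 / m ^+ 4 + 2 / m ^+ 3)) * S + 1.
have K0 : 0 < K.
  rewrite /K ltr_wpDl//; apply: mulr_ge0; last exact: ltW.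
  apply: mulr_ge0 => //; apply: mulr_ge0 => //.
  by apply: addr_ge0; rewrite divr_ge0// exprn_ge0// ltW.
have [m' m'0 [m'm Hin]] : exists2 m', 0 < m' & m' <= m / 2 /\ forall w', nm (w' - w) < m' ->
    a < Re w' < b /\ c < Im w' < d.
  move: (h1) (h2) => /andP[? ?] /andP[? ?].
  exists (Num.min (m / 2) (Num.min (Num.min (Re w - a) (b - Re w)) (Num.min (Im w - c) (d - Im w)))).
    by rewrite !lt_min divr_gt0// !subr_gt0; apply/andP; split => //; lra.
  split; first by rewrite ge_min lexx.
  move=> w'; rewrite !lt_min => /andP[_ /andP[/andP[k1 k2] /andP[k3 k4]]].
  have := Re_le_nm (w' - w); have := Im_le_nm (w' - w).
  rewrite !ler_norml ReD ReN ImD ImN; lra.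
move=> e e0; exists (Num.min m' (e / K)); first by rewrite lt_min m'0 divr_gt0.
move=> w'; rewrite lt_min => /andP[hw hwe].
have [h1' h2'] := Hin _ hw.
set D := w' - w in hw hwe *.
have hz z : onbd a b c d z -> [/\ z != w, z != w', nm (z - w)^-1 <= m^-1 & nm (z - w')^-1 <= 2 / m].
  move=> zb; have zm := Hm z zb.
  have zm' : m / 2 <= nm (z - w').
    have -> : z - w' = (z - w) - D by rewrite /D; ring.
    by apply: le_trans (nm_triB _ _); lra.
  split; [exact: (bd_neq h1 h2)|exact: (bd_neq h1' h2')| |].
    by rewrite nmV lef_pV2 ?posrE// (lt_le_trans m0).
  have -> : 2 / m = (m / 2)^-1 by rewrite invf_div.
  by rewrite nmV lef_pV2 ?posrE ?divr_gt0// (lt_le_trans _ zm')// divr_gt0.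
have Eq : cauchyI n w' - cauchyI n w - n%:R * cauchyI n.+1 w * D =
  rint (fun z => phi z * (z - w')^-1 ^+ n + (-1 * (phi z * (z - w)^-1 ^+ n) +
      - (n%:R * D) * (phi z * (z - w)^-1 ^+ n.+1))) a b c d.
  have c1 := bdcont_ker n h1' h2'; have c2 := bdcont_ker n h1 h2.
  have c3 := bdcont_ker n.+1 h1 h2.
  have c2' : bdcont (fun z => -1 * (phi z * (z - w)^-1 ^+ n)) a b c d.
    by move=> z hzb; under eq_fun do rewrite mulrC; apply: ccontM; [exact: c2|exact: hol_cst].
  have c3' : bdcont (fun z => - (n%:R * D) * (phi z * (z - w)^-1 ^+ n.+1)) a b c d.
    by move=> z hzb; under eq_fun do rewrite mulrC; apply: ccontM; [exact: c3|exact: hol_cst].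
  rewrite rintD ?ltW//; last by move=> z hzb; apply: ccontD; [exact: c2'|exact: c3'].
  rewrite rintD ?ltW// !rintZ ?ltW//.
  have aux (x y u v t : C) : x - y - u * v * t = x + (-1 * y + - (u * t) * v) by ring.
  exact: aux.
rewrite Eq.
have bnd : nm (rint (fun z => phi z * (z - w')^-1 ^+ n + (-1 * (phi z * (z - w)^-1 ^+ n) +
      - (n%:R * D) * (phi z * (z - w)^-1 ^+ n.+1))) a b c d) <=
   4 * (M * (nm D ^+ 2 * (16 / m ^+ 4 + 2 / m ^+ 3))) * S.
  apply: rint_bound; rewrite ?ltW//.
    move=> z hzb; apply: ccontD; first exact: (bdcont_ker _ h1' h2').
    apply: ccontD.
      under eq_fun do rewrite mulrC; apply: ccontM; last exact: hol_cst.
      exact: (bdcont_ker _ h1 h2).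
    under eq_fun do rewrite mulrC; apply: ccontM; last exact: hol_cst.
    exact: (bdcont_ker _ h1 h2).
  move=> z hzb; have [zw zw' b1 b2] := hz z hzb.
  set A := (z - w)^-1 in b1 *; set B := (z - w')^-1 in b2 *.
  have AB : B - A = D * (A * B).
    by rewrite /A /B /D; field; rewrite !subr_eq0 zw zw'.
  pose Q := A ^+ 2 * B * (if n == 1%N then 1 else 2 * A + B).
  have QE : B ^+ n - A ^+ n - n%:R * D * A ^+ n.+1 = D ^+ 2 * Q.
    case: n12 => nE; rewrite /Q nE /=.
      have -> : B ^+ 1 - A ^+ 1 - 1%:R * D * A ^+ 2 = (B - A) - D * A ^+ 2 by ring.
      rewrite AB; have -> : D * (A * B) - D * A ^+ 2 = D * A * (B - A) by ring.
      by rewrite AB; ring.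
    have -> : B ^+ 2 - A ^+ 2 - 2%:R * D * A ^+ 3 = (B - A) * (A + B) - 2 * D * A ^+ 3 by ring.
    rewrite AB.
    have -> : D * (A * B) * (A + B) - 2 * D * A ^+ 3 = D * A * ((B - A) * (2 * A + B)) by ring.
    by rewrite AB; ring.
  have -> : phi z * B ^+ n + (-1 * (phi z * A ^+ n) + - (n%:R * D) * (phi z * A ^+ n.+1)) =
    phi z * (B ^+ n - A ^+ n - n%:R * D * A ^+ n.+1) by ring.
  rewrite QE (nmM (phi z)) (nmM (D ^+ 2)) nmX; apply: ler_pM; rewrite ?mulr_ge0 ?exprn_ge0 ?nm_ge0//; first exact: HM.
  rewrite ler_wpM2l ?exprn_ge0 ?nm_ge0// /Q (nmM (A ^+ 2 * B)) (nmM (A ^+ 2)) nmX.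
  have mV : 0 < m^-1 by rewrite invr_gt0.
  have q1 : nm A ^+ 2 * nm B <= (m^-1) ^+ 2 * (2 / m).
    apply: ler_pM; rewrite ?exprn_ge0 ?nm_ge0//.
    by rewrite ler_pXn2r ?nnegrE ?nm_ge0 ?(ltW mV).
  have E3 : (m^-1) ^+ 2 * (2 / m) = 2 / m ^+ 3 by field; rewrite gt_eqF.
  case: ifP => _.
    rewrite nm1 mulr1; apply: le_trans q1 _; rewrite E3 lerDr divr_ge0 ?exprn_ge0 ?ltW//.
  apply: (@le_trans _ _ (2 / m ^+ 3 * (4 / m))).
    rewrite -E3; apply: ler_pM; rewrite ?mulr_ge0 ?exprn_ge0 ?nm_ge0//.
    apply: le_trans (nmD _ _) _; rewrite nmM nm_nat; lra.
  have -> : 2 / m ^+ 3 * (4 / m) = 8 / m ^+ 4 by field; rewrite gt_eqF.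
  have p4 : 0 < (m ^+ 4)^-1 by rewrite invr_gt0 exprn_gt0.
  have p3 : 0 < (m ^+ 3)^-1 by rewrite invr_gt0 exprn_gt0.
  lra.
apply: le_trans bnd _.
have -> : 4 * (M * (nm D ^+ 2 * (16 / m ^+ 4 + 2 / m ^+ 3))) * S = nm D * ((K - 1) * nm D).
  by rewrite /K; ring.
rewrite mulrC ler_wpM2r ?nm_ge0//.
move: hwe; rewrite ltr_pdivlMr// => hwe; have := nm_ge0 D; lra.
Qed.
End CauchyType.

Definition der f z : C := xget 0 [set d : C | cderiv f z d].

Lemma derP f z : hol f z -> cderiv f z (der f z).
Proof. by move=> [d dd]; rewrite /der; have := @xgetPex _ 0 [set d : C | cderiv f z d]; apply; exists d. Qed.

Lemma derE f z (d : C) : cderiv f z d -> der f z = d.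
Proof. by move=> dd; apply: (cderiv_unique (derP _) dd); exists d. Qed.

Lemma sqP w r z : 0 < r -> inrect (Re w - r / 2) (Re w + r / 2) (Im w - r / 2) (Im w + r / 2) z ->
  nm (z - w) < r.
Proof.
move=> r0 /andP[/andP[? ?] /andP[? ?]].
rewrite -(@ltr_pXn2r _ 2)// ?nnegrE ?nm_ge0 ?ltW// nm_sqr ReD ReN ImD ImN.
have h1 : (Re z - Re w) ^+ 2 <= (r / 2) ^+ 2.
  rewrite -[leLHS]real_normK ?num_real// ler_pXn2r ?nnegrE// ?ler_norml; lra.
have h2 : (Im z - Im w) ^+ 2 <= (r / 2) ^+ 2.
  rewrite -[leLHS]real_normK ?num_real// ler_pXn2r ?nnegrE// ?ler_norml; lra.
have : 0 < r ^+ 2 by rewrite exprn_gt0.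
move: h1 h2; have -> : (r / 2) ^+ 2 = r ^+ 2 / 4 by field.
lra.
Qed.

Lemma ball_sq w r z : nm (z - w) < r / 2 ->
  Re w - r / 2 < Re z < Re w + r / 2 /\ Im w - r / 2 < Im z < Im w + r / 2.
Proof.
move=> h; have := Re_le_nm (z - w); have := Im_le_nm (z - w).
rewrite !ler_norml ReD ReN ImD ImN; lra.
Qed.

Lemma cauchy_ball f w r : 0 < r -> (forall z, nm (z - w) < r -> hol f z) ->
  forall z, nm (z - w) < r / 2 ->
  f z = twopii^-1 * cauchyI f (Re w - r / 2) (Re w + r / 2) (Im w - r / 2) (Im w + r / 2) 1 z /\
  cderiv f z (twopii^-1 * cauchyI f (Re w - r / 2) (Re w + r / 2) (Im w - r / 2) (Im w + r / 2) 2 z).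
Proof.
move=> r0 H; set a := Re w - _; set b := Re w + _; set c := Im w - _; set d := Im w + _.
have ab : a < b by rewrite /a /b; lra.
have cd : c < d by rewrite /c /d; lra.
have E z : nm (z - w) < r / 2 -> f z = twopii^-1 * cauchyI f a b c d 1 z.
  move=> hz; have [h1 h2] := ball_sq hz.
  rewrite /cauchyI (_ : (fun _ => _) = (fun u => f u / (u - z))); last first.
    by apply/funext => u; rewrite expr1.
  rewrite (cauchy h1 h2) ?mulKf ?twopii_neq0// => u /(sqP r0); exact: H.
move=> z hz; split; first exact: E.
have [h1 h2] := ball_sq hz.
have hr : 0 < r / 2 - nm (z - w) by lra.
apply: (@cderiv_near _ (fun z => twopii^-1 * cauchyI f a b c d 1 z) _ _ _ _ hr).
  move=> u hu; rewrite -E//; have -> : u - w = (u - z) + (z - w) by ring.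
  by apply: le_lt_trans (nmD _ _) _; lra.
apply: cderivZ.
have cf : bdcont f a b c d by move=> u /onbd_in /(sqP r0) /H /hol_cont.
have := cauchyI_deriv ab cd cf (or_introl (erefl 1%N)) h1 h2.
by rewrite mul1r.
Qed.

Lemma der_hol f w r : 0 < r -> (forall z, nm (z - w) < r -> hol f z) -> hol (der f) w.
Proof.
move=> r0 H; set a := Re w - r / 2; set b := Re w + r / 2; set c := Im w - r / 2; set d := Im w + r / 2.
have r2 : 0 < r / 2 by rewrite divr_gt0.
have ab : a < b by rewrite /a /b; lra.
have cd : c < d by rewrite /c /d; lra.
apply: (@hol_near _ (fun z => twopii^-1 * cauchyI f a b c d 2 z) _ _ _ r2).
  by move=> z hz; apply/esym/derE; exact: (cauchy_ball r0 H hz).2.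
have hw : nm (w - w) < r / 2 by rewrite subrr nm0.
have [h1 h2] := ball_sq hw.
have cf : bdcont f a b c d by move=> u /onbd_in /(sqP r0) /H /hol_cont.
apply: holM; first exact: hol_cst.
by eexists; exact: (cauchyI_deriv ab cd cf (or_intror (erefl 2%N)) h1 h2).
Qed.

(** Cauchy's formula on the square of side [r] about [w]: [rint_bound] yields
    [4 * (M * (2 / r) ^+ 2) * (2 * r)], and the division by [twopii] is estimated by 1. *)
Lemma cauchy_estimate f w r M : 0 < r -> (forall z, nm (z - w) < r -> hol f z) ->
  (forall z, nm (z - w) < r -> nm (f z) <= M) -> nm (der f w) <= 32 * M / r.
Proof.
move=> r0 H HM; have M0 : 0 <= M.
  by apply: le_trans (nm_ge0 (f w)) (HM _ _); rewrite subrr nm0.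
have hw : nm (w - w) < r / 2 by rewrite subrr nm0 divr_gt0.
have := (cauchy_ball r0 H hw).2.
set a := Re w - r / 2; set b := Re w + r / 2; set c := Im w - r / 2; set d := Im w + r / 2.
have ab : a < b by rewrite /a /b; lra.
have cd : c < d by rewrite /c /d; lra.
move=> /derE ->; rewrite nmM nmV.
have [h1 h2] := ball_sq hw.
have cf : bdcont f a b c d by move=> u /onbd_in /(sqP r0) /H /hol_cont.
have B : nm (cauchyI f a b c d 2 w) <= 4 * (M * (2 / r) ^+ 2) * (b - a + (d - c)).
  apply: rint_bound; rewrite ?ltW//; first exact: (bdcont_ker cf 2 h1 h2).
  move=> z hz; rewrite nmM nmX; apply: ler_pM; rewrite ?nm_ge0 ?exprn_ge0 ?nm_ge0//.
    by apply: HM; apply: sqP => //; exact: onbd_in hz.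
  rewrite ler_pXn2r ?nnegrE ?nm_ge0 ?divr_ge0 ?(ltW r0)//.
  have -> : 2 / r = (r / 2)^-1 by rewrite invf_div.
  rewrite nmV lef_pV2 ?posrE ?divr_gt0// ?nm_gt0 ?subr_eq0 ?(bd_neq h1 h2 hz)//.
  move: hz => /andP[_] /or4P[] /eqP E.
  - apply: le_trans (Re_le_nm _); rewrite ReD ReN E ler_normr /a; lra.
  - apply: le_trans (Re_le_nm _); rewrite ReD ReN E ler_normr /b; lra.
  - apply: le_trans (Im_le_nm _); rewrite ImD ImN E ler_normr /c; lra.
  - apply: le_trans (Im_le_nm _); rewrite ImD ImN E ler_normr /d; lra.
apply: (@le_trans _ _ (nm (cauchyI f a b c d 2 w))).
  by rewrite ler_piMl ?nm_ge0// invf_le1 ?nm_twopii// (lt_le_trans _ nm_twopii).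
apply: le_trans B _; rewrite /a /b /c /d le_eqVlt; apply/orP; left; apply/eqP; field; rewrite gt_eqF//.
Qed.

Definition divpole f w z := if z == w then der f w else f z / (z - w).

Lemma divpole_mul f w z : f w = 0 -> f z = (z - w) * divpole f w z.
Proof.
move=> fw; rewrite /divpole; case: eqVneq => [->|zw]; first by rewrite subrr mul0r.
by rewrite mulrC divfK// subr_eq0.
Qed.

(** Near [w] the quotient equals the Cauchy type integral with density [f u / (u - w)]; this is the
    partial fraction decomposition of [1 / ((u - w) (u - z))] combined with [f w = 0]. *)
Lemma divpole_hol f w r : 0 < r -> (forall z, nm (z - w) < r -> hol f z) -> f w = 0 ->
  hol (divpole f w) w.
Proof.
move=> r0 H fw; set a := Re w - r / 2; set b := Re w + r / 2; set c := Im w - r / 2; set d := Im w + r / 2.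
have r2 : 0 < r / 2 by rewrite divr_gt0.
have ab : a < b by rewrite /a /b; lra.
have cd : c < d by rewrite /c /d; lra.
have cf : bdcont f a b c d by move=> u /onbd_in /(sqP r0) /H /hol_cont.
have hw : nm (w - w) < r / 2 by rewrite subrr nm0.
have [h1 h2] := ball_sq hw.
pose phi z := f z * (z - w)^-1 ^+ 1.
have cphi : bdcont phi a b c d := bdcont_ker cf 1 h1 h2.
apply: (@hol_near _ (fun z => twopii^-1 * cauchyI phi a b c d 1 z) _ _ _ r2); last first.
  apply: holM; first exact: hol_cst.
  by eexists; exact: (cauchyI_deriv ab cd cphi (or_introl (erefl 1%N)) h1 h2).
move=> z hz; rewrite /divpole; case: eqVneq => [->|zw].
  rewrite (derE (cauchy_ball r0 H hw).2); congr (_ * _); apply: rint_ext; rewrite ?ltW// => u _.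
  by rewrite /phi !expr1 expr2 mulrA.
have [h1' h2'] := ball_sq hz.
have -> : cauchyI phi a b c d 1 z = (z - w)^-1 * (cauchyI f a b c d 1 z + -1 * cauchyI f a b c d 1 w).
  have c1 := bdcont_ker cf 1 h1' h2'; have c2 := bdcont_ker cf 1 h1 h2.
  have c2' : bdcont (fun u => -1 * (f u * (u - w)^-1 ^+ 1)) a b c d.
    by move=> u hu; under eq_fun do rewrite mulrC; apply: ccontM; [exact: c2|exact: hol_cst].
  rewrite /cauchyI -rintZ ?ltW// -rintD ?ltW// -rintZ ?ltW//; last first.
    by move=> u hu; apply: ccontD; [exact: c1|exact: c2'].
  apply: rint_ext; rewrite ?ltW// => u hu; rewrite /phi !expr1.
  have uz := bd_neq h1' h2' hu; have uw := bd_neq h1 h2 hu.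
  by field; rewrite !subr_eq0 uz uw zw.
have Ez := (cauchy_ball r0 H hz).1; have Ew := (cauchy_ball r0 H hw).1.
rewrite mulrCA mulrDr -Ez mulrCA -Ew fw mulr0 addr0 mulrC //.
Qed.

(** Cauchy's formula survives the uniform limit, so near [w] the limit is a Cauchy type integral
    with continuous density. *)
Lemma weierstrass (F : nat -> C -> C) f w r : 0 < r ->
  (forall n z, nm (z - w) < r -> hol (F n) z) ->
  (forall e, 0 < e -> exists N, forall n, (N <= n)%N -> forall z, nm (z - w) < r ->
    nm (F n z - f z) <= e) -> hol f w.
Proof.
move=> r0 HF U.
have cf z : nm (z - w) < r -> ccontat f z.
  move=> hz e e0; have e3 : 0 < e / 4 by rewrite divr_gt0.
  have [N /(_ N (leqnn _)) HN] := U _ e3.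
  have [s s0 Hs] := hol_cont (HF N z hz) e3.
  exists (Num.min s (r - nm (z - w))); first by rewrite lt_min s0; lra.
  move=> u; rewrite lt_min => /andP[/Hs h1 h2].
  have hu : nm (u - w) < r.
    have -> : u - w = (u - z) + (z - w) by ring.
    by apply: le_lt_trans (nmD _ _) _; lra.
  have -> : f u - f z = (F N u - F N z) - (F N u - f u) + (F N z - f z) by ring.
  have h3 := HN u hu; have h4 := HN z hz.
  apply: le_lt_trans (nmD _ _) _.
  by have := nmB (F N u - F N z) (F N u - f u); lra.
set a := Re w - r / 2; set b := Re w + r / 2; set c := Im w - r / 2; set d := Im w + r / 2.
have r2 : 0 < r / 2 by rewrite divr_gt0.
have ab : a < b by rewrite /a /b; lra.
have cd : c < d by rewrite /c /d; lra.
have cfb : bdcont f a b c d by move=> u /onbd_in /(sqP r0) /cf.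
have hw : nm (w - w) < r / 2 by rewrite subrr nm0.
have [h1 h2] := ball_sq hw.
apply: (@hol_near _ (fun z => twopii^-1 * cauchyI f a b c d 1 z) _ _ _ r2); last first.
  apply: holM; first exact: hol_cst.
  by eexists; exact: (cauchyI_deriv ab cd cfb (or_introl (erefl 1%N)) h1 h2).
move=> z hz; apply/eqP; rewrite -subr_eq0 -nm_eq0; apply/eqP/le_anti; rewrite nm_ge0 andbT.
apply/ler_addgt0Pr => e e0; rewrite add0r.
have [h1' h2'] := ball_sq hz; have [m m0 Hm] := bd_dist h1' h2'.
set K := 4 / m * (b - a + (d - c)) + 1.
have K1 : 1 <= K by rewrite /K lerDr !mulr_ge0 ?invr_ge0 ?ltW//; rewrite /a /b /c /d; lra.
have K0 : 0 < K by lra.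
have [N /(_ N (leqnn _)) HN] := U _ (divr_gt0 e0 K0).
have hzr : nm (z - w) < r by lra.
have HNz := HN z hzr.
have cFb : bdcont (F N) a b c d by move=> u /onbd_in /(sqP r0) /HF /hol_cont; exact.
have EF := (cauchy_ball r0 (HF N) hz).1.
have E : twopii^-1 * cauchyI f a b c d 1 z - f z = (F N z - f z) -
   twopii^-1 * rint (fun u => (F N u + -1 * f u) * (u - z)^-1 ^+ 1) a b c d.
  rewrite [in RHS]EF.
  have -> : rint (fun u => (F N u + -1 * f u) * (u - z)^-1 ^+ 1) a b c d =
     cauchyI (F N) a b c d 1 z + -1 * cauchyI f a b c d 1 z.
    have c1 := bdcont_ker cFb 1 h1' h2'; have c2 := bdcont_ker cfb 1 h1' h2'.
    have c2' : bdcont (fun u => -1 * (f u * (u - z)^-1 ^+ 1)) a b c d.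
      by move=> u hu; under eq_fun do rewrite mulrC; apply: ccontM; [exact: c2|exact: hol_cst].
    rewrite /cauchyI -rintZ ?ltW// -rintD ?ltW//.
    by apply: rint_ext; rewrite ?ltW// => u _; rewrite mulrDl mulrA.
  ring.
rewrite E; apply: le_trans (nmB _ _) _; rewrite nmM nmV.
have B : nm (rint (fun u => (F N u + -1 * f u) * (u - z)^-1 ^+ 1) a b c d) <=
   4 * (e / K / m) * (b - a + (d - c)).
  apply: rint_bound; rewrite ?ltW//.
    move=> u hu; apply: ccontM; last exact/hol_invsub/(bd_neq h1' h2').
    apply: ccontD; first exact: cFb.
    by under eq_fun do rewrite mulrC; apply: ccontM; [exact: cfb|exact: hol_cst].
  move=> u hu; rewrite nmM expr1 mulN1r; apply: ler_pM; rewrite ?nm_ge0//.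
    by apply: HN; apply: sqP => //; exact: onbd_in hu.
  rewrite nmV lef_pV2 ?posrE//; first exact: Hm.
  by rewrite nm_gt0 subr_eq0 (bd_neq h1' h2').
have B2 : (nm twopii)^-1 * nm (rint (fun u => (F N u + -1 * f u) * (u - z)^-1 ^+ 1) a b c d) <=
   4 * (e / K / m) * (b - a + (d - c)).
  apply: le_trans B; rewrite ler_piMl ?nm_ge0// invf_le1 ?nm_twopii// (lt_le_trans _ nm_twopii)//.
have -> : e = e / K + 4 * (e / K / m) * (b - a + (d - c)).
  have -> : 4 * (e / K / m) * (b - a + (d - c)) = e / K * (K - 1) by rewrite /K; ring.
  by rewrite mulrBr mulr1 divfK ?gt_eqF//; ring.
lra.
Qed.
End CauchyConsequences.

(** * Exponential, maximum modulus and logarithms *)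

Section Cexp.
Variable R : realType.
Local Notation C := R[i].
Local Notation nm := (@nm R).
Implicit Types (z w : C).

Definition cexp z : C := (expR (Re z))%:C * (cos (Im z) +i* sin (Im z)).

Lemma ReCexp z : Re (cexp z) = expR (Re z) * cos (Im z).
Proof. by rewrite /cexp ReM /= mul0r subr0. Qed.
Lemma ImCexp z : Im (cexp z) = expR (Re z) * sin (Im z).
Proof. by rewrite /cexp ImM /= mul0r addr0. Qed.
Lemma cexpD z w : cexp (z + w) = cexp z * cexp w.
Proof.
apply: ceqP.
  rewrite (ReM (cexp z)) !ReCexp !ImCexp ReD ImD expRD cosD; ring.
rewrite (ImM (cexp z)) !ImCexp !ReCexp ReD ImD expRD sinD; ring.
Qed.
Lemma cexp0 : cexp 0 = 1.
Proof. by apply: ceqP; rewrite ?ReCexp ?ImCexp /= expR0 ?cos0 ?sin0 mul1r. Qed.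
Lemma nm_cexp z : nm (cexp z) = expR (Re z).
Proof.
rewrite /cexp nmM nm_real ger0_norm ?expR_ge0// -[RHS]mulr1; congr (_ * _).
apply/eqP; rewrite -(@eqrXn2 _ 2)// ?nm_ge0// nm_sqr /= expr1n.
by rewrite cos2Dsin2.
Qed.
Lemma cexp_neq0 z : cexp z != 0.
Proof. by rewrite -nm_gt0 nm_cexp expR_gt0. Qed.
Lemma rcpowE (x : R) z : rcpow x z = cexp (z * (ln x)%:C).
Proof.
by rewrite /rcpow /cexp ReM ImM /= !mulr0 subr0 add0r.
Qed.

Lemma cexp_near0 (e : R) : 0 < e -> exists2 r, 0 < r &
  forall z, nm z < r -> nm (cexp z - 1 - z) <= e * nm z.
Proof.
(* The four error terms below are at most 1, 3, 1 and 4 times [e1 * N]; 12 leaves room for them. *)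
move=> e0; have [e1 [e10 e11 e1e]] : exists e1, [/\ 0 < e1, e1 <= 1 & 12 * e1 <= e].
  exists (Num.min 1 (e / 12)); split; [by rewrite lt_min ltr01 divr_gt0|by rewrite ge_min lexx|].
  by rewrite mulrC -ler_pdivlMr// ge_min lexx orbT.
have [r1 r10 H1] := proj1 (rderivP _ _ _) (is_derive_expR (0 : R)) _ e10.
have [r2 r20 H2] := proj1 (rderivP _ _ _) (is_derive_cos (0 : R)) _ e10.
have [r3 r30 H3] := proj1 (rderivP _ _ _) (is_derive_sin (0 : R)) _ e10.
exists (Num.min (Num.min r1 r2) (Num.min r3 e1)).
  by rewrite !lt_min r10 r20 r30.
case=> x y; rewrite !lt_min => /andP[/andP[h1 h2] /andP[h3 h4]].
set N := nm _ in h1 h2 h3 h4 *.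
have xN : `|x| <= N := Re_le_nm (x +i* y).
have yN : `|y| <= N := Im_le_nm (x +i* y).
have := H1 x; rewrite subr0 expR0 mul1r => /(_ (le_lt_trans xN h1)).
have := H2 y; rewrite subr0 cos0 sin0 oppr0 mul0r subr0 => /(_ (le_lt_trans yN h2)).
have := H3 y; rewrite subr0 cos0 sin0 subr0 mul1r => /(_ (le_lt_trans yN h3)).
set s := sin y - y; set c := cos y - 1; set t := expR x - 1 - x => B3 B2 B1.
apply: le_trans (nm_le_ReIm _) _.
rewrite !ReD !ImD !ReN !ImN ReCexp ImCexp /= oppr0 addr0.
have -> : expR x * cos y - 1 - x = t + c * (1 + x + t) by rewrite /t /c; ring.
have -> : expR x * sin y - y = s + (x + t) * (y + s) by rewrite /t /s; ring.
have N0 : 0 <= N := nm_ge0 _.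
have tN : `|t| <= e1 * N by apply: le_trans B1 _; rewrite ler_wpM2l// ltW.
have cN : `|c| <= e1 * N by apply: le_trans B2 _; rewrite ler_wpM2l// ltW.
have sN : `|s| <= e1 * N by apply: le_trans B3 _; rewrite ler_wpM2l// ltW.
have e1N : e1 * N <= N by rewrite ler_piMl.
have xe : `|x| <= e1 by apply: le_trans xN (ltW h4).
have te : `|t| <= e1.
  by apply: le_trans tN _; rewrite ler_piMr ?(ltW e10)//; apply: le_trans (ltW h4) e11.
have b1 : `|1 + x + t| <= 3.
  apply: le_trans (ler_normD _ _) _; apply: (@le_trans _ _ (1 + `|x| + `|t|)); last lra.
  by rewrite lerD2r; apply: le_trans (ler_normD _ _) _; rewrite normr1.
have b2 : `|x + t| <= 2 * e1 by apply: le_trans (ler_normD _ _) _; lra.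
have b3 : `|y + s| <= 2 * N by apply: le_trans (ler_normD _ _) _; lra.
have b4 : `|c * (1 + x + t)| <= (e1 * N) * 3 by rewrite normrM; apply: ler_pM.
have b5 : `|(x + t) * (y + s)| <= (2 * e1) * (2 * N) by rewrite normrM; apply: ler_pM.
have b6 : 12 * e1 * N <= e * N by rewrite ler_wpM2r.
have := ler_normD t (c * (1 + x + t)); have := ler_normD s ((x + t) * (y + s)).
have : 0 <= e1 * N by rewrite mulr_ge0// ltW.
lra.
Qed.

Lemma cderiv_cexp z : cderiv cexp z (cexp z).
Proof.
move=> e e0; have E0 : 0 < e / nm (cexp z) by rewrite divr_gt0// nm_gt0 cexp_neq0.
have [r r0 Hr] := cexp_near0 E0; exists r => // w /Hr h.
have {1}-> : w = z + (w - z) by ring.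
rewrite cexpD.
have -> : cexp z * cexp (w - z) - cexp z - cexp z * (w - z) = cexp z * (cexp (w - z) - 1 - (w - z)) by ring.
have n0 : 0 < nm (cexp z) by rewrite nm_gt0 cexp_neq0.
rewrite nmM mulrC -ler_pdivlMr//; apply: le_trans h _.
by rewrite mulrAC.
Qed.

Lemma hol_cexp z : hol cexp z. Proof. by exists (cexp z); exact: cderiv_cexp. Qed.

Lemma nm_cexpi_le (x y : R) : nm (cexp (0 +i* x) - cexp (0 +i* y)) <= 2 * `|x - y|.
Proof.
have := @seg_bound R cexp cexp (0 +i* y) (0 +i* x) 1.
rewrite mulr1; have -> : nm ((0 +i* x) - (0 +i* y)) = `|x - y|.
  have -> : (0 +i* x) - (0 +i* y) = 'i * (x - y)%:C :> C by apply: ceqP => /=; ring.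
  by rewrite nmM nm_i mul1r nm_real.
apply=> t _; first exact: cderiv_cexp.
rewrite nm_cexp (_ : Re _ = 0) ?expR0//=; ring.
Qed.
End Cexp.
Arguments cexp : simpl never.

(** * Maximum modulus and primitives *)

Section MaxModulus.
Variable R : realType.
Local Notation C := R[i].
Local Notation nm := (@nm R).
Implicit Types (f g G : C -> C) (z w : C) (a b c d x y : R).

Lemma bernoulli (q : R) n : 1 <= q -> 1 + n%:R * (q - 1) <= q ^+ n.
Proof.
move=> q1; elim: n => [|n ih]; first by rewrite mul0r addr0 expr0.
rewrite exprS; apply: (@le_trans _ _ (q * (1 + n%:R * (q - 1)))); last by rewrite ler_wpM2l//; lra.
rewrite -natr1; have : 0 <= n%:R * (q - 1) * (q - 1) by rewrite !mulr_ge0 ?subr_ge0.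
lra.
Qed.

(* Applied to the powers of a holomorphic function, this removes the constant
   lost in the crude bound by Cauchy's formula. *)
Lemma pow_trick (x M K : R) : 0 <= M -> (forall n, x ^+ n <= K * M ^+ n) -> x <= M.
Proof.
move=> M0 H; rewrite leNgt; apply/negP => Mx.
have [M00|M00] := eqVneq M 0.
  by have := H 1%N; rewrite M00 !expr1 mulr0 leNgt -M00 Mx.
have Mp : 0 < M by rewrite lt_def M00.
have q1 : 1 < x / M by rewrite ltr_pdivlMr// mul1r.
have HK n : (x / M) ^+ n <= K.
  by rewrite expr_div_n ler_pdivrMr ?exprn_gt0.
have [n hn] : exists n : nat, K / (x / M - 1) < n%:R.
  by exists (Num.truncn (K / (x / M - 1))).+1; exact: truncnS_gt.
move: hn; rewrite ltr_pdivrMr ?subr_gt0// => hn.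
by have := bernoulli n (ltW q1); have := HK n; lra.
Qed.

Lemma cauchy_bound a b c d w : a < Re w < b -> c < Im w < d ->
  exists K, forall f, (forall z, inrect a b c d z -> hol f z) ->
  forall M, 0 <= M -> (forall z, onbd a b c d z -> nm (f z) <= M) -> nm (f w) <= K * M.
Proof.
move=> h1 h2; have [m m0 Hm] := bd_dist h1 h2.
have ab : a < b by move: h1 => /andP[? ?]; lra.
have cd : c < d by move: h2 => /andP[? ?]; lra.
exists (4 / m * (b - a + (d - c))) => g H M M0 HM.
have := cauchy h1 h2 H; move=> /(congr1 nm); rewrite nmM => E.
apply: (@le_trans _ _ (nm (twopii R) * nm (g w))).
  by rewrite ler_peMl ?nm_ge0 ?nm_twopii.
rewrite -E (_ : 4 / m * (b - a + (d - c)) * M = 4 * (M / m) * (b - a + (d - c))); last by ring.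
apply: rint_bound; rewrite ?ltW//.
  move=> z hz; apply/hol_cont/hol_div; [exact/H/onbd_in|exact: hol_subC|].
  by rewrite subr_eq0 (bd_neq h1 h2 hz).
move=> z hz; rewrite nmM nmV; apply: ler_pM; rewrite ?nm_ge0 ?invr_ge0 ?nm_ge0//; first exact: HM.
have zw : 0 < nm (z - w) by apply: lt_le_trans (Hm z hz).
by rewrite lef_pV2 ?posrE//; exact: Hm.
Qed.

Theorem max_modulus f a b c d M : a < b -> c < d -> 0 <= M ->
  (forall z, inrect a b c d z -> hol f z) ->
  (forall z, onbd a b c d z -> nm (f z) <= M) ->
  forall z, inrect a b c d z -> nm (f z) <= M.
Proof.
move=> ab cd M0 H HM w hw.
have [hb|nb] := boolP (onbd a b c d w); first exact: HM.
move: (hw) => /andP[/andP[w1 w2] /andP[w3 w4]].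
move: nb; rewrite /onbd hw /= !negb_or => /and4P[n1 n2 n3 n4].
have h1 : a < Re w < b by rewrite !lt_def w1 w2 n1 eq_sym n2.
have h2 : c < Im w < d by rewrite !lt_def w3 w4 n3 eq_sym n4.
have [K HK] := cauchy_bound h1 h2.
apply: (pow_trick (K := K)) => // n; rewrite -nmX.
apply: (HK (fun z => f z ^+ n)); rewrite ?exprn_ge0// => z hz; first by apply: holX; exact: H.
by rewrite nmX lerXn2r ?nnegrE ?nm_ge0//; exact: HM.
Qed.

Lemma cint_cst (k : C) a b : a <= b -> cint (fun=> k) a b = k * (b - a)%:C.
Proof.
move=> ab; have E : cint (fun x : R => (fun=> k) (x +i* 0)) a b = k * (b +i* 0) - k * (a +i* 0).
  apply: (@cint_primH R (fun z => k * z) (fun=> k)) => // x _.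
  by have := cderivZ k (cderiv_id (x +i* 0)); rewrite mulr1.
by rewrite E -mulrBr rmorphB.
Qed.

Lemma ccont_cst (k : C) a b : ccont (fun=> k) a b.
Proof. by move=> x _ e e0; exists 1 => // y _ _; rewrite subrr nm0. Qed.

Lemma cint_incr (phi : R -> C) (k : C) a b x x' e : ccont phi a b ->
  a <= x <= b -> a <= x' <= b ->
  (forall t, a <= t <= b -> `|t - x| <= `|x' - x| -> nm (phi t - k) <= e) ->
  nm (cint phi a x' - cint phi a x - k * (x' - x)%:C) <= 2 * e * `|x' - x|.
Proof.
have main s t (cf : ccont phi a b) : a <= s -> s <= t -> t <= b ->
  (forall u, s <= u <= t -> nm (phi u - k) <= e) ->
  nm (cint phi a t - cint phi a s - k * (t - s)%:C) <= 2 * e * (t - s).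
  move=> as_ st tb H.
  have cf1 : ccont phi a t := ccontW (lexx a) tb cf.
  have cf2 : ccont phi s t := ccontW as_ tb cf.
  have cf3 : ccont (fun u => phi u + - k) s t.
    move=> u hu e' e'0; have [d' d'0 Hd] := cf2 u hu e' e'0; exists d' => // y hy hyu.
    have -> : phi y + - k - (phi u + - k) = phi y - phi u by ring.
    exact: Hd.
  rewrite (cint_chasles as_ st cf1).
  have -> : cint phi a s + cint phi s t - cint phi a s - k * (t - s)%:C =
     cint (fun u => phi u + - k) s t.
    by rewrite cintD// ?cint_cst//; [ring|exact: ccont_cst].
  exact: cint_bound.
move=> cf /andP[x1 x2] /andP[y1 y2] H; have [xx|xx] := leP x x'.
  rewrite ger0_norm ?subr_ge0//; apply: main => // u /andP[u1 u2]; apply: H.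
    by rewrite (le_trans x1 u1) (le_trans u2 y2).
  by rewrite !ger0_norm ?subr_ge0// lerD2r.
rewrite distrC ger0_norm ?subr_ge0 ?(ltW xx)// -nmN.
have -> : - (cint phi a x' - cint phi a x - k * (x' - x)%:C) =
  cint phi a x - cint phi a x' - k * (x - x')%:C by rewrite !rmorphB; ring.
apply: main; rewrite ?(ltW xx)// => u /andP[u1 u2]; apply: H.
  by rewrite (le_trans y1 u1) (le_trans u2 x2).
by rewrite distrC [leRHS]distrC !ger0_norm ?subr_ge0 ?(ltW xx)// lerD2l lerN2.
Qed.

(** [F] integrates upwards and then across, [G] across and then upwards; by Goursat's theorem they
    agree. Horizontal increments are read off [F], vertical ones off [G]. *)
Lemma primitive f a b c d : a < b -> c < d -> (forall z, inrect a b c d z -> hol f z) ->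
  exists F, forall z, a < Re z < b -> c < Im z < d -> cderiv F z (f z).
Proof.
move=> ab cd H.
pose F z := 'i * cint (fun v => f (a +i* v)) c (Im z) + cint (fun u => f (u +i* Im z)) a (Re z).
pose G z := cint (fun u => f (u +i* c)) a (Re z) + 'i * cint (fun v => f (Re z +i* v)) c (Im z).
have FG z : a < Re z < b -> c < Im z < d -> F z = G z.
  move=> /andP[z1 z2] /andP[z3 z4].
  have : rint f a (Re z) c (Im z) = 0.
    apply: goursat => // u /andP[/andP[? ?] /andP[? ?]]; apply: H; rewrite /inrect; lra.
  move=> E; apply/eqP; rewrite -subr_eq0 -[X in _ == X]oppr0 -E /rint /F /G; apply/eqP; ring.
exists F => z hz1 hz2; move: (hz1) (hz2) => /andP[z1 z2] /andP[z3 z4].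
have cf : ccontat f z by apply/hol_cont/H; rewrite /inrect !ltW.
move=> e e0; have e4 : 0 < e / 4 by rewrite divr_gt0.
have [r r0 Hr] := cf _ e4.
exists (Num.min r (Num.min (Num.min (Re z - a) (b - Re z)) (Num.min (Im z - c) (d - Im z)))).
  by rewrite !lt_min r0 !subr_gt0 z1 z2 z3 z4.
move=> w; rewrite !lt_min => /andP[wr /andP[/andP[k1 k2] /andP[k3 k4]]].
have hx : `|Re w - Re z| <= nm (w - z) by rewrite -ReN -ReD Re_le_nm.
have hy : `|Im w - Im z| <= nm (w - z) by rewrite -ImN -ImD Im_le_nm.
have [wx1 wx2] : a < Re w /\ Re w < b by move: hx; rewrite ler_norml; lra.
have [wy1 wy2] : c < Im w /\ Im w < d by move: hy; rewrite ler_norml; lra.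
have cH : ccont (fun u => f (u +i* Im z)) a b.
  by apply: contH_ccont => u hu; apply/hol_cont/H; rewrite /inrect /= hu !ltW.
have cV : ccont (fun v => f (Re w +i* v)) c d.
  by apply: contV_ccont => u hu; apply/hol_cont/H; rewrite /inrect /= hu !ltW.
have I1 := @cint_incr _ (f z) a b (Re z) (Re w) (e / 4) cH.
have I2 := @cint_incr _ (f z) c d (Im z) (Im w) (e / 4) cV.
have {}I1 : nm (cint (fun u => f (u +i* Im z)) a (Re w) - cint (fun u => f (u +i* Im z)) a (Re z)
    - f z * (Re w - Re z)%:C) <= 2 * (e / 4) * `|Re w - Re z|.
  apply: I1; rewrite ?ltW// => t _ ht; apply/ltW/Hr.
  have -> : t +i* Im z - z = (t - Re z)%:C by case: (z) => ? ?; apply: ceqP => /=; ring.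
  by rewrite nm_real; apply: le_lt_trans ht (le_lt_trans hx wr).
have {}I2 : nm (cint (fun u => f (Re w +i* u)) c (Im w) - cint (fun u => f (Re w +i* u)) c (Im z)
    - f z * (Im w - Im z)%:C) <= 2 * (e / 4) * `|Im w - Im z|.
  apply: I2; rewrite ?ltW// => t _ ht; apply/ltW/Hr; apply: le_lt_trans wr.
  rewrite -(@ler_pXn2r _ 2)// ?nnegrE ?nm_ge0// !nm_sqr !ReD !ImD !ReN !ImN /= lerD2l.
  by rewrite -(real_normK (num_real (t - _))) -(real_normK (num_real (Im w - _))) ler_pXn2r ?nnegrE.
have E : F w - F z - f z * (w - z) =
   'i * (cint (fun u => f (Re w +i* u)) c (Im w) - cint (fun u => f (Re w +i* u)) c (Im z)
    - f z * (Im w - Im z)%:C) +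
   (cint (fun u => f (u +i* Im z)) a (Re w) - cint (fun u => f (u +i* Im z)) a (Re z)
    - f z * (Re w - Re z)%:C).
  have -> : F w - F z = (G w - G (Re w +i* Im z)) + (F (Re w +i* Im z) - F z).
    rewrite (FG w) ?wx1 ?wy1// -(FG (Re w +i* Im z)) /= ?wx1 ?z3//; ring.
  have -> : w - z = (Re w - Re z)%:C + 'i * (Im w - Im z)%:C.
    by apply: ceqP; rewrite !(ReD, ImD, ReN, ImN, ReM, ImM) /=; ring.
  rewrite /F /G /=; ring.
rewrite E; apply: le_trans (nmD _ _) _; rewrite nmM nm_i mul1r.
have l1 : e / 4 * `|Re w - Re z| <= e / 4 * nm (w - z) by rewrite ler_wpM2l// ltW.
have l2 : e / 4 * `|Im w - Im z| <= e / 4 * nm (w - z) by rewrite ler_wpM2l// ltW.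
lra.
Qed.
End MaxModulus.

(** * Holomorphic logarithms and the Borel-Caratheodory inequality *)

Section BorelCaratheodory.
Variable R : realType.
Local Notation C := R[i].
Local Notation nm := (@nm R).
Implicit Types (f g G : C -> C) (z w : C).

Definition sq w (r : R) z := inrect (Re w - r) (Re w + r) (Im w - r) (Im w + r) z.

Lemma sqE w r z : sq w r z = (`|Re z - Re w| <= r) && (`|Im z - Im w| <= r).
Proof.
by rewrite /sq /inrect !ler_norml; congr (_ && _ && (_ && _)); apply/idP/idP; lra.
Qed.

Lemma nm_sq w r z : nm (z - w) <= r -> sq w r z.
Proof.
move=> h; rewrite sqE -ReN -ReD -ImN -ImD (le_trans (Re_le_nm _) h).
by rewrite (le_trans (Im_le_nm _) h).
Qed.

Lemma sq_nhd w r r' z : r < r' -> sq w r z -> forall u, nm (u - z) < r' - r -> sq w r' u.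
Proof.
move=> rr; rewrite sqE => /andP[h1 h2] u hu; rewrite sqE.
have -> : Re u - Re w = (Re (u - z)) + (Re z - Re w) by rewrite ReD ReN; ring.
have -> : Im u - Im w = (Im (u - z)) + (Im z - Im w) by rewrite ImD ImN; ring.
have := Re_le_nm (u - z); have := Im_le_nm (u - z) => k1 k2.
by apply/andP; split; apply: le_trans (ler_normD _ _) _; lra.
Qed.

Lemma sqW w r r' z : r <= r' -> sq w r z -> sq w r' z.
Proof. by move=> rr; rewrite !sqE => /andP[h1 h2]; rewrite !(le_trans _ rr). Qed.

Lemma sq_bd_dist w r z : onbd (Re w - r) (Re w + r) (Im w - r) (Im w + r) z -> r <= nm (z - w).
Proof.
move=> /andP[_] /or4P[] /eqP E.
- by apply: le_trans (Re_le_nm _); rewrite ReD ReN E ler_normr; lra.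
- by apply: le_trans (Re_le_nm _); rewrite ReD ReN E ler_normr; lra.
- by apply: le_trans (Im_le_nm _); rewrite ImD ImN E ler_normr; lra.
- by apply: le_trans (Im_le_nm _); rewrite ImD ImN E ler_normr; lra.
Qed.

Lemma sq_convex w r z u (t : R) : sq w r z -> sq w r u -> 0 <= t <= 1 -> sq w r (z + t%:C * (u - z)).
Proof.
rewrite !sqE => /andP[h1 h2] /andP[h3 h4] /andP[t0 t1].
have K (x y p : R) : `|x - p| <= r -> `|y - p| <= r -> `|x + t * (y - x) - p| <= r.
  move=> k1 k2; have -> : x + t * (y - x) - p = (1 - t) * (x - p) + t * (y - p) by ring.
  apply: le_trans (ler_normD _ _) _; rewrite !normrM (ger0_norm t0) ger0_norm; last lra.
  have : (1 - t) * `|x - p| <= (1 - t) * r by rewrite ler_wpM2l//; lra.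
  have : t * `|y - p| <= t * r by rewrite ler_wpM2l.
  lra.
have -> : Re (z + t%:C * (u - z)) = Re z + t * (Re u - Re z).
  by rewrite !(ReD, ReM, ReN, ImD, ImN) /=; ring.
have -> : Im (z + t%:C * (u - z)) = Im z + t * (Im u - Im z).
  by rewrite !(ReD, ReM, ReN, ImD, ImN, ImM) /=; ring.
by rewrite !K.
Qed.

Lemma divpole_hol_away f w z : z != w -> hol f z -> hol (divpole f w) z.
Proof.
move=> zw hf; have r0 : 0 < nm (z - w) by rewrite nm_gt0 subr_eq0.
apply: (@hol_near _ (fun z => f z / (z - w)) _ _ _ r0).
  move=> u hu; rewrite /divpole; case: eqVneq => // uw.
  by move: hu; rewrite uw nm_distC ltxx.
by apply: hol_div => //; [exact: hol_subC|rewrite subr_eq0].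
Qed.

Lemma der_zero_cst f w r z u : (forall z, sq w r z -> cderiv f z 0) -> sq w r z -> sq w r u ->
  f u = f z.
Proof.
move=> H hz hu; apply/eqP; rewrite -subr_eq0 -nm_eq0; apply/eqP/le_anti; rewrite nm_ge0 andbT.
have := @seg_bound R f (fun=> 0) z u 0; rewrite mulr0 mul0r; apply=> t ht.
  by apply: H; exact: sq_convex.
by rewrite nm0.
Qed.

(** The logarithm is a primitive [F] of [G' / G]: the product of [G] and [exp (- F)] has derivative
    zero on a convex set. *)
Lemma hol_log G w r r' : 0 < r' -> r' < r -> (forall z, sq w r z -> hol G z) ->
  (forall z, sq w r z -> G z != 0) ->
  exists h, [/\ forall z, sq w r' z -> cderiv h z (der G z / G z), h w = 0 &
    forall z, sq w r' z -> G z = G w * cexp (h z)].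
Proof.
move=> r'0 rr H G0; pose q := (r + r') / 2.
have [q1 q2] : r' < q /\ q < r by rewrite /q; lra.
have hf z : sq w q z -> hol (fun z => der G z / G z) z.
  move=> hz; apply: hol_div; last by apply: G0; apply: sqW hz; exact: ltW.
    apply: (@der_hol R G z (r - q)); first by rewrite subr_gt0.
    by move=> u hu; apply: H; exact: sq_nhd hz u hu.
  by apply: H; apply: sqW hz; exact: ltW.
have [||F HF] := @primitive R _ _ _ _ _ _ _ hf; [lra|lra|].
have HF' z : sq w r' z -> cderiv F z (der G z / G z).
  by move=> /andP[/andP[? ?] /andP[? ?]]; apply: HF; lra.
have sw : sq w r' w by apply: nm_sq; rewrite subrr nm0 ltW.
exists (fun z => F z - F w); split; last 1 first.
- move=> z hz.
  have E : G z * cexp (- (F z - F w)) = G w * cexp (- (F w - F w)).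
    apply: (@der_zero_cst (fun z => G z * cexp (- (F z - F w))) w r') => // u hu.
    have d1 : cderiv (fun z => - (F z - F w)) u (- (der G u / G u)).
      by apply: cderivN; rewrite -[X in cderiv _ _ X]subr0; apply: cderivB; [exact: HF'|exact: cderiv_cst].
    have hu' : sq w r u by apply: sqW hu; exact: ltW.
    have := cderivM (derP (H u hu')) (cderiv_comp d1 (cderiv_cexp _)).
    congr cderiv; field; exact: G0.
  move: E; rewrite subrr oppr0 cexp0 mulr1 => <-.
  by rewrite -mulrA -cexpD addNr cexp0 mulr1.
- move=> z hz; rewrite -[X in cderiv _ _ X]subr0; apply: cderivB; [exact: HF'|exact: cderiv_cst].
- by rewrite subrr.
Qed.

(* Borel-Caratheodory for a logarithm of [G], on squares instead of discs. *)
Lemma log_deriv_bound G w M : 1 < M ->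
  (forall z, sq w (39 / 20) z -> [/\ hol G z, G z != 0 & nm (G z) <= M * nm (G w)]) ->
  forall z, nm (z - w) <= 7 / 4 -> nm (der G z / G z) <= 32 * 760 * ln M.
Proof.
move=> M1 H z hz; set L := ln M.
have L0 : 0 < L by rewrite ln_gt0.
have H1 u : sq w (39 / 20) u -> hol G u by move=> /H[].
have H2 u : sq w (39 / 20) u -> G u != 0 by move=> /H[].
have p1 : 0 < 19 / 10 :> R by lra.
have p2 : 19 / 10 < 39 / 20 :> R by lra.
have [h [dh h0 Gh]] := hol_log p1 p2 H1 H2.
have sqi u : sq w (19 / 10) u -> sq w (39 / 20) u by apply: sqW; lra.
have wG : 0 < nm (G w).
  by have [] := H w; [apply: nm_sq; rewrite subrr nm0; lra|rewrite nm_gt0].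
have Reh u : sq w (19 / 10) u -> Re (h u) <= L.
  move=> hu; have [_ _] := H u (sqi u hu); rewrite Gh// nmM mulrC ler_pM2r// nm_cexp => le.
  by rewrite -ler_expR lnK// posrE; lra.
(* This Moebius map sends the half-plane [Re <= L] into the unit disc and fixes 0. *)
pose phi u := h u / ((2 * L)%:C - h u).
have dpos u : sq w (19 / 10) u -> L <= Re ((2 * L)%:C - h u).
  by move=> hu; rewrite ReD ReN /=; have := Reh u hu; lra.
have dn0 u : sq w (19 / 10) u -> (2 * L)%:C - h u != 0.
  by move=> hu; apply: contraTneq (dpos u hu) => ->; rewrite /= -ltNge.
have hphi u : sq w (19 / 10) u -> hol phi u.
  move=> hu; have hh : hol h u by eexists; exact: dh.
  by apply: hol_div => //; [apply: holB => //; exact: hol_cst|exact: dn0].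
have phi1 u : sq w (19 / 10) u -> nm (phi u) <= 1.
  move=> hu; rewrite /phi nmM nmV ler_pdivrMr ?nm_gt0 ?dn0// mul1r.
  rewrite -(@ler_pXn2r _ 2)// ?nnegrE ?nm_ge0// !nm_sqr ReD ReN ImD ImN /= sub0r sqrrN lerD2r.
  have -> : (2 * L - Re (h u)) ^+ 2 = Re (h u) ^+ 2 + 4 * L * (L - Re (h u)) by ring.
  by rewrite lerDl mulr_ge0 ?subr_ge0 ?Reh// mulr_ge0// ltW.
have sw : sq w (19 / 10) w by apply: nm_sq; rewrite subrr nm0; lra.
have phi0 : phi w = 0 by rewrite /phi h0 mul0r.
(* Schwarz's lemma on a square, whose boundary has distance at least [19 / 10] from [w]. *)
have psi u : sq w (19 / 10) u -> nm (divpole phi w u) <= (19 / 10)^-1.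
  apply: max_modulus; [lra|lra|by rewrite invr_ge0; lra| |].
    move=> v hv; have [->|vw] := eqVneq v w; last by apply: divpole_hol_away => //; exact: hphi.
    apply: (@divpole_hol _ _ _ (19 / 10)) => //.
    by move=> t /ltW /nm_sq; exact: hphi.
  move=> v hv; have vd := sq_bd_dist hv.
  have v0 : 0 < nm (v - w) by lra.
  have hv' : sq w (19 / 10) v by exact: onbd_in hv.
  rewrite /divpole; case: eqVneq => [E|vw]; first by move: v0; rewrite E subrr nm0 ltxx.
  rewrite nmM nmV -[leRHS]mul1r; apply: ler_pM; rewrite ?invr_ge0 ?nm_ge0 ?phi1//.
  by rewrite lef_pV2 ?posrE//; lra.
(* Here [nm (phi u) <= 37 / 38], and solving [h = 2 L phi - h phi] for [h] multiplies [2 L] by 38.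
   The margin [37 / 20 - 7 / 4 = 1 / 10] is the radius left for Cauchy's estimate. *)
have hb u : nm (u - w) <= 37 / 20 -> nm (h u) <= 76 * L.
  move=> hu; have hsq : sq w (19 / 10) u by apply: nm_sq; lra.
  have q1 : nm (phi u) <= 37 / 38.
    rewrite (@divpole_mul _ _ w u phi0) nmM.
    have -> : 37 / 38 = (37 / 20) * (19 / 10)^-1 :> R by field.
    by apply: ler_pM; rewrite ?nm_ge0 ?psi.
  have aux (x y : C) : x - y != 0 -> y = x * (y / (x - y)) - y * (y / (x - y)) by move=> ?; field.
  have E : h u = (2 * L)%:C * phi u - h u * phi u by apply: aux; exact: dn0.
  have := nmB ((2 * L)%:C * phi u) (h u * phi u).
  rewrite -E (nmM _ (phi u)) (nmM (h u) (phi u)) nm_real ger0_norm; last lra.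
  have : 2 * L * nm (phi u) <= 2 * L * 1 by rewrite ler_wpM2l ?phi1//; lra.
  have : nm (h u) * nm (phi u) <= nm (h u) * (37 / 38) by rewrite ler_wpM2l ?nm_ge0.
  by have := nm_ge0 (h u); lra.
have hsq : sq w (19 / 10) z by apply: nm_sq; lra.
rewrite -(derE (dh z hsq)).
have ball u : nm (u - z) < 1 / 10 -> nm (u - w) <= 37 / 20.
  move=> hu; have -> : u - w = (u - z) + (z - w) by ring.
  by apply: le_trans (nmD _ _) _; lra.
have := @cauchy_estimate R h z (1 / 10) (76 * L) _ _ _.
have -> : 32 * (76 * L) / (1 / 10) = 32 * 760 * L by field.
apply=> [|u /ball hu|u /ball]; [lra| |exact: hb].
by eexists; apply: dh; apply: nm_sq; lra.
Qed.
End BorelCaratheodory.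

(** * The zeta function on the right half-plane *)

Section ZetaContinuation.
Variable R : realType.
Local Notation C := R[i].
Local Notation nm := (@nm R).
Implicit Types (s z w : C) (n m N : nat).

Lemma cexp_real (x : R) : cexp x%:C = (expR x)%:C.
Proof. by apply: ceqP; rewrite ?ReCexp ?ImCexp /= ?cos0 ?sin0 ?mulr1 ?mulr0. Qed.

Definition npow n s : C := cexp (- s * (ln n%:R)%:C).
Definition pw n (x : R) : R := expR (- x * ln n%:R).

Lemma npowE n s : npow n s = rcpow n%:R (- s).
Proof. by rewrite rcpowE. Qed.

Lemma nm_npow n s : nm (npow n s) = pw n (Re s).
Proof. by rewrite nm_cexp /pw ReM ReN /= mulr0 subr0. Qed.

Lemma ln_nat_ge0 n : 0 <= ln n%:R :> R.
Proof. by case: n => [|n]; [rewrite ln0|rewrite ln_ge0// ler1n]. Qed.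

Lemma pw_gt0 n x : 0 < pw n x. Proof. exact: expR_gt0. Qed.
Lemma pw_le n x y : x <= y -> pw n y <= pw n x.
Proof.
by move=> xy; rewrite /pw ler_expR !mulNr lerN2 ler_wpM2r ?ln_nat_ge0.
Qed.
Lemma pw1 x : pw 1 x = 1. Proof. by rewrite /pw ln1 mulr0 expR0. Qed.
Lemma npow1 s : npow 1 s = 1. Proof. by rewrite /npow ln1 mulr0 cexp0. Qed.
Lemma pwD n x y : pw n (x + y) = pw n x * pw n y.
Proof. by rewrite /pw -expRD; congr expR; ring. Qed.
Lemma pwN1 n : (0 < n)%N -> pw n (-1) = n%:R.
Proof. by move=> n0; rewrite /pw opprK mul1r lnK// posrE ltr0n. Qed.
Lemma pw11 n : (0 < n)%N -> pw n 1 = n%:R^-1.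
Proof. by move=> n0; rewrite /pw mulN1r expRN lnK// posrE ltr0n. Qed.

Lemma pw_small x e : 0 < x -> 0 < e -> exists N, forall n, (N <= n)%N -> pw n x <= e.
Proof.
move=> x0 e0; exists (Num.truncn (expR (- ln e / x))).+1 => n hn.
have n0 : (0 < n)%N by exact: leq_trans hn.
rewrite -[leRHS]lnK ?posrE// /pw ler_expR mulNr lerNl -ler_pdivrMl//.
rewrite -[leLHS]expRK ler_ln ?posrE ?expR_gt0 ?ltr0n//.
rewrite mulrC; apply: le_trans (ltW (truncnS_gt _)) _; by rewrite ler_nat.
Qed.

Lemma ln_succ_le n : (0 < n)%N -> ln n.+1%:R - ln n%:R <= n%:R^-1 :> R.
Proof.
move=> n0; have p : 0 < n%:R :> R by rewrite ltr0n.
rewrite -ln_div ?posrE ?ltr0n//.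
have -> : n.+1%:R / n%:R = 1 + n%:R^-1 :> R by rewrite -natr1 mulrDl mulfV ?gt_eqF// mul1r.
by rewrite le_ln1Dx// (lt_trans (_ : _ < 0))// ?oppr_lt0// invr_gt0.
Qed.

Lemma ln_succ_ge n : (0 < n)%N -> n.+1%:R^-1 <= ln n.+1%:R - ln n%:R :> R.
Proof.
move=> n0; have p : 0 < n%:R :> R by rewrite ltr0n.
have p1 : 0 < n.+1%:R :> R by rewrite ltr0n.
rewrite -lerN2 opprB -ln_div ?posrE ?ltr0n//.
have -> : n%:R / n.+1%:R = 1 + - n.+1%:R^-1 :> R.
  by rewrite -natr1; field; rewrite natr1 gt_eqF.
by rewrite le_ln1Dx// ltrN2 invf_lt1// ltr1n ltnS.
Qed.

(** Integral comparison for the series of [n^(-x-1)] in telescoping form; it follows from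
    [ln (n+1) - ln n >= 1 / (n+1)] and [exp u >= 1 + u]. *)
Lemma pw_tele x n : 0 < x -> (0 < n)%N -> pw n.+1 (x + 1) <= (pw n x - pw n.+1 x) / x.
Proof.
move=> x0 n0; rewrite ler_pdivlMr// pwD pw11//.
have -> : pw n x = pw n.+1 x * expR (x * (ln n.+1%:R - ln n%:R)).
  by rewrite /pw -expRD; congr expR; ring.
rewrite -mulrA -[X in _ <= _ - X]mulr1 -mulrBr ler_wpM2l ?(ltW (pw_gt0 _ _))//.
rewrite lerBrDl; apply: le_trans (expR_ge1Dx _); rewrite lerD2l mulrC ler_wpM2l ?(ltW x0)//.
exact: ln_succ_ge.
Qed.

(* [Y s] is [(s - 1) * zeta s] for [0 < Re s]; the partial sums [YN n s] are
   those of Euler-Maclaurin summation to first order. *)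
Definition YN n s : C := (s - 1) * \sum_(1 <= k < n) npow k s + n%:R * npow n s.

Lemma seg_real_pt (x y : R) (t : R) : 0 <= t <= 1 -> x <= y ->
  exists2 u, x <= u <= y & x%:C + t%:C * (y%:C - x%:C) = u%:C :> C.
Proof.
move=> /andP[t0 t1] xy; exists (x + t * (y - x)); last by apply: ceqP => /=; ring.
rewrite lerDl mulr_ge0 ?subr_ge0//= -lerBrDl -[leRHS]mul1r ler_wpM2r ?subr_ge0//.
Qed.

(** The step is the increment of [G] between [ln n] and [ln (n+1)]. The derivative of [G] contains
    the factor [exp (- s v) - n^(-s)], which vanishes at the left end and is small by a second
    application of the mean value inequality; this gains the extra power of [n]. *)
Lemma YN_step n s : (0 < n)%N -> 0 <= Re s ->
  nm (YN n.+1 s - YN n s) <= 8 * nm s * nm (s - 1) * pw n (Re s + 1).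
Proof.
move=> n0 s0; set x := ln n%:R : R; set y := ln n.+1%:R : R.
have p : 0 < n%:R :> R by rewrite ltr0n.
have xy : x <= y by rewrite ler_ln ?posrE ?ltr0n// ler_nat.
have yx : y - x <= n%:R^-1 := ln_succ_le n0.
have cx : cexp x%:C = n%:R by rewrite cexp_real /x lnK ?posrE// rmorph_nat.
have cy : cexp y%:C = n.+1%:R by rewrite cexp_real /y lnK ?posrE ?ltr0n// rmorph_nat.
pose G (v : C) := cexp ((1 - s) * v) - (1 - s) * npow n s * cexp v.
have E : YN n.+1 s - YN n s = G y%:C - G x%:C.
  have e1 v : cexp ((1 - s) * v) = cexp v * cexp (- s * v).
    by rewrite -cexpD; congr cexp; ring.
  rewrite /G !e1 cx cy /YN big_nat_recr//= -/(npow n s) -/(npow n.+1 s).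
  by rewrite -natr1; ring.
have dG v : cderiv G v ((1 - s) * (cexp v * (cexp (- s * v) - npow n s))).
  have d1 : cderiv (fun v => (1 - s) * v) v (1 - s).
    by have := cderivZ (1 - s) (cderiv_id v); rewrite mulr1.
  have := cderivB (cderiv_comp d1 (cderiv_cexp _)) (cderivZ ((1 - s) * npow n s) (cderiv_cexp v)).
  congr cderiv; have -> : (1 - s) * v = v + - s * v by ring.
  by rewrite cexpD; ring.
have inner (u : R) : x <= u <= y -> nm (cexp (- s * u%:C) - npow n s) <=
    2 * (nm s * pw n (Re s)) * n%:R^-1.
  move=> /andP[xu uy].
  have := @seg_bound R (fun v => cexp (- s * v)) (fun v => - s * cexp (- s * v)) x%:C u%:C
     (nm s * pw n (Re s)).
  have -> : nm (u%:C - x%:C) = u - x by rewrite -rmorphB nm_real ger0_norm ?subr_ge0.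
  move=> B; apply: le_trans (B _ _) _; last first.
  - by rewrite ler_wpM2l ?mulr_ge0 ?nm_ge0 ?(ltW (pw_gt0 _ _))//; lra.
  - move=> t ht; have [v /andP[xv vu] ->] := seg_real_pt ht xu.
    rewrite nmM nmN ler_wpM2l ?nm_ge0// nm_cexp /pw ler_expR ReM ReN /= mulr0 subr0.
    by rewrite !mulNr lerN2 ler_wpM2l.
  - move=> t ht.
    have d1 (v : C) : cderiv (fun v => - s * v) v (- s).
      by have := cderivZ (- s) (cderiv_id v); rewrite mulr1.
    have := cderiv_comp (d1 (x%:C + t%:C * (u%:C - x%:C))) (cderiv_cexp _).
    by congr cderiv; exact: mulrC.
rewrite E.
have := @seg_bound R G (fun v => (1 - s) * (cexp v * (cexp (- s * v) - npow n s))) x%:C y%:C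
  (nm (1 - s) * (n.+1%:R * (2 * (nm s * pw n (Re s)) * n%:R^-1))).
have -> : nm (y%:C - x%:C) = y - x by rewrite -rmorphB nm_real ger0_norm ?subr_ge0.
move=> B; apply: le_trans (B _ _) _ => [t _|t ht|]; first exact: dG.
  have [v /andP[xv vu] ->] := seg_real_pt ht xy.
  rewrite nmM ler_wpM2l ?nm_ge0// nmM; apply: ler_pM; rewrite ?nm_ge0//.
    by rewrite nm_cexp /= -[leRHS]lnK ?posrE ?ltr0n// ler_expR.
  by apply: inner; rewrite xv.
rewrite pwD pw11// (nm_distC 1 s).
set A := nm s; set D := nm (s - 1); set P := pw n (Re s).
have A0 : 0 <= A := nm_ge0 _. have D0 : 0 <= D := nm_ge0 _.
have P0 : 0 <= P := ltW (pw_gt0 _ _).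
have ADP : 0 <= A * D * P by rewrite !mulr_ge0.
have n2 : n.+1%:R * n%:R^-1 <= 2 :> R.
  by rewrite ler_pdivrMr// -natrM ler_nat mul2n -addnn -addn1 leq_add2l.
have -> : 2 * (D * (n.+1%:R * (2 * (A * P) * n%:R^-1))) * (y - x) =
  4 * (A * D * P) * ((n.+1%:R * n%:R^-1) * (y - x)) by ring.
have -> : 8 * A * D * (P * n%:R^-1) = 4 * (A * D * P) * (2 * n%:R^-1) by ring.
rewrite ler_wpM2l ?mulr_ge0//; apply: ler_pM; rewrite ?subr_ge0//.
Qed.

(** The intervals [[v n - t n, v n + t n]] meet pairwise, and the supremum of their left ends lies
    in all of them. *)
Lemma real_tail_lim (v t : nat -> R) : (forall n, 0 <= t n) ->
  (forall n m, (n <= m)%N -> `|v m - v n| <= t n) ->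
  exists l, forall n, `|l - v n| <= t n.
Proof.
move=> t0 H.
have K n m : v n - t n <= v m + t m.
  case: (leqP n m) => h.
    by have := H _ _ h; have := t0 m; rewrite ler_norml; lra.
  by have := H _ _ (ltnW h); have := t0 n; rewrite ler_norml; lra.
pose S := range (fun n => v n - t n).
have ub : has_ubound S by exists (v 0%N + t 0%N) => _ [n _ <-].
exists (sup S) => n; rewrite ler_norml; apply/andP; split.
  have : v n - t n <= sup S by apply: ub_le_sup => //; exists n.
  lra.
have : sup S <= v n + t n.
  by apply: ge_sup; [exists (v 0%N - t 0%N), 0%N|move=> _ [m _ <-]].
lra.
Qed.

Lemma cplx_tail_lim (u : nat -> C) (t : nat -> R) :
  (forall n m, (n <= m)%N -> nm (u m - u n) <= t n) ->
  exists l, forall n, nm (l - u n) <= 2 * t n.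
Proof.
move=> H; have t0 n : 0 <= t n by exact: le_trans (nm_ge0 _) (H n n (leqnn n)).
have [x hx] : exists l, forall n, `|l - Re (u n)| <= t n.
  apply: real_tail_lim => // n m nm_; rewrite -ReN -ReD.
  exact: le_trans (Re_le_nm _) (H _ _ nm_).
have [y hy] : exists l, forall n, `|l - Im (u n)| <= t n.
  apply: real_tail_lim => // n m nm_; rewrite -ImN -ImD.
  exact: le_trans (Im_le_nm _) (H _ _ nm_).
exists (x +i* y) => n; apply: le_trans (nm_le_ReIm _) _; rewrite ReD ImD ReN ImN /=.
by have := hx n; have := hy n; lra.
Qed.

Definition Ytail n s : R := 8 * nm s * nm (s - 1) * (pw n (Re s) / Re s).

Lemma YN_tail s n m : 0 < Re s -> (0 < n)%N -> (n <= m)%N ->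
  nm (YN m.+1 s - YN n.+1 s) <= 8 * nm s * nm (s - 1) * ((pw n (Re s) - pw m (Re s)) / Re s).
Proof.
move=> s0 n0 /subnKC <-; elim: (m - n)%N => [|k ih].
  by rewrite addn0 !subrr nm0 mul0r mulr0.
rewrite addnS.
have -> : YN (n + k).+2 s - YN n.+1 s = (YN (n + k).+2 s - YN (n + k).+1 s) +
  (YN (n + k).+1 s - YN n.+1 s) by ring.
apply: le_trans (nmD _ _) _.
have nk0 : (0 < n + k)%N by rewrite addn_gt0 n0.
have h1 := @YN_step (n + k).+1 s isT (ltW s0).
have h2 : 8 * nm s * nm (s - 1) * pw (n + k).+1 (Re s + 1) <=
   8 * nm s * nm (s - 1) * ((pw (n + k) (Re s) - pw (n + k).+1 (Re s)) / Re s).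
  by rewrite ler_wpM2l ?mulr_ge0 ?nm_ge0// pw_tele.
apply: le_trans (lerD (le_trans h1 h2) ih) _.
rewrite -mulrDr -mulrDl le_eqVlt; apply/orP; left; apply/eqP; congr (_ * (_ / _)); ring.
Qed.

(** The value is selected by an explicit rate of convergence, from which locally uniform convergence
    is read off. *)
Definition Y s : C := xget 0 [set l | forall n, (0 < n)%N -> nm (l - YN n.+1 s) <= 2 * Ytail n s].

Lemma YP s n : 0 < Re s -> (0 < n)%N -> nm (Y s - YN n.+1 s) <= 2 * Ytail n s.
Proof.
move=> s0; rewrite /Y; move: n.
have := @xgetPex _ 0 [set l | forall n, (0 < n)%N -> nm (l - YN n.+1 s) <= 2 * Ytail n s].
apply; have [|l hl] := @cplx_tail_lim (fun n => YN n.+2 s) (fun n => Ytail n.+1 s).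
  move=> n m nm_; apply: le_trans (@YN_tail s n.+1 m.+1 s0 isT nm_) _.
  rewrite /Ytail ler_wpM2l ?mulr_ge0 ?nm_ge0// ler_wpM2r ?invr_ge0 ?(ltW s0)//.
  by rewrite gerBl ltW ?pw_gt0.
by exists l => -[//|n] _; exact: hl.
Qed.

Lemma Ytail_small w r : 0 < r -> r < Re w -> forall e, 0 < e -> exists N, forall n, (N <= n)%N ->
  forall z, nm (z - w) < r -> 2 * Ytail n z <= e.
Proof.
move=> r0 rw e e0; set x := Re w - r; have x0 : 0 < x by rewrite subr_gt0.
set B := nm w + r + 1.
have B0 : 0 < B by rewrite /B; have := nm_ge0 w; lra.
have K0 : 0 < 16 * B ^+ 2 / x by rewrite divr_gt0// mulr_gt0// exprn_gt0.
have [N HN] := pw_small x0 (divr_gt0 e0 K0).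
exists N => n /HN hn z hz.
have zx : x <= Re z.
  have := Re_le_nm (z - w); rewrite ReD ReN ler_norml /x; lra.
have zB : nm z <= B.
  have -> : z = (z - w) + w by ring.
  by apply: le_trans (nmD _ _) _; rewrite /B; lra.
have zB1 : nm (z - 1) <= B.
  have -> : z - 1 = (z - w) + (w - 1) by ring.
  apply: le_trans (nmD _ _) _; have := nmB w 1; rewrite nm1 /B; lra.
have h1 : nm z * nm (z - 1) <= B ^+ 2 by rewrite expr2; apply: ler_pM; rewrite ?nm_ge0.
have h2 : pw n (Re z) / Re z <= pw n x / x.
  apply: ler_pM; rewrite ?(ltW (pw_gt0 _ _)) ?invr_ge0 ?(le_trans (ltW x0) zx)//; first exact: pw_le.
  by rewrite lef_pV2 ?posrE// (lt_le_trans x0).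
rewrite /Ytail; have -> : 2 * (8 * nm z * nm (z - 1) * (pw n (Re z) / Re z)) =
  16 * ((nm z * nm (z - 1)) * (pw n (Re z) / Re z)) by ring.
apply: (@le_trans _ _ (16 * (B ^+ 2 * (pw n x / x)))).
  rewrite ler_wpM2l//; apply: ler_pM => //; first by rewrite mulr_ge0 ?nm_ge0.
  by rewrite divr_ge0 ?(ltW (pw_gt0 _ _))// (le_trans (ltW x0)).
have -> : 16 * (B ^+ 2 * (pw n x / x)) = pw n x * (16 * B ^+ 2 / x) by ring.
by rewrite -ler_pdivlMr.
Qed.

Lemma hol_npow n z : hol (npow n) z.
Proof.
apply: hol_comp; last exact: hol_cexp.
by apply: holM; [exact/holN/hol_id|exact: hol_cst].
Qed.
Lemma hol_YN n z : hol (YN n) z.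
Proof.
apply: holD.
  apply: holM; first exact: hol_subC.
  by apply: hol_sum => i; exact: hol_npow.
by apply: holM; [exact: hol_cst|exact: hol_npow].
Qed.

Lemma YN_unif w r : 0 < r -> r < Re w -> forall e, 0 < e -> exists N, forall n, (N <= n)%N ->
  forall z, nm (z - w) < r -> nm (YN n.+2 z - Y z) <= e.
Proof.
move=> r0 rw e e0; have [N HN] := Ytail_small r0 rw e0.
exists N => n hn z hz; rewrite nm_distC.
have z0 : 0 < Re z by have := Re_le_nm (z - w); rewrite ReD ReN ler_norml; lra.
apply: le_trans (YP z0 (ltn0Sn n)) _; apply: HN => //; exact: leq_trans hn _.
Qed.

Lemma hol_Y w : 0 < Re w -> hol Y w.
Proof.
move=> w0; apply: (@weierstrass R (fun n => YN n.+2) _ _ (Re w / 2)); first lra.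
  by move=> n z _; exact: hol_YN.
by apply: YN_unif; lra.
Qed.

(** The tail estimate for [n = 1]. Polynomial growth is the upper bound on which the count of zeros
    rests. *)
Lemma Y_growth s : 0 < Re s -> nm (Y s) <= nm (s - 1) + 2 + 16 * nm s * nm (s - 1) / Re s.
Proof.
move=> s0; have := YP s0 (ltn0Sn 0); rewrite /Ytail pw1 => h.
have -> : Y s = (Y s - YN 2 s) + YN 2 s by ring.
apply: le_trans (nmD _ _) _; rewrite addrC; apply: lerD; last first.
  by apply: le_trans h _; rewrite le_eqVlt; apply/orP; left; apply/eqP; ring.
rewrite /YN big_nat1 npow1 mulr1; apply: le_trans (nmD _ _) _; rewrite lerD2l nmM nm_nat nm_npow.
rewrite ler_piMr// /pw -[leRHS]expR0 ler_expR mulNr oppr_le0 mulr_ge0 ?ltW// ln_gt0// ltr1n//.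
Qed.

Lemma Y_lim s l : 0 < Re s ->
  (forall e, 0 < e -> exists N, forall n, (N <= n)%N -> nm (YN n s - l) <= e) -> Y s = l.
Proof.
move=> s0 H; apply/eqP; rewrite -subr_eq0 -nm_eq0; apply/eqP/le_anti; rewrite nm_ge0 andbT.
apply/ler_addgt0Pr => e e0; rewrite add0r.
have e2 : 0 < e / 2 by lra.
have [N HN] := H _ e2.
have [||M HM] := @YN_unif s (Re s / 2) _ _ (e / 2) e2; [lra|lra|].
have -> : Y s - l = (YN (maxn N M).+2 s - l) - (YN (maxn N M).+2 s - Y s) by ring.
apply: le_trans (nmB _ _) _.
have h1 := HN (maxn N M).+2 (leq_trans (leq_maxl N M) (leqW (leqnSn _))).
have h2 := HM (maxn N M) (leq_maxr N M) s.
have : nm (s - s) < Re s / 2 by rewrite subrr nm0; lra.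
by move=> /h2; lra.
Qed.

(** At 1 only the boundary term [n * n^(-1)] of [YN] survives; the value is the residue of zeta. *)
Lemma Y1 : Y 1 = 1.
Proof.
apply: Y_lim; first by rewrite /= ltr01.
move=> e e0; exists 1%N => n n1; rewrite /YN subrr mul0r add0r.
have -> : n%:R * npow n 1 = 1; last by rewrite subrr nm0 ltW.
apply: ceqP; rewrite -(rmorph_nat (real_complex R)) ?ReM ?ImM /npow ?ReCexp ?ImCexp !(ReM, ImM, ReN, ImN) /=.
  rewrite !mulr0 !mul0r ?oppr0 ?mul0r ?addr0 ?subr0 cos0 mulr1 mulN1r expRN lnK ?posrE ?ltr0n//.
  by rewrite mulfV// pnatr_eq0 -lt0n.
by rewrite !mulr0 !mul0r ?oppr0 ?mul0r ?addr0 ?subr0 sin0 !mulr0.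
Qed.

Lemma Y_dirichlet s l : 1 < Re s ->
  (forall e, 0 < e -> exists N, forall n, (N <= n)%N -> nm (\sum_(1 <= k < n) npow k s - l) <= e) ->
  Y s = (s - 1) * l.
Proof.
move=> s1 H; apply: Y_lim; first lra.
move=> e e0; have e2 : 0 < e / 2 by lra.
have K0 : 0 < nm (s - 1) + 1 by have := nm_ge0 (s - 1); lra.
have [N HN] := H _ (divr_gt0 e2 K0).
have s10 : 0 < Re s - 1 by lra.
have [M HM] := pw_small s10 e2.
exists (maxn (maxn N M) 1) => n; rewrite !geq_max => /andP[/andP[hN hM] n1].
have -> : YN n s - (s - 1) * l = (s - 1) * (\sum_(1 <= k < n) npow k s - l) + n%:R * npow n s.
  by rewrite /YN; ring.
apply: le_trans (nmD _ _) _; rewrite (nmM (s - 1)) (nmM n%:R) nm_nat nm_npow.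
have -> : n%:R * pw n (Re s) = pw n (Re s - 1) by rewrite [Re s - 1]addrC pwD pwN1.
have h1 := HM n hM.
have h2 : nm (s - 1) * nm (\sum_(1 <= k < n) npow k s - l) <= nm (s - 1) * (e / 2 / (nm (s - 1) + 1)).
  by rewrite ler_wpM2l ?nm_ge0// HN.
have h3 : nm (s - 1) * (e / 2 / (nm (s - 1) + 1)) <= e / 2.
  rewrite mulrCA ler_piMr ?(ltW e2)// ler_pdivrMr// mul1r lerDl//.
by lra.
Qed.

(* [D] is multiplied by [exp (n * exp (L * (s - i Im w)))]: on the boundary of a
   rectangle of height [pi / L] around [w], this is smaller than at [w] wherever
   [D] is not known to vanish, and Cauchy's formula gives [D w = 0] as [n] grows. *)
Lemma continuation_unique (D : C -> C) :
  (forall z, 0 < Re z -> z != 1 -> hol D z) -> (forall z, 1 < Re z -> D z = 0) ->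
  forall z, 0 < Re z -> z != 1 -> D z = 0.
Proof.
move=> hD D0.
have nonreal w : 0 < Re w -> Im w != 0 -> D w = 0.
  move=> w0 wi; have [h|w1] := ltP 1 (Re w); first exact: D0.
  (* With half height [q] the rectangle misses the real axis, hence the point 1; and
     [L * q = pi / 2] makes [Re (Q z)] vanish on the horizontal edges. *)
  pose q := `|Im w| / 2; have q0 : 0 < q by rewrite divr_gt0// normr_gt0.
  pose L := pi / (2 * q).
  have L0 : 0 < L by rewrite divr_gt0 ?pi_gt0// mulr_gt0.
  pose a := Re w / 2; pose b : R := 2; pose c := Im w - q; pose d := Im w + q.
  have h1 : a < Re w < b by rewrite /a /b; lra.
  have h2 : c < Im w < d by rewrite /c /d; lra.
  have ab : a < b by move: h1 => /andP[? ?]; lra.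
  have cd : c < d by move: h2 => /andP[? ?]; lra.
  have inn z : inrect a b c d z -> 0 < Re z /\ z != 1.
    move=> /andP[/andP[z1 z2] /andP[z3 z4]]; split; first by apply: lt_le_trans z1; rewrite /a; lra.
    apply/eqP => zE; move: z3 z4; rewrite zE /= /c /d /q.
    by move: wi; rewrite -normr_gt0; have := ler_norm (Im w); have := ler_norm (- Im w); rewrite normrN;
      case: (lerP 0 (Im w)) => h; [rewrite ger0_norm//; lra|rewrite ltr0_norm//; lra].
  have cD : bdcont D a b c d by move=> z /onbd_in /inn[? ?]; exact/hol_cont/hD.
  have [M M0 HM] := bdcont_bounded (ltW ab) (ltW cd) cD.
  have [K HK] := cauchy_bound h1 h2.
  pose Q (z : C) := cexp (L%:C * (z - 0 +i* Im w)).
  have ReQ z : Re (Q z) = expR (L * Re z) * cos (L * (Im z - Im w)).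
    by rewrite /Q ReCexp ReM ImM !ReD !ImD !ReN !ImN /= !mul0r !subr0 !addr0.
  have ImQw : Q w = (expR (L * Re w))%:C.
    apply: ceqP; first by rewrite ReQ subrr mulr0 cos0 mulr1.
    rewrite /Q ImCexp ReM ImM !ReD !ImD !ReN !ImN /= !mul0r subrr mulr0 addr0 sin0 mulr0 //.
  apply/eqP; rewrite -nm_eq0; apply/eqP/le_anti; rewrite nm_ge0 andbT leNgt; apply/negP => Dw.
  have : expR (expR (L * Re w)) <= expR (expR (L * a)).
    apply: (pow_trick (K := K * M / nm (D w))); first exact: expR_ge0.
    move=> n; rewrite -(ler_pM2r Dw) mulrC.
    have -> : K * M / nm (D w) * expR (expR (L * a)) ^+ n * nm (D w) = K * (M * expR (expR (L * a)) ^+ n).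
      by field; rewrite gt_eqF.
    have hF z : inrect a b c d z -> hol (fun z => D z * cexp (n%:R * Q z)) z.
      move=> /inn[? ?]; apply: holM; first exact: hD.
      apply: hol_comp; last exact: hol_cexp.
      apply: holM; first exact: hol_cst.
      apply: hol_comp; last exact: hol_cexp.
      by apply: holM; [exact: hol_cst|exact: hol_subC].
    have := HK _ hF (M * expR (expR (L * a)) ^+ n).
    have ReR (x : C) : Re (n%:R * x) = n%:R * Re x.
      by rewrite -(rmorph_nat (real_complex R)) ReM /= mul0r subr0.
    rewrite nmM nm_cexp ReR ImQw /= expRM_natl.
    apply=> [|z hz]; first by rewrite mulr_ge0 ?exprn_ge0 ?expR_ge0.
    have [z1|z1] := ltP 1 (Re z).
      by rewrite D0// mul0r nm0 mulr_ge0 ?exprn_ge0 ?expR_ge0.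
    rewrite nmM nm_cexp ReR; apply: ler_pM; rewrite ?nm_ge0 ?expR_ge0 ?HM//.
    rewrite expRM_natl lerXn2r ?nnegrE ?expR_ge0// ler_expR ReQ.
    have cospi : cos (L * q) = 0.
      have -> : L * q = pi / 2 by rewrite /L; field; rewrite gt_eqF.
      exact: cos_pihalf.
    move: hz => /andP[_] /or4P[] /eqP E.
    - rewrite E ler_piMr ?expR_ge0// cos_le1//.
    - by move: z1; rewrite E /b; lra.
    - by rewrite E /c (_ : Im w - q - Im w = - q) ?mulrN ?cosN ?cospi ?mulr0 ?expR_ge0//; ring.
    - by rewrite E /d (_ : Im w + q - Im w = q) ?cospi ?mulr0 ?expR_ge0//; ring.
  rewrite !ler_expR ler_pM2l// /a; lra.
(* Real points are reached by continuity from the non-real points above them. *)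
move=> w w0 w1; have [wi|wi] := eqVneq (Im w) 0; last exact: nonreal.
apply/eqP; rewrite -nm_eq0; apply/eqP/le_anti; rewrite nm_ge0 andbT.
apply/ler_addgt0Pr => e e0; rewrite add0r.
have [r r0 Hr] := hol_cont (hD w w0 w1) e0.
have := Hr (w + 0 +i* (r / 2)).
have -> : w + 0 +i* (r / 2) - w = 'i * (r / 2)%:C.
  rewrite addrAC subrr add0r; apply: ceqP => /=; ring.
rewrite nmM nm_i mul1r nm_real ger0_norm; last lra.
rewrite nonreal ?sub0r ?nmN; last 2 first.
- by rewrite ReD /= addr0.
- by rewrite ImD /= wi add0r gt_eqF// divr_gt0.
by move=> h; apply/ltW/h; lra.
Qed.

Lemma cvg_nm (u : nat -> C) (l : C) : (u : nat -> C^o) @ \oo --> (l : C^o) ->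
  forall e, 0 < e -> exists N, forall n, (N <= n)%N -> nm (u n - l) <= e.
Proof.
move=> /cvgrPdist_lt H e e0; have [|N _ HN] := H e%:C; first by rewrite ltcR.
exists N => n /HN /=; rewrite nmE ltcR nm_distC; exact: ltW.
Qed.

Lemma continues_zetaY (f : C -> C) : continues_zeta f ->
  forall s, 0 < Re s -> s != 1 -> (s - 1) * f s = Y s.
Proof.
move=> [f1 f2]; have h1 s : 1 < Re s -> (s - 1) * f s = Y s.
  move=> s1; rewrite (@Y_dirichlet s (f s))// => e e0.
  have [N HN] := cvg_nm (f1 s s1) e0; exists N.+1 => -[//|n] hn.
  have := HN n hn; rewrite big_add1 /=.
  suff -> : \sum_(0 <= i < n) npow i.+1 s = [series rcpow k.+1%:R (- s)]_k n by [].
  by rewrite /series /=; apply: eq_bigr => k _; rewrite npowE.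
move=> s s0 s1; apply/eqP; rewrite -subr_eq0; apply/eqP.
apply: (@continuation_unique (fun s => (s - 1) * f s - Y s)) => // z z0.
  move=> z1; apply: holB; last exact: hol_Y.
  by apply: holM; [exact: hol_subC|exact/holP/(f2 _ z0 z1)].
by rewrite h1// subrr.
Qed.

(** [zeta] is selected among the functions with the required properties. If there were none, it
    would be the zero function by default, and [1 / 4] would be a zero off the critical line. *)
Lemma rh_continues : riemann_hypothesis R -> continues_zeta (@zeta R).
Proof.
move=> RH; apply: contrapT => H.
have z0 s : @zeta R s = 0.
  rewrite /zeta; case: xgetP => [f E cf|_ //].
  by case: H; rewrite /zeta; case: xgetP => // /(_ f).
have := RH ((1 / 4)%:C); rewrite /nontrivial_zero z0 /= => h.
have E : 1 / 4 = 1 / 2 :> R by apply: h; split => //; lra.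
by exfalso; lra.
Qed.
End ZetaContinuation.
Arguments npow : simpl never.
Arguments pw : simpl never.

(** * Finite factorisations and the number of zeros *)

Section ZeroCount.
Variable R : realType.
Local Notation C := R[i].
Local Notation nm := (@nm R).
Local Notation Y := (@Y R).
Implicit Types (z w rho : C) (l : seq C) (g : C -> C) (t U : R).

(* [l] lists zeros of [Y], repeated according to multiplicity; [g] may have
   further zeros. *)
Definition fact l g := (forall z, 0 < Re z -> hol g z) /\
  (forall z, 0 < Re z -> Y z = (\prod_(rho <- l) (z - rho)) * g z).

Lemma fact_nil : fact [::] Y.
Proof. by split=> [z|z _]; [exact: hol_Y|rewrite big_nil mul1r]. Qed.

Lemma fact_cons l g rho : fact l g -> 0 < Re rho -> g rho = 0 -> fact (rho :: l) (divpole g rho).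
Proof.
move=> [hg E] r0 g0; split=> z z0; last first.
  by rewrite E// (divpole_mul z g0) big_cons mulrCA mulrA.
have [->|zr] := eqVneq z rho; last by apply: divpole_hol_away => //; exact: hg.
apply: (divpole_hol r0) => // u hu; apply: hg.
by have := Re_le_nm (u - rho); rewrite ReD ReN ler_norml; lra.
Qed.

Lemma ln3_ge t : 2 / 3 <= ln (`|t| + 3).
Proof.
have t3 : 3 <= `|t| + 3 by rewrite lerDr.
apply: (@le_trans _ _ (ln 3)); last by rewrite ler_ln ?posrE//; lra.
have := @le_ln1Dx R (- (2 / 3)).
have -> : 1 + - (2 / 3) = 3^-1 :> R by field.
by rewrite lnV ?posrE// lerN2; apply; lra.
Qed.

(** The term 1 of the Dirichlet series dominates: the sum of [k^(-2)] over [k >= 2] is at most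
    [1/4 + 1/2], the part with [k >= 3] being compared with a telescoping sum. Moreover
    [nm (s - 1) >= 1]. *)
Lemma Y_lower s : 2 <= Re s -> 1 / 4 <= nm (Y s).
Proof.
move=> s2; rewrite leNgt; apply/negP => H.
have e0 : 0 < (1 / 4 - nm (Y s)) / 3 by lra.
have [||N HN] := @YN_unif R s 1 _ _ _ e0; [lra|lra|].
have [M HM] := pw_small (@ltr01 R) e0.
have := HN (maxn N M) (leq_maxl _ _) s; rewrite subrr nm0 => /(_ ltr01).
have := HM (maxn N M).+2 (leq_trans (leq_maxr N M) (leqW (leqnSn _))).
set n := maxn N M => h1 h2.
have inv (k : nat) : (0 < k)%N -> pw k 2 = k%:R^-1 ^+ 2 :> R.
  by move=> k0; rewrite (_ : 2 = 1 + 1 :> R)// pwD pw11// expr2.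
have S (m : nat) : \sum_(0 <= i < m) pw i.+3 2 <= 1 / 2 - m.+2%:R^-1 :> R.
  elim: m => [|m ih]; first by rewrite big_geq//; lra.
  rewrite big_nat_recr//=; apply: le_trans (lerD ih (lexx _)) _.
  rewrite inv// -addrA lerD2l -subr_ge0.
  have p (j : nat) : (j.+1%:R : R) != 0 by rewrite pnatr_eq0.
  have -> : - m.+3%:R^-1 - (- m.+2%:R^-1 + m.+3%:R^-1 ^+ 2) =
     (m.+2%:R^-1 * m.+3%:R^-1 * m.+3%:R^-1) :> R.
    have aux (x y : R) : x != 0 -> y != 0 -> y = x + 1 -> - y^-1 - (- x^-1 + y^-1 ^+ 2) = x^-1 * y^-1 * y^-1.
      by move=> x0 y0 yE; subst y; field; rewrite ?x0 ?y0.
    by apply: aux; rewrite ?p ?natr1.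
  by rewrite !mulr_ge0 ?invr_ge0.
have S2 : nm (\sum_(1 <= k < n.+2) npow k s) >= 1 / 4.
  rewrite big_nat_recl// npow1.
  have B : nm (\sum_(1 <= k < n.+1) npow k.+1 s) <= 3 / 4.
    apply: le_trans (nm_sum _ _ _) _.
    have le2 : \sum_(1 <= k < n.+1) nm (npow k.+1 s) <= \sum_(1 <= k < n.+1) pw k.+1 2.
      by apply: ler_sum => k _; rewrite nm_npow pw_le.
    apply: le_trans le2 _; rewrite big_add1 /=; case: n h1 h2 => [|n] _ _; first by rewrite big_geq//; lra.
    rewrite big_nat_recl//; have : pw 2 2 = 1 / 4 :> R by rewrite inv//; field.
    have : 0 <= n.+2%:R^-1 :> R by rewrite invr_ge0.
    have := S n => h1 h2 h3; apply: (le_trans (lerD (lexx _) h1)); rewrite -[X in X + _]/(pw 2 2) h3; move: (n.+2%:R^-1 : R) h2 => x h2; lra.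
  have := nm_triB 1 (- \sum_(1 <= k < n.+1) npow k.+1 s); rewrite opprK nm1 nmN; lra.
have Ys : nm (YN n.+2 s) >= nm (s - 1) * nm (\sum_(1 <= k < n.+2) npow k s) - n.+2%:R * pw n.+2 2.
  have : nm (n.+2%:R * npow n.+2 s) <= n.+2%:R * pw n.+2 2.
    by rewrite (nmM n.+2%:R) nm_nat nm_npow ler_wpM2l// pw_le.
  rewrite -nmM => hle; apply: (@le_trans _ _ (nm ((s - 1) * \sum_(1 <= k < n.+2) npow k s) -
    nm (n.+2%:R * npow n.+2 s))); first by rewrite lerD2l lerN2.
  by rewrite -[X in _ - X]nmN; apply: le_trans (nm_triB _ _) _; rewrite opprK.
have : n.+2%:R * pw n.+2 2 = pw n.+2 1 :> R.
  by rewrite (_ : 2 = 1 + 1 :> R)// pwD pw11// mulrA mulfV ?pnatr_eq0// mul1r.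
have s1 : 1 <= nm (s - 1).
  apply: le_trans (Re_le_nm _); rewrite ReD ReN /= ler_normr; clear -s2; lra.
have : 1 * (1 / 4) <= nm (s - 1) * nm (\sum_(1 <= k < n.+2) npow k s) by apply: ler_pM => //; lra.
have := nm_triB (YN n.+2 s) (YN n.+2 s - Y s).
have -> : YN n.+2 s - (YN n.+2 s - Y s) = Y s by ring.
lra.
Qed.

(** It measures how far the modulus of the Blaschke factor [(z - rho) / (z + conj rho)] of the right
    half-plane stays below 1. *)
Lemma BB_sq z rho : nm (z - rho) ^+ 2 = nm (z + conjc rho) ^+ 2 - 4 * Re z * Re rho.
Proof.
rewrite !nm_sqr !ReD !ImD !ReN !ImN; case: rho => a b /=; ring.
Qed.

(** The lower bound keeps [rho] away from its reflection in the imaginary axis; the bound 4 leaves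
    room for squares of half side [39 / 20] about [2 + i t]. *)
Definition inreg t U rho := 1 / 2 <= Re rho <= 4 /\ `|Im rho - t| <= U.

(* [Y] with each factor [z - rho] replaced by [z + conj rho]: each zero raises the
   modulus at [2 + i t] by a larger factor than on the boundary of a large
   rectangle, so the maximum principle bounds the number of zeros. *)
Definition GG l g z := g z * \prod_(rho <- l) (z + conjc rho).

Lemma prod_sqr_le l (F H : C -> R) q : 0 <= q -> (forall rho, 0 <= F rho) -> (forall rho, 0 <= H rho) ->
  (forall rho, rho \in l -> F rho ^+ 2 <= q ^+ 2 * H rho ^+ 2) ->
  \prod_(rho <- l) F rho <= q ^+ size l * \prod_(rho <- l) H rho.
Proof.
move=> q0 F0 H0; elim: l => [|r l ih] h; first by rewrite !big_nil expr0 mul1r.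
rewrite !big_cons /= exprS.
have -> : q * q ^+ size l * (H r * \prod_(j <- l) H j) = (q * H r) * (q ^+ size l * \prod_(j <- l) H j) by ring.
apply: ler_pM => //; first by rewrite prodr_ge0.
  rewrite -(@ler_pXn2r _ 2)// ?nnegrE ?mulr_ge0// exprMn; apply: h; exact: mem_head.
by apply: ih => rho hr; apply: h; rewrite in_cons hr orbT.
Qed.

Lemma prod_sqr_ge l (F H : C -> R) q : 0 <= q -> (forall rho, 0 <= F rho) -> (forall rho, 0 <= H rho) ->
  (forall rho, rho \in l -> q ^+ 2 * H rho ^+ 2 <= F rho ^+ 2) ->
  q ^+ size l * \prod_(rho <- l) H rho <= \prod_(rho <- l) F rho.
Proof.
move=> q0 F0 H0; elim: l => [|r l ih] h; first by rewrite !big_nil expr0 mul1r.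
rewrite !big_cons /= exprS.
have -> : q * q ^+ size l * (H r * \prod_(j <- l) H j) = (q * H r) * (q ^+ size l * \prod_(j <- l) H j) by ring.
apply: ler_pM; rewrite ?mulr_ge0 ?exprn_ge0 ?prodr_ge0//.
  rewrite -(@ler_pXn2r _ 2)// ?nnegrE ?mulr_ge0// exprMn; apply: h; exact: mem_head.
by apply: ih => rho hr; apply: h; rewrite in_cons hr orbT.
Qed.

Lemma Y_rect_bound (ep X t : R) z : 0 < ep -> ep <= 1 -> 1 <= X -> inrect ep X (t - X) (t + X) z ->
  nm (Y z) <= 20 / ep * (2 * X + 1) ^+ 2 * (`|t| + 3) ^+ 2.
Proof.
move=> ep0 ep1 X1 /andP[/andP[z1 z2] /andP[z3 z4]].
have z0 : 0 < Re z by exact: lt_le_trans z1.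
apply: le_trans (Y_growth z0) _.
have tp : 0 <= `|t| by [].
have aI : `|Im z| <= `|t| + X.
  rewrite ler_norml; have := ler_norm t; have := ler_norm (- t); rewrite normrN; clear -z3 z4; lra.
have a1 : nm z <= 2 * X + `|t|.
  apply: le_trans (nm_le_ReIm _) _; rewrite (ger0_norm (ltW z0)); clear -z2 aI; lra.
pose T := (2 * X + 1) * (`|t| + 3).
have T1 : 2 * X + `|t| + 1 <= T.
  have : 0 <= X * `|t| by rewrite mulr_ge0//; exact: le_trans ler01 X1.
  by rewrite /T; clear -X1 tp; lra.
have T2 : 20 / ep * (2 * X + 1) ^+ 2 * (`|t| + 3) ^+ 2 = 16 * (T * T) / ep + 4 * (T * T) / ep.
  by rewrite /T; field; rewrite gt_eqF.
rewrite T2; move: (T) T1 => {T2} {}T T1.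
have a2 : nm (z - 1) <= T by apply: le_trans (nmB _ _) _; rewrite nm1; clear -a1 T1; lra.
have a3 : nm z <= T by clear -a1 T1; lra.
have Tp : 1 <= T by clear -T1 X1 tp; lra.
have T0 : 0 <= T by exact: le_trans ler01 Tp.
have a4 : nm z * nm (z - 1) <= T * T by apply: ler_pM; rewrite ?nm_ge0.
have a5 : 16 * nm z * nm (z - 1) / Re z <= 16 * (T * T) / ep.
  rewrite -(mulrA 16); apply: ler_pM; [by rewrite !mulr_ge0 ?nm_ge0|by rewrite invr_ge0 ltW|by rewrite ler_wpM2l|].
  by rewrite lef_pV2 ?posrE.
have TT : T <= T * T by rewrite ler_peMr.
have a6 : 3 * (T * T) <= 4 * (T * T) / ep.
  have TT0 : 0 <= T * T by rewrite mulr_ge0.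
  have h : T * T * ep <= T * T by rewrite ler_piMr.
  by rewrite ler_pdivlMr//; clear -h TT0; lra.
by clear -a2 Tp a5 a6 TT; lra.
Qed.

(** By [BB_sq] it suffices that [4 Re z Re rho] is small against [nm (z + conjc rho) ^+ 2]: on the
    left edge because [Re z = de / 16], on the other three because the squared distance is of order
    [X ^+ 2]. *)
Lemma edge_far (de X t U : R) z rho : 0 < de -> de <= 1 / 9 -> 128 <= de * X -> 100 <= X -> 2 * U <= X ->
  inreg t U rho -> onbd (de / 16) X (t - X) (t + X) z ->
  (1 - de / 2) * nm (z + conjc rho) ^+ 2 <= nm (z - rho) ^+ 2.
Proof.
move=> de0 de1 dX X1 XU [/andP[r1 r2] r3] /andP[/andP[/andP[z1 z2] /andP[z3 z4]] hz]; rewrite BB_sq.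
suff : 4 * Re z * Re rho <= de / 2 * nm (z + conjc rho) ^+ 2 by clear; lra.
have DE : nm (z + conjc rho) ^+ 2 = (Re z + Re rho) ^+ 2 + (Im z - Im rho) ^+ 2.
  by rewrite nm_sqr ReD ImD; case: (rho).
have d20 : 0 <= de / 2 by clear -de0; lra.
have z0 : 0 <= Re z by clear -z1 de0; lra.
have q0 : 0 <= Re rho by clear -r1; lra.
have X0 : 0 <= X by clear -X1; lra.
have d4 : 128 * X <= de * X * X by rewrite ler_wpM2r.
have d2 : 4 * Re z * Re rho <= 4 * X * 4.
  by apply: ler_pM; rewrite ?mulr_ge0// ler_wpM2l.
have sqle (u v : R) : 0 <= u -> u <= v -> u ^+ 2 <= v ^+ 2.
  by move=> u0 uv; rewrite ler_pXn2r ?nnegrE// (le_trans u0).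
have yedge : X / 2 <= `|Im z - Im rho| -> 4 * Re z * Re rho <= de / 2 * nm (z + conjc rho) ^+ 2.
  move=> hy; have d1 : (X / 2) ^+ 2 <= nm (z + conjc rho) ^+ 2.
    rewrite DE -[leLHS]add0r lerD ?sqr_ge0// -[leRHS]real_normK ?num_real//.
    by apply: sqle hy; rewrite divr_ge0.
  have d3 := ler_wpM2l d20 d1.
  have E8 : de / 2 * (X / 2) ^+ 2 = de * X * X / 8 by field.
  by rewrite E8 in d3; clear -d2 d3 d4 X1; lra.
case/or4P: hz => /eqP zE.
- have d1 : Re rho ^+ 2 <= nm (z + conjc rho) ^+ 2.
    rewrite DE -[leLHS]addr0 lerD ?sqr_ge0//; apply: sqle => //; clear -z0; lra.
  have d3 := ler_wpM2l d20 d1.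
  apply: le_trans d3; rewrite zE.
  have k1 : 0 <= Re rho - 1 / 2 by clear -r1; lra.
  have := mulr_ge0 (mulr_ge0 (ltW de0) q0) k1; clear; rewrite expr2; lra.
- have d1 : X ^+ 2 <= nm (z + conjc rho) ^+ 2.
    rewrite DE -[leLHS]addr0 lerD ?sqr_ge0//; apply: sqle => //; clear -zE q0; lra.
  have d3 := ler_wpM2l d20 d1.
  have E8 : de / 2 * X ^+ 2 = de * X * X / 2 by field.
  by rewrite E8 in d3; clear -d2 d3 d4 X1; lra.
- by apply: yedge; rewrite ler_normr; apply/orP; right; move: r3; rewrite ler_norml zE; clear -XU; lra.
- by apply: yedge; rewrite ler_normr; apply/orP; left; move: r3; rewrite ler_norml zE; clear -XU; lra.
Qed.

(** At the centre [4 * 2 * Re rho >= 4], whereas the squared distance to the reflected zero is at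
    most [(2 + 4) ^+ 2 + U ^+ 2]; this dictates [de]. *)
Lemma center_near (de t U : R) rho : 0 < U -> 0 < de -> de * (36 + U ^+ 2) = 4 -> inreg t U rho ->
  nm ((2 +i* t) - rho) ^+ 2 <= (1 - de) * nm ((2 +i* t) + conjc rho) ^+ 2.
Proof.
move=> U0 de0 dU [/andP[r1 r2] r3]; rewrite BB_sq /=.
suff : de * nm ((2 +i* t) + conjc rho) ^+ 2 <= 4 * 2 * Re rho by clear; lra.
have DE : nm ((2 +i* t) + conjc rho) ^+ 2 = (2 + Re rho) ^+ 2 + (Im rho - t) ^+ 2.
  by rewrite nm_sqr ReD ImD; case: (rho) => a b /=; ring.
have h : nm ((2 +i* t) + conjc rho) ^+ 2 <= 36 + U ^+ 2.
  rewrite DE lerD//; last first.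
    by rewrite -[leLHS]real_normK ?num_real// ler_pXn2r ?nnegrE// ltW.
  have -> : 36 = 6 ^+ 2 :> R by rewrite expr2; clear; lra.
  by rewrite ler_pXn2r ?nnegrE//; clear -r1 r2; lra.
by apply: le_trans (ler_wpM2l (ltW de0) h) _; rewrite dU; clear -r1; lra.
Qed.

Lemma GG_consts U : 0 < U -> exists de X : R, [/\ 0 < de <= 1 / 9, de * (36 + U ^+ 2) = 4,
  128 <= de * X, 100 <= X & 2 * U <= X].
Proof.
move=> U0; have U2 : 0 < U ^+ 2 by rewrite exprn_gt0.
have D0 : 0 < 36 + U ^+ 2 by lra.
exists (4 / (36 + U ^+ 2)); set de := 4 / _.
have deE : de * (36 + U ^+ 2) = 4 by rewrite divfK ?gt_eqF.
have de0 : 0 < de by rewrite divr_gt0.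
have de1 : de <= 1 / 9 by rewrite /de ler_pdivrMr//; lra.
exists (2 * U + 128 / de).
have e : de * (2 * U + 128 / de) = 2 * (de * U) + 128 by field; rewrite gt_eqF.
have h0 : 0 <= de * U by rewrite mulr_ge0 ?ltW.
have h2 : 100 <= 128 / de by rewrite ler_pdivlMr//; lra.
split => //; first by rewrite de0.
  by rewrite e; clear -h0; lra.
  by clear -h2 U0; lra.
by clear -h2; lra.
Qed.

(** The squared Blaschke factors are at most [1 - de] at the centre and at least [1 - de / 2] on the
    boundary, with ratio at least [1 + de / 2] per zero. The first conclusion counts zeros. The
    second compares [GG] with its value at the centre, uniformly in the number of zeros, as the
    Borel-Caratheodory argument requires. *)
Lemma GG_bound U : 0 < U -> exists K d : R, [/\ 1 <= K, 0 < d & forall t l g, fact l g ->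
  (forall rho, rho \in l -> inreg t U rho) ->
  (1 + d) ^+ size l <= (K * (`|t| + 3) ^+ 2) ^+ 2 /\
  forall z, sq (2 +i* t) (39 / 20) z -> nm (GG l g z) <= K * (`|t| + 3) ^+ 2 * nm (GG l g (2 +i* t))].
Proof.
move=> U0; have [de [X [/andP[de0 de1] deU dX X1 XU]]] := GG_consts U0.
have ep0 : 0 < de / 16 by clear -de0; lra.
have ep1 : de / 16 <= 1 by clear -de1; lra.
have X0 : 1 <= X by clear -X1; lra.
pose q0 := Num.sqrt (1 - de); pose q1 := Num.sqrt (1 - de / 2).
have e1 : 0 < 1 - de by clear -de1; lra.
have e2 : 0 < 1 - de / 2 by clear -de1; lra.
have q0s : q0 ^+ 2 = 1 - de by rewrite sqr_sqrtr// ltW.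
have q1s : q1 ^+ 2 = 1 - de / 2 by rewrite sqr_sqrtr// ltW.
have q00 : 0 < q0 by rewrite sqrtr_gt0.
have q10 : 0 < q1 by rewrite sqrtr_gt0.
have q01 : q0 <= q1 by rewrite ler_wsqrtr//; clear -de0; lra.
pose Kq := 20 / (de / 16) * (2 * X + 1) ^+ 2.
have K1 : 1 <= Kq.
  have h1 : 1 <= (2 * X + 1) ^+ 2 by rewrite exprn_ege1//; clear -X0; lra.
  have h2 : 1 <= 20 / (de / 16) by rewrite ler_pdivlMr// mul1r; clear -ep1; lra.
  by have := ler_pM ler01 ler01 h2 h1; rewrite mulr1.
exists (4 * Kq), (de / 2); split; [by clear -K1; lra|by clear -de0; lra|].
move=> t l g [hg E] hl; set s := 2 +i* t.
have Yb z : inrect (de / 16) X (t - X) (t + X) z -> nm (Y z) <= Kq * (`|t| + 3) ^+ 2.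
  exact: Y_rect_bound.
have Y2 : 1 / 4 <= nm (Y s) by exact: Y_lower.
have T1 : 1 <= (`|t| + 3) ^+ 2.
  by rewrite exprn_ege1// -[leLHS]add0r lerD// ler1n.
have -> : 4 * Kq * (`|t| + 3) ^+ 2 = 4 * (Kq * (`|t| + 3) ^+ 2) by rewrite mulrA.
move: (Kq * (`|t| + 3) ^+ 2) (ler_pM ler01 ler01 K1 T1) Yb => M M1 Yb; rewrite mulr1 in M1.
clear K1 T1 Kq.
have M0 : 0 < M by exact: lt_le_trans ltr01 M1.
have inp z : inrect (de / 16) X (t - X) (t + X) z -> 0 < Re z.
  by move=> /andP[/andP[h _] _]; exact: lt_le_trans h.
have hG z : 0 < Re z -> hol (GG l g) z.
  move=> z0; apply: holM; first exact: hg.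
  by apply: hol_prod => rho; apply: holD; [exact: hol_id|exact: hol_cst].
have EG z : 0 < Re z -> nm (Y z) * \prod_(rho <- l) nm (z + conjc rho) =
    \prod_(rho <- l) nm (z - rho) * nm (GG l g z).
  by move=> z0; rewrite E// /GG !nmM !nm_prod; ring.
have pos z rho : 0 < Re z -> rho \in l -> 0 < nm (z + conjc rho).
  move=> z0 /hl[/andP[r1 _] _]; apply: lt_le_trans (Re_le_nm _).
  have -> : Re (z + conjc rho) = Re z + Re rho by rewrite ReD; case: (rho).
  by rewrite normr_gt0 gt_eqF//; clear -z0 r1; lra.
have ppos z : 0 < Re z -> 0 < \prod_(rho <- l) nm (z + conjc rho).
  by move=> z0; rewrite big_seq_cond prodr_gt0// => rho; rewrite andbT => /pos; exact.
have bdq z rho : onbd (de / 16) X (t - X) (t + X) z -> rho \in l ->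
    q1 ^+ 2 * nm (z + conjc rho) ^+ 2 <= nm (z - rho) ^+ 2.
  by move=> hz /hl hr; rewrite q1s; exact: edge_far hr hz.
have ats rho : rho \in l -> nm (s - rho) ^+ 2 <= q0 ^+ 2 * nm (s + conjc rho) ^+ 2.
  by move=> /hl hr; rewrite q0s; exact: center_near hr.
have Q1 : 0 < q1 ^+ size l by rewrite exprn_gt0.
have Q0 : 0 < q0 ^+ size l by rewrite exprn_gt0.
have Q01 : q0 ^+ size l <= q1 ^+ size l by apply: lerXn2r; rewrite ?nnegrE ?(ltW q10) ?(ltW q00).
have P0 : 0 < (1 - de) ^+ size l by rewrite exprn_gt0.
have Q1s : (q1 ^+ size l) ^+ 2 = (1 - de / 2) ^+ size l by rewrite -exprM mulnC exprM q1s.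
have Q0s : (q0 ^+ size l) ^+ 2 = (1 - de) ^+ size l by rewrite -exprM mulnC exprM q0s.
have Gb z : inrect (de / 16) X (t - X) (t + X) z -> nm (GG l g z) <= M / q1 ^+ size l.
  apply: max_modulus.
  - by clear -ep1 X1; lra.
  - by clear -X1; lra.
  - by rewrite divr_ge0 ?(ltW Q1) ?(ltW M0).
  - by move=> u /inp; exact: hG.
  move=> u hu; have u0 := inp u (onbd_in hu).
  rewrite ler_pdivlMr// -(ler_pM2r (ppos u u0)).
  apply: (@le_trans _ _ (nm (Y u) * \prod_(rho <- l) nm (u + conjc rho))); last first.
    by rewrite ler_wpM2r ?(ltW (ppos u u0))//; exact/Yb/onbd_in.
  rewrite EG// -mulrA mulrC ler_wpM2r ?nm_ge0//.
  by apply: prod_sqr_ge => [|rho|rho|rho hr]; [exact: ltW|exact: nm_ge0|exact: nm_ge0|exact: bdq].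
have sp : 0 < Re s by rewrite ltr0n.
have Gs : 1 / 4 / q0 ^+ size l <= nm (GG l g s).
  rewrite ler_pdivrMr// -(ler_pM2r (ppos s sp)).
  apply: (@le_trans _ _ (nm (Y s) * \prod_(rho <- l) nm (s + conjc rho))).
    by rewrite ler_wpM2r ?(ltW (ppos s sp)).
  rewrite EG// mulrC -mulrA ler_wpM2l ?nm_ge0//.
  by apply: prod_sqr_le => [|rho|rho|rho hr]; [exact: ltW|exact: nm_ge0|exact: nm_ge0|exact: ats].
have ins : inrect (de / 16) X (t - X) (t + X) s by rewrite /inrect /=; clear -ep1 X1; lra.
have key : q1 ^+ size l <= 4 * M * q0 ^+ size l.
  have := le_trans Gs (Gb s ins); rewrite ler_pdivrMr// mulrAC ler_pdivlMr//; clear; lra.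
have M40 : 0 <= 4 * M by clear -M0; lra.
split.
  have : (q1 ^+ size l) ^+ 2 <= (4 * M * q0 ^+ size l) ^+ 2.
    apply: lerXn2r; [by rewrite nnegrE ltW|by rewrite nnegrE mulr_ge0// ltW|exact: key].
  rewrite exprMn Q1s Q0s => h.
  rewrite -(ler_pM2r P0); apply: le_trans h; rewrite -exprMn.
  have d2 : 0 <= de * de by rewrite mulr_ge0// ltW.
  apply: lerXn2r; rewrite ?nnegrE; [by rewrite mulr_ge0 ?(ltW e1)//; clear -de0; lra|exact: ltW|].
  by clear -d2; lra.
move=> z hz; apply: le_trans (Gb z _) _.
  by move: hz; rewrite /sq /inrect /=; clear -de1 X1 => /andP[/andP[? ?] /andP[? ?]]; lra.
apply: le_trans (ler_wpM2l M40 Gs).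
rewrite (_ : 4 * M * (1 / 4 / q0 ^+ size l) = M / q0 ^+ size l); last by field; rewrite gt_eqF.
by rewrite ler_wpM2l ?(ltW M0)// lef_pV2.
Qed.
End ZeroCount.

(** * The logarithmic derivative as a Dirichlet series *)

Section VonMangoldt.
Variable R : realType.
Local Notation Lam := (@vonMangoldt R).
Implicit Types (n m k p N : nat).

Lemma Lam_pow p k : prime p -> (0 < k)%N -> Lam (p ^ k) = ln p%:R.
Proof.
move=> pp k0; rewrite /vonMangoldt; case: pickP => [q /andP[pq /existsP[j /andP[j0 /eqP E]]]|H].
  suff pE : p = q :> nat by congr (ln _%:R); rewrite -pE.
  have : (p %| q ^ j)%N by rewrite -E dvdn_exp.
  by rewrite (Euclid_dvdX _ _ pp) j0 andbT dvdn_prime2// => /eqP.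
have pn : (p < (p ^ k).+1)%N.
  by rewrite ltnS -{1}(expn1 p) leq_exp2l// prime_gt1.
have kn : (k < (p ^ k).+1)%N.
  by rewrite ltnS ltnW// ltn_expl// prime_gt1.
have := H (Ordinal pn); rewrite pp /= => /negbT/negP; case; apply/existsP.
by exists (Ordinal kn); rewrite /= k0 eqxx.
Qed.

Lemma Lam_neq0P n : Lam n != 0 -> exists p k, [/\ prime p, (0 < k)%N & n = (p ^ k)%N].
Proof.
rewrite /vonMangoldt; case: pickP => [q /andP[pq /existsP[j /andP[j0 /eqP E]]] _|]; last by rewrite eqxx.
by exists q, j.
Qed.

Lemma Lam_ge0 n : 0 <= Lam n.
Proof.
by rewrite /vonMangoldt; case: pickP => [q /andP[pq _]|//]; rewrite ln_ge0// ler1n prime_gt0.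
Qed.

Lemma Lam_le_ln n : Lam n <= ln n%:R.
Proof.
have [->|/Lam_neq0P[p [k [pp k0 ->]]]] := eqVneq (Lam n) 0.
  by case: n => [|n]; [rewrite ln0|rewrite ln_ge0// ler1n].
rewrite Lam_pow// ler_ln ?posrE ?ltr0n ?expn_gt0 ?prime_gt0// ler_nat.
by rewrite -{1}(expn1 p) leq_exp2l// prime_gt1.
Qed.

Lemma ln_prodn (r : seq nat) (P : pred nat) (F : nat -> nat) : (forall i, (0 < F i)%N) ->
  ln (\prod_(i <- r | P i) F i)%N%:R = \sum_(i <- r | P i) ln (F i)%:R :> R.
Proof.
move=> F0; suff [//] : (0 < \prod_(i <- r | P i) F i)%N /\
  ln (\prod_(i <- r | P i) F i)%N%:R = \sum_(i <- r | P i) ln (F i)%:R :> R.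
elim: r => [|i r [p0 ih]]; first by rewrite !big_nil ln1.
rewrite !big_cons; case: ifP => _ //; rewrite muln_gt0 F0 p0; split => //.
by rewrite natrM lnM ?posrE ?ltr0n// ih.
Qed.

(** An explicit sum over prime powers, in a form that permits exchanging summations in [sum_Lam]. *)
Lemma LamE n N : (0 < n < N)%N -> Lam n =
  \sum_(0 <= p < N | prime p) \sum_(1 <= j < N) (if n == (p ^ j)%N then ln p%:R else 0).
Proof.
move=> /andP[n0 nN]; have [L0|/Lam_neq0P[q [k [pq k0 E]]]] := eqVneq (Lam n) 0.
  rewrite L0 big1// => p pp; rewrite big_nat_cond big1// => j /andP[/andP[j0 _] _].
  by case: eqP => // nE; rewrite -(Lam_pow pp j0) -nE.
have qN : (q < N)%N.
  by apply: leq_ltn_trans nN; rewrite E -{1}(expn1 q) leq_exp2l// prime_gt1.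
have kN : (k < N)%N.
  by apply: leq_trans nN; rewrite ltnS E ltnW// ltn_expl// prime_gt1.
rewrite E Lam_pow//.
rewrite (eq_bigr (fun p => if p == q then ln q%:R else 0)); last first.
  move=> p pp; case: eqP => [->|pq'].
    rewrite (eq_bigr (fun j => if j == k then ln q%:R else 0)).
      by rewrite -big_mkcond big_nat1_eq k0 kN.
    move=> j _; case: (eqVneq j k) => [->|jk]; first by rewrite eqxx.
    by case: eqP => // /eqP; rewrite eqn_exp2l ?prime_gt1// eq_sym (negPf jk).
  rewrite big_nat_cond big1// => j /andP[/andP[j0 _] _]; case: eqP => // E2; case: pq'.
  have : (q %| p ^ j)%N by rewrite -E2 dvdn_exp.
  by rewrite (Euclid_dvdX _ _ pq) j0 andbT dvdn_prime2// => /eqP.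
rewrite -big_mkcondr /= (eq_bigl (fun p => p == q)); last first.
  by move=> p; case: eqP => [->|]; rewrite ?pq ?andbF.
by rewrite big_nat1_eq /= qN.
Qed.

(** For each prime [p] exactly [logn p k] of its powers divide [k]; the rest is the logarithm of the
    prime factorisation. *)
Lemma sum_Lam k N : (0 < k < N)%N -> \sum_(1 <= n < N | (n %| k)%N) Lam n = ln k%:R.
Proof.
move=> /andP[k0 kN]; rewrite big_nat_cond.
rewrite (eq_bigr (fun n => \sum_(0 <= p < N | prime p) \sum_(1 <= j < N)
    (if n == (p ^ j)%N then ln p%:R else 0))); last by move=> n /andP[h _]; exact: LamE.
rewrite -big_nat_cond exchange_big /=.
transitivity (\sum_(0 <= p < N | prime p) (ln p%:R *+ logn p k) : R).
  apply: eq_bigr => p pp; rewrite exchange_big /=.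
  rewrite (eq_big_nat _ _ (F2 := fun j => if (j <= logn p k)%N then ln p%:R else 0)); last first.
    move=> j /andP[j0 jN]; rewrite -big_mkcondr /= -pfactor_dvdn//.
    rewrite (eq_bigl (fun n => (p ^ j %| k)%N && (n == p ^ j)%N)); last first.
      by move=> n; case: eqP => [->|]; rewrite ?andbT ?andbF.
    case: ifP => pk; last by rewrite big_pred0.
    rewrite big_nat1_eq expn_gt0 prime_gt0//= (leq_ltn_trans (dvdn_leq k0 pk) kN) //.
  have lN : (logn p k < N)%N by apply: leq_trans (ltnW kN); exact: ltn_logl.
  rewrite -big_mkcond /= (eq_bigl (fun j => xpredT j && (j < (logn p k).+1)%N)) //.
  by rewrite -big_nat_widen// sumr_const_nat subn1.
have kE : k = (\prod_(0 <= p < N) p ^ logn p k)%N.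
  have kN1 : (k <= N.-1)%N by case: N kN {k0}.
  have := @widen_partn N.-1 predT k kN1; rewrite partnT// prednK; last by case: N kN {kN1}.
  by move=> {1}->; apply: eq_bigl.
have lp p : (0 < p ^ logn p k)%N by rewrite expn_gt0; case: p => //; rewrite lognE.
rewrite [in RHS]kE ln_prodn//.
rewrite [RHS](bigID prime) /= [X in _ = _ + X]big1 ?addr0.
  by apply: eq_bigr => p pp; rewrite natrX lnXn ?ltr0n ?prime_gt0.
by move=> p /negPf pp; rewrite lognE pp expn0 ln1.
Qed.
End VonMangoldt.

(** * The Dirichlet series of the logarithmic derivative *)

Section DirichletProduct.
Variable R : realType.
Local Notation C := R[i].
Local Notation nm := (@nm R).
Local Notation Y := (@Y R).
Local Notation Lam := (@vonMangoldt R).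
Implicit Types (s z w : C) (n m k N : nat).

Definition LamN N s : C := \sum_(1 <= n < N) (Lam n)%:C * npow n s.

Lemma pwM n m (x : R) : (0 < n)%N -> (0 < m)%N -> pw (n * m) x = pw n x * pw m x.
Proof.
move=> n0 m0; rewrite /pw -expRD natrM lnM ?posrE ?ltr0n//; congr expR; ring.
Qed.
Lemma npowM n m s : (0 < n)%N -> (0 < m)%N -> npow (n * m) s = npow n s * npow m s.
Proof.
move=> n0 m0; rewrite /npow -cexpD natrM lnM ?posrE ?ltr0n// rmorphD; congr cexp; ring.
Qed.
Lemma pw_anti n m (x : R) : 0 <= x -> (0 < n)%N -> (n <= m)%N -> pw m x <= pw n x.
Proof.
move=> x0 n0 nm_; rewrite /pw ler_expR !mulNr lerN2 ler_wpM2l// ler_ln ?posrE ?ltr0n ?ler_nat//.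
exact: leq_trans nm_.
Qed.
Lemma pw_sum (x : R) N : 0 < x -> \sum_(1 <= n < N) pw n (x + 1) <= 1 + x^-1.
Proof.
move=> x0; suff H : forall N, \sum_(1 <= n < N.+2) pw n (x + 1) <= 1 + (1 - pw N.+1 x) / x.
  have p : 0 <= 1 + x^-1 by rewrite addr_ge0// invr_ge0 ltW.
  case: N => [|[|N]]; [by rewrite big_geq|by rewrite big_geq|].
  apply: le_trans (H N) _; rewrite lerD2l -[leRHS]mul1r ler_wpM2r ?invr_ge0 ?(ltW x0)//.
  by rewrite gerBl ltW ?pw_gt0.
elim=> [|M ih]; first by rewrite big_nat1 !pw1 subrr mul0r addr0.
rewrite big_nat_recr//=; apply: le_trans (lerD ih (pw_tele x0 (ltn0Sn M))) _.
by rewrite -addrA -mulrDl lerD2l ler_wpM2r ?invr_ge0 ?(ltW x0)//; lra.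
Qed.

Lemma ln_pw_le n (x : R) : 0 < x -> (0 < n)%N -> ln n%:R <= x^-1 * pw n (- x).
Proof.
move=> x0 n0; rewrite ler_pdivlMl// /pw opprK.
by apply: le_trans _ (expR_ge1Dx _); rewrite lerDr.
Qed.

Lemma Lam_npow n s (x : R) : 0 < x -> (0 < n)%N -> Re s = 1 + 2 * x ->
  nm ((Lam n)%:C * npow n s) <= x^-1 * pw n (x + 1).
Proof.
move=> x0 n0 sE; rewrite (nmM (Lam n)%:C) nm_real (ger0_norm (Lam_ge0 _ _)) nm_npow sE.
have -> : pw n (x + 1) = pw n (- x) * pw n (1 + 2 * x) by rewrite -pwD; congr pw; ring.
rewrite mulrA ler_wpM2r ?(ltW (pw_gt0 _ _))//.
exact: le_trans (Lam_le_ln _ _) (ln_pw_le x0 n0).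
Qed.

Lemma LamN_tail s (x : R) n m : 0 < x -> Re s = 1 + 2 * x -> (0 < n)%N -> (n <= m)%N ->
  nm (LamN m.+1 s - LamN n.+1 s) <= x^-1 * ((pw n x - pw m x) / x).
Proof.
move=> x0 sE n0 /subnKC <-; elim: (m - n)%N => [|k ih].
  by rewrite addn0 !subrr nm0 mul0r mulr0.
rewrite addnS.
have -> : LamN (n + k).+2 s - LamN n.+1 s =
    (Lam (n + k).+1)%:C * npow (n + k).+1 s + (LamN (n + k).+1 s - LamN n.+1 s).
  have -> : LamN (n + k).+2 s = LamN (n + k).+1 s + (Lam (n + k).+1)%:C * npow (n + k).+1 s.
    by rewrite /LamN big_nat_recr.
  ring.
have nk0 : (0 < n + k)%N by rewrite addn_gt0 n0.
apply: le_trans (nmD _ _) _.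
apply: le_trans (lerD (Lam_npow x0 (ltn0Sn _) sE) ih) _.
have h : x^-1 * pw (n + k).+1 (x + 1) <= x^-1 * ((pw (n + k) x - pw (n + k).+1 x) / x).
  by rewrite ler_wpM2l ?invr_ge0 ?(ltW x0)// pw_tele.
apply: le_trans (lerD h (lexx _)) _; rewrite -mulrDr -mulrDl.
by rewrite le_eqVlt; apply/orP; left; apply/eqP; congr (_ * (_ / _)); ring.
Qed.

Lemma Lam_lim s (x : R) : 0 < x -> Re s = 1 + 2 * x ->
  exists l, (forall n, (0 < n)%N -> nm (l - LamN n.+1 s) <= 2 * (x^-1 * (pw n x / x))).
Proof.
move=> x0 sE.
have [|l hl] := @cplx_tail_lim R (fun n => LamN n.+2 s) (fun n => x^-1 * (pw n.+1 x / x)).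
  move=> n m nm_; apply: le_trans (@LamN_tail s x n.+1 m.+1 x0 sE isT nm_) _.
  rewrite ler_wpM2l ?invr_ge0 ?(ltW x0)// ler_wpM2r ?invr_ge0 ?(ltW x0)//.
  by rewrite gerBl ltW ?pw_gt0.
by exists l => -[//|n] _; exact: hl.
Qed.

Lemma dirichlet_conv N s :
  \sum_(1 <= n < N) \sum_(1 <= m < N | (n * m < N)%N) (Lam n)%:C * npow (n * m) s =
  \sum_(1 <= k < N) (ln k%:R)%:C * npow k s.
Proof.
transitivity (\sum_(1 <= n < N) \sum_(1 <= k < N | (n %| k)%N) (Lam n)%:C * npow k s).
  apply: eq_big_nat => n /andP[n0 nN].
  transitivity (\sum_(1 <= m < N) \sum_(1 <= k < N | k == (n * m)%N) (Lam n)%:C * npow k s).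
    rewrite big_nat_cond [RHS]big_nat_cond [LHS]big_mkcond [RHS]big_mkcond /=.
    apply: eq_bigr => m _; case: (boolP (0 < m < N)%N) => [/andP[m0 mN]|//].
    by rewrite big_nat1_eq muln_gt0 n0 m0 /=.
  rewrite (exchange_big_dep_nat (fun k => n %| k)%N) /=; last by move=> m k _ _ _ /eqP ->; exact: dvdn_mulr.
  rewrite big_nat_cond [RHS]big_nat_cond; apply: eq_bigr => k /andP[/andP[k0 kN] nk].
  rewrite (eq_bigl (fun m => m == k %/ n)%N); last first.
    by move=> m /=; apply/eqP/eqP => ->; [rewrite mulKn|rewrite mulnC divnK].
  rewrite big_nat1_eq divn_gt0// dvdn_leq//=.
  by rewrite (leq_ltn_trans (leq_div _ _) kN).
rewrite (exchange_big_dep_nat xpredT) //=.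
apply: eq_big_nat => k /andP[k0 kN].
by rewrite -big_distrl /= -rmorph_sum /= sum_Lam// k0.
Qed.

(** The product of the two truncated series has in excess the pairs with [n * m >= N]. From these a
    factor [(n m)^(-x) <= N^(-x)] is split off, and the remaining double sum is bounded; a further
    part of the exponent absorbs [Lam n]. *)
Lemma dirichlet_err N s (x : R) : 0 < x -> Re s = 1 + 2 * (2 * x) -> (0 < N)%N ->
  nm (LamN N s * \sum_(1 <= m < N) npow m s - \sum_(1 <= k < N) (ln k%:R)%:C * npow k s) <=
  (2 * x)^-1 * pw N x * (1 + x^-1) ^+ 2.
Proof.
move=> x0 sE N0; have x20 : 0 < 2 * x by lra.
have -> : LamN N s * \sum_(1 <= m < N) npow m s =
   \sum_(1 <= n < N) \sum_(1 <= m < N) (Lam n)%:C * npow (n * m) s.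
  rewrite /LamN big_distrl /=; apply: eq_big_nat => n /andP[n0 nN]; rewrite big_distrr /=.
  by apply: eq_big_nat => m /andP[m0 mN]; rewrite npowM// mulrA.
rewrite -dirichlet_conv -sumrB.
under eq_bigr => n _ do rewrite [X in X - _](bigID (fun m => n * m < N)%N) /= addrAC subrr add0r.
apply: le_trans (nm_sum _ _ _) _.
apply: (@le_trans _ _ (\sum_(1 <= n < N) \sum_(1 <= m < N) (2 * x)^-1 * pw N x * (pw n (x + 1) * pw m (x + 1)))).
  rewrite big_nat_cond [leRHS]big_nat_cond; apply: ler_sum => n /andP[/andP[n0 nN] _].
  apply: le_trans (nm_sum _ _ _) _.
  rewrite big_mkcond /= big_nat_cond [leRHS]big_nat_cond; apply: ler_sum => m /andP[/andP[m0 mN] _].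
  have p0 : 0 <= (2 * x)^-1 * pw N x * (pw n (x + 1) * pw m (x + 1)).
    by rewrite !mulr_ge0 ?invr_ge0 ?(ltW x20) ?(ltW (pw_gt0 _ _)).
  case: ifP => // nmN.
  rewrite npowM// mulrA (nmM _ (npow m s)); apply: (@le_trans _ _ ((2 * x)^-1 * pw n (2 * x + 1) * pw m (Re s))).
    by apply: ler_pM; rewrite ?nm_ge0 ?nm_npow//; exact: Lam_npow.
  have h1 : pw m (Re s) <= pw m (2 * x + 1) by apply: pw_le; rewrite sE; lra.
  have e1 k : pw k (2 * x + 1) = pw k x * pw k (x + 1) by rewrite -pwD; congr pw; ring.
  have h2 : pw n x * pw m x <= pw N x.
    by rewrite -pwM//; apply: pw_anti; rewrite ?(ltW x0)// leqNgt nmN.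
  rewrite -!mulrA ler_wpM2l ?invr_ge0 ?(ltW x20)//.
  apply: (@le_trans _ _ (pw n (2 * x + 1) * pw m (2 * x + 1))).
    by rewrite ler_wpM2l ?(ltW (pw_gt0 _ _)).
  rewrite !e1; have -> : pw n x * pw n (x + 1) * (pw m x * pw m (x + 1)) =
     (pw n x * pw m x) * (pw n (x + 1) * pw m (x + 1)) by ring.
  by rewrite ler_wpM2r ?mulr_ge0 ?(ltW (pw_gt0 _ _)).
under eq_bigr do rewrite -!big_distrr /=.
rewrite -big_distrr /= -big_distrl /= ler_wpM2l//.
  by rewrite mulr_ge0 ?invr_ge0 ?(ltW x20) ?(ltW (pw_gt0 _ _)).
rewrite expr2; apply: ler_pM; rewrite ?pw_sum ?sumr_ge0// => i _; exact: ltW (pw_gt0 _ _).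
Qed.

Lemma cderiv_npow n s : cderiv (npow n) s (- (ln n%:R)%:C * npow n s).
Proof.
have d1 : cderiv (fun s => - s * (ln n%:R)%:C) s (- (ln n%:R)%:C).
  have := cderivM (cderivN (cderiv_id s)) (cderiv_cst (ln n%:R)%:C s).
  by rewrite mulr0 add0r mulN1r.
by have := cderiv_comp d1 (cderiv_cexp _); congr cderiv; exact: mulrC.
Qed.

Lemma cderiv_sum (I : Type) (r : seq I) (F : I -> C -> C) (dF : I -> C) z :
  (forall i, cderiv (F i) z (dF i)) -> cderiv (fun w => \sum_(i <- r) F i w) z (\sum_(i <- r) dF i).
Proof.
move=> h; elim: r => [|i r ih].
  by rewrite big_nil; under eq_fun do rewrite big_nil; exact: cderiv_cst.
by rewrite big_cons; under eq_fun do rewrite big_cons; exact: cderivD.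
Qed.

Lemma der_YN n s : der (YN n) s = \sum_(1 <= k < n) npow k s -
  (s - 1) * \sum_(1 <= k < n) (ln k%:R)%:C * npow k s - (ln n%:R)%:C * (n%:R * npow n s).
Proof.
apply: derE.
have := cderivD (cderivM (cderiv_subC 1 s) (cderiv_sum (index_iota 1 n) (fun k => cderiv_npow k s)))
  (cderivZ n%:R (cderiv_npow n s)).
congr cderiv.
have -> : \sum_(1 <= k < n) - (ln k%:R)%:C * npow k s = - \sum_(1 <= k < n) (ln k%:R)%:C * npow k s.
  by rewrite -sumrN; apply: eq_bigr => i _; rewrite mulNr.
ring.
Qed.

(** Cauchy's estimate for the difference carries locally uniform convergence over to derivatives. *)
Lemma der_Y_lim s : 0 < Re s -> forall e, 0 < e -> exists N, forall n, (N <= n)%N ->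
  nm (der (YN n.+2) s - der Y s) <= e.
Proof.
move=> s0 e e0; pose r := Re s / 2; have r0 : 0 < r by rewrite /r; lra.
have rs : r < Re s by rewrite /r; lra.
have e1 : 0 < e * r / 32 by rewrite divr_gt0// mulr_gt0.
have [N HN] := YN_unif r0 rs e1.
exists N => n hn.
have hY z : nm (z - s) < r -> hol Y z.
  by move=> hz; apply: hol_Y; have := Re_le_nm (z - s); rewrite ReD ReN ler_norml; lra.
have ss : nm (s - s) < r by rewrite subrr nm0.
have E : der (fun z => YN n.+2 z - Y z) s = der (YN n.+2) s - der Y s.
  by apply: derE; apply: cderivB; apply: derP; [exact: hol_YN|exact: hY].
rewrite -E; have := @cauchy_estimate R (fun z => YN n.+2 z - Y z) s r (e * r / 32) r0.
have -> : 32 * (e * r / 32) / r = e by field; rewrite gt_eqF.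
apply=> z hz; last exact: HN.
by apply: holB; [exact: hol_YN|exact: hY].
Qed.

Lemma lim_unique (u : nat -> C) (a b : C) :
  (forall e, 0 < e -> exists N, forall n, (N <= n)%N -> nm (u n - a) <= e) ->
  (forall e, 0 < e -> exists N, forall n, (N <= n)%N -> nm (u n - b) <= e) -> a = b.
Proof.
move=> ha hb; apply/eqP; rewrite -subr_eq0 -nm_eq0; apply/eqP/le_anti; rewrite nm_ge0 andbT.
apply/ler_addgt0Pr => e e0; rewrite add0r; have e2 : 0 < e / 2 by lra.
have [N HN] := ha _ e2; have [M HM] := hb _ e2.
have -> : a - b = (u (maxn N M) - b) - (u (maxn N M) - a) by ring.
apply: le_trans (nmB _ _) _.
by have := HN _ (leq_maxl N M); have := HM _ (leq_maxr N M); lra.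
Qed.

Definition lim_to (u : nat -> C) (a : C) :=
  forall e, 0 < e -> exists N, forall n, (N <= n)%N -> nm (u n - a) <= e.

Lemma lim_toD u v a b : lim_to u a -> lim_to v b -> lim_to (fun n => u n + v n) (a + b).
Proof.
move=> ha hb e e0; have e2 : 0 < e / 2 by lra.
have [N HN] := ha _ e2; have [M HM] := hb _ e2.
exists (maxn N M) => n; rewrite geq_max => /andP[/HN h1 /HM h2].
have -> : u n + v n - (a + b) = (u n - a) + (v n - b) by ring.
by apply: le_trans (nmD _ _) _; lra.
Qed.
Lemma lim_toZ (c : C) u a : lim_to u a -> lim_to (fun n => c * u n) (c * a).
Proof.
move=> ha e e0; have c0 : 0 < nm c + 1 by have := nm_ge0 c; lra.
have [N HN] := ha _ (divr_gt0 e0 c0); exists N => n /HN h.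
rewrite -mulrBr nmM; apply: (@le_trans _ _ (nm c * (e / (nm c + 1)))).
  by rewrite ler_wpM2l ?nm_ge0.
by rewrite mulrCA ler_piMr ?(ltW e0)// ler_pdivrMr// mul1r lerDl.
Qed.
Lemma lim_toM u v a b : lim_to u a -> lim_to v b -> lim_to (fun n => u n * v n) (a * b).
Proof.
move=> ha hb e e0; pose A := nm a + nm b + 1 + e.
have A0 : 0 < A by rewrite /A; have := nm_ge0 a; have := nm_ge0 b; lra.
have e1 : 0 < e / A by rewrite divr_gt0.
have eA : e / A * A = e by rewrite divfK ?gt_eqF.
have e1e : e / A <= e by rewrite ler_pdivrMr// ler_peMr ?(ltW e0)// /A; have := nm_ge0 a; have := nm_ge0 b; lra.
have [N HN] := ha _ e1; have [M HM] := hb _ e1.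
exists (maxn N M) => n; rewrite geq_max => /andP[/HN h1 /HM h2].
have -> : u n * v n - a * b = (u n - a) * (v n - b) + ((u n - a) * b + a * (v n - b)) by ring.
apply: le_trans (nmD _ _) _.
have q1 : nm ((u n - a) * (v n - b)) <= e / A * e.
  by rewrite nmM; apply: ler_pM; rewrite ?nm_ge0//; lra.
have q2 : nm ((u n - a) * b) <= e / A * nm b by rewrite nmM ler_wpM2r ?nm_ge0.
have q3 : nm (a * (v n - b)) <= e / A * nm a by rewrite nmM mulrC ler_wpM2r ?nm_ge0.
have := nmD ((u n - a) * b) (a * (v n - b)).
have : e = e / A * nm a + e / A * nm b + e / A + e / A * e by rewrite -{1}eA /A; ring.
have := ltW e1; lra.
Qed.
Lemma lim_to_unshift u a : lim_to (fun n => u n.+1) a -> lim_to u a.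
Proof. by move=> ha e /ha[N HN]; exists N.+1 => -[//|n] hn; exact: HN. Qed.
Lemma lim_to0 u : (forall e, 0 < e -> exists N, forall n, (N <= n)%N -> nm (u n) <= e) -> lim_to u 0.
Proof. by move=> h e /h[N HN]; exists N => n /HN; rewrite subr0. Qed.

(** [L] is the value of [- zeta' / zeta]. In the formula [der_YN] the sums [Z n] tend to
    [z = Y s / (s - 1)], and [D n], being nearly the product of [LamN n s] and [Z n], tends to
    [L * z]. The rate of convergence is kept for later truncations. *)
Theorem log_deriv_Y s : 1 < Re s -> exists L,
  (forall n, (0 < n)%N -> nm (L - LamN n.+1 s) <=
     2 * (((Re s - 1) / 2)^-1 * (pw n ((Re s - 1) / 2) / ((Re s - 1) / 2)))) /\
  der Y s = Y s * ((s - 1)^-1 - L).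
Proof.
move=> s1; set x := (Re s - 1) / 2; have x0 : 0 < x by rewrite /x; lra.
have sE : Re s = 1 + 2 * x by rewrite /x; lra.
have [L HL] := Lam_lim x0 sE; exists L; split => //.
have s10 : s - 1 != 0 by apply/eqP => /(congr1 (@complex.Re R)); rewrite ReD ReN /= => ?; lra.
pose x2 := x / 2; have x20 : 0 < x2 by rewrite /x2; lra.
have sE2 : Re s = 1 + 2 * (2 * x2) by rewrite /x2; lra.
have pws (u : nat -> C) (c : R) : 0 < c -> (forall n, (0 < n)%N -> nm (u n) <= c * pw n x2) -> lim_to u 0.
  move=> c0 h; apply: lim_to0 => e e0; have [N HN] := pw_small x20 (divr_gt0 e0 c0).
  exists N.+1 => n hn; apply: le_trans (h n (leq_ltn_trans (leq0n N) hn)) _.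
  by rewrite mulrC -ler_pdivlMr//; apply: HN; exact: ltnW.
have xx2 n : pw n x <= pw n x2 :> R by apply: pw_le; rewrite /x2; lra.
have tL : lim_to (fun n => LamN n s) L.
  have t0 : lim_to (fun n => LamN n.+1 s - L) 0.
    apply: (pws _ (2 * (x^-1 / x))); first by rewrite !mulr_gt0 ?invr_gt0.
    move=> n n0; rewrite nm_distC; apply: le_trans (HL n n0) _.
    have -> : 2 * (x^-1 * (pw n x / x)) = 2 * (x^-1 / x) * pw n x by ring.
    by rewrite ler_wpM2l ?mulr_ge0 ?invr_ge0 ?(ltW x0).
  by apply: lim_to_unshift => e e0; have [N HN] := t0 e e0; exists N => n /HN; rewrite subr0.
have s0 : 0 < Re s by lra.
have tdY : lim_to (fun n => der (YN n) s) (der Y s).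
  by do 2 apply: lim_to_unshift; exact: der_Y_lim.
have tY : lim_to (fun n => YN n s) (Y s).
  do 2 apply: lim_to_unshift; move=> e e0.
  have [||N HN] := @YN_unif R s (Re s / 2) _ _ e e0; [lra|lra|].
  by exists N => n /HN; apply; rewrite subrr nm0; lra.
have npw n : (0 < n)%N -> n%:R * pw n (Re s) = pw n (2 * x) :> R.
  by move=> n0; rewrite sE pwD pw11// mulrA mulfV ?mul1r// pnatr_eq0 -lt0n.
have tn : lim_to (fun n => n%:R * npow n s) 0.
  apply: (pws _ 1 ltr01) => n n0; rewrite (nmM n%:R) nm_nat nm_npow npw// mul1r.
  by apply: pw_le; rewrite /x2; lra.
have tln : lim_to (fun n => (ln n%:R)%:C * (n%:R * npow n s)) 0.
  apply: (pws _ x^-1); first by rewrite invr_gt0.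
  move=> n n0; rewrite (nmM (ln n%:R)%:C) nm_real ger0_norm ?ln_nat_ge0//.
  rewrite (nmM n%:R) nm_nat nm_npow npw//.
  have -> : pw n (2 * x) = pw n x * pw n x :> R by rewrite -pwD; congr pw; ring.
  apply: (@le_trans _ _ (x^-1 * pw n (- x) * (pw n x * pw n x))).
    by rewrite ler_wpM2r ?mulr_ge0 ?(ltW (pw_gt0 _ _))// ln_pw_le.
  have e1 : pw n (- x) * pw n x = 1 :> R by rewrite -pwD addNr /pw oppr0 mul0r expR0.
  have -> : x^-1 * pw n (- x) * (pw n x * pw n x) = x^-1 * (pw n (- x) * pw n x) * pw n x by ring.
  by rewrite e1 mulr1 ler_wpM2l ?invr_ge0 ?(ltW x0).
pose Z n := \sum_(1 <= k < n) npow k s; pose D n := \sum_(1 <= k < n) (ln k%:R)%:C * npow k s.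
pose z := (s - 1)^-1 * Y s.
have tZ : lim_to Z z.
  have := lim_toZ (s - 1)^-1 (lim_toD tY (lim_toZ (-1) tn)); rewrite mulr0 addr0.
  congr lim_to; apply/funext => n; rewrite /YN -/(Z n); field; exact: s10.
have tD : lim_to D (L * z).
  have terr : lim_to (fun n => LamN n s * Z n - D n) 0.
    apply: (pws _ ((2 * x2)^-1 * (1 + x2^-1) ^+ 2)).
      by apply: mulr_gt0; [rewrite invr_gt0 mulr_gt0|rewrite exprn_gt0// addr_gt0// invr_gt0].
    by move=> n n0; apply: le_trans (dirichlet_err x20 sE2 n0) _; rewrite mulrAC.
  have := lim_toD (lim_toM tL tZ) (lim_toZ (-1) terr); rewrite mulr0 addr0.
  congr lim_to; apply/funext => n; ring.
apply: (lim_unique tdY).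
have := lim_toD (lim_toD tZ (lim_toZ (- (s - 1)) tD)) (lim_toZ (-1) tln).
have -> : z + - (s - 1) * (L * z) + -1 * 0 = Y s * ((s - 1)^-1 - L) by rewrite /z; field; exact: s10.
congr lim_to; apply/funext => n; rewrite der_YN -/(Z n) -/(D n); ring.
Qed.

End DirichletProduct.

(** * Location of the zeros and local partial fractions *)

Section Zeros.
Variable R : realType.
Local Notation C := R[i].
Local Notation nm := (@nm R).
Local Notation Y := (@Y R).
Local Notation Lam := (@vonMangoldt R).
Local Notation fact := (@fact R).
Implicit Types (s z w rho : C) (l : seq C) (g : C -> C) (t U : R).

Lemma zero_count U : 0 < U -> exists2 K, 0 < K & forall t l g, fact l g ->
  (forall rho, rho \in l -> inreg t U rho) -> (size l)%:R <= K * ln (`|t| + 3).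
Proof.
move=> U0; have [K [d [K1 d0 H]]] := GG_bound U0.
have d1 : 0 < ln (1 + d) by rewrite ln_gt0//; lra.
have K0 : 0 < K by lra.
have lK : 0 <= ln K by rewrite ln_ge0.
(* The logarithm of the bound is [2 ln K + 4 ln (|t| + 3)]; since [ln (|t| + 3) >= 2 / 3], the
   constant [2 ln K] is at most [3 ln K] times that logarithm. *)
exists ((3 * ln K + 4) / ln (1 + d)); first by rewrite divr_gt0//; lra.
move=> t l g fg hl; have [h _] := H t l g fg hl.
have T0 : 0 < `|t| + 3 by rewrite ltr_wpDl.
rewrite mulrAC ler_pdivlMr//.
have : ln ((1 + d) ^+ size l) <= ln ((K * (`|t| + 3) ^+ 2) ^+ 2).
  by rewrite ler_ln ?posrE ?exprn_gt0 ?mulr_gt0 ?exprn_gt0//; lra.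
rewrite !lnXn ?mulr_gt0 ?exprn_gt0//; last lra.
rewrite lnM ?posrE ?exprn_gt0// lnXn// (mulr_natl (ln (1 + d))).
move=> h1; apply: le_trans h1 _; have := ln3_ge t; set T := ln _ => hT.
have : ln K * (2 / 3) <= ln K * T by rewrite ler_wpM2l.
by rewrite !mulr2n; lra.
Qed.

Lemma fact_zero l g rho : fact l g -> rho \in l -> 0 < Re rho -> Y rho = 0.
Proof.
by move=> [_ E] hr r0; rewrite E// (big_rem rho)//= subrr !mul0r.
Qed.

Lemma fact_mem l g rho : fact l g -> 0 < Re rho -> Y rho = 0 -> g rho != 0 -> rho \in l.
Proof.
move=> [_ E] r0; rewrite E// => /eqP; rewrite mulf_eq0 => /orP[|/eqP ->]; last by rewrite eqxx.
rewrite prodf_seq_eq0 => /hasP[r hr]; rewrite /= subr_eq0 => /eqP -> _; exact: hr.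
Qed.

(** Zeros are divided out one at a time. If this never ended there would be factorisations with
    arbitrarily many zeros in the region, against [zero_count]. *)
Lemma full_fact t U : 0 < U -> exists l g, [/\ fact l g,
  forall rho, rho \in l -> inreg t U rho & forall z, inreg t U z -> g z != 0].
Proof.
move=> U0; apply: contrapT => H.
have P k : exists l g, [/\ fact l g, forall rho, rho \in l -> inreg t U rho & size l = k].
  elim: k => [|k [l [g [fg hl sl]]]]; first by exists [::], Y; split => //; exact: fact_nil.
  have [z [hz gz]] : exists z, inreg t U z /\ g z = 0.
    apply: contrapT => N; apply: H; exists l, g; split => // z hz.
    by apply/eqP => gz; apply: N; exists z.
  exists (z :: l), (divpole g z); split; last by rewrite /= sl.
    by apply: fact_cons => //; case: hz => /andP[? _] _; lra.
  by move=> rho; rewrite in_cons => /orP[/eqP ->|/hl].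
have [K K0 HK] := zero_count U0.
have [l [g [fg hl sl]]] := P (Num.truncn (K * ln (`|t| + 3))).+1.
have := HK t l g fg hl; rewrite sl leNgt.
by rewrite truncnS_gt.
Qed.

Lemma cderiv_prodsub l (a : C -> C) z : (forall rho, rho \in l -> z - a rho != 0) ->
  cderiv (fun z => \prod_(rho <- l) (z - a rho)) z
    (\prod_(rho <- l) (z - a rho) * \sum_(rho <- l) (z - a rho)^-1).
Proof.
elim: l => [|r l ih] h.
  by rewrite !big_nil mulr0; under eq_fun do rewrite big_nil; exact: cderiv_cst.
under eq_fun do rewrite big_cons; rewrite !big_cons.
have hr : z - a r != 0 by apply: h; exact: mem_head.
have hl rho : rho \in l -> z - a rho != 0 by move=> k; apply: h; rewrite in_cons k orbT.
have := cderivM (cderiv_subC (a r) z) (ih hl).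
by congr cderiv; rewrite /=; field.
Qed.

Lemma ld_fact l g z : fact l g -> 0 < Re z -> Y z != 0 ->
  der Y z / Y z = \sum_(rho <- l) (z - rho)^-1 + der g z / g z.
Proof.
move=> [hg E] z0; rewrite E// mulf_eq0 negb_or => /andP[p0 g0].
have hl rho : rho \in l -> z - rho != 0.
  move=> hr; move: p0; rewrite prodf_seq_neq0 => /allP /(_ rho hr) //.
have d1 := cderivM (cderiv_prodsub hl) (derP (hg z z0)).
have -> : der Y z = \prod_(rho <- l) (z - rho) * der g z +
   \prod_(rho <- l) (z - rho) * (\sum_(rho <- l) (z - rho)^-1) * g z.
  apply: derE; refine (cderiv_near z0 _ d1).
  move=> w hw; rewrite [RHS]E//; have := Re_le_nm (w - z); rewrite ReD ReN ler_norml; lra.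
by field; rewrite p0 g0.
Qed.

(** The order of vanishing as the growth rate [m / d] of the logarithmic derivative. The approach is
    horizontal from the right, because for [Re w >= 1] this stays in the half-plane of the Dirichlet
    series. *)
Lemma order_at w : 1 / 2 <= Re w <= 3 -> exists (m : nat) (r B : R), [/\ 0 < r, (m == 0)%N = (Y w != 0) &
  forall d : R, 0 < d < r -> Y (w + d%:C) != 0 /\ nm (der Y (w + d%:C) / Y (w + d%:C) - m%:R / d%:C) <= B].
Proof.
move=> /andP[w1 w2]; have [l [g [fg hl hg]]] := full_fact (Im w) (@ltr01 R).
have inw : inreg (Im w) 1 w by split; [lra|rewrite subrr normr0].
have w0 : 0 < Re w by lra.
have hw : hol (fun z => der g z / g z) w.
  have [hgh _] := fg; apply: hol_div; [|exact: hgh|exact: hg].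
  apply: (@der_hol R g w (Re w)) => // z hz; apply: hgh.
  by have := Re_le_nm (z - w); rewrite ReD ReN ler_norml; lra.
have [r1 r10 Hr1] := hol_cont hw (@ltr01 R).
have [e [e0 He]] : exists e, 0 < e /\ forall rho, rho \in l -> rho != w -> e <= nm (w - rho).
  elim: (l) => [|r l' [e [e0 ih]]]; first by exists 1; split.
  have [->|rw] := eqVneq r w.
    by exists e; split => // rho; rewrite in_cons => /orP[/eqP ->|/ih//]; rewrite eqxx.
  exists (Num.min e (nm (w - r))); split.
    by rewrite lt_min e0 nm_gt0 subr_eq0 eq_sym.
  move=> rho; rewrite in_cons => /orP[/eqP -> _|hr hw']; rewrite ge_min ?lexx ?orbT//.
  by rewrite ih.
pose m := count_mem w l.
exists m, (Num.min r1 (Num.min (e / 2) 1)), ((size l)%:R * (2 / e) + (nm (der g w / g w) + 1)).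
have big_split_l (F : C -> C) : \sum_(rho <- l) F rho = m%:R * F w + \sum_(rho <- l | rho != w) F rho.
  rewrite (bigID (pred1 w)) /=; congr (_ + _).
  rewrite (eq_bigr (fun=> F w)); last by move=> i /eqP ->.
  by rewrite big_const_seq iter_addr addr0 mulr_natl.
split; first by rewrite !lt_min r10 divr_gt0//=.
  rewrite -leqn0 leqNgt -has_count has_pred1; congr (~~ _); apply/idP/eqP => [/fact_zero|h].
    by apply; eassumption.
  by apply: (fact_mem fg) => //; exact: hg.
move=> d /andP[d0]; rewrite !lt_min => /andP[dr1 /andP[de d1]].
set z := w + d%:C.
have zw : z - w = d%:C by rewrite /z; ring.
have Rz : Re z = Re w + d by rewrite ReD.
have dn0 : d%:C != 0 :> C by rewrite -nm_gt0 nm_real normr_gt0 gt_eqF.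
have z0 : 0 < Re z by rewrite Rz; lra.
have far rho : rho \in l -> rho != w -> e / 2 <= nm (z - rho).
  move=> hr hw'; have -> : z - rho = (w - rho) - (- d%:C) by rewrite /z; ring.
  apply: le_trans (nm_triB _ _); rewrite nmN nm_real gtr0_norm//.
  by have := He _ hr hw'; lra.
have e2 : 0 < e / 2 by lra.
have gz : g z != 0 by apply: hg; split; [rewrite Rz; lra|rewrite ImD /= addr0 subrr normr0].
have Yz : Y z != 0.
  apply/eqP => Yz0; have := fact_mem fg z0 Yz0 gz => hz.
  have zw' : z != w by rewrite -subr_eq0 zw.
  by have := far z hz zw'; rewrite subrr nm0; lra.
split => //.
rewrite (ld_fact fg)// big_split_l zw.
have -> : m%:R * d%:C^-1 + \sum_(rho <- l | rho != w) (z - rho)^-1 + der g z / g z - m%:R / d%:C =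
   \sum_(rho <- l | rho != w) (z - rho)^-1 + der g z / g z by ring.
apply: le_trans (nmD _ _) _; apply: lerD; last first.
  have := Hr1 z; rewrite zw nm_real gtr0_norm// => /(_ dr1) h.
  rewrite -[X in nm X](subrK (der g w / g w)); apply: le_trans (nmD _ _) _; lra.
apply: le_trans (nm_sum _ _ _) _.
apply: (@le_trans _ _ (\sum_(rho <- l | rho != w) 2 / e)).
  rewrite big_seq_cond [leRHS]big_seq_cond; apply: ler_sum => rho /andP[hr hw'].
  have := far _ hr hw' => h; rewrite nmV (_ : 2 / e = (e / 2)^-1); last by rewrite invf_div.
  by rewrite lef_pV2 ?posrE// (lt_le_trans e2).
rewrite big_const_seq iter_addr addr0 -[leLHS]mulr_natl ler_wpM2r ?divr_ge0 ?(ltW e0)//.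
by rewrite ler_nat count_size.
Qed.

Lemma Lam1 : Lam 1 = 0.
Proof. by apply/le_anti; rewrite Lam_ge0 andbT (le_trans (Lam_le_ln _ _))// ln1. Qed.

Lemma LamN2 s : LamN 2 s = 0.
Proof. by rewrite /LamN big_nat1 Lam1 mul0r. Qed.

(** The Dirichlet series keeps the logarithmic derivative bounded on the approach to [w], whereas a
    zero of order [m] would make it grow like [m / d]. *)
Lemma Y_neq0_gt1 w : 1 < Re w <= 2 -> Y w != 0.
Proof.
move=> /andP[w1 w2]; have [|m [r [B [r0 mE H]]]] := @order_at w; first lra.
rewrite -mE -leqn0 leqNgt; apply/negP => m0.
pose x := (Re w - 1) / 2; have x0 : 0 < x by rewrite /x; lra.
pose K := `|B| + (Re w - 1)^-1 + 2 * (x^-1 * x^-1) + 1.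
have w10 : 0 < (Re w - 1)^-1 by rewrite invr_gt0; lra.
have K1 : 1 <= K.
  have : 0 <= 2 * (x^-1 * x^-1) by rewrite !mulr_ge0 ?invr_ge0 ?(ltW x0).
  by rewrite /K; have := normr_ge0 B; lra.
have K0 : 0 < K by lra.
(* Then [d^-1 >= 2 * K], while a zero would force [d^-1 < K]. *)
pose d := Num.min (r / 2) ((2 * K)^-1).
have d0 : 0 < d by rewrite lt_min divr_gt0//= invr_gt0 mulr_gt0.
have dr : d < r by apply: (@le_lt_trans _ _ (r / 2)); [rewrite ge_min lexx|lra].
have dK : d <= (2 * K)^-1 by rewrite ge_min lexx orbT.
have [Yz Hz] := H d (introT andP (conj d0 dr)).
set z := w + d%:C in Yz Hz.
have Rz : Re z = Re w + d by rewrite ReD.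
have z1 : 1 < Re z by rewrite Rz; lra.
have [L [HL EL]] := log_deriv_Y z1.
have Lb : nm L <= 2 * (x^-1 * x^-1).
  have := HL 1%N isT; rewrite LamN2 subr0 pw1 mul1r => h; apply: le_trans h _.
  rewrite ler_wpM2l//; apply: ler_pM; rewrite ?invr_ge0//; try (by rewrite Rz /x; lra);
  by rewrite lef_pV2 ?posrE /x ?Rz//; lra.
have zb : nm (z - 1)^-1 <= (Re w - 1)^-1.
  have h : Re w - 1 <= nm (z - 1).
    by apply: le_trans (Re_le_nm _); rewrite ReD ReN Rz /= ler_normr; lra.
  by rewrite nmV lef_pV2 ?posrE//; lra.
have E : der Y z / Y z = (z - 1)^-1 - L by rewrite EL mulrC mulKf.
have h1 : d^-1 <= nm (m%:R / d%:C).
  rewrite nmM nmV nm_nat nm_real gtr0_norm// ler_peMl ?invr_ge0 ?(ltW d0)//.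
  by rewrite ler1n.
have h2 : 2 * K <= d^-1 by rewrite -[leLHS]invrK lef_pV2 ?posrE ?invr_gt0 ?mulr_gt0.
move: Hz; rewrite E => Hz.
have h3 : nm (m%:R / d%:C) - nm ((z - 1)^-1 - L) <= nm ((z - 1)^-1 - L - m%:R / d%:C).
  by rewrite [leRHS]nm_distC nm_triB.
have := nmB (z - 1)^-1 L; have := ler_norm B.
by move: h2 K1 h1 h3 Hz Lb zb; rewrite /K; clear; lra.
Qed.

(* [3 + 4 cos th + cos (2 th) = 2 (1 + cos th) ^ 2]. *)
Lemma mertens (x : R) t (L0 L1 L2 : C) : 0 < x ->
  let s (y : R) := (1 + x) +i* y in
  (forall n, (0 < n)%N -> nm (L0 - LamN n.+1 (s 0)) <= 2 * ((x / 2)^-1 * (pw n (x / 2) / (x / 2)))) ->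
  (forall n, (0 < n)%N -> nm (L1 - LamN n.+1 (s t)) <= 2 * ((x / 2)^-1 * (pw n (x / 2) / (x / 2)))) ->
  (forall n, (0 < n)%N -> nm (L2 - LamN n.+1 (s (2 * t))) <= 2 * ((x / 2)^-1 * (pw n (x / 2) / (x / 2)))) ->
  0 <= 3 * Re L0 + 4 * Re L1 + Re L2.
Proof.
move=> x0 s H0 H1 H2; apply/ler_addgt0Pr => e e0.
have x20 : 0 < x / 2 by lra.
pose c := 2 * ((x / 2)^-1 * (x / 2)^-1).
have c0 : 0 < c by rewrite !mulr_gt0 ?invr_gt0.
have ec : 0 < e / (8 * c) by rewrite divr_gt0//; lra.
have [N HN] := pw_small x20 ec.
have cE n : 2 * ((x / 2)^-1 * (pw n (x / 2) / (x / 2))) = c * pw n (x / 2) by rewrite /c; ring.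
pose n := N.+1.
have b : c * pw n (x / 2) <= e / 8.
  have c8 : 0 < 8 * c by lra.
  have := HN n (leqnSn N); rewrite (ler_pdivlMr _ _ c8); move: (pw n (x / 2)) (c) => p c' hh; move: hh; clear; lra.
have q0 := H0 n isT; have q1 := H1 n isT; have q2 := H2 n isT.
move: q0 q1 q2; rewrite !cE => q0 q1 q2.
have P : 0 <= 3 * Re (LamN n.+1 (s 0)) + 4 * Re (LamN n.+1 (s t)) + Re (LamN n.+1 (s (2 * t))).
  have Rk (y : R) : Re (LamN n.+1 (s y)) = \sum_(1 <= k < n.+1) Lam k * (pw k (1 + x) * cos (y * ln k%:R)).
    rewrite /LamN ReS; apply: eq_bigr => k _.
    by rewrite (ReM (Lam k)%:C) /= !(mulr0, mul0r, subr0, add0r) (mulNr y) cosN.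
  rewrite !Rk !big_distrr /= -!big_split /=.
  apply: sumr_ge0 => k _; rewrite mul0r cos0.
  set A := Lam k; set B := pw k (1 + x); set th := t * ln k%:R.
  have -> : 2 * t * ln k%:R = th *+ 2 by rewrite /th mulr2n; ring.
  rewrite cos_mulr2n.
  have -> : 3 * (A * (B * 1)) + 4 * (A * (B * cos th)) + A * (B * (cos th ^+ 2 *+ 2 - 1)) =
    2 * (A * B) * (1 + cos th) ^+ 2 by rewrite mulr2n; ring.
  by rewrite !mulr_ge0 ?Lam_ge0 ?(ltW (pw_gt0 _ _))// sqr_ge0.
have r0 := Re_le_nm (L0 - LamN n.+1 (s 0)).
have r1 := Re_le_nm (L1 - LamN n.+1 (s t)).
have r2 := Re_le_nm (L2 - LamN n.+1 (s (2 * t))).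
move: r0 r1 r2; rewrite !ler_norml !ReD !ReN.
move: q0 q1 q2 b P; clear -e0; lra.
Qed.

(** As [d] tends to 0, [L0], [L1] and [L2] behave like [1 / d], [- m1 / d] and [- m2 / d]. The
    inequality of [mertens] then gives [3 - 4 m1 - m2 >= 0], so [m1 = 0]. *)
Lemma Y_neq0_1 t : Y (1 +i* t) != 0.
Proof.
have [->|t0] := eqVneq t 0.
  have -> : 1 +i* 0 = 1 :> C by [].
  by rewrite Y1 oner_eq0.
have ord y : exists (m : nat) (r B : R), [/\ 0 < r, (m == 0)%N = (Y (1 +i* y) != 0) &
  forall d : R, 0 < d < r -> Y ((1 +i* y) + d%:C) != 0 /\
  nm (der Y ((1 +i* y) + d%:C) / Y ((1 +i* y) + d%:C) - m%:R / d%:C) <= B].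
  by apply: order_at; rewrite /=; lra.
have [m0 [r0 [B0 [r00 mE0 H0]]]] := ord 0.
have [m1 [r1 [B1 [r10 mE1 H1]]]] := ord t.
have [m2 [r2 [B2 [r20 mE2 H2]]]] := ord (2 * t).
have m00 : m0 = 0%N.
  by apply/eqP; rewrite mE0 (_ : 1 +i* 0 = 1)// Y1 oner_eq0.
rewrite -mE1 -leqn0 leqNgt; apply/negP => m1p.
pose T := `|t|^-1; have Tp : 0 < T by rewrite invr_gt0 normr_gt0.
pose K := 3 * `|B0| + 4 * (`|B1| + T) + (`|B2| + T) + 1.
have K0 : 0 < K by rewrite /K; have := normr_ge0 B0; have := normr_ge0 B1; have := normr_ge0 B2; lra.
pose d := Num.min (Num.min (r0 / 2) (r1 / 2)) (Num.min (r2 / 2) ((2 * K)^-1)).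
have d0 : 0 < d by rewrite !lt_min !divr_gt0//= invr_gt0 mulr_gt0.
have [d1 d2 d3 dK] : [/\ d < r0, d < r1, d < r2 & d <= (2 * K)^-1].
  split.
  - by apply: (@le_lt_trans _ _ (r0 / 2)); [rewrite /d !ge_min lexx|lra].
  - by apply: (@le_lt_trans _ _ (r1 / 2)); [rewrite /d !ge_min lexx orbT|lra].
  - by apply: (@le_lt_trans _ _ (r2 / 2)); [rewrite /d !ge_min lexx !orbT|lra].
  - by rewrite /d !ge_min lexx !orbT.
have sE y : 1 +i* y + d%:C = (1 + d) +i* y :> C by apply: ceqP => /=; ring.
have [Y0 E0] := H0 d (introT andP (conj d0 d1)).
have [Yt E1] := H1 d (introT andP (conj d0 d2)).
have [Y2 E2] := H2 d (introT andP (conj d0 d3)).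
move: Y0 E0 Yt E1 Y2 E2; rewrite !sE => Y0 E0 Yt E1 Y2 E2.
have gt1 y : 1 < Re ((1 + d) +i* y : C) by rewrite /=; lra.
have [L0 [HL0 D0]] := log_deriv_Y (gt1 0).
have [L1 [HL1 D1]] := log_deriv_Y (gt1 t).
have [L2 [HL2 D2]] := log_deriv_Y (gt1 (2 * t)).
have xE : (1 + d - 1) / 2 = d / 2 by ring.
rewrite /= xE in HL0 HL1 HL2.
have M := mertens d0 HL0 HL1 HL2.
have F y L : Y ((1 + d) +i* y) != 0 -> der Y ((1 + d) +i* y) = Y ((1 + d) +i* y) * (((1 + d) +i* y - 1)^-1 - L) ->
   L = ((1 + d) +i* y - 1)^-1 - der Y ((1 + d) +i* y) / Y ((1 + d) +i* y).
  by move=> Yn ->; rewrite [_ * (_ - L)]mulrC mulfK//; ring.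
have := F _ _ Y0 D0; have := F _ _ Yt D1; have := F _ _ Y2 D2.
set Q0 := der Y _ / _ in E0 *; set Q1 := der Y ((1 + d) +i* t) / _ in E1 *.
set Q2 := der Y ((1 + d) +i* (2 * t)) / _ in E2 *.
move=> LE2 LE1 LE0.
have md (m : nat) : Re (m%:R / d%:C : C) = m%:R / d.
  by rewrite -(rmorph_nat (real_complex R)) -fmorphV -rmorphM.
have R0 : Re L0 <= d^-1 + `|B0|.
  rewrite LE0 ReD ReN; have -> : (1 + d) +i* 0 - 1 = d%:C :> C by apply: ceqP => /=; ring.
  rewrite -fmorphV /=; have := Re_le_nm (Q0 - m0%:R / d%:C); rewrite ReD ReN md m00 mul0r subr0.
  by move: E0; rewrite m00 mul0r subr0 ler_norml; have := ler_norm B0; lra.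
have inv y : y != 0 -> Re (((1 + d) +i* y - 1)^-1 : C) <= `|y|^-1.
  move=> y0; apply: le_trans (ler_norm _) _; apply: le_trans (Re_le_nm _) _.
  have h : `|y| <= nm ((1 + d) +i* y - 1).
    by apply: le_trans (Im_le_nm _); rewrite ImD ImN /= oppr0 addr0.
  by rewrite nmV lef_pV2 ?posrE ?normr_gt0// (lt_le_trans _ h)// normr_gt0.
have R1 : Re L1 <= T + `|B1| - m1%:R / d.
  rewrite LE1 ReD ReN; have := inv t t0; have := Re_le_nm (Q1 - m1%:R / d%:C).
  rewrite ReD ReN md -/T ler_norml; have := ler_norm B1; lra.
have R2 : Re L2 <= T + `|B2| - m2%:R / d.
  have t20 : 2 * t != 0 by rewrite mulf_neq0.
  rewrite LE2 ReD ReN; have := inv (2 * t) t20; have := Re_le_nm (Q2 - m2%:R / d%:C).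
  have : `|2 * t|^-1 <= T by rewrite normrM invfM /T ler_piMl ?invr_ge0// ger0_norm// invf_le1// ler1n.
  rewrite ReD ReN md ler_norml; have := ler_norm B2; lra.
have h1 : d^-1 <= m1%:R / d by rewrite ler_peMl ?invr_ge0 ?(ltW d0)// ler1n.
have h2 : 0 <= m2%:R / d by rewrite divr_ge0 ?(ltW d0).
have h3 : 2 * K <= d^-1 by rewrite -[leLHS]invrK lef_pV2 ?posrE ?invr_gt0 ?mulr_gt0.
move: h3 M R0 R1 R2 h1 h2 K0; rewrite /K; clear; lra.
Qed.

Lemma rh_zeros : riemann_hypothesis R -> forall z, 0 < Re z -> Y z = 0 -> Re z = 1 / 2.
Proof.
move=> RH z z0 Yz.
have [z2|z2] := ltP 2 (Re z).
  by have := Y_lower (ltW z2); rewrite Yz nm0; lra.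
have [z1|z1] := ltP 1 (Re z).
  by have := @Y_neq0_gt1 z; rewrite z1 z2 Yz eqxx => /(_ isT).
have [E|z1'] := eqVneq (Re z) 1.
  have := Y_neq0_1 (Im z); have -> : 1 +i* Im z = z by rewrite -E; case: (z).
  by rewrite Yz eqxx.
apply: (RH); split; first by rewrite z0 lt_neqAle z1' z1.
have zn1 : z != 1 by apply: contraNneq z1' => ->.
have := continues_zetaY (rh_continues RH) z0 zn1; rewrite Yz => /eqP.
by rewrite mulf_eq0 subr_eq0 (negPf zn1) /= => /eqP.
Qed.
End Zeros.

(** * Multiplicities and conjugate zeros *)

Section Multiplicity.
Variable R : realType.
Local Notation C := R[i].
Local Notation nm := (@nm R).
Local Notation Y := (@Y R).
Local Notation fact := (@fact R).
Implicit Types (s z w rho : C) (l : seq C) (f g : C -> C) (t U : R).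

(** If [m < n], cancelling [(w - z) ^+ m] makes [g1] tend to 0 along [w = z + d], against
    [g1 z != 0]. *)
Lemma order_le f z m n g1 g2 r : 0 < r -> (forall w, nm (w - z) < r -> f w = (w - z) ^+ m * g1 w) ->
  (forall w, nm (w - z) < r -> f w = (w - z) ^+ n * g2 w) -> ccontat g1 z -> ccontat g2 z ->
  g1 z != 0 -> (n <= m)%N.
Proof.
move=> r0 E1 E2 c1 c2 g0; rewrite leqNgt; apply/negP => mn.
pose e := nm (g1 z) / 2.
have e0 : 0 < e by rewrite divr_gt0// nm_gt0.
have [r1 r10 H1] := c1 _ e0.
have [r2 r20 H2] := c2 _ (@ltr01 R).
pose B := nm (g2 z) + 1.
have B0 : 0 < B by have := nm_ge0 (g2 z); rewrite /B; lra.
pose d := Num.min (Num.min (r / 2) (r1 / 2)) (Num.min (Num.min (r2 / 2) 1) (e / (2 * B))).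
have B20 : 0 < 2 * B by lra.
have [k1 k2 k3] : [/\ 0 < r / 2, 0 < r1 / 2 & 0 < r2 / 2] by split; lra.
have d0 : 0 < d by rewrite !lt_min k1 k2 k3 ltr01 (divr_gt0 e0 B20).
have [dr dr1 dr2 d1 de] : [/\ d <= r / 2, d <= r1 / 2, d <= r2 / 2, d <= 1 & d <= e / (2 * B)].
  by rewrite /d !ge_min !lexx !orbT.
have dz : z + d%:C - z = d%:C by ring.
have nd : nm d%:C = d by rewrite nm_real (gtr0_norm d0).
have h1 := H1 (z + d%:C); rewrite dz nd in h1.
have h2 := H2 (z + d%:C); rewrite dz nd in h2.
have e1 := E1 (z + d%:C); rewrite dz nd in e1.
have e2 := E2 (z + d%:C); rewrite dz nd in e2.
have dne0 : d%:C != 0 :> C by rewrite -nm_gt0 nd.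
have {}h1 : nm (g1 (z + d%:C) - g1 z) < e by apply: h1; lra.
have {}h2 : nm (g2 (z + d%:C) - g2 z) < 1 by apply: h2; lra.
have {}e1 : f (z + d%:C) = d%:C ^+ m * g1 (z + d%:C) by apply: e1; lra.
have {}e2 : f (z + d%:C) = d%:C ^+ n * g2 (z + d%:C) by apply: e2; lra.
have G : g1 (z + d%:C) = d%:C ^+ (n - m) * g2 (z + d%:C).
  apply: (@mulfI _ (d%:C ^+ m)); first by rewrite expf_neq0.
  by rewrite -e1 e2 mulrA -exprD subnKC// ltnW.
have b1 : nm (g2 (z + d%:C)) <= B.
  have -> : g2 (z + d%:C) = g2 z + (g2 (z + d%:C) - g2 z) by ring.
  by apply: le_trans (nmD _ _) _; rewrite lerD2l ltW.
have b2 : nm (d%:C ^+ (n - m)) <= d.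
  rewrite nmX nd; case: (n - m)%N (subn_gt0 m n) => [|k _]; first by rewrite mn.
  by rewrite exprS ler_piMr ?(ltW d0)// exprn_ile1// ltW.
have : nm (g1 (z + d%:C)) <= d * B by rewrite G nmM; apply: ler_pM; rewrite ?nm_ge0.
have := nm_triB (g1 z) (g1 z - g1 (z + d%:C)); rewrite [nm (g1 z - g1 _)]nm_distC.
have -> : g1 z - (g1 z - g1 (z + d%:C)) = g1 (z + d%:C) by ring.
move: de; rewrite ler_pdivlMr// => de.
move: h1 de e0; rewrite /e; clear; lra.
Qed.

Lemma fact_order l g z : fact l g -> 0 < Re z -> g z != 0 ->
  exists h, [/\ forall w, 0 < Re w -> hol h w, h z != 0 &
    forall w, 0 < Re w -> Y w = (w - z) ^+ count_mem z l * h w].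
Proof.
move=> [hg E] z0 gz; exists (fun w => \prod_(r <- l | r != z) (w - r) * g w); split.
- move=> w w0; apply: holM; last exact: hg.
  under eq_fun do rewrite -big_filter.
  by apply: hol_prod => r; exact: hol_subC.
- rewrite mulf_neq0// prodf_seq_neq0; apply/allP => r _; apply/implyP.
  by rewrite subr_eq0 eq_sym.
- move=> w w0; rewrite E// (bigID (pred1 z)) /= mulrA; congr (_ * _ * _).
  rewrite (eq_bigr (fun=> w - z)); last by move=> i /eqP ->.
  by rewrite big_const_seq iter_mulr mulr1.
Qed.

Lemma Re_ball z w : nm (w - z) < Re z -> 0 < Re w.
Proof. by have := Re_le_nm (w - z); rewrite ReD ReN ler_norml; lra. Qed.

Lemma near_ball (P : C -> Prop) z r : 0 < r -> (forall w, nm (w - z) < r -> P w) ->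
  \forall w \near (z : C^o), P w.
Proof.
move=> r0 H; apply/nbhs_ballP; exists r%:C; first by rewrite /= ltcR.
by move=> w; rewrite /ball /= nmE ltcR nm_distC => /H.
Qed.

Lemma ball_near (P : C -> Prop) z : (\forall w \near (z : C^o), P w) ->
  exists2 r, 0 < r & forall w, nm (w - z) < r -> P w.
Proof.
move=> /nbhs_ballP[_/cltP[r r0 ->] H]; exists r => // w hw.
by apply: H; rewrite /ball /= nmE ltcR nm_distC.
Qed.

(** Away from 1, dividing by [w - 1] turns a factorisation of [Y] into one of [zeta]; [order_le] in
    both directions makes the vanishing order unique, hence the selected one. *)
Lemma fact_multiplicity l g z : riemann_hypothesis R -> fact l g -> 0 < Re z -> z != 1 -> g z != 0 ->
  multiplicity z = count_mem z l.
Proof.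
move=> RH fg z0 z1 gz.
have [h [hh h0 hE]] := fact_order fg z0 gz.
have z10 : 0 < nm (z - 1) by rewrite nm_gt0 subr_eq0.
pose r := Num.min (Re z) (nm (z - 1)).
have r0 : 0 < r by rewrite lt_min z0.
have zE w : nm (w - z) < r -> @zeta R w = (w - z) ^+ count_mem z l * (h w / (w - 1)).
  rewrite lt_min => /andP[/Re_ball w0 w1].
  have wn1 : w != 1 by apply: contraTneq w1 => ->; rewrite nm_distC ltxx.
  rewrite mulrA -hE// -(continues_zetaY (rh_continues RH) w0 wn1) mulrC mulKf// subr_eq0//.
have hq w : nm (w - z) < r -> hol (fun w => h w / (w - 1)) w.
  rewrite lt_min => /andP[/Re_ball w0 w1].
  apply: hol_div; [exact: hh|exact: hol_subC|].
  by rewrite subr_eq0; apply: contraTneq w1 => ->; rewrite nm_distC ltxx.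
have qz : h z / (z - 1) != 0 by rewrite mulf_neq0// invr_eq0 subr_eq0.
apply: xget_unique.
  exists (fun w => h w / (w - 1)); split => //.
    by apply: near_ball r0 _ => w hw; apply/holP; exact: hq.
  exact: near_ball r0 zE.
move=> m [k [kh k0 kE]].
have [r1 r10 k1] := ball_near kE.
have kc : ccontat k z.
  by have [r2 r20 H] := ball_near kh; apply: hol_cont; apply/holP/H; rewrite subrr nm0.
have qc : ccontat (fun w => h w / (w - 1)) z by apply: hol_cont; apply: hq; rewrite subrr nm0.
have rr : 0 < Num.min r r1 by rewrite lt_min r0.
apply/eqP; rewrite eqn_leq; apply/andP; split.
  apply: (order_le rr (f := @zeta R) _ _ qc kc) => // w; rewrite lt_min => /andP[??]; auto.
apply: (order_le rr (f := @zeta R) _ _ kc qc) => // w; rewrite lt_min => /andP[??]; auto.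
Qed.

Lemma conjD z w : conjc (z + w) = conjc z + conjc w. Proof. exact: rmorphD. Qed.
Lemma conjB z w : conjc (z - w) = conjc z - conjc w. Proof. exact: rmorphB. Qed.
Lemma conjM z w : conjc (z * w) = conjc z * conjc w. Proof. exact: rmorphM. Qed.
Lemma conjX z n : conjc (z ^+ n) = conjc z ^+ n. Proof. exact: rmorphXn. Qed.
Lemma conj_nat n : conjc (n%:R : C) = n%:R. Proof. exact: rmorph_nat. Qed.
Lemma conj_sum I (r : seq I) (P : pred I) (F : I -> C) :
  conjc (\sum_(i <- r | P i) F i) = \sum_(i <- r | P i) conjc (F i).
Proof. exact: rmorph_sum. Qed.

Lemma npow_conj n s : npow n (conjc s) = conjc (npow n s).
Proof.
apply: ceqP; rewrite /npow /cexp /=; case: s => a b /=; rewrite  !(mulr0, mul0r, subr0, add0r, addr0) ?opprK ?mulNr ?cosN ?sinN ?mulrN ?opprK //.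
Qed.

Lemma YN_conj n s : YN n (conjc s) = conjc (YN n s).
Proof.
rewrite /YN npow_conj conjD (conjM (s - 1)) (conjM n%:R) conjB (conj_nat 1) conj_nat conj_sum.
by congr (_ * _ + _); apply: eq_bigr => k _; rewrite npow_conj.
Qed.

Lemma Re_conj s : Re (conjc s) = Re s. Proof. by case: s. Qed.
Lemma Im_conj s : Im (conjc s) = - Im s. Proof. by case: s. Qed.
Lemma nm_conjc s : nm (conjc s) = nm s. Proof. exact: nm_conj. Qed.

Lemma Y_conj s : 0 < Re s -> Y (conjc s) = conjc (Y s).
Proof.
move=> s0; apply: Y_lim; rewrite ?Re_conj// => e e0.
have [||N HN] := @YN_unif R s (Re s / 2) _ _ _ e0; [lra|lra|].
exists N.+2 => -[//|[//|n]] hn; rewrite YN_conj -conjB nm_conjc.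
have := HN n hn s; rewrite subrr nm0 => h; apply: h; lra.
Qed.

(** Reflecting a factorisation at [conjc z] yields one at [z], by [Y_conj]; the two orders are then
    compared. The cofactor obtained is known to be continuous, which is what [order_le] asks for. *)
Lemma fact_conj l g l' g' z : fact l g -> fact l' g' -> 0 < Re z -> g z != 0 -> g' (conjc z) != 0 ->
  (count_mem (conjc z) l' <= count_mem z l)%N.
Proof.
move=> f1 f2 z0 n1 n2.
have z0' : 0 < Re (conjc z) by rewrite Re_conj.
have [h [hh h0 hE]] := fact_order f1 z0 n1.
have [k [kh k0 kE]] := fact_order f2 z0' n2.
apply: (order_le z0 (g1 := h) (g2 := fun w => conjc (k (conjc w))) (f := Y)) => //.
- by move=> w /Re_ball; exact: hE.
- move=> w /Re_ball w0; rewrite -[w in LHS]conjcK Y_conj ?Re_conj// kE ?Re_conj//.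
  by rewrite conjM conjX conjB !conjcK.
- exact: hol_cont (hh _ z0).
- move=> e e0; have [d d0 Hd] := hol_cont (kh _ z0') e0; exists d => // w hw.
  by rewrite -conjB nm_conjc; apply: Hd; rewrite -conjB nm_conjc.
- exact: h0.
Qed.
End Multiplicity.

(** * Partial fractions of the logarithmic derivative near a given height *)

Section Landau.
Variable R : realType.
Local Notation C := R[i].
Local Notation nm := (@nm R).
Local Notation Y := (@Y R).
Local Notation fact := (@fact R).
Implicit Types (s z w rho : C) (l : seq C) (f g : C -> C) (t U : R).

(** In contrast to [fact], the list is complete: it exhausts the zeros of the region with their
    multiplicities. *)
Definition full t U l g := [/\ fact l g, forall rho, rho \in l -> inreg t U rho &
  forall z, inreg t U z -> g z != 0].

Hypothesis RH : riemann_hypothesis R.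

Lemma full_zero t U l g rho : full t U l g -> rho \in l ->
  [/\ Re rho = 1 / 2, `|Im rho - t| <= U & Y rho = 0].
Proof.
move=> [fg hl _] hr; have [/andP[h1 h2] h3] := hl _ hr.
have r0 : 0 < Re rho by lra.
have Y0 := fact_zero fg hr r0; split => //; exact: rh_zeros RH _ r0 Y0.
Qed.

(** To the left of [1 / 2] a zero of [g] would be a zero of [Y] off the critical line. *)
Lemma full_neq0 t U l g z : full t U l g -> 0 < Re z <= 4 -> `|Im z - t| <= U -> g z != 0.
Proof.
move=> [fg hl hg] /andP[z0 z4] hz; have [h|h] := leP (1 / 2) (Re z).
  by apply: hg; split; rewrite ?h.
apply/eqP => gz; have Yz : Y z = 0 by case: fg => _ -> //; rewrite gz mulr0.
by have := rh_zeros RH z0 Yz; lra.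
Qed.

Lemma zero_full t U l g z : full t U l g -> 0 < Re z -> Y z = 0 -> `|Im z - t| <= U -> z \in l.
Proof.
move=> fg z0 Yz hz; have zh := rh_zeros RH z0 Yz.
by have [f1 _ hg] := fg; apply: fact_mem f1 z0 Yz _; apply: hg; split => //; lra.
Qed.

(* [z] runs over a disc whose leftmost point is [1/4 + i t]. *)
Lemma landau : exists2 K, 0 < K & forall t l g, full t (39 / 20) l g -> forall z,
  nm (z - (2 +i* t)) <= 7 / 4 -> Y z != 0 ->
  nm (der Y z / Y z - \sum_(rho <- l) (z - rho)^-1) <= K * ln (`|t| + 3).
Proof.
have U0 : 0 < 39 / 20 :> R by lra.
have [K [d [K1 d0 HG]]] := GG_bound U0.
have [D D0 HD] := zero_count U0.
have K0 : 0 < K by lra.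
have lK : 0 <= ln K by rewrite ln_ge0.
pose A : R := 32 * 760.
have A0 : 0 <= A by rewrite /A; clear; lra.
exists (A * (2 * ln K + 2) + 2 * D); first by move: (mulr_ge0 A0 lK) D0 => h D0; lra.
move=> t l g fl z hz Yz; have [fg hl _] := fl.
have [_ HGG] := HG t l g fg hl.
pose T := `|t| + 3; have T3 : 3 <= T by rewrite /T lerDr.
have w_in u : sq (2 +i* t) (39 / 20) u -> 0 < Re u <= 4 /\ `|Im u - t| <= 39 / 20.
  rewrite sqE /= => /andP[]; rewrite ler_norml => h1 h2; split => //; lra.
have pos u rho : 0 < Re u -> rho \in l -> 1 / 2 <= Re (u + conjc rho).
  by move=> u0 /(full_zero fl)[h _ _]; rewrite ReD Re_conj; lra.
have pn0 u rho : 0 < Re u -> rho \in l -> u + conjc rho != 0.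
  by move=> u0 /(pos u _ u0) h; apply/eqP => E; rewrite E /= in h; lra.
pose M := K * T ^+ 2.
have M1 : 1 < M.
  have : 3 * 3 <= T * T by apply: ler_pM.
  have : T * T <= K * (T * T) by rewrite ler_peMl// mulr_ge0//; lra.
  by rewrite /M expr2; lra.
(* [GG l g] has no zeros in the square, since every zero was replaced by its reflection, and
   [GG_bound] compares it with its value at the centre. *)
have HL : nm (der (GG l g) z / GG l g z) <= A * ln M.
  apply: (log_deriv_bound M1 _ hz) => u hu; have [u0 ut] := w_in u hu.
  have u0' : 0 < Re u by case/andP: u0.
  split; last exact: HGG.
    apply: holM; first by case: fg => hh _; exact: hh.
    by apply: hol_prod => rho; apply: holD; [exact: hol_id|exact: hol_cst].
  rewrite /GG mulf_neq0 ?(full_neq0 fl)//.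
  by rewrite prodf_seq_neq0; apply/allP => rho hr; rewrite /= pn0.
have zs : sq (2 +i* t) (39 / 20) z by apply: nm_sq; lra.
have [zz zt] := w_in z zs; have z0 : 0 < Re z by case/andP: zz.
have gz := full_neq0 fl zz zt.
have dp : der (GG l g) z / GG l g z = der g z / g z + \sum_(rho <- l) (z + conjc rho)^-1.
  have hp : forall rho, rho \in l -> z - (- conjc rho) != 0 by move=> rho hr; rewrite opprK pn0.
  have := @cderiv_prodsub R l (fun rho => - conjc rho) z hp.
  under eq_fun do under eq_bigr do rewrite opprK.
  have -> : \prod_(rho <- l) (z - - conjc rho) = \prod_(rho <- l) (z + conjc rho).
    by apply: eq_bigr => rho _; rewrite opprK.
  have -> : \sum_(rho <- l) (z - - conjc rho)^-1 = \sum_(rho <- l) (z + conjc rho)^-1.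
    by apply: eq_bigr => rho _; rewrite opprK.
  move=> dpr; have hgz : hol g z by case: fg => hh _; exact: hh.
  have dG : cderiv (GG l g) z _ := cderivM (derP hgz) dpr.
  rewrite (derE dG) /GG.
  have : \prod_(rho <- l) (z + conjc rho) != 0.
    by rewrite prodf_seq_neq0; apply/allP => rho hr; rewrite /= pn0.
  move: gz; set a := g z; set b := \prod_(_ <- _) _; set c := \sum_(_ <- _) _.
  by move=> a0 b0; field; rewrite a0 b0.
(* The reflected zeros have real part [- 1 / 2], so each term is at most 2. *)
have S : nm (\sum_(rho <- l) (z + conjc rho)^-1) <= 2 * (size l)%:R.
  apply: le_trans (nm_sum _ _ _) _.
  apply: (@le_trans _ _ (\sum_(rho <- l) 2)).
    rewrite big_seq [leRHS]big_seq; apply: ler_sum => rho hr.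
    rewrite nmV; have := pos z rho z0 hr => h1; have := ler_norm (Re (z + conjc rho)).
    have := Re_le_nm (z + conjc rho) => h2 h3.
    rewrite -[leRHS]invrK lef_pV2 ?posrE ?invr_gt0//; clear -h1 h2 h3; lra.
  by rewrite big_const_seq count_predT iter_addr addr0 mulr_natr.
have -> : der Y z / Y z - \sum_(rho <- l) (z - rho)^-1 =
    der (GG l g) z / GG l g z - \sum_(rho <- l) (z + conjc rho)^-1.
  by rewrite dp (ld_fact fg)//; ring.
apply: le_trans (nmB _ _) _.
have lT := ln3_ge t; rewrite -/T in lT.
have lM : ln M = ln K + 2 * ln T.
  by rewrite /M lnM ?posrE ?exprn_gt0//; [rewrite lnXn// ?mulr_natl//|]; lra.
have := HD t l g fg hl; rewrite -/T => cl.
have h1 : ln K * (2 / 3) <= ln K * ln T by rewrite ler_wpM2l.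
have h2 : A * ln M <= A * ((2 * ln K + 2) * ln T).
  by apply: ler_wpM2l A0 _ _ _; rewrite lM; move: h1 lT lK; clear; lra.
by move: HL S cl h2; rewrite -/T; clear; lra.
Qed.
End Landau.

(** * The smoothed explicit formula *)

Section Heights.
Variable R : realType.
Local Notation C := R[i].
Local Notation nm := (@nm R).
Local Notation Y := (@Y R).
Implicit Types (s z w rho : C) (l : seq C) (f g : C -> C) (t U : R).

(** Pigeonhole: among [n + 1] candidates at mutual distance at least [d = 1 / (n + 1)], no point of
    [s] is within [d / 4] of two of them. *)
Lemma gap (s : seq R) (a : R) : exists2 T, a <= T <= a + 1 &
  forall y, y \in s -> (4 * (size s).+1%:R)^-1 <= `|y - T|.
Proof.
apply: contrapT => H; set n := size s in H.
pose d : R := n.+1%:R^-1; have d0 : 0 < d by rewrite invr_gt0.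
pose T (j : 'I_n.+1) := a + j%:R * d.
have P j : has (fun y => `|y - T j| < d / 4) s.
  apply: contrapT => /negP/hasPn h; apply: H; exists (T j).
    have : 0 <= (j : nat)%:R * d by rewrite mulr_ge0// ltW.
    have : (j : nat)%:R * d <= 1 by rewrite ler_pdivrMr// mul1r ler_nat ltnW.
    by rewrite /T; clear; lra.
  by move=> y /h; rewrite -leNgt invfM mulrC.
pose F (j : 'I_n.+1) : 'I_n := Ordinal (etrans (esym (has_find _ _)) (P j)).
have injF : injective F.
  have aux (i j : 'I_n.+1) : F i = F j -> (i <= j)%N.
    move=> /(congr1 val) /= E; rewrite leqNgt; apply/negP => ij.
    have h1 := nth_find 0 (P i); have h2 := nth_find 0 (P j).
    move: h1 h2; rewrite /= E; set y := nth _ _ _; rewrite !ltr_norml /T.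
    have : (j : nat)%:R + 1 <= (i : nat)%:R :> R by rewrite natr1 ler_nat.
    move=> ij' /andP[a1 a2] /andP[b1 b2].
    have := ler_wpM2r (ltW d0) ij'; rewrite mulrDl mul1r.
    by move: a1 a2 b1 b2 d0; clear; lra.
  by move=> i j E; apply/val_inj/eqP; rewrite /= eqn_leq !aux.
by have := leq_card F injF; rewrite !card_ord ltnn.
Qed.

Hypothesis RH : riemann_hypothesis R.

Lemma rh_gap l g T0 T d rho : full T0 4 l g -> T0 <= T <= T0 + 1 -> d <= 1 ->
  (forall rho, rho \in l -> d <= `|Im rho - T|) -> 0 < Re rho -> Y rho = 0 -> d <= `|Im rho - T|.
Proof.
move=> fl hT d1 H r0 Yr; have [h|h] := leP `|Im rho - T0| 4.
  by apply: H; exact: (zero_full RH fl).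
move: h; rewrite lter_normr => /orP h; rewrite ler_normr; apply/orP.
by case: h => h; [left|right]; lra.
Qed.

(** On this line all zeros are at distance at least [1 / 4], so the partial fractions are bounded by
    the number of zeros nearby. *)
Lemma ld_left : exists2 K, 0 < K & forall t,
  nm (der Y ((1 / 4) +i* t) / Y ((1 / 4) +i* t)) <= K * ln (`|t| + 3).
Proof.
have [A A0 HA] := landau RH.
have U0 : 0 < 39 / 20 :> R by lra.
have [D D0 HD] := zero_count U0.
exists (A + 4 * D); first lra.
move=> t; set z := _ +i* t; have [l [g [f1 f2 f3]]] := full_fact t U0.
have fl : full t (39 / 20) l g by [].
have z0 : 0 < Re z by rewrite /=; lra.
have Yz : Y z != 0 by apply/eqP => E; have := rh_zeros RH z0 E; rewrite /=; lra.
have zz : nm (z - (2 +i* t)) <= 7 / 4.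
  have -> : z - (2 +i* t) = (- (7 / 4))%:C by apply: ceqP => /=; [field|ring].
  by rewrite nm_real normrN ger0_norm; lra.
have := HA t l g fl z zz Yz; have := HD t l g f1 f2.
have S : nm (\sum_(rho <- l) (z - rho)^-1) <= 4 * (size l)%:R.
  apply: le_trans (nm_sum _ _ _) _.
  apply: (@le_trans _ _ (\sum_(rho <- l) 4)).
    rewrite big_seq [leRHS]big_seq; apply: ler_sum => rho hr.
    have [r1 _ _] := full_zero RH fl hr.
    have h : 1 / 4 <= nm (z - rho).
      by apply: le_trans (Re_le_nm _); rewrite ReD ReN r1 /= ler_normr; apply/orP; right; lra.
    by rewrite nmV -[leRHS]invrK lef_pV2 ?posrE ?invr_gt0//; lra.
  by rewrite big_const_seq count_predT iter_addr addr0 mulr_natr.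
have := nmD (der Y z / Y z - \sum_(rho <- l) (z - rho)^-1) (\sum_(rho <- l) (z - rho)^-1).
rewrite subrK; move: S; clear; lra.
Qed.

(** The height avoids all zeros by a constant over [ln T], and about [ln T] zeros are near; number
    times inverse distance gives the squared logarithm. *)
Lemma good_height : exists2 K, 0 < K & forall T0, 0 <= T0 -> exists2 T, T0 <= T <= T0 + 1 &
  forall s, 1 / 4 <= Re s <= 2 -> `|Im s| = T ->
    Y s != 0 /\ nm (der Y s / Y s) <= K * ln (T + 3) ^+ 2.
Proof.
have [A A0 HA] := landau RH.
have U0 : 0 < 39 / 20 :> R by lra.
have [D D0 HD] := zero_count U0.
have [E E0 HE] := zero_count (@ltr0Sn R 3).
exists (A * 2 + D * (4 * (E + 2))).
  have : 0 < D * (4 * (E + 2)) by rewrite mulr_gt0//; lra.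
  lra.
move=> T0 T00; have [l0 [g0 [k1 k2 k3]]] := full_fact T0 (@ltr0Sn R 3).
have fl0 : full T0 4 l0 g0 by [].
have [T hT HT] := gap [seq Im rho | rho <- l0] T0; rewrite size_map in HT.
exists T => //; set d := (4 * _)^-1 in HT.
have N1 : 1 <= (size l0).+1%:R :> R by rewrite ler1n.
have d0 : 0 < d by rewrite invr_gt0; lra.
have d1 : d <= 1 by rewrite invf_le1; lra.
have HT' rho : rho \in l0 -> d <= `|Im rho - T| by move=> hr; apply: HT; exact: map_f.
have G1 rho := rh_gap fl0 hT d1 HT' (rho := rho).
(* Height [- T] is reduced to height [T] by conjugating the zero. *)
have far s rho : `|Im s| = T -> 0 < Re rho -> Y rho = 0 -> d <= nm (s - rho).
  move=> sT r0 Yr; rewrite nm_distC; apply: le_trans (Im_le_nm _); rewrite ImD ImN.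
  have [h|h] := leP 0 (Im s).
    by move: sT; rewrite (ger0_norm h) => ->; exact: G1.
  have sT' : Im s = - T by move: sT; rewrite (ltr0_norm h) => <-; rewrite opprK.
  have := G1 (conjc rho); rewrite Re_conj Im_conj Y_conj// Yr conjc0 sT' opprK => /(_ r0 erefl).
  by rewrite -opprD normrN.
move=> s /andP[s1 s2] sT; have s0 : 0 < Re s by lra.
have Ys : Y s != 0.
  by apply/eqP => Ys0; have := far s s sT s0 Ys0; rewrite subrr nm0; lra.
split => //; set t := Im s in sT *; have [l [g [f1 f2 f3]]] := full_fact t U0.
have fl : full t (39 / 20) l g by [].
have zz : nm (s - (2 +i* t)) <= 7 / 4.
  have -> : s - (2 +i* t) = (Re s - 2)%:C by apply: ceqP => /=; rewrite ?ReD ?ImD /= ?subrr.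
  by rewrite nm_real ler_norml; lra.
have hA := HA t l g fl s zz Ys; have hD := HD t l g f1 f2; have hE := HE T0 l0 g0 k1 k2.
rewrite sT in hA hD; rewrite (ger0_norm T00) in hE.
have lnT : 1 / 2 <= ln (T + 3).
  have Tp : 0 <= T by clear -RH hT T00; lra.
  have h := ln3_ge T; rewrite (ger0_norm Tp) in h; clear -RH h; lra.
have lnT0 : ln (T0 + 3) <= ln (T + 3) by rewrite ler_ln ?posrE; clear -RH hT T00; lra.
set L := ln (T + 3) in hA hD lnT lnT0 *.
have dV : d^-1 <= 4 * (E + 2) * L.
  rewrite /d invrK -natr1; have : E * ln (T0 + 3) <= E * L by rewrite ler_wpM2l// ltW.
  move: hE lnT; clear; lra.
have S : nm (\sum_(rho <- l) (s - rho)^-1) <= (size l)%:R * d^-1.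
  apply: le_trans (nm_sum _ _ _) _.
  apply: (@le_trans _ _ (\sum_(rho <- l) d^-1)).
    rewrite big_seq [leRHS]big_seq; apply: ler_sum => rho hr.
    have [r1 _ r3] := full_zero RH fl hr.
    have r0 : 0 < Re rho by rewrite r1 divr_gt0.
    have h := far s rho sT r0 r3.
    by rewrite nmV lef_pV2 ?posrE//; exact: lt_le_trans d0 h.
  by rewrite big_const_seq count_predT iter_addr addr0 mulr_natl.
have S2 : (size l)%:R * d^-1 <= D * L * (4 * (E + 2) * L).
  by apply: ler_pM => //; rewrite invr_ge0 ltW.
have h1 := nmD (der Y s / Y s - \sum_(rho <- l) (s - rho)^-1) (\sum_(rho <- l) (s - rho)^-1).
rewrite subrK in h1.
have h2 : A * L <= A * L * (2 * L).
  rewrite ler_peMr//; last by clear -RH lnT; lra.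
  by rewrite mulr_ge0 ?(ltW A0)//; clear -RH lnT; lra.
by rewrite expr2; clear -RH h1 h2 S S2 hA; lra.
Qed.
End Heights.

(** * A smoothed Perron formula *)

Section Perron.
Variable R : realType.
Local Notation C := R[i].
Local Notation nm := (@nm R).
Implicit Types (s z w rho : C) (f g : C -> C) (y T : R).

Lemma two_edges f a b c d M : a <= b -> c <= d -> bdcont f a b c d ->
  (forall x, a <= x <= b -> nm (f (x +i* c)) <= M /\ nm (f (x +i* d)) <= M) ->
  nm ('i * cint (fun y => f (b +i* y)) c d - 'i * cint (fun y => f (a +i* y)) c d
      - rint f a b c d) <= 4 * M * (b - a).
Proof.
move=> ab cd /(bdcontE ab cd)[h1 h2 h3 h4] le; rewrite /rint.
have B1 : nm (cint (fun x => f (x +i* c)) a b) <= 2 * M * (b - a).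
  by apply: cint_bound => //; [exact: contH_ccont|move=> x /le[]].
have B2 : nm (cint (fun x => f (x +i* d)) a b) <= 2 * M * (b - a).
  by apply: cint_bound => //; [exact: contH_ccont|move=> x /le[]].
have := nmB (cint (fun x => f (x +i* d)) a b) (cint (fun x => f (x +i* c)) a b).
set P := cint _ a b in B2 *; set Q := cint _ a b in B1 *; move=> h.
set u := cint _ c d; set v := cint _ c d.
have -> : 'i * u - 'i * v - (Q - P + 'i * (u - v)) = P - Q by ring.
by move: B1 B2 h; clear; lra.
Qed.

Definition cpow y s : C := cexp (s * (ln y)%:C).

Lemma cpowE y s : cpow y s = cexp (s * (ln y)%:C). Proof. by []. Qed.

Lemma nm_cpow y s : nm (cpow y s) = expR (Re s * ln y).
Proof. by rewrite /cpow nm_cexp ReM /= mulr0 subr0. Qed.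

Lemma cpowD y s w : cpow y (s + w) = cpow y s * cpow y w.
Proof. by rewrite /cpow mulrDl cexpD. Qed.

Lemma cpow1 y : 0 < y -> cpow y 1 = y%:C.
Proof. by move=> y0; rewrite /cpow mul1r cexp_real lnK. Qed.

Lemma hol_cpow y s : hol (cpow y) s.
Proof. by apply: hol_comp; [apply: holM; [exact: hol_id|exact: hol_cst]|exact: hol_cexp]. Qed.

(** The Perron kernel belonging to the weight [max (y - 1) 0]; its quadratic decay makes the
    vertical integral absolutely convergent. *)
Definition Phi y s : C := cpow y (s + 1) / (s * (s + 1)).

Lemma Phi_bound y s T : 0 < y -> 0 < T -> (Re s + 1) * ln y <= 3 * ln y -> T <= nm s -> T / 2 <= nm (s + 1) ->
  nm (Phi y s) <= 2 * (y ^+ 3 / T ^+ 2).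
Proof.
move=> y0 T0 h h1 h2; rewrite /Phi nmM nmV nm_cpow ReD nmM.
have e : expR ((Re s + 1) * ln y) <= y ^+ 3.
  have -> : y ^+ 3 = expR (3 * ln y) by rewrite expRM_natl lnK.
  by rewrite ler_expR.
have -> : 2 * (y ^+ 3 / T ^+ 2) = y ^+ 3 * (T * (T / 2))^-1 by field; rewrite gt_eqF.
apply: ler_pM => //; try by rewrite ?expR_ge0 ?invr_ge0 ?mulr_ge0 ?nm_ge0.
have T2 : 0 < T / 2 by lra.
have p : T * (T / 2) <= nm s * nm (s + 1) by apply: ler_pM => //; exact: ltW.
have q : 0 < T * (T / 2) by rewrite mulr_gt0.
by rewrite lef_pV2 ?posrE// (lt_le_trans q p).
Qed.

Lemma hol_Phi y s : s != 0 -> s + 1 != 0 -> hol (Phi y) s.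
Proof.
move=> s0 s1; apply: hol_div.
- by apply: hol_comp; [apply: holD; [exact: hol_id|exact: hol_cst]|exact: hol_cpow].
- by apply: holM; [exact: hol_id|apply: holD; [exact: hol_id|exact: hol_cst]].
- by rewrite mulf_neq0.
Qed.

(* Close the contour to the right for [y <= 1], and to the left, across the
   poles [0] and [-1], for [1 < y]. *)
Lemma perron y T : 0 < y -> 2 <= T ->
  nm ('i * cint (fun t => Phi y (2 +i* t)) (- T) T - twopii R * (Num.max (y - 1) 0)%:C) <= 24 * (y ^+ 3 / T).
Proof.
move=> y0 T2; have T0 : 0 < T by lra.
set M := 2 * (y ^+ 3 / T ^+ 2).
have MT : M * T = 2 * (y ^+ 3 / T) by rewrite /M; field; rewrite gt_eqF.
have M0 : 0 <= M by rewrite /M mulr_ge0// divr_ge0 ?exprn_ge0// ltW.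
have TN : - T <= T by lra.
have horiz x c : `|c| = T -> (x + 1) * ln y <= 3 * ln y -> nm (Phi y (x +i* c)) <= M.
  move=> cT hx; apply: Phi_bound => //.
    by apply: le_trans (Im_le_nm _); rewrite /= cT.
  by apply: le_trans (Im_le_nm _); rewrite ImD /= addr0 cT; lra.
have nT : `|- T| = T by rewrite normrN gtr0_norm.
have pT : `|T| = T by rewrite gtr0_norm.
have bd a b : (forall s, onbd a b (- T) T s -> s != 0 /\ s + 1 != 0) -> bdcont (Phi y) a b (- T) T.
  by move=> H s /H[??]; apply/hol_cont/hol_Phi.
have [y1|y1] := leP y 1.
- have ly : ln y <= 0 by rewrite ln_le0.
  have sgn x : 2 <= x -> (x + 1) * ln y <= 3 * ln y by move=> hx; rewrite ler_wnM2r//; lra.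
  rewrite max_r ?mulr0 ?subr0; last lra.
  have ab : 2 < 2 + T by lra.
  have nz s : inrect 2 (2 + T) (- T) T s -> s != 0 /\ s + 1 != 0.
    by move=> /andP[/andP[h _] _]; split; apply/eqP => /(congr1 (@complex.Re R)); rewrite ?ReD /=; lra.
  have c : - T < T by lra.
  have G : rint (Phi y) 2 (2 + T) (- T) T = 0.
    by apply: goursat => // s /nz[??]; exact: hol_Phi.
  have bc := bd _ _ (fun s h => nz s (onbd_in h)).
  have := two_edges (ltW ab) TN bc (M := M).
  rewrite G subr0 (_ : 2 + T - 2 = T); last by ring.
  have B : nm (cint (fun t => Phi y ((2 + T) +i* t)) (- T) T) <= 2 * M * (T - - T).
    have [_ _ _ h4] := bdcontE (ltW ab) TN bc.
    apply: cint_bound => //; first exact: contV_ccont.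
    move=> t _; apply: Phi_bound => //; first by apply: sgn => /=; lra.
      by apply: le_trans (Re_le_nm _); rewrite /= ler_normr; apply/orP; left; lra.
    by apply: le_trans (Re_le_nm _); rewrite ReD /= ler_normr; apply/orP; left; lra.
  move=> /(_ _) H.
  have {}H : nm ('i * cint (fun y0 => Phi y ((2 + T) +i* y0)) (- T) T -
     'i * cint (fun y0 => Phi y (2 +i* y0)) (- T) T) <= 4 * M * T.
    by apply: H => x /andP[hx _]; split; apply: horiz => //; exact: sgn.
  set P := _ * cint (fun y0 => Phi y (2 +i* y0)) _ _ in H *; set Q := _ * cint _ _ _ in H.
  have nQ : nm Q = nm (cint (fun t => Phi y ((2 + T) +i* t)) (- T) T) by rewrite /Q (nmM 'i) nm_i mul1r.
  have := nmB Q (Q - P); rewrite (_ : Q - (Q - P) = P); last by ring.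
  have yT : 0 <= y ^+ 3 / T by rewrite divr_ge0 ?exprn_ge0// ltW.
  rewrite nQ; move: H B MT yT; clear; lra.
- have ly : 0 <= ln y by rewrite ln_ge0// ltW.
  have sgn x : x <= 2 -> (x + 1) * ln y <= 3 * ln y by move=> hx; rewrite ler_wpM2r//; lra.
  rewrite max_l; last lra.
  have ab : - T < 2 by lra.
  have c : - T < T by lra.
  pose E s := cpow y (s + 1).
  have hE s : hol E s by apply: hol_comp; [apply: holD; [exact: hol_id|exact: hol_cst]|exact: hol_cpow].
  have in0 : - T < Re (0 : C) < 2 /\ - T < Im (0 : C) < T by rewrite /=; split; lra.
  have in1 : - T < Re (- 1 : C) < 2 /\ - T < Im (- 1 : C) < T by rewrite !(ReN, ImN) /=; split; lra.
  have nz s : onbd (- T) 2 (- T) T s -> s != 0 /\ s + 1 != 0.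
    move=> hs; split; first exact: bd_neq in0.1 in0.2 hs.
    by have := bd_neq in1.1 in1.2 hs; rewrite -subr_eq0 opprK.
  have bc := bd _ _ nz.
  have C0 := cauchy in0.1 in0.2 (fun z _ => hE z).
  have C1 := cauchy in1.1 in1.2 (fun z _ => hE z).
  have J : rint (Phi y) (- T) 2 (- T) T = twopii R * (y - 1)%:C.
    have b0 : bdcont (fun z => E z / (z - 0)) (- T) 2 (- T) T.
      move=> s /nz[s0 _]; apply/hol_cont/hol_div; [exact: hE|exact: hol_subC|by rewrite subr0].
    have b1 : bdcont (fun z => E z / (z - -1)) (- T) 2 (- T) T.
      move=> s /nz[_ s0]; apply/hol_cont/hol_div; [exact: hE|exact: hol_subC|by rewrite opprK].
    have b2 : bdcont (fun z => - 1 * (E z / (z - -1))) (- T) 2 (- T) T.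
      move=> s /nz[_ s0]; apply/hol_cont/holM; first exact: hol_cst.
      by apply: hol_div; [exact: hE|exact: hol_subC|by rewrite opprK].
    have -> : rint (Phi y) (- T) 2 (- T) T = rint (fun z => E z / (z - 0) + - 1 * (E z / (z - -1))) (- T) 2 (- T) T.
      apply: rint_ext; rewrite ?(ltW ab)// => s /nz[s0 s1].
      by rewrite /Phi -/(E s) subr0 opprK; field; rewrite s0 s1.
    rewrite rintD ?(ltW ab)// rintZ ?(ltW ab)// C0 C1 /E add0r addNr cpow1// /cpow mul0r cexp0.
    by rewrite mulN1r -mulrBr rmorphB rmorph1.
  have := two_edges (ltW ab) TN bc (M := M).
  rewrite J.
  have B : nm (cint (fun t => Phi y ((- T) +i* t)) (- T) T) <= 2 * M * (T - - T).
    have [_ _ h3 _] := bdcontE (ltW ab) TN bc.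
    apply: cint_bound => //; first exact: contV_ccont.
    move=> t _; apply: Phi_bound => //; first by apply: sgn => /=; lra.
      by apply: le_trans (Re_le_nm _); rewrite /= ler_normr; apply/orP; right; lra.
    by apply: le_trans (Re_le_nm _); rewrite ReD /= ler_normr; apply/orP; right; lra.
  move=> /(_ _) H.
  have {}H : nm ('i * cint (fun y0 => Phi y (2 +i* y0)) (- T) T -
     'i * cint (fun y0 => Phi y ((- T) +i* y0)) (- T) T - twopii R * (y - 1)%:C) <= 4 * M * (2 - - T).
    by apply: H => x /andP[_ hx]; split; apply: horiz => //; exact: sgn.
  have := nm_triB ('i * cint (fun y0 => Phi y (2 +i* y0)) (- T) T - twopii R * (y - 1)%:C) ('i * cint (fun y0 => Phi y ((- T) +i* y0)) (- T) T).
  rewrite addrAC [nm ('i * cint (fun y0 => Phi y ((- T) +i* y0)) (- T) T)]nmM nm_i mul1r.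
  have : M * 2 <= M * T by rewrite ler_wpM2l.
  by move: H B MT; clear; lra.
Qed.
End Perron.

(** * The integral along the left edge *)

Section LeftIntegral.
Variable R : realType.
Local Notation C := R[i].
Local Notation nm := (@nm R).
Implicit Types (f : R -> C) (t A T : R).

Definition decay t : R := expR (- (3 / 2) * ln (t + 3)) * ln (t + 3).

(** In the variable [u = t + 3] this is [- (2 ln u + 4) u^(-1/2)], a primitive of
    [u^(-3/2) ln u]. *)
Let Gd t : R := - ((2 * ln (t + 3) + 4) * expR (- (1 / 2) * ln (t + 3))).

Let dln t : - 3 < t -> is_derive t 1 (fun u : R => ln (u + 3)) (t + 3)^-1.
Proof.
move=> t3; have t0 : 0 < t + 3 by lra.
have h1 : is_derive t 1 (fun u : R => u + 3) 1.
  by have := is_deriveD (is_derive_id t 1) (is_derive_cst (3 : R) t 1); rewrite addr0.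
have h2 := is_derive1_ln t0.
by have := @is_derive1_comp R (@ln R) (fun u => u + 3) t _ _ h2 h1; rewrite mulr1.
Qed.

Let dGd t : - 3 < t -> is_derive t 1 Gd (decay t).
Proof.
move=> t3; have t0 : 0 < t + 3 by lra.
have h := dln t3.
have h1 := is_deriveD (is_deriveZ 2 h) (is_derive_cst (4 : R) t 1).
have h2 := @is_derive1_comp R (@expR R) (fun u => - (1 / 2) * ln (u + 3)) t _ _ (is_derive_expR (- (1 / 2) * ln (t + 3))) (is_deriveZ (- (1 / 2)) h).
have := is_deriveN (is_deriveM h1 h2).
have E : expR (- (3 / 2) * ln (t + 3)) = expR (- (1 / 2) * ln (t + 3)) / (t + 3).
  have -> : - (3 / 2) * ln (t + 3) = - (1 / 2) * ln (t + 3) - ln (t + 3) by field.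
  by rewrite expRD expRN lnK.
congr is_derive; rewrite /decay E /GRing.scale /=.
rewrite addr0 -[(_ + cst 4) t]/(2 * ln (t + 3) + 4).
by field; rewrite gt_eqF.
Qed.

(** The primitive [Gd] varies by at most 8 on a half line, [cint_le] doubles this, and there are two
    half lines. *)
Lemma left_int f A T : 0 <= A -> 0 <= T -> ccont f (- T) T ->
  (forall t, - T <= t <= T -> nm (f t) <= A * decay `|t|) -> nm (cint f (- T) T) <= 32 * A.
Proof.
move=> A0 T0 cf H.
have n0 : - T <= 0 by lra.
have l3 : ln 3 <= 2 :> R by have := @le_ln1Dx R 2; rewrite (_ : 1 + 2 = 3); [apply; lra|ring].
have l30 : 0 <= ln 3 :> R by rewrite ln_ge0//; lra.
have G0 : - 8 <= Gd 0.
  rewrite /Gd add0r lerN2.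
  have e1 : expR (- (1 / 2) * ln 3) <= 1 :> R by rewrite -[leRHS]expR0 ler_expR; lra.
  have : (2 * ln 3 + 4) * expR (- (1 / 2) * ln 3) <= 8 * 1 :> R by apply: ler_pM; rewrite ?expR_ge0//; lra.
  lra.
have GT : Gd T <= 0.
  rewrite oppr_le0 mulr_ge0 ?expR_ge0//.
  have : 0 <= ln (T + 3) by rewrite ln_ge0//; lra.
  lra.
rewrite (cint_chasles n0 T0 cf).
have B1 : nm (cint f 0 T) <= 2 * ((A \*: Gd) T - (A \*: Gd) 0).
  apply: (cint_le T0 (g := fun t => A * decay t)).
  - by apply: ccontW cf.
  - move=> t /andP[t0 _]; apply: is_deriveZ; apply: dGd; lra.
  - by move=> t /andP[t0 t1]; rewrite -[in decay t](ger0_norm t0); apply: H; lra.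
have B2 : nm (cint f (- T) 0) <= 2 * ((- A) * Gd (- 0) - (- A) * Gd (- - T)).
  apply: (cint_le n0 (g := fun t => A * decay (- t)) (G := fun t => (- A) * Gd (- t))).
  - by apply: ccontW cf.
  - move=> t /andP[_ t0].
    have t3 : - 3 < - t by lra.
    have h := @is_derive1_comp R Gd (fun u => - u) t _ _ (dGd t3) (is_deriveN (is_derive_id t 1)).
    have := is_deriveZ (- A) h; congr is_derive; rewrite /GRing.scale /=; ring.
  - by move=> t /andP[t1 t0]; rewrite -[in decay _](ler0_norm t0); apply: H; lra.
rewrite oppr0 opprK in B2.
apply: le_trans (nmD _ _) _.
have h1 : A * Gd T <= 0 by rewrite mulr_ge0_le0.
have h2 : A * - 8 <= A * Gd 0 by rewrite ler_wpM2l.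
have {}B1 : nm (cint f 0 T) <= 2 * (A * Gd T - A * Gd 0) by [].
by move: B1 B2 h1 h2; clear; lra.
Qed.
End LeftIntegral.

(** * The averaged kernel *)

Section Kernel.
Variable R : realType.
Local Notation C := R[i].
Local Notation nm := (@nm R).
Local Notation cpow := (@cpow R).
Implicit Types (s z w rho : C).

(* The mean of [u ^ s / s] over [u] between [x] and [x + h]. *)
Definition KK (x h : R) s : C := (cpow (x + h) (s + 1) - cpow x (s + 1)) / (h%:C * (s * (s + 1))).

Lemma KKdef x h s : KK x h s = (cpow (x + h) (s + 1) - cpow x (s + 1)) / (h%:C * (s * (s + 1))).
Proof. by []. Qed.

Lemma cexp_sub1 z (B : R) : `|Re z| <= B -> nm (cexp z - 1) <= 2 * expR B * nm z.
Proof.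
move=> zB; rewrite -cexp0 -[in nm z](subr0 z).
apply: (@seg_bound R (@cexp R) (@cexp R) 0 z (expR B)) => t t01; first exact: cderiv_cexp.
rewrite nm_cexp ler_expR add0r subr0 ReM /= mul0r subr0.
apply: le_trans (ler_norm _) _; rewrite normrM; apply: le_trans _ zB.
by rewrite ler_piMl// ger0_norm; case/andP: t01.
Qed.

Variables (r x h : R).
Hypotheses (r2 : 2 <= r) (xr : x = r ^+ 2) (hr : `|h| = r).

Let r0 : 0 < r. Proof. by apply: lt_le_trans r2; rewrite ltr0n. Qed.
Let rr : 2 * r <= r * r. Proof. by rewrite ler_wpM2r// ltW. Qed.

Lemma kern_h : h != 0 /\ `|h| = r. Proof. by rewrite -normr_gt0 hr; split => //; exact: r0. Qed.

Lemma kern_y : x / 2 <= x + h /\ x + h <= 2 * x /\ 2 <= x + h.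
Proof.
have : `|h| <= r by rewrite hr.
rewrite ler_norml xr expr2 => /andP[h1 h2].
have : r * (r - 2) >= 0 by rewrite mulr_ge0 ?subr_ge0 ?(ltW r0).
by move: rr r2; lra.
Qed.

Let x0 : 0 < x. Proof. by rewrite xr exprn_gt0. Qed.
Let y0 : 0 < x + h. Proof. by have [_ [_ h1]] := kern_y; lra. Qed.

Definition kern_ln : R := ln (x + h) - ln x.

Lemma kern_lnP : `|kern_ln| <= 2 / r.
Proof.
have [y1 _] := kern_y; have hb : `|h| <= r by rewrite hr.
move: hb; rewrite ler_norml => /andP[h1 h2].
have xrr : x = r * r by rewrite xr expr2.
have xr1 : r / x = r^-1 by rewrite xrr; field; rewrite gt_eqF.
have e1 : kern_ln <= h / x.
  rewrite /kern_ln -ln_div ?posrE// mulrDl divff ?gt_eqF//.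
  by apply: le_ln1Dx; rewrite ltr_pdivlMr// mulN1r; have := x0; move: y1; lra.
have e2 : - kern_ln <= - h / (x + h).
  rewrite /kern_ln opprB -ln_div ?posrE//.
  have E : x / (x + h) = 1 + - h / (x + h) by field; rewrite gt_eqF.
  by rewrite E; apply: le_ln1Dx; rewrite ltr_pdivlMr// mulN1r; have := x0; move: y1; lra.
have b1 : h / x <= r^-1 by rewrite -xr1 ler_wpM2r// invr_ge0 ltW.
have b2 : - h / (x + h) <= 2 * r^-1.
  rewrite -xr1; have -> : 2 * (r / x) = r * (x / 2)^-1 by field; rewrite gt_eqF.
  have x20 : 0 < x / 2 by have := x0; lra.
  have i1 : (x + h)^-1 <= (x / 2)^-1 by rewrite lef_pV2 ?posrE.
  apply: (@le_trans _ _ (r / (x + h))); first by rewrite ler_wpM2r ?invr_ge0 ?(ltW y0)//; lra.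
  by rewrite ler_wpM2l// ltW.
have ri : 0 < r^-1 by rewrite invr_gt0.
by rewrite ler_norml; lra.
Qed.

Lemma KKE s : KK x h s = cpow x (s + 1) * (cexp ((s + 1) * kern_ln%:C) - 1) / (h%:C * (s * (s + 1))).
Proof.
rewrite /KK; congr (_ / _); rewrite mulrBr mulr1 !cpowE -cexpD; congr (cexp _ - _).
by rewrite -mulrDr -rmorphD /kern_ln; congr (_ * _%:C); ring.
Qed.

Let rh s : 0 <= Re s <= 2 -> `|Re ((s + 1) * kern_ln%:C)| <= 3.
Proof.
move=> /andP[s1 s2]; rewrite ReM /= mulr0 subr0 normrM ReD /=.
have h1 : `|Re s + 1| <= 3 by rewrite ger0_norm; lra.
have h2 : `|kern_ln| <= 1 by apply: le_trans kern_lnP _; rewrite ler_pdivrMr// mul1r.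
by have := ler_pM (normr_ge0 _) (normr_ge0 _) h1 h2; rewrite mulr1.
Qed.

Lemma Re_pos_neq0 s : 0 < Re s -> s != 0 /\ s + 1 != 0.
Proof. by move=> s0; split; apply/eqP => /(congr1 (@complex.Re R)); rewrite ?ReD /=; lra. Qed.

Let hn : nm h%:C = r. Proof. by rewrite nm_real hr. Qed.

(** The two powers nearly cancel: their quotient differs from 1 by a constant times
    [nm (s + 1) / r]. This is the useful bound up to the height [r]. *)
Lemma KK_bound1 s : 0 < Re s <= 2 -> nm (KK x h s) <= 4 * expR 3 * expR (Re s * ln x) / nm s.
Proof.
move=> /andP[s0 s2]; have [sn sn1] := Re_pos_neq0 s0.
have s01 : 0 <= Re s <= 2 by rewrite (ltW s0).
have hb := cexp_sub1 (rh s01); rewrite (nmM (s + 1)) nm_real in hb.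
have a0 : 0 < nm s by rewrite nm_gt0.
have b0 : 0 < nm (s + 1) by rewrite nm_gt0.
rewrite KKE (nmM (_ * _)) (nmM (cpow x (s + 1))) nmV (nmM h%:C) (nmM s) hn nm_cpow ReD mulrDl mul1r expRD lnK ?posrE//.
set X := expR _; set E := expR 3 in hb *; set d := nm (_ - 1) in hb *.
have X0 : 0 <= X by exact: expR_ge0.
have hb' : d <= 4 * E * nm (s + 1) / r.
  apply: le_trans hb _; have := kern_lnP => kl.
  have : 2 * E * nm (s + 1) * `|kern_ln| <= 2 * E * nm (s + 1) * (2 / r).
    by rewrite ler_wpM2l// !mulr_ge0 ?expR_ge0 ?(ltW b0).
  by move=> q; rewrite !mulrA in q *; apply: (le_trans q); rewrite le_eqVlt; apply/orP; left; apply/eqP; ring.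
have -> : 4 * E * X / nm s = X * x * (4 * E * nm (s + 1) / r) / (r * (nm s * nm (s + 1))).
  by rewrite xr; field; rewrite !gt_eqF.
rewrite ler_wpM2r ?invr_ge0 ?mulr_ge0 ?(ltW r0) ?(ltW a0) ?(ltW b0)//.
by rewrite ler_wpM2l// mulr_ge0// ltW.
Qed.

(** The two powers are estimated separately; beyond the height [r] the quadratic decay wins over
    [KK_bound1]. *)
Lemma KK_bound2 s : 0 < Re s <= 2 -> nm (KK x h s) <= 2 * expR 3 * r * expR (Re s * ln x) / nm s ^+ 2.
Proof.
move=> /andP[s0 s2]; have [sn sn1] := Re_pos_neq0 s0.
have s01 : 0 <= Re s <= 2 by rewrite (ltW s0).
have a0 : 0 < nm s by rewrite nm_gt0.
have ab : nm s <= nm (s + 1).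
  rewrite -(ler_pXn2r (ltn0Sn 1)) ?nnegrE ?nm_ge0// !nm_sqr ReD ImD /= addr0 lerD2r.
  by rewrite ler_pXn2r ?nnegrE//; lra.
rewrite KKE (nmM (_ * _)) (nmM (cpow x (s + 1))) nmV (nmM h%:C) (nmM s) hn nm_cpow ReD mulrDl mul1r expRD lnK ?posrE//.
set X := expR _; set E := expR 3; set d := nm (_ - 1).
have X0 : 0 <= X by exact: expR_ge0.
have hd : d <= 2 * E.
  apply: le_trans (nmB _ _) _; rewrite nm1 nm_cexp.
  have : expR (Re ((s + 1) * kern_ln%:C)) <= E.
    by rewrite ler_expR; apply: le_trans (ler_norm _) (rh s01).
  have : 1 <= E by rewrite -expR0 ler_expR.
  by lra.
have -> : 2 * E * r * X / nm s ^+ 2 = X * x * (2 * E) / (r * (nm s * nm s)).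
  by rewrite xr; field; rewrite !gt_eqF.
apply: ler_pM; rewrite ?mulr_ge0 ?nm_ge0 ?(ltW x0)//.
- by rewrite invr_ge0 !mulr_ge0 ?nm_ge0 ?(ltW r0).
- by rewrite ler_wpM2l// mulr_ge0// ltW.
- have p : r * (nm s * nm s) <= r * (nm s * nm (s + 1)) by rewrite ler_wpM2l ?(ltW r0)// ler_wpM2l// ltW.
  have q : 0 < r * (nm s * nm s) by rewrite !mulr_gt0.
  by rewrite lef_pV2 ?posrE// (lt_le_trans q p).
Qed.

(* Geometric mean of the two preceding bounds. *)
Lemma KK_left t : nm (KK x h ((1 / 4) +i* t)) <= 144 * expR 3 * r * expR (- (3 / 2) * ln (`|t| + 3)).
Proof.
set s := _ +i* t; have s0 : 0 < Re s <= 2 by rewrite /=; lra.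
have b1 := KK_bound1 s0; have b2 := KK_bound2 s0.
set X := expR (_ * ln x) in b1 b2; set E := expR 3 in b1 b2 *.
have XX : X ^+ 2 = r.
  rewrite /X -expRM_natl xr lnXn// -[RHS](lnK r0); congr expR.
  by rewrite /= -mulr_natl; field.
have X0 : 0 < X by exact: expR_gt0.
have E0 : 0 < E by exact: expR_gt0.
have T0 : 0 < `|t| + 3 by rewrite ltr_wpDl.
set p := expR (- _ * _).
have p0 : 0 < p by exact: expR_gt0.
have pp : p ^+ 2 = ((`|t| + 3) ^+ 3)^-1.
  rewrite /p -expRM_natl -[in RHS](lnK T0) -expRM_natl -expRN//; congr expR; field=> //.
have sl : (`|t| + 3) / 13 <= nm s.
  have : 1 / 4 <= nm s by apply: le_trans (Re_le_nm _); rewrite /= ger0_norm; lra.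
  have : `|t| <= nm s by exact: (Im_le_nm s).
  by lra.
have n0 : 0 < nm s by apply: lt_le_trans sl; rewrite divr_gt0.
suff : nm (KK x h s) ^+ 2 <= (144 * E * r * p) ^+ 2.
  by rewrite ler_pXn2r ?nnegrE ?nm_ge0 ?mulr_ge0 ?(ltW p0) ?(ltW E0) ?(ltW r0).
have h1 : nm (KK x h s) ^+ 2 <= 8 * (E * E) * r ^+ 2 / nm s ^+ 3.
  rewrite expr2; apply: le_trans (ler_pM (nm_ge0 _) (nm_ge0 _) b1 b2) _.
  have -> : 4 * E * X / nm s * (2 * E * r * X / nm s ^+ 2) = 8 * (E * E) * (r * X ^+ 2) / nm s ^+ 3.
    by field; rewrite gt_eqF.
  by rewrite XX -expr2.
have h2 : (nm s ^+ 3)^-1 <= 13 * 13 * 13 * p ^+ 2.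
  rewrite pp; have -> : 13 * 13 * 13 * ((`|t| + 3) ^+ 3)^-1 = (((`|t| + 3) / 13) ^+ 3)^-1.
    by field; rewrite gt_eqF.
  have q : 0 < ((`|t| + 3) / 13) ^+ 3 by rewrite exprn_gt0// divr_gt0.
  have q' : ((`|t| + 3) / 13) ^+ 3 <= nm s ^+ 3.
    by rewrite ler_pXn2r ?nnegrE ?nm_ge0// divr_ge0// ltW.
  by rewrite lef_pV2 ?posrE// (lt_le_trans q q').
apply: (le_trans h1).
have k0 : 0 <= 8 * (E * E) * r ^+ 2 by rewrite !mulr_ge0 ?exprn_ge0 ?(ltW E0) ?(ltW r0).
apply: le_trans (ler_wpM2l k0 h2) _.
have k1 : 0 <= E * E * r ^+ 2 * p ^+ 2 by rewrite !mulr_ge0 ?exprn_ge0 ?(ltW E0) ?(ltW r0) ?(ltW p0).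
have -> : 8 * (E * E) * r ^+ 2 * (13 * 13 * 13 * p ^+ 2) = (8 * 13 * 13 * 13) * (E * E * r ^+ 2 * p ^+ 2) by ring.
have -> : (144 * E * r * p) ^+ 2 = (144 * 144) * (E * E * r ^+ 2 * p ^+ 2) by ring.
rewrite ler_wpM2r//; lra.
Qed.

Lemma hol_KK s : 0 < Re s -> hol (KK x h) s.
Proof.
move=> s0; have [sn sn1] := Re_pos_neq0 s0.
have h1 y : hol (fun s => cpow y (s + 1)) s.
  by apply: hol_comp; [apply: holD; [exact: hol_id|exact: hol_cst]|exact: hol_cpow].
apply: hol_div.
- by apply: holB.
- apply: holM; first exact: hol_cst.
  by apply: holM; [exact: hol_id|apply: holD; [exact: hol_id|exact: hol_cst]].
- by rewrite !mulf_neq0// -nm_gt0 hn.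
Qed.

Lemma KK_one : KK x h 1 = (x + h / 2)%:C.
Proof.
have [hn0 _] := kern_h.
rewrite /KK !cpowD !cpow1//.
have -> : (x + h)%:C * (x + h)%:C - x%:C * x%:C = (h * (2 * x + h))%:C :> C by apply: ceqP => /=; ring.
have -> : h%:C * (1 * (1 + 1)) = (h * 2)%:C :> C by apply: ceqP => /=; ring.
by rewrite -fmorphV -rmorphM; congr (_%:C); field.
Qed.
End Kernel.

(** * Contour integrals of finite sums *)

Section Lists.
Variable R : realType.
Local Notation C := R[i].
Local Notation nm := (@nm R).
Implicit Types (s z w rho : C) (f g : C -> C).

Lemma rint_list (l : seq C) (F : C -> C -> C) (v : C -> C) a b c d : a <= b -> c <= d ->
  (forall rho, rho \in l -> bdcont (F rho) a b c d /\ rint (F rho) a b c d = v rho) ->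
  bdcont (fun s => \sum_(rho <- l) F rho s) a b c d /\
  rint (fun s => \sum_(rho <- l) F rho s) a b c d = \sum_(rho <- l) v rho.
Proof.
move=> ab cd; elim: l => [|p l ih] H.
  under eq_fun do rewrite big_nil; rewrite big_nil; split; first by move=> s _; exact/hol_cont/hol_cst.
  rewrite -[RHS](rint_affine 0 0 ab cd); apply: rint_ext => // s _; by rewrite mul0r addr0.
have [c1 r1] := H p (mem_head _ _).
have [|c2 r2] := ih; first by move=> q hq; apply: H; rewrite in_cons hq orbT.
under eq_fun do rewrite big_cons; rewrite big_cons -r1 -r2; split; last exact: rintD.
by move=> s hs; apply: ccontD; [exact: c1|exact: c2].
Qed.

Definition vline sg f (t : R) : C := f (sg +i* t).

Lemma vline_cont sg f a b : (forall t, hol f (sg +i* t)) -> ccont (vline sg f) a b.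
Proof. by move=> H; apply: contV_ccont => t _; exact: hol_cont. Qed.

Lemma vint_sum (I : Type) (q : seq I) (F : I -> C -> C) (k : I -> C) (sg a b : R) : a <= b ->
  (forall i t, hol (F i) (sg +i* t)) ->
  cint (vline sg (fun s => \sum_(i <- q) k i * F i s)) a b = \sum_(i <- q) k i * cint (vline sg (F i)) a b.
Proof.
move=> ab H; elim: q => [|i q ih].
  by rewrite big_nil /vline; under eq_fun do rewrite big_nil; rewrite cint_cst// mul0r.
rewrite big_cons -ih /vline; under eq_fun do rewrite big_cons.
have c1 : ccont (vline sg (F i)) a b by apply: vline_cont; exact: H.
have c2 : ccont (vline sg (fun s => k i * F i s)) a b.
  by apply: vline_cont => t; apply: holM; [exact: hol_cst|exact: H].
have c3 : ccont (vline sg (fun s => \sum_(j <- q) k j * F j s)) a b.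
  by apply: vline_cont => t; apply: hol_sum => j; apply: holM; [exact: hol_cst|exact: H].
by rewrite (cintD ab c2 c3) (cintZ _ ab c1).
Qed.

Lemma vintD f g sg a b : a <= b -> (forall t, hol f (sg +i* t)) -> (forall t, hol g (sg +i* t)) ->
  cint (vline sg (fun s => f s + g s)) a b = cint (vline sg f) a b + cint (vline sg g) a b.
Proof. by move=> ab hf hg; apply: cintD => //; exact: vline_cont. Qed.

Lemma vintB f g sg a b : a <= b -> (forall t, hol f (sg +i* t)) -> (forall t, hol g (sg +i* t)) ->
  cint (vline sg (fun s => f s - g s)) a b = cint (vline sg f) a b - cint (vline sg g) a b.
Proof.
move=> ab hf hg; rewrite vintD//; last by move=> t; exact: holN.
congr (_ + _); rewrite -mulN1r -cintZ//; last exact: vline_cont.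
by apply: cint_ext => // t _; rewrite mulN1r.
Qed.
End Lists.

(** * Residues and the Dirichlet series side *)

Section Explicit.
Variable R : realType.
Local Notation C := R[i].
Local Notation nm := (@nm R).
Local Notation Y := (@Y R).
Local Notation Lam := (@vonMangoldt R).
Implicit Types (s z w rho : C) (l : seq C) (f g : C -> C) (T : R).

Hypothesis RH : riemann_hypothesis R.
Variables (r x h : R).
Hypotheses (r2 : 2 <= r) (xr : x = r ^+ 2) (hr : `|h| = r).

Let r0 : 0 < r. Proof. by apply: lt_le_trans r2; rewrite ltr0n. Qed.
Let x0 : 0 < x. Proof. by rewrite xr exprn_gt0. Qed.
Let y0 : 0 < x + h. Proof. by have [_ [_ h1]] := kern_y r2 xr hr; apply: lt_le_trans h1; rewrite ltr0n. Qed.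
Let hn0 : h != 0. Proof. by case: (kern_h r2 hr). Qed.

Local Notation KK := (@KK R x h).
(** The second factor is [- zeta' / zeta], because [Y s = (s - 1) * zeta s]. *)
Definition integrand s := KK s * ((s - 1)^-1 - der Y s / Y s).

Let hKK s : 0 < Re s -> hol KK s. Proof. exact: (hol_KK x r2 hr). Qed.

Lemma der_hol_pos g s : (forall z, 0 < Re z -> hol g z) -> 0 < Re s -> hol (der g) s.
Proof. by move=> hg s0; apply: (der_hol s0) => z hz; apply: hg; exact: Re_ball hz. Qed.

Lemma hol_integrand s : 0 < Re s -> s != 1 -> Y s != 0 -> hol integrand s.
Proof.
move=> s0 s1 Ys; apply: holM; first exact: hKK.
apply: holB; first by apply: holV; [rewrite subr_eq0|exact: hol_subC].
by apply: hol_div => //; [apply: der_hol_pos => // z; exact: hol_Y|exact: hol_Y].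
Qed.

(** By [ld_fact] the integrand is a finite sum of simple poles plus [KK * g' / g]. Cauchy's formula
    evaluates each pole, and the last term is holomorphic since [g] has no zeros in the
    rectangle. *)
Lemma rect_part T l g : 1 <= T -> full 0 T l g ->
  (forall s, 1 / 4 <= Re s <= 2 -> `|Im s| = T -> Y s != 0) ->
  bdcont integrand (1 / 4) 2 (- T) T /\
  rint integrand (1 / 4) 2 (- T) T = twopii R * (KK 1 - \sum_(rho <- l) KK rho).
Proof.
move=> T1 fl HY; have fg : fact l g by case: fl.
have T0 : 0 < T by apply: lt_le_trans T1.
have ab : 1 / 4 <= 2 :> R by lra.
have cd : - T <= T by lra.
have pos s : inrect (1 / 4) 2 (- T) T s -> 0 < Re s.
  by move=> /andP[/andP[h1 _] _]; apply: lt_le_trans h1; lra.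
have bY s : onbd (1 / 4) 2 (- T) T s -> Y s != 0.
  move=> hs; have := pos _ (onbd_in hs); move: hs => /andP[/andP[/andP[h1 h2] /andP[h3 h4]] hs] s0.
  have re : Re s != 1 / 2 -> Y s != 0.
    by move=> ne; apply/eqP => /(rh_zeros RH s0)/eqP; apply/negP.
  case/or4P: hs => /eqP sE.
  - by apply: re; rewrite sE; apply/eqP; lra.
  - by apply: re; rewrite sE; apply/eqP; lra.
  - by apply: HY; rewrite ?h1// sE normrN gtr0_norm.
  - by apply: HY; rewrite ?h1// sE gtr0_norm.
have in1 : 1 / 4 < Re (1 : C) < 2 /\ - T < Im (1 : C) < T by rewrite /=; split; lra.
have inl rho : rho \in l -> 1 / 4 < Re rho < 2 /\ - T < Im rho < T.
  move=> hr'; have [q1 q2 q3] := full_zero RH fl hr'; split; first by rewrite q1; lra.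
  rewrite subr0 in q2; rewrite -ltr_norml lt_neqAle q2 andbT; apply/eqP => E.
  by have := HY rho; rewrite q1 E q3 eqxx => H; have := H _ erefl; rewrite (_ : 1 / 4 <= 1 / 2 <= 2) => [/(_ isT)|]; lra.
have n1 s : onbd (1 / 4) 2 (- T) T s -> s != 1 by exact: bd_neq in1.1 in1.2.
have nl s rho : rho \in l -> onbd (1 / 4) 2 (- T) T s -> s != rho.
  by move=> /inl[i1 i2]; exact: bd_neq.
have bd : bdcont integrand (1 / 4) 2 (- T) T.
  by move=> s hs; apply/hol_cont/hol_integrand; [exact/pos/onbd_in|exact: n1|exact: bY].
split => //.
have hK1 z : inrect (1 / 4) 2 (- T) T z -> hol KK z by move=> /pos; exact: hKK.
have C1 := cauchy in1.1 in1.2 hK1.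
have CL rho : rho \in l -> bdcont (fun z => KK z / (z - rho)) (1 / 4) 2 (- T) T /\
    rint (fun z => KK z / (z - rho)) (1 / 4) 2 (- T) T = twopii R * KK rho.
  move=> hr'; split; last by have [i1 i2] := inl _ hr'; exact: cauchy i1 i2 hK1.
  move=> s hs; apply/hol_cont/hol_div; [exact/hKK/pos/onbd_in|exact: hol_subC|].
  by rewrite subr_eq0; exact: nl.
have [bL rL] := rint_list ab cd CL.
pose G z := KK z * (der g z / g z).
have hG z : inrect (1 / 4) 2 (- T) T z -> hol G z.
  move=> hz; have z0 := pos z hz; apply: holM; first exact: hKK.
  have hg w : 0 < Re w -> hol g w by case: fg => hh _; exact: hh.
  apply: hol_div; [exact: der_hol_pos|exact: hg|].
  move: hz => /andP[/andP[z1 z2] z3]; apply: (full_neq0 RH fl); first by rewrite z0; lra.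
  by rewrite subr0 ler_norml.
have ab' : 1 / 4 < 2 :> R by lra.
have cd' : - T < T by lra.
have rG : rint G (1 / 4) 2 (- T) T = 0 by exact: goursat.
have bG : bdcont G (1 / 4) 2 (- T) T by move=> s hs; exact/hol_cont/hG/onbd_in.
pose LS z := \sum_(rho <- l) KK z / (z - rho).
have b1 : bdcont (fun z => KK z / (z - 1)) (1 / 4) 2 (- T) T.
  move=> s hs; apply/hol_cont/hol_div; [exact/hKK/pos/onbd_in|exact: hol_subC|].
  by rewrite subr_eq0; exact: n1.
have bS : bdcont (fun z => LS z + G z) (1 / 4) 2 (- T) T.
  by move=> s hs; apply: ccontD; [exact: bL|exact: bG].
have bS' : bdcont (fun z => -1 * (LS z + G z)) (1 / 4) 2 (- T) T.
  move=> s hs; have := ccontM (bS s hs) (hol_cst (-1) s).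
  by under eq_fun do rewrite mulrC.
have -> : rint integrand (1 / 4) 2 (- T) T =
    rint (fun z => KK z / (z - 1) + -1 * (LS z + G z)) (1 / 4) 2 (- T) T.
  apply: rint_ext => // s hs; rewrite /integrand /LS /G (ld_fact fg); [|exact/pos/onbd_in|exact: bY].
  by rewrite -big_distrr /=; ring.
rewrite rintD// rintZ// rintD// C1 rL rG addr0 -big_distrr /=; ring.
Qed.

(** The smoothed indicator of [k <= x]: 1 below both [x] and [x + h], 0 above both, linear in
    between. *)
Definition kk (k : nat) : R := (Num.max (x + h - k%:R) 0 - Num.max (x - k%:R) 0) / h.

Lemma KK_Phi k s : (0 < k)%N -> 0 < Re s -> KK s * ((Lam k)%:C * npow k s) =
  (Lam k * (k%:R / h))%:C * (Phi ((x + h) / k%:R) s - Phi (x / k%:R) s).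
Proof.
move=> k0 s0; have [sn sn1] := Re_pos_neq0 s0.
have kn : 0 < k%:R :> R by rewrite ltr0n.
have P (z : R) : 0 < z -> cpow (z / k%:R) (s + 1) * k%:R = cpow z (s + 1) * npow k s.
  move=> z0; rewrite /cpow ln_div ?posrE// rmorphB mulrBr cexpD /npow -mulrA; congr (_ * _).
  have -> : k%:R = cexp (ln k%:R)%:C :> C by rewrite cexp_real lnK// rmorph_nat.
  by rewrite -cexpD; congr cexp; ring.
have hC : h%:C != 0 :> C by rewrite -nm_gt0 nm_real (kern_h r2 hr).2.
have -> : (Lam k * (k%:R / h))%:C = (Lam k)%:C * (k%:R / h%:C) :> C.
  by rewrite !rmorphM fmorphV rmorph_nat.
rewrite /Phi KKdef.
have P1 := P _ y0; have P2 := P _ x0.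
set u := cpow ((x + h) / _) _ in P1 *; set v := cpow (x / _) _ in P2 *.
have -> : (Lam k)%:C * (k%:R / h%:C) * (u / (s * (s + 1)) - v / (s * (s + 1))) =
   (Lam k)%:C * (u * k%:R - v * k%:R) / (h%:C * (s * (s + 1))).
  by move: hC; set b := h%:C => hC; field; rewrite hC sn sn1.
by rewrite P1 P2; ring.
Qed.

Lemma kk_max k : (0 < k)%N ->
  k%:R / h * (Num.max ((x + h) / k%:R - 1) 0 - Num.max (x / k%:R - 1) 0) = kk k.
Proof.
move=> k0; have kn : 0 < k%:R :> R by rewrite ltr0n.
have P (z : R) : k%:R * Num.max (z / k%:R - 1) 0 = Num.max (z - k%:R) 0.
  rewrite maxr_pMr ?(ltW kn)// mulr0 mulrBr mulr1; congr (Num.max (_ - _) _).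
  by rewrite mulrC divfK// gt_eqF.
by rewrite /kk -!P; field.
Qed.

(** The series is truncated after [T] is fixed, with an error uniform on the segment; then [perron]
    is applied to each remaining term. Each of the two errors is at most 1. *)
Lemma series_part T n0 : 2 <= T -> 1296 * r ^+ 5 <= T -> exists2 N, (n0 <= N)%N &
  nm ('i * cint (vline 2 integrand) (- T) T - twopii R * (\sum_(1 <= k < N) Lam k * kk k)%:C) <= 2.
Proof.
move=> T2 Tr; have T0 : 0 < T by apply: lt_le_trans T2.
have cd : - T <= T by lra.
set E := expR 3 : R; have E0 : 0 < E by exact: expR_gt0.
have r5 : 0 < r ^+ 5 by rewrite exprn_gt0.
(* The truncation error [8 * del] times the kernel bound [E * r ^+ 5] is [1 / (4 T)], which
   integrates to at most 1 over a segment of length [2 T]. *)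
pose del := (32 * E * r ^+ 5 * T)^-1.
have del0 : 0 < del by rewrite invr_gt0 !mulr_gt0.
have half : 0 < 1 / 2 :> R by lra.
have [N0 HN0] := pw_small half del0.
pose n := (maxn N0 n0).+1.
have nN : (N0 <= n)%N by rewrite /n leqW// leq_maxl.
exists n.+1; first by rewrite /n !leqW// leq_maxr.
have pos t : 0 < Re (2 +i* t : C) by rewrite /=; lra.
have ne1 t : 2 +i* t != 1 :> C by apply/eqP => /(congr1 (@complex.Re R)) /=; lra.
have Yn t : Y (2 +i* t) != 0 by rewrite -nm_gt0; apply: lt_le_trans (Y_lower _); rewrite /=; lra.
have hI t : hol integrand (2 +i* t) by exact: hol_integrand.
pose S s := KK s * LamN n.+1 s.
have hS t : hol S (2 +i* t).
  apply: holM; first exact: hKK.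
  by apply: hol_sum => k; apply: holM; [exact: hol_cst|exact: hol_npow].
have KB t : nm (KK (2 +i* t)) <= E * r ^+ 5.
  have s2 : 0 < Re (2 +i* t : C) <= 2 by rewrite /=; lra.
  apply: le_trans (KK_bound2 r2 xr hr s2) _; rewrite -/E.
  have -> : expR (Re (2 +i* t : C) * ln x) = r ^+ 4 by rewrite /= expRM_natl lnK// xr -exprM.
  have n2 : 2 <= nm (2 +i* t) by apply: le_trans (Re_le_nm _); rewrite /= ger0_norm.
  have n4 : 2 <= nm (2 +i* t) ^+ 2.
    by have := ler_pM (ler0n R 2) (ler0n R 2) n2 n2; rewrite -[X in _ <= X]expr2; lra.
  rewrite ler_pdivrMr; last by apply: lt_le_trans n4; rewrite ltr0n.
  have -> : 2 * E * r * r ^+ 4 = E * r ^+ 5 * 2 by ring.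
  by rewrite ler_wpM2l// mulr_ge0// ltW.
have D1 : nm ('i * cint (vline 2 (fun s => integrand s - S s)) (- T) T) <= 1.
  rewrite (nmM 'i) nm_i mul1r.
  apply: (@le_trans _ _ (2 * (4 * T)^-1 * (T - - T))); last first.
    by rewrite le_eqVlt; apply/orP; left; apply/eqP; field; rewrite gt_eqF.
  apply: cint_bound => //; first by apply: vline_cont => t; exact: holB.
  move=> t _; rewrite /vline; have s1 : 1 < Re (2 +i* t : C) by rewrite /=; lra.
  have [L [HL EL]] := log_deriv_Y s1.
  have -> : integrand (2 +i* t) - S (2 +i* t) = KK (2 +i* t) * (L - LamN n.+1 (2 +i* t)).
    rewrite /integrand EL [RHS]mulrBr; congr (_ - _); congr (_ * _).
    by rewrite [_ * (_ - L)]mulrC mulfK//; ring.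
  have hL : nm (L - LamN n.+1 (2 +i* t)) <= 8 * del.
    apply: le_trans (HL n isT) _; rewrite (_ : (Re (2 +i* t : C) - 1) / 2 = 1 / 2); last by rewrite /=; field.
    have := HN0 n nN; move: (pw n (1 / 2)) (del) => p d pd.
    have -> : 2 * ((1 / 2)^-1 * (p / (1 / 2))) = 8 * p by field.
    by rewrite ler_wpM2l.
  rewrite nmM; apply: le_trans (ler_pM (nm_ge0 _) (nm_ge0 _) (KB t) hL) _.
  rewrite le_eqVlt; apply/orP; left; apply/eqP; rewrite /del.
  by field; rewrite !gt_eqF.
have SE : cint (vline 2 S) (- T) T = \sum_(1 <= k < n.+1) (Lam k * (k%:R / h))%:C *
    cint (vline 2 (fun s => Phi ((x + h) / k%:R) s - Phi (x / k%:R) s)) (- T) T.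
  rewrite -vint_sum//.
    apply: cint_ext => // t _; rewrite /vline /S /LamN big_distrr /=.
    by apply: eq_big_nat => k /andP[k0 _]; exact: KK_Phi.
  by move=> k t; have [p1 p2] := Re_pos_neq0 (pos t); apply: holB; exact: hol_Phi.
have D2 : nm ('i * cint (vline 2 S) (- T) T - twopii R * (\sum_(1 <= k < n.+1) Lam k * kk k)%:C) <= 1.
  (* Two applications of [perron] give [24 * (8 + 1) = 216], and [Lam k <= 2 k^(1/2)] doubles it.
     The sum of [k^(-3/2)] is at most 3, and [3 * 432 = 1296]. *)
  pose B k : R := 432 * r ^+ 5 / T * pw k (1 / 2 + 1).
  rewrite SE rmorph_sum !big_distrr -sumrB /=; apply: le_trans (nm_sum _ _ _) _.
  apply: (@le_trans _ _ (\sum_(1 <= k < n.+1) B k)); last first.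
    rewrite -big_distrr /=; have := pw_sum n.+1 half; rewrite invf_div divr1 => h3.
    have q0 : 0 <= 432 * r ^+ 5 / T by exact: divr_ge0 (mulr_ge0 (ler0n _ _) (ltW r5)) (ltW T0).
    apply: le_trans (ler_wpM2l q0 h3) _.
    by rewrite mulrAC ler_pdivrMr//; lra.
  apply: ler_sum_nat => k /andP[k0 _]; have kn : 0 < k%:R :> R by rewrite ltr0n.
  rewrite -(kk_max k0) vintB//; try by move=> t; have [p1 p2] := Re_pos_neq0 (pos t); exact: hol_Phi.
  have a1 : 0 < (x + h) / k%:R by rewrite divr_gt0.
  have a2 : 0 < x / k%:R by rewrite divr_gt0.
  have := perron a1 T2; have := perron a2 T2.
  rewrite -/(vline 2 (Phi (x / k%:R))) -/(vline 2 (Phi ((x + h) / k%:R))).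
  set I2 := cint _ _ _; set m2 := Num.max _ _ => p2.
  set I1 := cint _ _ _; set m1 := Num.max _ _ => p1.
  have -> : 'i * ((Lam k * (k%:R / h))%:C * (I1 - I2)) - twopii R * (Lam k * (k%:R / h * (m1 - m2)))%:C =
    (Lam k * (k%:R / h))%:C * (('i * I1 - twopii R * m1%:C) - ('i * I2 - twopii R * m2%:C)).
    by rewrite [Lam k * (_ * (_ - _))]mulrA [(Lam k * _ * (m1 - m2))%:C]rmorphM rmorphB; ring.
  rewrite nmM nm_real normrM (ger0_norm (Lam_ge0 _ _)) normrM normfV hr (ger0_norm (ltW kn)).
  have xx : ((x + h) / k%:R) ^+ 3 <= 8 * (x ^+ 3 * k%:R^-1 ^+ 3).
    rewrite exprMn mulrA ler_wpM2r ?exprn_ge0 ?invr_ge0 ?(ltW kn)//.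
    have [_ [y2 _]] := kern_y r2 xr hr.
    have -> : 8 * x ^+ 3 = (2 * x) ^+ 3 by ring.
    by rewrite ler_pXn2r ?nnegrE// ?mulr_ge0// ltW.
  have nB : nm (('i * I1 - twopii R * m1%:C) - ('i * I2 - twopii R * m2%:C)) <= 216 * (x ^+ 3 * k%:R^-1 ^+ 3) / T.
    apply: le_trans (nmB _ _) _.
    apply: (@le_trans _ _ (24 * (((x + h) / k%:R) ^+ 3 / T) + 24 * ((x / k%:R) ^+ 3 / T))); first by rewrite lerD.
    have := ler_wpM2r (ltW (_ : 0 < T^-1)) xx; rewrite invr_gt0 => /(_ T0).
    rewrite [(x / _) ^+ 3]exprMn; set a := _ / T; set b := x ^+ 3 * _; move=> hb.
    by move: hb; lra.
  have q2 : 0 <= Lam k * (k%:R / r) by exact: mulr_ge0 (Lam_ge0 _ _) (divr_ge0 (ltW kn) (ltW r0)).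
  apply: le_trans (ler_wpM2l q2 nB) _.
  have lk : Lam k <= 2 * pw k (- (1 / 2)).
    apply: le_trans (Lam_le_ln _ _) _; apply: le_trans (ln_pw_le half k0) _; by rewrite invf_div divr1.
  have pk : pw k (1 / 2 + 1) = pw k (- (1 / 2)) * k%:R^-1 ^+ 2 :> R.
    by rewrite -(pw11 _ k0) expr2 -!pwD; congr pw; field.
  have -> : Lam k * (k%:R / r) * (216 * (x ^+ 3 * k%:R^-1 ^+ 3) / T) = 216 * r ^+ 5 / T * k%:R^-1 ^+ 2 * Lam k.
    by rewrite xr; field; rewrite !gt_eqF.
  rewrite /B pk.
  have q1 : 0 <= 216 * r ^+ 5 / T * k%:R^-1 ^+ 2.
    apply: mulr_ge0; first exact: divr_ge0 (mulr_ge0 (ler0n _ _) (ltW r5)) (ltW T0).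
    by rewrite exprn_ge0// invr_ge0 ltW.
  apply: le_trans (ler_wpM2l q1 lk) _; rewrite le_eqVlt; apply/orP; left; apply/eqP; ring.
have IE : cint (vline 2 integrand) (- T) T =
    cint (vline 2 (fun s => integrand s - S s)) (- T) T + cint (vline 2 S) (- T) T.
  by rewrite vintB// subrK.
rewrite IE mulrDr -addrA; apply: le_trans (nmD _ _) _; lra.
Qed.
End Explicit.

(** * From the contour to psi *)

Section PsiExplicit.
Variable R : realType.
Local Notation C := R[i].
Local Notation nm := (@nm R).
Local Notation Y := (@Y R).
Local Notation Lam := (@vonMangoldt R).
Implicit Types (s z w rho : C) (l : seq C) (f g : C -> C) (T r x h : R).

Lemma sqr_ln_le T : 1 <= T -> ln (T + 3) ^+ 2 <= 16 * T.
Proof.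
move=> T1; have z0 : 0 < T + 3 by lra.
have s0 : 0 < Num.sqrt (T + 3) by rewrite sqrtr_gt0.
have zE : T + 3 = Num.sqrt (T + 3) ^+ 2 by rewrite sqr_sqrtr// ltW.
have h : ln (T + 3) <= 2 * Num.sqrt (T + 3).
  have -> : ln (T + 3) = ln (Num.sqrt (T + 3)) *+ 2 by rewrite {1}zE lnXn.
  by have := ln_sublinear s0; rewrite mulr2n; lra.
have l0 : 0 <= ln (T + 3) by rewrite ln_ge0; lra.
have : ln (T + 3) ^+ 2 <= (2 * Num.sqrt (T + 3)) ^+ 2.
  by rewrite ler_pXn2r ?nnegrE// mulr_ge0// ltW.
rewrite exprMn -zE (_ : 2 ^+ 2 = 4 :> R); last by rewrite expr2; ring.
by move=> h2; apply: le_trans h2 _; lra.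
Qed.

Hypothesis RH : riemann_hypothesis R.

(** The truncated series costs 2, the horizontal edges cost 1 for a good height, and the edge
    [Re s = 1 / 4] costs a multiple of [r = x^(1/2)]. The heights and lengths [T] and [N] may be
    taken arbitrarily large, with no loss in [K]. *)
Lemma explicit : exists2 K, 0 < K & forall r x h T0 n0, 2 <= r -> x = r ^+ 2 -> `|h| = r ->
  exists T l g N, [/\ T0 <= T, full 0 T l g, (n0 <= N)%N &
    nm ((\sum_(1 <= k < N) Lam k * kk x h k)%:C - (x + h / 2)%:C + \sum_(rho <- l) KK x h rho) <= K * r].
Proof.
have [K1 K10 HL] := ld_left RH.
have [K2 K20 HH] := good_height RH.
pose E := expR 3 : R; have E0 : 0 < E by exact: expR_gt0.
pose A := 144 * E * (2 + K1).
have A0 : 0 < A by rewrite !mulr_gt0//; lra.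
exists (3 + 32 * A); first lra.
move=> r x h T0 n0 r2 xr hr.
have r0 : 0 < r by lra.
have x0 : 0 < x by rewrite xr exprn_gt0.
have r5 : 0 < r ^+ 5 by rewrite exprn_gt0.
have [B [BE B0]] : exists B, (forall u, 14 * E * r ^+ 5 * ((1 + 16 * K2) * u) = B * u) /\ 0 < B.
  exists (14 * E * r ^+ 5 * (1 + 16 * K2)); split; first by move=> u; rewrite mulrA.
  by rewrite !mulr_gt0//; lra.
(* [1296 * r ^+ 5] is demanded by [series_part], and [B] makes the horizontal edges contribute at
   most 1. *)
have t0 : 0 <= `|T0| + 1296 * r ^+ 5 + B + 2.
  by have := normr_ge0 T0; move: r5 B0; move: (r ^+ 5) => q; lra.
have [T /andP[hT _] HT] := HH _ t0.
have [T2 TB Tr TT0] : [/\ 2 <= T, B <= T, 1296 * r ^+ 5 <= T & T0 <= T].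
  have n1 := ler_norm T0; have n2 := normr_ge0 T0; clear -RH n1 n2 r5 B0 hT.
  by move: (r ^+ 5) r5 hT => q r5 hT; split; lra.
clear hT t0.
have T00 : 0 < T by exact: lt_le_trans (ltr0n R 2) T2.
have [l [g [f1 f2 f3]]] := full_fact 0 T00.
have fl : full 0 T l g by [].
have T1 : 1 <= T by clear -RH T2; lra.
have HY s : 1 / 4 <= Re s <= 2 -> `|Im s| = T -> Y s != 0 by move=> a b; have [] := HT s a b.
have [bd rE] := rect_part RH x r2 hr T1 fl HY.
have [N hN hS] := series_part r2 xr hr n0 T2 Tr.
exists T, l, g, N; split => //; clear Tr TT0.
set f := integrand x h in bd rE hS.
have ab : 1 / 4 <= 2 :> R by lra.
have cd : - T <= T by lra.
have [_ _ bdL _] := bdcontE ab cd bd.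
pose M := 2 * E * r ^+ 5 / T ^+ 2 * (1 + K2 * ln (T + 3) ^+ 2).
have hM s : 1 / 4 <= Re s <= 2 -> `|Im s| = T -> nm (f s) <= M.
  move=> s1 s2; have [Ys ld] := HT s s1 s2.
  have s0 : 0 < Re s <= 2 by case/andP: s1 => q1 q2; rewrite q2 andbT; clear -RH q1; lra.
  rewrite /f /integrand (nmM (KK x h s)).
  have Tn : T <= nm s by rewrite -s2; exact: Im_le_nm.
  have Tn1 : 1 <= nm (s - 1).
    by apply: le_trans (Im_le_nm _); rewrite ImD ImN /= subr0 s2.
  have h1 : nm (KK x h s) <= 2 * E * r ^+ 5 / T ^+ 2.
    apply: le_trans (KK_bound2 r2 xr hr s0) _.
    have e4 : expR (Re s * ln x) <= r ^+ 4.
      have -> : r ^+ 4 = expR (2 * ln x) by rewrite expRM_natl lnK// xr -exprM.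
      rewrite ler_expR ler_wpM2r//; last by case/andP: s0.
      by rewrite xr lnXn// mulrn_wge0// ln_ge0//; clear -RH r2; lra.
    apply: ler_pM.
    - by rewrite !mulr_ge0 ?expR_ge0// ltW.
    - by rewrite invr_ge0 exprn_ge0 ?nm_ge0.
    - have -> : 2 * E * r ^+ 5 = 2 * E * r * r ^+ 4 by ring.
      by rewrite ler_wpM2l// !mulr_ge0// ltW.
    - rewrite lef_pV2 ?posrE ?exprn_gt0 ?(lt_le_trans T00 Tn)//.
      by rewrite ler_pXn2r ?nnegrE ?nm_ge0// ltW.
  have h2 : nm ((s - 1)^-1 - der Y s / Y s) <= 1 + K2 * ln (T + 3) ^+ 2.
    apply: le_trans (nmB _ _) _; apply: lerD => //.
    by rewrite nmV invf_le1// (lt_le_trans _ Tn1).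
  by apply: ler_pM; rewrite ?nm_ge0.
have M7 : 4 * M * (2 - 1 / 4) <= 1.
  have -> : 4 * M * (2 - 1 / 4) = 14 * E * r ^+ 5 * (1 + K2 * ln (T + 3) ^+ 2) / T ^+ 2.
    by rewrite /M; field; rewrite gt_eqF.
  rewrite ler_pdivrMr ?exprn_gt0// mul1r.
  have h1 : 1 + K2 * ln (T + 3) ^+ 2 <= (1 + 16 * K2) * T.
    have hK := ler_wpM2l (ltW K20) (sqr_ln_le T1); clear -RH hK T1; lra.
  apply: (@le_trans _ _ (B * T)); last by rewrite expr2 ler_wpM2r// ltW.
  rewrite -BE ler_wpM2l// !mulr_ge0// ltW//.
have D1 := two_edges ab cd bd (M := M).
have {}D1 : nm ('i * cint (vline 2 f) (- T) T - 'i * cint (vline (1 / 4) f) (- T) T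
    - rint f (1 / 4) 2 (- T) T) <= 1.
  apply: le_trans M7; apply: D1 => u hu.
  by split; apply: hM => //=; rewrite ?normrN gtr0_norm.
have D2 : nm (cint (vline (1 / 4) f) (- T) T) <= 32 * (A * r).
  apply: (left_int (mulr_ge0 (ltW A0) (ltW r0)) (ltW T00) (contV_ccont bdL)).
  move=> t _; rewrite /vline /f /integrand (nmM (KK _ _ _)).
  have h1 := KK_left r2 xr hr t; have h2 := HL t.
  have h3 : nm (((1 / 4) +i* t - 1)^-1) <= 2 * ln (`|t| + 3).
    have : 3 / 4 <= nm ((1 / 4) +i* t - 1).
      by apply: le_trans (Re_le_nm _); rewrite ReD ReN /= ler_normr; apply/orP; right; lra.
    have := ln3_ge t => h4 h5; rewrite nmV; apply: (@le_trans _ _ (3 / 4)^-1).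
      by rewrite lef_pV2 ?posrE//; lra.
    by rewrite invf_div; lra.
  have h4 := le_trans (nmB _ _) (lerD h3 h2).
  apply: le_trans (ler_pM (nm_ge0 _) (nm_ge0 _) h1 h4) _.
  by rewrite le_eqVlt; apply/orP; left; apply/eqP; rewrite /A /E /decay; ring.
rewrite -(KK_one r2 xr hr).
set Z := (\sum_(1 <= k < N) _)%:C in hS *.
set S := \sum_(rho <- l) _ in rE *.
have D3 : nm (twopii R * (Z - KK x h 1 + S)) <= 3 + 32 * (A * r).
  have -> : twopii R * (Z - KK x h 1 + S) =
    - ('i * cint (vline 2 f) (- T) T - twopii R * Z) +
    ('i * cint (vline 2 f) (- T) T - 'i * cint (vline (1 / 4) f) (- T) T - rint f (1 / 4) 2 (- T) T)
    + 'i * cint (vline (1 / 4) f) (- T) T by rewrite rE; ring.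
  apply: le_trans (nmD _ _) _; apply: lerD; last by rewrite (nmM 'i) nm_i mul1r.
  apply: le_trans (nmD _ _) _; rewrite nmN; lra.
have : nm (Z - KK x h 1 + S) <= nm (twopii R * (Z - KK x h 1 + S)).
  by rewrite nmM ler_peMl ?nm_ge0// nm_twopii.
move=> h1; apply: le_trans h1 (le_trans D3 _); lra.
Qed.

(** Since [Lam >= 0], the weights for [h = r] majorise the indicator of [k <= x] and those for
    [h = - r] minorise it. The main term [x + h / 2] differs from [x] by [r / 2], absorbed in the
    constant. *)
Lemma psi_explicit : exists2 K, 0 < K & forall r x T0 B, 2 <= r -> x = r ^+ 2 ->
  (forall h T l g, `|h| = r -> T0 <= T -> full 0 T l g -> nm (\sum_(rho <- l) KK x h rho) <= B) ->
  `|psi_remainder x| <= K * r + B.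
Proof.
have [K K0 HK] := explicit.
exists (K + 1); first lra.
move=> r x T0 B r2 xr HB.
have r0 : 0 < r by lra.
have x0 : 0 < x by rewrite xr exprn_gt0.
pose n0 := (Num.truncn x).+1.
have hr : `|r| = r by rewrite gtr0_norm.
have hnr : `|- r| = r by rewrite normrN.
have ReE (S a : R) (Z : C) : nm (S%:C - a%:C + Z) <= K * r -> nm Z <= B -> `|S - a| <= K * r + B.
  move=> h1 h2; have := Re_le_nm (S%:C - a%:C + Z); have := Re_le_nm Z.
  rewrite !ReD ReN /= !ler_norml; lra.
have [T [l [g [N [hT fl hN /ReE h1]]]]] := HK r x r T0 n0 r2 xr hr.
have {}h1 := h1 (HB r T l g hr hT fl).
have [T' [l' [g' [N' [hT' fl' hN' /ReE h2]]]]] := HK r x (- r) T0 n0 r2 xr hnr.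
have {}h2 := h2 (HB (- r) T' l' g' hnr hT' fl').
have small k : (k < n0)%N -> k%:R <= x.
  by move=> kn; apply: le_trans (_ : (Num.truncn x)%:R <= x); rewrite ?ler_nat// truncn_le ltW.
have large k : (n0 <= k)%N -> x < k%:R.
  by move=> kn; apply: lt_le_trans (truncnS_gt x) _; rewrite ler_nat.
have up : chebyshev_psi x <= \sum_(1 <= k < N) Lam k * kk x r k.
  rewrite (big_cat_nat (n := n0))//= /chebyshev_psi -/n0 -[leLHS]addr0; apply: lerD.
    apply: ler_sum_nat => k /andP[_ /small kx]; rewrite /kk !max_l; try lra.
    have -> : (x + r - k%:R - (x - k%:R)) / r = 1 by field; rewrite gt_eqF.
    by rewrite mulr1.
  rewrite big_nat; apply: sumr_ge0 => k /andP[/large kx _].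
  rewrite mulr_ge0 ?Lam_ge0// /kk (@max_r _ _ (x - k%:R)); last lra.
  by rewrite subr0 divr_ge0 ?(ltW r0)// le_max lexx orbT.
have low : \sum_(1 <= k < N') Lam k * kk x (- r) k <= chebyshev_psi x.
  rewrite (big_cat_nat (n := n0))//= /chebyshev_psi -/n0 -[leRHS]addr0; apply: lerD.
    apply: ler_sum_nat => k /andP[_ /small kx].
    apply: ler_piMr; first exact: Lam_ge0.
    rewrite /kk [Num.max (x - _) _]max_l; last lra.
    rewrite invrN mulrN -mulNr ler_pdivrMr// mul1r.
    by have : x + - r - k%:R <= Num.max (x + - r - k%:R) 0; [rewrite le_max lexx|lra].
  rewrite big_nat big1// => k /andP[/large kx _].
  by rewrite /kk !max_r ?subrr ?mul0r ?mulr0//; lra.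
rewrite /psi_remainder; move: h1 h2 up low; rewrite !ler_norml mulNr; lra.
Qed.
End PsiExplicit.

(** * Sums over zeros *)

Section ZeroCounts.
Variable R : realType.
Local Notation C := R[i].
Local Notation nm := (@nm R).
Local Notation Y := (@Y R).
Implicit Types (s z w rho : C) (l : seq C) (f g : C -> C) (T r x h : R).

(** The factors of the discarded zeros move into the cofactor; this lets [zero_count] apply to part
    of a list. *)
Lemma fact_filter (P : pred C) l g : fact l g -> exists g', fact (seq.filter P l) g'.
Proof.
move=> [hg E]; exists (fun z => \prod_(rho <- l | ~~ P rho) (z - rho) * g z); split.
  move=> z z0; apply: holM; last exact: hg.
  by under eq_fun do rewrite -big_filter; apply: hol_prod => rho; exact: hol_subC.
by move=> z z0; rewrite E// big_filter mulrA; congr (_ * _); exact: bigID.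
Qed.

(** Each step from [n] to [n + 1] adds only zeros within 1 of the heights [n] and [- n]. *)
Lemma zero_lt_count : exists2 K : R, 0 < K & forall T l g, full 0 T l g -> forall n : nat,
  (count (fun rho => `|Im rho| < n%:R) l)%:R <= 2 * n%:R * K * ln (n%:R + 3) :> R.
Proof.
have [K K0 HK] := zero_count (@ltr01 R).
exists K => // T l g [fg hl _]; elim=> [|n ih].
  rewrite mulr0 !mul0r (eq_count (a2 := pred0)) ?count_pred0// => rho /=.
  by apply/negbTE; rewrite -leNgt; exact: normr_ge0.
have near (t : R) : `|t| = n%:R -> (count (fun rho => `|Im rho - t| <= 1) l)%:R <= K * ln (n%:R + 3) :> R.
  move=> tn; have [g' f'] := fact_filter (fun rho => `|Im rho - t| <= 1) fg.
  rewrite -size_filter -tn; apply: HK f' _ => rho; rewrite mem_filter => /andP[h1 /hl[h2 _]]; split => //.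
have h1 := near n%:R (ger0_norm (ler0n _ _)).
have h2 := near (- n%:R) (etrans (normrN _) (ger0_norm (ler0n _ _))).
pose P0 rho := `|Im rho| < n.+1%:R; pose P1 rho := `|Im rho| < n%:R.
pose P2 rho := `|Im rho - n%:R| <= 1; pose P3 rho := `|Im rho - - n%:R| <= 1.
have le : (count P0 l <= count P1 l + (count P2 l + count P3 l))%N.
  have H rho : P0 rho -> [|| P1 rho, P2 rho | P3 rho].
    rewrite /P0 /P1 /P2 /P3 -natr1; case: (ltP `|Im rho| n%:R) => //= h' h.
    have [hp|hp] := leP 0 (Im rho).
      by rewrite (ger0_norm hp) in h h'; rewrite ler_norml; apply/orP; left; lra.
    by rewrite (ltr0_norm hp) in h h'; apply/orP; right; rewrite ler_norml; lra.
  elim: (l) => //= rho l' ih'.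
  have := H rho; case: (P0 rho); case: (P1 rho); case: (P2 rho); case: (P3 rho) => //= [] // h;
    try (by have := h isT); lia.
have {}le : (count P0 l)%:R <= (count P1 l)%:R + ((count P2 l)%:R + (count P3 l)%:R) :> R.
  by rewrite -!natrD ler_nat.
apply: (le_trans le).
apply: (@le_trans _ _ (2 * n%:R * K * ln (n%:R + 3) + (K * ln (n%:R + 3) + K * ln (n%:R + 3)))).
  by apply: lerD => //; apply: lerD.
have n0 : 0 <= n%:R :> R by [].
have L : ln (n%:R + 3) <= ln (n.+1%:R + 3) :> R by rewrite ler_ln ?posrE -?natr1; lra.
have p : 0 <= 2 * (n%:R + 1) * K by rewrite !mulr_ge0 ?(ltW K0)// addr_ge0.
have := ler_wpM2l p L; rewrite -natr1; lra.
Qed.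

Definition block (a b : R) rho := a < `|Im rho| <= b.

Lemma block_count : exists2 K : R, 0 < K & forall T l g, full 0 T l g ->
  (count (fun rho => `|Im rho| <= 1) l)%:R <= K :> R /\
  forall k : nat, (count (block (2 ^+ k) (2 ^+ k.+1)) l)%:R <= K * (2 ^+ k * (k%:R + 3)) :> R.
Proof.
have [K K0 HK] := zero_lt_count.
exists (16 * K); first lra.
move=> T l g fl.
have lnle (k : nat) : ln (2 ^+ k) <= k%:R :> R.
  rewrite lnXn// (_ : ln 2 *+ k = k%:R * ln 2); last by rewrite mulr_natl.
  rewrite ler_piMr//.
  by have := @ln_sublinear R 2; have := @le_ln1Dx R 1; rewrite (_ : 1 + 1 = 2 :> R)// => h _; apply: h; lra.
have e8 : 2 ^+ 3 = 8 :> R by rewrite -natrX.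
split.
  have h := HK _ _ _ fl 2%N; apply: (@le_trans _ _ (count (fun rho => `|Im rho| < 2%:R) l)%:R).
    by rewrite ler_nat; apply: sub_count => rho /= h1; apply: le_lt_trans h1 _; lra.
  apply: (le_trans h).
  have l5 : ln (2%:R + 3) <= 3 :> R.
apply: le_trans (lnle 3%N); rewrite ler_ln ?posrE ?exprn_gt0// ?e8; lra.
  have := ler_wpM2l (ltW K0) l5; lra.
move=> k; have h := HK _ _ _ fl (2 ^ k.+1).+1.
have P2 : 1 <= 2 ^+ k :> R by rewrite exprn_ege1//; lra.
have EN : (2 ^ k.+1).+1%:R = 2 * 2 ^+ k + 1 :> R by rewrite -natr1 natrX exprS.
apply: (@le_trans _ _ (count (fun rho => `|Im rho| < (2 ^ k.+1).+1%:R) l)%:R).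
  rewrite ler_nat; apply: sub_count => rho /andP[_ h1]; apply: le_lt_trans h1 _.
  by rewrite EN exprS; lra.
apply: (le_trans h); rewrite EN.
have l5 : ln (2 * 2 ^+ k + 1 + 3) <= k%:R + 3 :> R.
  have := lnle (k + 3)%N; rewrite natrD; apply: le_trans.
  have q : 2 * 2 ^+ k + 1 + 3 <= 2 ^+ (k + 3) :> R by rewrite exprD e8; lra.
  have q0 : 0 < 2 * 2 ^+ k + 1 + 3 :> R by lra.
  by rewrite ler_ln ?posrE ?(lt_le_trans q0 q).
have p : 0 <= 2 * (2 * 2 ^+ k + 1) * K by rewrite !mulr_ge0 ?(ltW K0)//; lra.
apply: le_trans (ler_wpM2l p l5) _.
have q : 0 <= K * (k%:R + 3) by rewrite mulr_ge0 ?(ltW K0)// addr_ge0.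
have := ler_wpM2r q P2; lra.
Qed.

Lemma dyadic_split (V : zmodType) (F : C -> V) l (a b : nat) : (a <= b)%N ->
  \sum_(rho <- l | block (2 ^+ a) (2 ^+ b) rho) F rho =
  \sum_(a <= k < b) \sum_(rho <- l | block (2 ^+ k) (2 ^+ k.+1) rho) F rho.
Proof.
elim: b => [|b ih].
  rewrite leqn0 => /eqP ->; rewrite big_geq// big_pred0// => rho.
  by rewrite /block; apply/negbTE/negP => /andP[h1 h2]; have := lt_le_trans h1 h2; rewrite ltxx.
rewrite leq_eqVlt => /orP[/eqP ->|ab].
  rewrite big_geq// big_pred0// => rho.
  by rewrite /block; apply/negbTE/negP => /andP[h1 h2]; have := lt_le_trans h1 h2; rewrite ltxx.
rewrite big_nat_recr//= -ih// (bigID (fun rho => `|Im rho| <= 2 ^+ b)) /=.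
have ge1 : 1 <= 2 :> R by rewrite ler1n.
congr (_ + _); apply: eq_bigl => rho; rewrite /block.
  have [h1|h1] := leP `|Im rho| (2 ^+ b); last by rewrite !andbF.
  by rewrite (le_trans h1 (ler_weXn2l ge1 (leqnSn b))) !andbT.
have [h1|h1] := leP `|Im rho| (2 ^+ b); first by rewrite andbF.
by rewrite (le_lt_trans (ler_weXn2l ge1 (ab : (a <= b)%N)) h1) andbT.
Qed.

Lemma block_sum (F : C -> R) l (P : pred C) (B N : R) : (forall rho, rho \in l -> P rho -> F rho <= B) ->
  0 <= B -> (count P l)%:R <= N -> \sum_(rho <- l | P rho) F rho <= N * B.
Proof.
move=> H B0 cN; apply: (@le_trans _ _ (\sum_(rho <- l | P rho) B)).
  by rewrite big_seq_cond [leRHS]big_seq_cond; apply: ler_sum => rho /andP[]; exact: H.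
rewrite big_const_seq iter_addr addr0 -[leLHS]mulr_natl; exact: ler_wpM2r.
Qed.

Hypothesis RH : riemann_hypothesis R.

Lemma full_half T l g rho : full 0 T l g -> rho \in l -> rho = (1 / 2) +i* Im rho.
Proof. by move=> fl hr; have [<- _ _] := full_zero RH fl hr; case: (rho). Qed.

(** A block at height [2^k] has about [2^k * k] zeros. With the kernel bound [r / 2^k] it
    contributes [r * k], which sums to the square; with [r^2 / 4^k] it contributes [r^2 * k / 2^k],
    which sums to a tail of the same shape. *)
Lemma low_tail : exists2 K, 0 < K & forall r x h T l g, 2 <= r -> x = r ^+ 2 -> `|h| = r ->
  full 0 T l g -> forall k : nat,
  \sum_(rho <- l | `|Im rho| <= 2 ^+ k) nm (KK x h rho) <= K * r * (k%:R + 3) ^+ 2 /\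
  forall b, (k <= b)%N ->
  \sum_(rho <- l | block (2 ^+ k) (2 ^+ b) rho) nm (KK x h rho) <= K * r ^+ 2 * ((k%:R + 4) / 2 ^+ k).
Proof.
have [K K0 HK] := block_count.
pose E := expR 3 : R; have E0 : 0 < E by exact: expR_gt0.
have KE : 0 < K * E by rewrite mulr_gt0.
exists (8 * (K * E)); first lra.
move=> r x h T l g r2 xr hr fl k; have [c1 ck] := HK _ _ _ fl.
have r0 : 0 < r by lra.
have X2 rho : rho \in l -> 0 < Re rho <= 2 /\ expR (Re rho * ln x) = r.
  move=> hr'; have [-> _ _] := full_zero RH fl hr'; split; first lra.
  by rewrite xr lnXn// (_ : 1 / 2 * (ln r *+ 2) = ln r) ?lnK// mulr2n; field.
have b1 rho (y : R) : rho \in l -> 0 < y -> y <= nm rho -> nm (KK x h rho) <= 4 * E * r / y.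
  move=> hr' y0 yn; have [h1 h2] := X2 _ hr'.
  apply: le_trans (KK_bound1 r2 xr hr h1) _; rewrite h2 ler_wpM2l//; first by rewrite !mulr_ge0// ltW.
  by rewrite lef_pV2 ?posrE// (lt_le_trans y0).
have b2 rho (y : R) : rho \in l -> 0 < y -> y <= nm rho -> nm (KK x h rho) <= 2 * E * r ^+ 2 / y ^+ 2.
  move=> hr' y0 yn; have [h1 h2] := X2 _ hr'.
  apply: le_trans (KK_bound2 r2 xr hr h1) _; rewrite h2 (_ : 2 * E * r * r = 2 * E * r ^+ 2); last by ring.
  rewrite ler_wpM2l//; first by rewrite !mulr_ge0 ?exprn_ge0// ltW.
  rewrite lef_pV2 ?posrE ?exprn_gt0 ?(lt_le_trans y0 yn)//.
  by rewrite ler_pXn2r ?nnegrE ?nm_ge0// ltW.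
have p2 (j : nat) : 0 < 2 ^+ j :> R by rewrite exprn_gt0.
have inb j rho : block (2 ^+ j) (2 ^+ j.+1) rho -> 2 ^+ j <= nm rho.
  by move=> /andP[h1 _]; apply: le_trans (Im_le_nm _); exact: ltW.
split.
  elim: k => [|k ih].
    rewrite expr0 add0r; apply: (@le_trans _ _ (K * (4 * E * r / (1 / 2)))).
      apply: block_sum => // [rho hr' _|]; last by rewrite divr_ge0// ?mulr_ge0// ltW.
      apply: b1 => //; apply: le_trans (Re_le_nm _).
      by have [-> _ _] := full_zero RH fl hr'; rewrite ger0_norm; lra.
    have : 0 <= K * E * r by rewrite mulr_ge0// ltW.
    by rewrite expr2; lra.
  rewrite (bigID (fun rho => `|Im rho| <= 2 ^+ k)) /=.
  rewrite (eq_bigl (fun rho => `|Im rho| <= 2 ^+ k)); last first.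
    move=> rho; apply: andb_idl => h1; apply: le_trans h1 _; rewrite ler_weXn2l//; lra.
  rewrite [X in _ + X](eq_bigl (block (2 ^+ k) (2 ^+ k.+1))); last first.
    by move=> rho; rewrite -ltNge andbC.
  have h2 : \sum_(rho <- l | block (2 ^+ k) (2 ^+ k.+1) rho) nm (KK x h rho) <= K * (2 ^+ k * (k%:R + 3)) * (4 * E * r / 2 ^+ k).
    apply: block_sum => // [rho hr' /inb hb|]; first exact: b1.
    by rewrite divr_ge0 ?mulr_ge0// ltW.
  apply: le_trans (lerD ih h2) _.
  have -> : K * (2 ^+ k * (k%:R + 3)) * (4 * E * r / 2 ^+ k) = 4 * (K * E * r) * (k%:R + 3).
    by field; rewrite gt_eqF.
  have q : 0 <= K * E * r by rewrite mulr_ge0// ltW.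
  have k0 : 0 <= k%:R :> R by [].
  have := mulr_ge0 q k0; rewrite -natr1 !expr2; lra.
move=> b kb; rewrite dyadic_split//.
(* [(j + 3) / 2 ^+ j] is the difference of consecutive values of [(2 j + 8) / 2 ^+ j], so the sum
   over blocks telescopes. *)
have st j : \sum_(rho <- l | block (2 ^+ j) (2 ^+ j.+1) rho) nm (KK x h rho) <=
   2 * (K * E) * r ^+ 2 * ((2 * j%:R + 8) / 2 ^+ j - (2 * j.+1%:R + 8) / 2 ^+ j.+1).
  apply: (@le_trans _ _ (K * (2 ^+ j * (j%:R + 3)) * (2 * E * r ^+ 2 / (2 ^+ j) ^+ 2))).
    apply: block_sum => // [rho hr' /inb hb|]; first exact: b2.
    by rewrite divr_ge0 ?mulr_ge0 ?exprn_ge0// ltW.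
  rewrite le_eqVlt; apply/orP; left; apply/eqP; rewrite [2 ^+ j.+1]exprS -[j.+1%:R]natr1.
  by field; rewrite gt_eqF.
apply: le_trans (ler_sum_nat (fun j _ => st j)) _.
rewrite -big_distrr /=.
pose S (j : nat) : R := (2 * j%:R + 8) / 2 ^+ j.
have -> : \sum_(k <= j < b) ((2 * j%:R + 8) / 2 ^+ j - (2 * j.+1%:R + 8) / 2 ^+ j.+1) = S k - S b.
  rewrite (@telescope_sumr_eq _ k b (fun j => - S j))//; first by rewrite opprK addrC.
  by move=> j _; rewrite /S opprK addrC.
have Sb : 0 <= S b by rewrite divr_ge0 ?(ltW (p2 b))// addr_ge0// mulr_ge0.
have q : 0 <= 2 * (K * E) * r ^+ 2 by rewrite !mulr_ge0 ?exprn_ge0// ltW.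
apply: (@le_trans _ _ (2 * (K * E) * r ^+ 2 * S k)); first by rewrite ler_wpM2l// lerBlDr lerDl.
have -> : S k = 2 * ((k%:R + 4) / 2 ^+ k) by rewrite /S; ring.
have q2 : 0 <= (k%:R + 4) / 2 ^+ k :> R by rewrite divr_ge0 ?(ltW (p2 k))// addr_ge0.
have := mulr_ge0 q q2; lra.
Qed.
End ZeroCounts.

(** * Positivity of Cauchy matrices *)

Section CauchyMatrix.
Variable R : realType.
Local Notation C := R[i].
Local Notation nm := (@nm R).
Implicit Types (s z w rho q : C) (l : seq C) (c p : C -> C).

Lemma conjV z : conjc z^-1 = (conjc z)^-1. Proof. exact: fmorphV. Qed.

Lemma conj_term (a b z : C) : conjc (conjc a * conjc (conjc b) / z) = a * conjc b / conjc z.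
Proof. by rewrite !conjM conjV !conjcK. Qed.

Definition cform l p c : C := \sum_(i <- l) \sum_(j <- l) c i * conjc (c j) / (p i + conjc (p j)).

Lemma Re_conj_neq0 z w : 0 < Re z -> 0 < Re w -> z + conjc w != 0.
Proof.
by move=> z0 w0; apply/eqP => /(congr1 (@complex.Re R)); rewrite ReD Re_conj /=; lra.
Qed.

(* Schur complement of the Cauchy matrix [1 / (p i + conj (p j))]. For [q = p a]
   the new weight of [a] is [0], which makes an induction on [l] possible. *)
Lemma schur l p c q : 0 < Re q -> (forall i, i \in l -> 0 < Re (p i)) ->
  let S := \sum_(i <- l) c i / (p i + conjc q) in
  cform l p c = (q + conjc q) * (S * conjc S) +
    cform l p (fun i => c i * (p i - q) / (p i + conjc q)).
Proof.
move=> q0 hp S; rewrite /S conj_sum big_distrl big_distrr /= -big_split /=.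
apply: eq_big_seq => i hi; rewrite big_distrr big_distrr /= -big_split /=.
apply: eq_big_seq => j hj.
have n1 := Re_conj_neq0 (hp i hi) (hp j hj).
have n2 := Re_conj_neq0 (hp i hi) q0.
have n3 : conjc (p j) + q != 0 by rewrite addrC Re_conj_neq0// hp.
rewrite !conjM !conjV conjB conjD conjcK.
move: (p i) (conjc (p j)) (c i) (conjc (c j)) (conjc q) n1 n2 n3 => a b d e f n1 n2 n3.
by field; rewrite n1 n2 n3.
Qed.

Lemma diag_re q S : Re ((q + conjc q) * (S * conjc S)) = 2 * Re q * nm S ^+ 2.
Proof. by rewrite nm_sqr !(ReM, ImM, ReD, ImD) !Re_conj !Im_conj; ring. Qed.

Lemma cform_ge0 l p c : (forall i, i \in l -> 0 < Re (p i)) -> 0 <= Re (cform l p c).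
Proof.
elim: l c => [|a l ih] c hp; first by rewrite /cform big_nil.
have a0 : 0 < Re (p a) by apply: hp; exact: mem_head.
rewrite (schur c a0 hp) ReD diag_re addr_ge0//.
  by rewrite mulr_ge0 ?exprn_ge0 ?nm_ge0// mulr_ge0// ltW.
set d := fun i => _; have da : d a = 0 by rewrite /d subrr mulr0 mul0r.
have -> : cform (a :: l) p d = cform l p d.
  rewrite /cform big_cons big1 ?add0r; last by move=> j _; rewrite da !mul0r.
  by apply: eq_bigr => i _; rewrite big_cons da conjc0 mulr0 mul0r add0r.
by apply: ih => i hi; apply: hp; rewrite in_cons hi orbT.
Qed.

(** The remainder in [schur] is a form of the same kind, with new coefficients, and so is
    nonnegative. *)
Lemma cform_ge l p c (q : R) : 0 < q -> (forall i, i \in l -> 0 < Re (p i)) ->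
  2 * q * nm (\sum_(i <- l) c i / (p i + q%:C)) ^+ 2 <= Re (cform l p c).
Proof.
move=> q0 hp; have q0' : 0 < Re q%:C by [].
have qc : conjc q%:C = q%:C by apply: ceqP => //=; rewrite oppr0.
have := schur c q0' hp; rewrite qc /= => E.
have d := diag_re q%:C (\sum_(i <- l) c i / (p i + q%:C)).
by rewrite qc in d; rewrite E ReD d lerDl cform_ge0.
Qed.

Definition pair_sum l (ga : C -> R) c (b : R) : C :=
  \sum_(i <- l) \sum_(j <- l) c i * conjc (c j) * (pair_weight b (ga i - ga j))%:C.

(** The weight is [b * (1 / (2 b + i u) + 1 / (2 b - i u))], so the pair sum is [b] times a Cauchy
    form plus the conjugate of another one. The first dominates the rank one term, the second is
    dropped by positivity. *)
Lemma pair_sum_ge l (ga : C -> R) c (b q : R) : 0 < b -> 0 < q ->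
  2 * b * q * nm (\sum_(i <- l) c i / ((b + q) +i* ga i)) ^+ 2 <= nm (pair_sum l ga c b).
Proof.
move=> b0 q0; pose p i : C := b +i* ga i.
have hp i : i \in l -> 0 < Re (p i) by [].
have E : pair_sum l ga c b = b%:C * (cform l p c + conjc (cform l p (fun i => conjc (c i)))).
  rewrite /pair_sum /cform conj_sum -big_split big_distrr /=; apply: eq_bigr => i _.
  rewrite conj_sum -big_split big_distrr /=; apply: eq_bigr => j _.
  rewrite conj_term.
  set u := ga i - ga j.
  have -> : p i + conjc (p j) = (2 * b) +i* u by apply: ceqP; rewrite /p /u /=; ring.
  have -> : conjc ((2 * b) +i* u) = (2 * b) +i* (- u) :> C by [].
  have n1 : (2 * b) +i* u != 0 :> C by apply/eqP => /(congr1 (@complex.Re R)) /=; lra.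
  have n2 : (2 * b) +i* (- u) != 0 :> C by apply/eqP => /(congr1 (@complex.Re R)) /=; lra.
  have D0 : 4 * b ^+ 2 + u ^+ 2 != 0.
    by rewrite gt_eqF// ltr_wpDr ?sqr_ge0// mulr_gt0// exprn_gt0.
  have DE : (4 * b ^+ 2 + u ^+ 2)%:C = ((2 * b) +i* u) * ((2 * b) +i* (- u)) :> C.
    by apply: ceqP => /=; ring.
  have SE : ((2 * b) +i* u) + ((2 * b) +i* (- u)) = (4 * b)%:C :> C by apply: ceqP => /=; ring.
  have W : (pair_weight b u)%:C = b%:C * (((2 * b) +i* u)^-1 + ((2 * b) +i* (- u))^-1) :> C.
    have -> : (pair_weight b u)%:C = b%:C * (4 * b)%:C / (4 * b ^+ 2 + u ^+ 2)%:C :> C.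
      by rewrite -rmorphM -fmorphV -rmorphM /pair_weight; congr (_ / _)%:C; rewrite expr2; ring.
    rewrite DE -SE; move: n1 n2; set z := _ +i* _; set w := _ +i* _ => n1 n2.
    by field; rewrite n1 n2.
  rewrite W; ring.
have S1 := cform_ge c q0 hp.
have S2 := cform_ge0 (fun i => conjc (c i)) hp.
apply: le_trans (Re_le_nm _); rewrite E ReM /= mul0r subr0 ReD Re_conj.
apply: le_trans (ler_norm _).
have -> : \sum_(i <- l) c i / ((b + q) +i* ga i) = \sum_(i <- l) c i / (p i + q%:C).
  by apply: eq_bigr => i _; congr (_ / _); apply: ceqP => /=; rewrite ?addr0.
have -> : forall t, 2 * b * q * t = b * (2 * q * t) by move=> t; ring.
by rewrite ler_wpM2l ?(ltW b0)//; lra.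
Qed.
End CauchyMatrix.

(** * The pair correlation as a sum over lists of zeros *)

Section PairCorrelation.
Variable R : realType.
Local Notation C := R[i].
Local Notation nm := (@nm R).
Implicit Types (s z w rho : C) (l : seq C) (f g : C -> C) (T r x h : R).

Hypothesis RH : riemann_hypothesis R.

(** The unimodular part [x^(i gamma)] of [x^rho]. *)
Definition osc x rho : C := cexp (0 +i* (Im rho * ln x)).

Lemma osc_conj x z w : osc x z * conjc (osc x w) = rcpow x (0 +i* (Im z - Im w)).
Proof.
have -> : conjc (osc x w) = cexp (0 +i* (- (Im w * ln x))).
  apply: ceqP; rewrite ?Re_conj ?Im_conj !(ReCexp, ImCexp) /= ?cosN ?sinN//; ring.
rewrite rcpowE -cexpD; congr cexp; apply: ceqP => /=; ring.
Qed.

(** The multiplicities of [z] and [conjc z] agree by [fact_conj] in both directions. This reduces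
    negative ordinates to positive ones. *)
Lemma conj_perm T l g : full 0 T l g -> perm_eq (map conjc l) l.
Proof.
move=> fl; have [fg hl _] := fl.
have hc z : z \in l -> g z != 0 /\ g (conjc z) != 0.
  move=> hz; have [r1 r2 _] := full_zero RH fl hz.
  have h4 : (0 < 1 / 2 :> R) && (1 / 2 <= 4 :> R) by lra.
  split; first by apply: (full_neq0 RH fl); rewrite ?r1.
  by apply: (full_neq0 RH fl); rewrite ?Re_conj ?r1// Im_conj subr0 normrN; rewrite subr0 in r2.
have cE z : count_mem z (map conjc l) = count_mem (conjc z) l.
  rewrite count_map; apply: eq_count => w /=; apply/eqP/eqP => [<-|->]; by rewrite conjcK.
have key z : z \in l -> count_mem (conjc z) l = count_mem z l.
  move=> hz; have [r1 _ _] := full_zero RH fl hz; have [g1 g2] := hc z hz.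
  have r0 : 0 < Re z by lra.
  have r0' : 0 < Re (conjc z) by rewrite Re_conj.
  apply/eqP; rewrite eqn_leq (fact_conj fg fg r0 g1 g2) /=.
  by have := fact_conj fg fg r0' g2; rewrite conjcK; apply.
apply/allP => z; rewrite mem_cat => /orP[/mapP[w hw ->]|hz]; rewrite /= cE.
  by rewrite conjcK key.
by rewrite key.
Qed.

Lemma KK_conj x h s : KK x h (conjc s) = conjc (KK x h s).
Proof.
have P y z : cpow y (conjc z) = conjc (cpow y z).
  rewrite /cpow; apply: ceqP; rewrite ?Re_conj ?Im_conj !(ReCexp, ImCexp) !(ReM, ImM) Re_conj Im_conj /=;
  by rewrite !mulr0 ?subr0 ?addr0 ?add0r mulNr ?cosN ?sinN ?mulrN.
have h1 : conjc h%:C = h%:C :> C by apply: ceqP => //=; rewrite oppr0.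
have s1 : conjc s + 1 = conjc (s + 1) by rewrite conjD (conj_nat R 1).
rewrite /KK s1 !P; move: (cpow (x + h) (s + 1)) (cpow x (s + 1)) => a b.
by rewrite !(conjM, conjV, conjB) h1.
Qed.

Definition upto t rho := 0 < Im rho <= t.

Lemma zeros_uptoE T l g t : full 0 T l g -> t <= T ->
  @zeros_upto R t = [set` undup (seq.filter (upto t) l)].
Proof.
move=> fl tT; apply/seteqP; split => rho /=.
  move=> [[/andP[r0 r1] z0] /andP[i0 it]].
  rewrite mem_undup mem_filter /upto i0 it /=.
  apply: (zero_full RH fl) => //; last by rewrite subr0 ger0_norm; lra.
  have n1 : rho != 1 by apply: contraTneq r1 => ->; rewrite /= ltxx.
  by rewrite -(continues_zetaY (rh_continues RH) r0 n1) z0 mulr0.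
rewrite mem_undup mem_filter => /andP[hu hr].
have [r1 r2 Yr] := full_zero RH fl hr.
have n1 : rho != 1 by apply/eqP => E; rewrite E /= in r1; lra.
have r0 : 0 < Re rho by lra.
split => //; split; first by rewrite r1; lra.
have := continues_zetaY (rh_continues RH) r0 n1; rewrite Yr => /eqP.
by rewrite mulf_eq0 subr_eq0 (negPf n1) /= => /eqP.
Qed.

(** [zeros_upto] is a set and meets each zero once; the factor [multiplicity] restores the
    repetitions in [l]. *)
Lemma zeros_sum T l g t (F : C -> C) : full 0 T l g -> t <= T ->
  \sum_(rho \in @zeros_upto R t) (multiplicity rho)%:R * F rho = \sum_(rho <- l | upto t rho) F rho.
Proof.
move=> fl tT; rewrite (zeros_uptoE fl tT) -fsbig_seq ?undup_uniq//.
rewrite -[RHS]big_filter -[RHS]big_undup_iterop_count.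
apply: eq_big_seq => rho; rewrite mem_undup mem_filter => /andP[hu hr].
have [fg _ _] := fl; have [r1 r2 Yr] := full_zero RH fl hr.
have n1 : rho != 1 by apply/eqP => E; rewrite E /= in r1; lra.
have gr : g rho != 0 by apply: (full_neq0 RH fl) => //; lra.
rewrite (fact_multiplicity RH fg)//; last lra.
rewrite mulr_natl -[RHS]/(F rho *+ count_mem rho (seq.filter (upto t) l)); congr (_ *+ _).
by rewrite count_filter; apply: eq_count => w /=; case: eqP => //= ->; rewrite hu.
Qed.

Lemma zeros_scale T l g t (a : C) (F G : C -> C) : full 0 T l g -> t <= T ->
  (forall rho, F rho = a * G rho) ->
  \sum_(rho \in @zeros_upto R t) F rho = a * \sum_(rho \in @zeros_upto R t) G rho.
Proof.
move=> fl tT H; rewrite (zeros_uptoE fl tT) -(fsbig_seq _ F (undup_uniq _)) -(fsbig_seq _ G (undup_uniq _)) big_distrr /=.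
by apply: eq_bigr => rho _; exact: H.
Qed.

Lemma pair_correlationE T l g x b t : full 0 T l g -> t <= T ->
  pair_correlation b x t = pair_sum (seq.filter (upto t) l) (@complex.Im R) (osc x) b.
Proof.
move=> fl tT; rewrite /pair_correlation /pair_sum big_filter.
pose G z w := osc x z * conjc (osc x w) * (pair_weight b (Im z - Im w))%:C.
rewrite -(zeros_sum (fun z => \sum_(w <- seq.filter (upto t) l) G z w) fl tT).
apply: eq_fsbigr => rho _; rewrite big_filter -(zeros_sum (G rho) fl tT).
apply: (zeros_scale fl tT) => w; rewrite /G osc_conj natrM -!mulrA; congr (_ * _).
Qed.

Lemma pair_correlation_ge T l g x b q t : full 0 T l g -> t <= T -> 0 < b -> 0 < q ->
  2 * b * q * nm (\sum_(rho <- l | upto t rho) osc x rho / ((b + q) +i* Im rho)) ^+ 2 <=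
  nm (pair_correlation b x t).
Proof.
by move=> fl tT b0 q0; rewrite (pair_correlationE _ _ fl tT) -big_filter; exact: pair_sum_ge.
Qed.
End PairCorrelation.

(** * Partial summation *)

Section Abel.
Variable R : realType.
Local Notation C := R[i].
Local Notation nm := (@nm R).

Lemma le_of_inv_nat (u v w : R) : 0 <= w -> (forall n : nat, u <= v + w / n.+1%:R) -> u <= v.
Proof.
move=> w0 H; apply/ler_addgt0Pr => e e0.
have := H (Num.truncn (w / e)); set n := Num.truncn _ => h; apply: le_trans h _.
rewrite lerD2l ler_pdivrMr// mulrC -ler_pdivrMr//.
by apply: ltW; exact: truncnS_gt.
Qed.

(* Partial summation over a uniform grid with ever more cells, so that the
   points [ga i] need not be sorted. *)
Lemma abel (T : Type) (l : seq T) (ga : T -> R) (f : T -> C) (m : R -> C) (a b V c M : R) :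
  a <= b -> 0 <= c -> 0 <= V ->
  (forall t, a <= t <= b -> nm (\sum_(i <- l | ga i <= t) f i) <= V) ->
  (forall t, a <= t <= b -> nm (m t) <= M) ->
  (forall t u, a <= t <= b -> a <= u <= b -> nm (m t - m u) <= c * `|t - u|) ->
  nm (\sum_(i <- l | a < ga i <= b) f i * m (ga i)) <= 2 * M * V + c * (b - a) * V.
Proof.
move=> ab c0 V0 hA hM hm.
pose A t := \sum_(i <- l | ga i <= t) f i.
pose U := \sum_(i <- l) nm (f i).
have U0 : 0 <= U by apply: sumr_ge0 => i _; exact: nm_ge0.
have ba : 0 <= b - a by rewrite subr_ge0.
apply: (@le_of_inv_nat _ _ (c * (b - a) * U)); first by rewrite !mulr_ge0.
move=> N; pose d := (b - a) / N.+1%:R.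
have d0 : 0 <= d by rewrite divr_ge0.
pose tau (j : nat) := a + j%:R * d.
have tauS j : tau j.+1 = tau j + d by rewrite /tau -natr1; ring.
have tauN : tau N.+1 = b by rewrite /tau /d mulrC divfK ?pnatr_eq0//; ring.
have tau0 : tau 0%N = a by rewrite /tau mul0r addr0.
have taub j : (j <= N.+1)%N -> a <= tau j <= b.
  move=> jN; rewrite -tauN /tau lerDl mulr_ge0//= lerD2l ler_wpM2r// ler_nat//.
pose S t := \sum_(i <- l | a < ga i <= t) f i * m (ga i).
pose Un t := \sum_(i <- l | a < ga i <= t) nm (f i).
have split_le (V' : zmodType) (F : T -> V') (t u : R) : a <= t -> t <= u ->
    \sum_(i <- l | a < ga i <= u) F i = \sum_(i <- l | a < ga i <= t) F i + \sum_(i <- l | t < ga i <= u) F i.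
  move=> h1 h2; rewrite (bigID (fun i => ga i <= t)) /=; congr (_ + _); apply: eq_bigl => i.
    have [h|h] := leP (ga i) t; last by rewrite !andbF.
    by rewrite (le_trans h h2) !andbT.
  have [h|h] := leP (ga i) t; first by rewrite andbF.
  by rewrite (le_lt_trans h1 h) andbT.
have split_A (t u : R) : t <= u -> A u = A t + \sum_(i <- l | t < ga i <= u) f i.
  move=> h2; rewrite /A (bigID (fun i => ga i <= t)) /=; congr (_ + _); apply: eq_bigl => i.
    have [h|h] := leP (ga i) t; last by rewrite !andbF.
    by rewrite (le_trans h h2).
  by rewrite -ltNge andbC.
(* The first term on the right is the variation of [m] against the partial sums. The second comes
   from replacing [m (ga i)] by the value at the right end of its cell, and it disappears as the
   mesh [d] shrinks. *)
have key n : (n <= N.+1)%N -> nm (S (tau n) - (m (tau n) * A (tau n) - m a * A a)) <=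
    n%:R * (c * d * V) + c * d * Un (tau n).
  elim: n => [_|n ih nN].
    rewrite tau0 /S /Un !big_pred0 ?mul0r ?mulr0; last 2 first.
      by move=> i; apply/negbTE/negP => /andP[h1 h2]; have := lt_le_trans h1 h2; rewrite ltxx.
      by move=> i; apply/negbTE/negP => /andP[h1 h2]; have := lt_le_trans h1 h2; rewrite ltxx.
    by rewrite subrr subr0 nm0 addr0.
  have {}ih := ih (ltnW nN).
  have /andP[n1 n2] := taub n (ltnW nN); have /andP[n3 n4] := taub n.+1 nN.
  have nn : tau n <= tau n.+1 by rewrite tauS lerDl.
  have tt : a <= tau n <= b by rewrite n1.
  have tt' : a <= tau n.+1 <= b by rewrite n3.
  set X := S (tau n) - _ in ih.
  pose E1 := \sum_(i <- l | tau n < ga i <= tau n.+1) f i * (m (ga i) - m (tau n.+1)).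
  pose E2 := (m (tau n.+1) - m (tau n)) * A (tau n).
  have E : S (tau n.+1) - (m (tau n.+1) * A (tau n.+1) - m a * A a) = X + E1 - E2.
    have -> : E1 = \sum_(i <- l | tau n < ga i <= tau n.+1) f i * m (ga i) -
       m (tau n.+1) * \sum_(i <- l | tau n < ga i <= tau n.+1) f i.
      by rewrite big_distrr -sumrB; apply: eq_bigr => i _ /=; ring.
    by rewrite /S (split_le _ _ _ _ n1 nn) (split_A _ _ nn) /X /E2 /S; ring.
  have b1 : nm E1 <= c * d * \sum_(i <- l | tau n < ga i <= tau n.+1) nm (f i).
    rewrite big_distrr /=; apply: le_trans (nm_sum _ _ _) _; apply: ler_sum => i /andP[h1 h2].
    rewrite nmM mulrC ler_wpM2r ?nm_ge0//.
    have hi : a <= ga i <= b by rewrite (le_trans n1 (ltW h1)) (le_trans h2 n4).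
    apply: le_trans (hm _ _ hi tt') _; rewrite ler_wpM2l//.
    by rewrite ler_norml tauS in h2 *; apply/andP; split; lra.
  have b2 : nm E2 <= c * d * V.
    rewrite nmM; apply: ler_pM; rewrite ?nm_ge0//; last exact: hA.
    apply: le_trans (hm _ _ tt' tt) _; rewrite ler_wpM2l// tauS.
    by rewrite addrAC subrr add0r ger0_norm.
  rewrite E; apply: le_trans (nmB _ _) _; have := nmD X E1.
  rewrite /Un (split_le _ _ _ _ n1 nn) -/(Un (tau n)) -natr1 mulrDr mulrDl mul1r; lra.
have := key N.+1 (leqnn _); rewrite tauN => k.
have UnU : Un b <= U.
  by rewrite /Un /U big_mkcond; apply: ler_sum => i _; case: ifP => // _; exact: nm_ge0.
have nN0 : N.+1%:R != 0 :> R by rewrite pnatr_eq0.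
have cdN : N.+1%:R * (c * d * V) = c * (b - a) * V by rewrite /d; move: (N.+1%:R : R) nN0 => q q0; field.
have cdU : c * d * Un b <= c * (b - a) * U / N.+1%:R.
  have -> : c * (b - a) * U / N.+1%:R = c * d * U by rewrite /d; ring.
  by rewrite ler_wpM2l// mulr_ge0.
have aab : a <= a <= b by rewrite lexx.
have abb : a <= b <= b by rewrite lexx andbT.
have B1 : nm (m b * A b) <= M * V by rewrite nmM; apply: ler_pM; rewrite ?nm_ge0 ?hM// hA.
have B2 : nm (m a * A a) <= M * V by rewrite nmM; apply: ler_pM; rewrite ?nm_ge0 ?hM// hA.
have := nmD (S b - (m b * A b - m a * A a)) (m b * A b - m a * A a).
have := nmB (m b * A b) (m a * A a).
rewrite subrK; rewrite cdN in k.
have -> : \sum_(i <- l | a < ga i <= b) f i * m (ga i) = S b by [].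
move: k cdU B1 B2 UnU; move: (S b) (m b * A b) (m a * A a) (c * d * Un b) (c * (b - a) * U / _) => z1 z2 z3 z4 z5.
move: (z1 - (z2 - z3)) (z2 - z3) => z6 z7; clear; lra.
Qed.
End Abel.

(** * The smooth factor of the kernel on a dyadic block *)

Section Weight.
Variable R : realType.
Local Notation C := R[i].
Local Notation nm := (@nm R).
Variables (r x h : R).
Hypotheses (r2 : 2 <= r) (xr : x = r ^+ 2) (hr : `|h| = r).

Let r0 : 0 < r. Proof. by apply: lt_le_trans r2; rewrite ltr0n. Qed.
Let x0 : 0 < x. Proof. by rewrite xr exprn_gt0. Qed.
Local Notation lam := (kern_ln x h).
Local Notation E3 := (expR 3 : R).

Let lamP : `|lam| <= 2 / r. Proof. exact: (kern_lnP r2 xr hr). Qed.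
Let lam1 : `|lam| <= 1. Proof. by apply: le_trans lamP _; rewrite ler_pdivrMr// mul1r. Qed.
Let E0 : 0 < E3. Proof. exact: expR_gt0. Qed.
Let qr : `|x / h| = r.
Proof. by rewrite normrM normfV hr (gtr0_norm x0) xr; field; rewrite gt_eqF. Qed.

(** The factor [x / h] of modulus [r] offsets [lam], which is at most [2 / r]; hence the Lipschitz
    constant in [y] is absolute. *)
Definition wD (y : R) : C := (x / h)%:C * (cexp (((3 / 2) +i* y) * lam%:C) - 1).

Lemma wD_lip y y' : nm (wD y - wD y') <= 4 * E3 * `|y - y'|.
Proof.
have -> : wD y - wD y' = (x / h)%:C * (cexp ((3 / 2 * lam)%:C) * (cexp (0 +i* (y * lam)) - cexp (0 +i* (y' * lam)))).
  have P z : ((3 / 2) +i* z) * lam%:C = (3 / 2 * lam)%:C + 0 +i* (z * lam) :> C by apply: ceqP => /=; ring.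
  by rewrite /wD !P !cexpD; ring.
rewrite (nmM (x / h)%:C) (nmM (cexp (3 / 2 * lam)%:C)) nm_real qr nm_cexp /=.
have e : expR (3 / 2 * lam) <= E3.
  by rewrite ler_expR; move: lam1; rewrite ler_norml; lra.
have d : nm (cexp (0 +i* (y * lam)) - cexp (0 +i* (y' * lam))) <= 2 * (`|y - y'| * (2 / r)).
  apply: le_trans (nm_cexpi_le _ _) _; rewrite ler_wpM2l// -mulrBl normrM ler_wpM2l//.
have h1 := ler_pM (expR_ge0 _) (nm_ge0 _) e d.
apply: le_trans (ler_wpM2l (ltW r0) h1) _.
by rewrite le_eqVlt; apply/orP; left; apply/eqP; field; rewrite gt_eqF.
Qed.

Lemma wD_bound y : nm (wD y) <= 4 * E3 * nm ((3 / 2) +i* y).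
Proof.
rewrite /wD nmM nm_real qr.
have hR : `|Re (((3 / 2) +i* y) * lam%:C : C)| <= 3.
  by rewrite ReM /= mulr0 subr0; move: lam1; rewrite !ler_norml; lra.
have := cexp_sub1 hR; rewrite (nmM (_ +i* y)) nm_real => h1.
apply: le_trans (ler_wpM2l (ltW r0) h1) _.
have p : 0 <= r * (2 * E3 * nm ((3 / 2) +i* y)) by rewrite !mulr_ge0 ?nm_ge0 ?(ltW r0) ?(ltW E0).
have -> : r * (2 * E3 * (nm ((3 / 2) +i* y) * `|lam|)) = r * (2 * E3 * nm ((3 / 2) +i* y)) * `|lam| by ring.
apply: le_trans (ler_wpM2l p lamP) _.
by rewrite le_eqVlt; apply/orP; left; apply/eqP; field; rewrite gt_eqF.
Qed.

(* With [rho = 1/2 + i y], the kernel is [KK rho = x ^ rho * wm t0 y / (t0 + i y)];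
   near height [P] the weight [wm] is bounded and varies at scale [P]. *)
Definition wm (t0 y : R) : C := (t0 +i* y) / (((1 / 2) +i* y) * ((3 / 2) +i* y)) * wD y.

Lemma KK_wm t0 y : 0 < t0 -> KK x h ((1 / 2) +i* y) = r%:C * (osc x ((1 / 2) +i* y) / (t0 +i* y) * wm t0 y).
Proof.
move=> t00; rewrite KKE.
have s1 : (1 / 2) +i* y + 1 = (3 / 2) +i* y :> C by apply: ceqP => /=; field.
have n0 : t0 +i* y != 0 :> C by apply/eqP => /(congr1 (@complex.Re R)) /=; lra.
have n1 : (1 / 2) +i* y != 0 :> C by apply/eqP => /(congr1 (@complex.Re R)) /=; lra.
have n2 : (3 / 2) +i* y != 0 :> C by apply/eqP => /(congr1 (@complex.Re R)) /=; lra.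
have hn : h%:C != 0 :> C by rewrite -nm_gt0 nm_real hr.
have P : cpow x ((1 / 2) +i* y + 1) = x%:C * (r%:C * osc x ((1 / 2) +i* y)).
  rewrite cpowD cpow1// mulrC; congr (_ * _); rewrite /cpow /osc /=.
  have -> : r%:C = cexp (ln r)%:C :> C by rewrite cexp_real lnK.
  by rewrite -cexpD xr lnXn//; congr cexp; apply: ceqP; rewrite mulr2n /=; field.
have xh : (x / h)%:C = x%:C / h%:C :> C by rewrite -fmorphV -rmorphM.
rewrite P s1 /wm /wD xh.
move: (cexp _) (osc _ _) x%:C r%:C n0 n1 n2 hn => e o xx rr; set a := t0 +i* y; set b := _ +i* y; set c := _ +i* y; set d := h%:C.
by move=> n0 n1 n2 hn; field; rewrite n0 n1 n2 hn.
Qed.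

Variables (P : R) (P1 : 1 <= P).
Let P0 : 0 < P. Proof. by apply: lt_le_trans P1. Qed.

Let sz y : P <= y <= 2 * P -> [/\ P <= nm ((1 / 2) +i* y), P <= nm ((3 / 2) +i* y),
  nm ((3 / 2) +i* y) <= 4 * P & nm ((2 * P) +i* y) <= 4 * P].
Proof.
move=> /andP[y1 y2]; have y0 : 0 <= y by have := P0; lra.
split.
- by apply: le_trans (Im_le_nm _); rewrite /= ger0_norm.
- by apply: le_trans (Im_le_nm _); rewrite /= ger0_norm.
- by apply: le_trans (nm_le_ReIm _) _; rewrite /= !ger0_norm//; have := P1; lra.
- by apply: le_trans (nm_le_ReIm _) _; rewrite /= !ger0_norm//; have := P1; lra.
Qed.

Lemma wm_bound y : P <= y <= 2 * P -> nm (wm (2 * P) y) <= 16 * E3.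
Proof.
move=> hy; have [a1 b1 b2 c1] := sz hy.
rewrite /wm (nmM (_ / _)) (nmM (_ +i* y)) nmV nmM.
have a0 := lt_le_trans P0 a1; have b0 := lt_le_trans P0 b1.
set a := nm _ in a1 a0 *; set b := nm _ in b1 b2 b0 *; set c := nm _ in c1 *.
have hD := wD_bound y; rewrite -/b in hD.
have q : 0 <= c / (a * b) by rewrite divr_ge0 ?nm_ge0// mulr_ge0// ltW.
apply: le_trans (ler_wpM2l q hD) _.
have -> : c / (a * b) * (4 * E3 * b) = 4 * E3 * (c / a) by field; rewrite !gt_eqF.
have : c / a <= 4 by rewrite ler_pdivrMr//; lra.
by move=> ca; have := ler_wpM2l (mulr_ge0 (ler0n R 4) (ltW E0)) ca; lra.
Qed.

Lemma wm_lip y y' : P <= y <= 2 * P -> P <= y' <= 2 * P ->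
  nm (wm (2 * P) y - wm (2 * P) y') <= 64 * E3 / P * `|y - y'|.
Proof.
move=> hy hy'; have [a1 b1 b2 c1] := sz hy; have [a1' b1' b2' c1'] := sz hy'.
have hD := wD_lip y y'; have hD' := wD_bound y'.
have dl (k : R) : nm (k +i* y - (k +i* y')) = `|y - y'|.
  have -> : k +i* y - (k +i* y') = 'i * (y - y')%:C :> C by apply: ceqP => /=; ring.
  by rewrite nmM nm_i mul1r nm_real.
have da := dl (1 / 2); have db := dl (3 / 2); have dc := dl (2 * P).
rewrite /wm; set d := `|y - y'| in hD da db dc *.
have d0 : 0 <= d by exact: normr_ge0.
set a := (1 / 2) +i* y in a1 da *; set b := (3 / 2) +i* y in b1 b2 db *; set c := (2 * P) +i* y in c1 dc *.
set a' := (1 / 2) +i* y' in a1' da *; set b' := (3 / 2) +i* y' in b1' b2' db hD' *; set c' := (2 * P) +i* y' in c1' dc *.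
move: (wD y) (wD y') hD hD' => D D' hD hD'.
have [na nb na' nb'] : [/\ 0 < nm a, 0 < nm b, 0 < nm a' & 0 < nm b'].
  by split; apply: lt_le_trans P0 _.
have [za zb za' zb'] : [/\ a != 0, b != 0, a' != 0 & b' != 0] by rewrite -!nm_gt0.
(* One factor is exchanged at a time; each of the four differences contributes at most
   [16 * E3 / P * d]. *)
have -> : c / (a * b) * D - c' / (a' * b') * D' =
   c / (a * b) * (D - D') + ((c - c') / (a * b) * D' - (c' / (a * b * b') * (b - b') * D' + c' / (a * a' * b') * (a - a') * D')).
  by field; rewrite za zb za' zb'.
have E30 : 0 < 4 * E3 by have := E0; lra.
have inv z : P <= nm z -> (nm z)^-1 <= P^-1.
  by move=> hz; rewrite lef_pV2 ?posrE// (lt_le_trans P0 hz).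
have Pi0 : 0 < P^-1 by rewrite invr_gt0.
have PP : P * P^-1 = 1 by rewrite mulfV// gt_eqF.
have ia := inv _ a1; have ib := inv _ b1; have ia' := inv _ a1'; have ib' := inv _ b1'.
have iab : (nm a)^-1 * (nm b)^-1 <= P^-1 * P^-1 by apply: ler_pM; rewrite ?invr_ge0 ?nm_ge0.
have iaa : (nm a)^-1 * (nm a')^-1 <= P^-1 * P^-1 by apply: ler_pM; rewrite ?invr_ge0 ?nm_ge0.
have t1 : nm (c / (a * b) * (D - D')) <= 16 * E3 / P * d.
  rewrite (nmM (c / _)) (nmM c) nmV (nmM a) invfM.
  have h1 : nm c * ((nm a)^-1 * (nm b)^-1) <= 4 * P * (P^-1 * P^-1).
    by apply: ler_pM; rewrite ?nm_ge0 ?mulr_ge0 ?invr_ge0 ?nm_ge0.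
  apply: le_trans (ler_pM _ (nm_ge0 _) h1 hD) _; first by rewrite !mulr_ge0 ?invr_ge0 ?nm_ge0.
  by rewrite le_eqVlt; apply/orP; left; apply/eqP; field; rewrite gt_eqF.
have t2 : nm ((c - c') / (a * b) * D') <= 16 * E3 / P * d.
  rewrite (nmM (_ / _)) (nmM (c - c')) nmV (nmM a) invfM dc.
  have h1 : d * ((nm a)^-1 * (nm b)^-1) <= d * (P^-1 * P^-1) by rewrite ler_wpM2l.
  have h2 : nm D' <= 4 * E3 * (4 * P).
    by apply: le_trans hD' _; rewrite ler_wpM2l// ltW.
  apply: le_trans (ler_pM _ (nm_ge0 _) h1 h2) _; first by rewrite !mulr_ge0 ?invr_ge0 ?nm_ge0.
  by rewrite le_eqVlt; apply/orP; left; apply/eqP; field; rewrite gt_eqF.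
have t3 : nm (c' / (a * b * b') * (b - b') * D') <= 16 * E3 / P * d.
  rewrite (nmM (_ * (b - b'))) (nmM (c' / _)) (nmM c') nmV (nmM (a * b)) (nmM a) db.
  have h2 : nm c' / (nm a * nm b * nm b') * d * nm D' <= nm c' / (nm a * nm b * nm b') * d * (4 * E3 * nm b').
    by rewrite ler_wpM2l// mulr_ge0// divr_ge0 ?nm_ge0// !mulr_ge0 ?nm_ge0.
  apply: le_trans h2 _.
  have -> : nm c' / (nm a * nm b * nm b') * d * (4 * E3 * nm b') = 4 * E3 * d * (nm c' * ((nm a)^-1 * (nm b)^-1)).
    by field; rewrite !gt_eqF.
  have h1 : nm c' * ((nm a)^-1 * (nm b)^-1) <= 4 * P * (P^-1 * P^-1).
    by apply: ler_pM; rewrite ?nm_ge0 ?mulr_ge0 ?invr_ge0 ?nm_ge0.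
  apply: le_trans (ler_wpM2l (mulr_ge0 (ltW E30) d0) h1) _.
  by rewrite le_eqVlt; apply/orP; left; apply/eqP; field; rewrite gt_eqF.
have t4 : nm (c' / (a * a' * b') * (a - a') * D') <= 16 * E3 / P * d.
  rewrite (nmM (_ * (a - a'))) (nmM (c' / _)) (nmM c') nmV (nmM (a * a')) (nmM a) da.
  have h2 : nm c' / (nm a * nm a' * nm b') * d * nm D' <= nm c' / (nm a * nm a' * nm b') * d * (4 * E3 * nm b').
    by rewrite ler_wpM2l// mulr_ge0// divr_ge0 ?nm_ge0// !mulr_ge0 ?nm_ge0.
  apply: le_trans h2 _.
  have -> : nm c' / (nm a * nm a' * nm b') * d * (4 * E3 * nm b') = 4 * E3 * d * (nm c' * ((nm a)^-1 * (nm a')^-1)).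
    by field; rewrite !gt_eqF.
  have h1 : nm c' * ((nm a)^-1 * (nm a')^-1) <= 4 * P * (P^-1 * P^-1).
    by apply: ler_pM; rewrite ?nm_ge0 ?mulr_ge0 ?invr_ge0 ?nm_ge0.
  apply: le_trans (ler_wpM2l (mulr_ge0 (ltW E30) d0) h1) _.
  by rewrite le_eqVlt; apply/orP; left; apply/eqP; field; rewrite gt_eqF.
apply: le_trans (nmD _ _) _.
have s1 := nmB ((c - c') / (a * b) * D') (c' / (a * b * b') * (b - b') * D' + c' / (a * a' * b') * (a - a') * D').
have s2 := nmD (c' / (a * b * b') * (b - b') * D') (c' / (a * a' * b') * (a - a') * D').
apply: le_trans (lerD t1 (le_trans s1 (lerD t2 (le_trans s2 (lerD t3 t4))))) _.
by rewrite le_eqVlt; apply/orP; left; apply/eqP; ring.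
Qed.
End Weight.

(** * One dyadic block *)

Section Block.
Variable R : realType.
Local Notation C := R[i].
Local Notation nm := (@nm R).
Hypothesis RH : riemann_hypothesis R.

(** Partial summation with the bound [16 * expR 3] and Lipschitz constant [64 * expR 3 / P] on an
    interval of length [P] gives [(2 * 16 + 64) * expR 3]. Negative ordinates double this, by
    conjugation. *)
Lemma block_bound (r x h T : R) l g (k : nat) (V : R) : 2 <= r -> x = r ^+ 2 -> `|h| = r ->
  full 0 T l g -> 0 <= V ->
  (forall t, 2 ^+ k <= t <= 2 ^+ k.+1 ->
     nm (\sum_(rho <- l | upto t rho) osc x rho / (2 ^+ k.+1 +i* Im rho)) <= V) ->
  nm (\sum_(rho <- l | block (2 ^+ k) (2 ^+ k.+1) rho) KK x h rho) <= 192 * expR 3 * (r * V).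
Proof.
move=> r2 xr hr fl V0 HV; have r0 : 0 < r by lra.
set P := 2 ^+ k in HV *; have PE : 2 ^+ k.+1 = 2 * P :> R by rewrite exprS.
rewrite PE in HV *.
have P1 : 1 <= P by rewrite exprn_ege1//; lra.
have P0 : 0 < P by lra.
have P20 : 0 < 2 * P by lra.
pose lp := seq.filter (fun rho : C => 0 < Im rho) l.
have pos : nm (\sum_(rho <- l | P < Im rho <= 2 * P) KK x h rho) <= 96 * expR 3 * (r * V).
  have -> : \sum_(rho <- l | P < Im rho <= 2 * P) KK x h rho =
     r%:C * \sum_(rho <- lp | P < Im rho <= 2 * P) osc x rho / ((2 * P) +i* Im rho) * wm x h (2 * P) (Im rho).
    rewrite big_filter_cond big_distrr /= (eq_bigl (fun rho => (0 < Im rho) && (P < Im rho <= 2 * P))); last first.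
      by move=> rho; apply/esym/andb_idl => /andP[h1 _]; exact: lt_trans h1.
    rewrite big_seq_cond [RHS]big_seq_cond; apply: eq_bigr => rho /andP[hr' _].
    by rewrite {1}(full_half RH fl hr') (KK_wm r2 xr hr _ P20) -(full_half RH fl hr').
  rewrite nmM nm_real gtr0_norm// mulrCA ler_wpM2l ?(ltW r0)//.
  have E0 : 0 < expR 3 :> R by exact: expR_gt0.
  have c0 : 0 <= 64 * expR 3 / P by rewrite divr_ge0 ?(ltW P0)// mulr_ge0// ltW.
  have PP : P <= 2 * P by lra.
  apply: le_trans (abel PP c0 V0 _ (wm_bound r2 xr hr P1) (wm_lip r2 xr hr P1)) _.
    by move=> t ht; rewrite big_filter_cond; exact: HV.
  rewrite le_eqVlt; apply/orP; left; apply/eqP; field; rewrite gt_eqF//.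
have neg : nm (\sum_(rho <- l | P < - Im rho <= 2 * P) KK x h rho) <= 96 * expR 3 * (r * V).
  rewrite -(perm_big _ (conj_perm RH fl)) big_map /=.
  have -> : \sum_(rho <- l | P < - Im (conjc rho) <= 2 * P) KK x h (conjc rho) =
     conjc (\sum_(rho <- l | P < Im rho <= 2 * P) KK x h rho).
    rewrite conj_sum; under eq_bigl do rewrite Im_conj opprK.
    by apply: eq_bigr => rho _; rewrite KK_conj.
  by rewrite nm_conjc.
rewrite (bigID (fun rho => 0 < Im rho)) /=.
rewrite (eq_bigl (fun rho => P < Im rho <= 2 * P)); last first.
  move=> rho; rewrite /block; have [h1|h1] := ltP 0 (Im rho); first by rewrite andbT gtr0_norm.
  by rewrite andbF; apply/esym/negbTE/negP => /andP[h2 _]; lra.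
rewrite [X in nm (_ + X)](eq_bigl (fun rho => P < - Im rho <= 2 * P)); last first.
  move=> rho; rewrite /block; have [h1|h1] := ltP 0 (Im rho); last by rewrite andbT ler0_norm.
  by rewrite andbF; apply/esym/negbTE/negP => /andP[h2 _]; lra.
apply: le_trans (nmD _ _) _; apply: le_trans (lerD pos neg) _.
by rewrite le_eqVlt; apply/orP; left; apply/eqP; ring.
Qed.
End Block.

(** * Comparison of the dyadic sums *)

Section DyadicComparison.
Variable R : realType.
Local Notation sq n := (Num.sqrt (n%:R : R)).

Lemma sqrt_succ (k : nat) : (0 < k)%N -> sq k.+1 <= 2 * sq k.
Proof.
move=> k0; have -> : 2 * sq k = Num.sqrt (4 * k%:R).
  by rewrite sqrtrM// (_ : 4 = 2 ^+ 2 :> R) ?sqrtr_sqr ?ger0_norm//; rewrite expr2; ring.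
rewrite ler_wsqrtr// -natr1; have : 1 <= k%:R :> R by rewrite ler1n.
lra.
Qed.

(** Increments of [k^(3/2)] and [k^(-1/2)], both from the gap [b - a <= 1 / (2 a)] between
    consecutive square roots. *)
Lemma sqrt_gap (k : nat) : (0 < k)%N ->
  k.+1%:R * sq k.+1 - k%:R * sq k <= 2 * sq k.+1 /\
  (sq k)^-1 - (sq k.+1)^-1 <= (k%:R * sq k)^-1.
Proof.
move=> k0; have kp : 0 < k%:R :> R by rewrite ltr0n.
have a0 : 0 < sq k by rewrite sqrtr_gt0.
have b0 : 0 < sq k.+1 by rewrite sqrtr_gt0 ltr0n.
have aa : sq k * sq k = k%:R by rewrite -expr2 sqr_sqrtr.
have bb : sq k.+1 * sq k.+1 = k%:R + 1 by rewrite -expr2 sqr_sqrtr// natr1.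
have ab : sq k <= sq k.+1 by rewrite ler_wsqrtr// ler_nat.
move: (sq k) (sq k.+1) a0 b0 aa bb ab => a b a0 b0 aa bb ab; rewrite -[k.+1%:R]natr1 -aa.
have a1 : 1 <= a * a by rewrite aa ler1n.
have a10 : 1 <= a.
  rewrite leNgt; apply/negP => h.
  by have := ltr_pM (ltW a0) (ltW a0) h h; lra.
have bba : b * b = a * a + 1 by rewrite bb aa.
have gap : b - a <= (2 * a)^-1.
  rewrite -[leRHS]mul1r ler_pdivlMr; last by lra.
  have : (b - a) * (2 * a) <= (b - a) * (b + a) by apply: ler_wpM2l; lra.
  by move=> h; apply: (le_trans h); lra.
split.
  have h : (b - a) * (a * a) <= (2 * a)^-1 * (a * a) by apply: ler_wpM2r => //; rewrite mulr_ge0 ?(ltW a0).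
  have e : (2 * a)^-1 * (a * a) = a / 2 by field; rewrite gt_eqF.
  by rewrite e in h; lra.
have -> : a^-1 - b^-1 = (b - a) / (a * b) by field; rewrite !gt_eqF.
rewrite ler_pdivrMr ?mulr_gt0//.
have -> : (a * a * a)^-1 * (a * b) = b / (a * a) by field; rewrite gt_eqF.
rewrite ler_pdivlMr ?mulr_gt0//.
have h : (b - a) * (a * a) <= (2 * a)^-1 * (a * a) by apply: ler_wpM2r => //; rewrite mulr_ge0 ?(ltW a0).
have e : (2 * a)^-1 * (a * a) = a / 2 by field; rewrite gt_eqF.
by rewrite e in h; lra.
Qed.

Variables (a b V : nat -> R) (k0 : nat) (kap c1 c2 : R).
Hypotheses (k00 : (0 < k0)%N) (kap0 : 0 <= kap) (c10 : 0 <= c1) (c20 : 0 <= c2).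
Hypotheses (a0 : forall k, (k0 <= k)%N -> 0 <= a k) (aS : forall k, (k0 <= k)%N -> a k <= a k.+1).
Hypotheses (b0 : forall k, (k0 <= k)%N -> 0 <= b k <= 1) (bS : forall k, (k0 <= k)%N -> b k.+1 <= b k).
Hypotheses (aL : forall k, (k0 <= k)%N -> sq k <= c1 * a k)
  (bL : forall k, (k0 <= k)%N -> 1 <= c2 * (k%:R * sq k) * b k).
Hypotheses (V1 : forall k, (k0 <= k)%N -> V k <= a k.+1 * b k)
  (V2 : forall k, (k0 <= k)%N -> V k <= kap * k.+1%:R).

(** With [Q] this splits [k] as [k^(3/2) * k^(-1/2)]: the increments of [P] are controlled by [a],
    through [aL], and those of [Q] by [b], through [bL]. In the application [a] is [sqrt L] and [b]
    is [1 / sqrt beta] at powers of 2. *)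
Let P (k : nat) : R := k%:R * sq k.
Let Q (k : nat) : R := (sq k)^-1.

(* [V k] minus the first two terms is at most both [X = (a k.+1 - a k) (b k - b k.+1)]
   and [Z = kap (k + 1)], and [X * Z] is the product of the last two terms. *)
Lemma compare_step k : (k0 <= k)%N -> V k <= a k * b k + a k.+1 * b k.+1 +
  (kap * (P k.+1 * (b k - b k.+1)) + Q k.+1 * (a k.+1 - a k)).
Proof.
move=> hk; have hk' : (k0 <= k.+1)%N by exact: leqW.
have hV1 := V1 hk; have hV2 := V2 hk; have ha := a0 hk; have ha' := aS hk; have hb' := bS hk.
have /andP[hb _] := b0 hk; have /andP[hb1 _] := b0 hk'.
have s0 : 0 < sq k.+1 by rewrite sqrtr_gt0 ltr0n.
have PQ : P k.+1 * Q k.+1 = k.+1%:R by rewrite /P /Q mulfK// gt_eqF.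
set da := a k.+1 - a k; set db := b k - b k.+1; set u := kap * (P k.+1 * db); set v := Q k.+1 * da.
have da0 : 0 <= da by rewrite subr_ge0.
have db0 : 0 <= db by rewrite subr_ge0.
have u0 : 0 <= u by rewrite /u /P !mulr_ge0// ltW.
have v0 : 0 <= v by rewrite /v /Q mulr_ge0// invr_ge0 ltW.
have uv : u * v = da * db * (kap * k.+1%:R) by rewrite -PQ /u /v; ring.
have ab0 : 0 <= a k * b k by rewrite mulr_ge0.
have ab1 : 0 <= a k.+1 * b k.+1 by rewrite mulr_ge0// a0.
rewrite leNgt; apply/negP => H.
have X : u + v < da * db.
  have E : a k.+1 * b k = a k * b k + (a k.+1 * b k.+1 - a k * b k.+1) + da * db by rewrite /da /db; ring.
  have : 0 <= a k * b k.+1 by rewrite mulr_ge0.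
  by move: hV1 H; rewrite E; lra.
have Z : u + v < kap * k.+1%:R by lra.
have uv0 : 0 <= u + v by rewrite addr_ge0.
have := ltr_pM uv0 uv0 X Z; rewrite -uv.
have := mulr_ge0 u0 u0; have := mulr_ge0 v0 v0; have := mulr_ge0 u0 v0; lra.
Qed.

(** Summation by parts moves the difference from [b] to [P], whose increments are at most
    [4 * sq k], hence at most [4 * c1 * a k]. *)
Lemma sum_P n : (k0 <= n)%N ->
  \sum_(k0 <= k < n) P k.+1 * (b k - b k.+1) + P n * b n <= P k0 * b k0 + \sum_(k0 <= k < n) 4 * c1 * (a k * b k).
Proof.
elim: n => [|n ih]; first by rewrite leqn0 => /eqP E; move: k00; rewrite E.
rewrite leq_eqVlt => /orP[/eqP <-|hn]; first by rewrite !big_geq//; lra.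
have {hn} hn : (k0 <= n)%N by []. 
have {}ih := ih hn; rewrite !big_nat_recr//=.
have n0 : (0 < n)%N by apply: leq_trans hn.
have [g1 _] := sqrt_gap n0; have /andP[hb _] := b0 hn; have hs := sqrt_succ n0; have hL := aL hn.
have h1 : (P n.+1 - P n) * b n <= 4 * c1 * a n * b n.
  by apply: ler_wpM2r => //; rewrite /P; lra.
lra.
Qed.

(** Summation by parts again: the decrements of [Q] are at most [c2 * b k]. The boundary term
    [Q n * a n] remains, because [a] increases. *)
Lemma sum_Q n : (k0 <= n)%N ->
  \sum_(k0 <= k < n) Q k.+1 * (a k.+1 - a k) <= Q n * a n + \sum_(k0 <= k < n) c2 * (a k * b k).
Proof.
elim: n => [|n ih]; first by rewrite leqn0 => /eqP E; move: k00; rewrite E.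
rewrite leq_eqVlt => /orP[/eqP <-|hn].
  by rewrite !big_geq// addr0 mulr_ge0 ?a0// /Q invr_ge0 sqrtr_ge0.
have {hn} hn : (k0 <= n)%N by [].
have {}ih := ih hn; rewrite !big_nat_recr//=.
have n0 : (0 < n)%N by apply: leq_trans hn.
have [_ g2] := sqrt_gap n0.
have p0 : 0 < n%:R * sq n by rewrite mulr_gt0 ?sqrtr_gt0 ?ltr0n.
have h1 : (n%:R * sq n)^-1 <= c2 * b n.
  rewrite -[leLHS]mul1r ler_pdivrMr//; have := bL hn; lra.
have h2 : (Q n - Q n.+1) * a n <= c2 * b n * a n.
  by apply: ler_wpM2r; [exact: a0|rewrite /Q; lra].
lra.
Qed.

Lemma a_mono m n : (k0 <= m)%N -> (m <= n)%N -> a m <= a n.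
Proof.
move=> hm; elim: n => [|n ih]; first by rewrite leqn0 => /eqP ->.
rewrite leq_eqVlt => /orP[/eqP -> //|hn]; apply: le_trans (ih hn) _.
by apply: aS; exact: leq_trans hm hn.
Qed.

(** [compare_step] is summed by means of [sum_P] and [sum_Q]; the boundary term of the latter makes
    the sum on the right run up to [2 * k1]. *)
Lemma compare k1 : (k0 <= k1)%N ->
  \sum_(k0 <= k < k1) V k <= (2 + 4 * kap * c1 + 5 * c2) * \sum_(k0 <= k < (2 * k1).+1) a k * b k + kap * k0%:R ^+ 2.
Proof.
move=> h01; set M := \sum_(k0 <= k < (2 * k1).+1) _.
have ab k : (k0 <= k)%N -> 0 <= a k * b k by move=> hk; rewrite mulr_ge0 ?a0//; case/andP: (b0 hk).
have sub i j : (k0 <= i)%N -> (i <= j)%N -> (j <= (2 * k1).+1)%N -> \sum_(i <= k < j) a k * b k <= M.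
  move=> hi ij hj; 
  have -> : M = \sum_(k0 <= k < i) a k * b k + (\sum_(i <= k < j) a k * b k + \sum_(j <= k < (2 * k1).+1) a k * b k).
    by rewrite -(big_cat_nat ij hj) -(big_cat_nat hi (leq_trans ij hj)).
  have : 0 <= \sum_(k0 <= k < i) a k * b k by rewrite big_nat sumr_ge0// => k /andP[hk _]; exact: ab.
  have : 0 <= \sum_(j <= k < (2 * k1).+1) a k * b k.
    by rewrite big_nat sumr_ge0// => k /andP[hk _]; apply: ab; apply: leq_trans hk; exact: leq_trans ij.
  lra.
have k1p : (0 < k1)%N by apply: leq_trans h01.
have S1 : \sum_(k0 <= k < k1) a k * b k <= M by apply: (sub _ _ (leqnn _) h01); rewrite mul2n -addnn leqW// leq_addr.
have S2 : \sum_(k0 <= k < k1) a k.+1 * b k.+1 <= M.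
  by rewrite -(big_add1 _ _ k0 k1.+1 xpredT (fun k => a k * b k)); apply: sub; rewrite ?leqnSn// ltnS ?mul2n -?addnn ?leq_addr.
have SP := sum_P h01; have SQ := sum_Q h01.
have St : \sum_(k0 <= k < k1) V k <= \sum_(k0 <= k < k1) (a k * b k + a k.+1 * b k.+1 +
    (kap * (P k.+1 * (b k - b k.+1)) + Q k.+1 * (a k.+1 - a k))).
  by apply: ler_sum_nat => k /andP[hk _]; exact: compare_step.
apply: (le_trans St); rewrite !big_split /= -big_distrr /=.
have /andP[bk0 _] := b0 h01; have /andP[bk00 bk01] := b0 (leqnn k0).
have Pk1 : 0 <= P k1 * b k1 by rewrite mulr_ge0// /P mulr_ge0// sqrtr_ge0.
have Pk0 : P k0 * b k0 <= k0%:R ^+ 2.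
  have k0R : 1 <= k0%:R :> R by rewrite ler1n.
  have s1 : sq k0 <= k0%:R.
    rewrite -[leRHS]ger0_norm// -sqrtr_sqr ler_wsqrtr// expr2 ler_peMr//.
  apply: (@le_trans _ _ (k0%:R * k0%:R * 1)); last by rewrite mulr1 expr2.
  apply: ler_pM => //; first by rewrite /P mulr_ge0// sqrtr_ge0.
  by rewrite /P ler_wpM2l.
have B1 : \sum_(k0 <= k < k1) P k.+1 * (b k - b k.+1) <= k0%:R ^+ 2 + 4 * c1 * M.
  rewrite -big_distrr /= in SP.
  have := ler_wpM2l (mulr_ge0 (ler0n R 4) c10) S1; lra.
(* [Q k1 * a k1] is the sum of [k1] copies of [a k1 / (k1 * sq k1)]. For [k] between [k1] and [2 k1]
   such a copy is at most [4 * c2 * (a k * b k)], as [a] increases and [k^(3/2)] grows by a factor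
   at most 4. *)
have Qa : Q k1 * a k1 <= 4 * c2 * M.
  have s10 : 0 < sq k1 by rewrite sqrtr_gt0 ltr0n.
  have k1R : 0 < k1%:R :> R by rewrite ltr0n.
  have lower k : (k1 <= k < k1 + k1)%N -> a k1 / (k1%:R * sq k1) <= 4 * c2 * (a k * b k).
    move=> /andP[hk1 hk2]; have hk : (k0 <= k)%N by exact: leq_trans hk1.
    have kR : 0 < k%:R :> R by rewrite ltr0n (leq_trans k1p hk1).
    have s2 : sq k <= 2 * sq k1.
      have -> : 2 * sq k1 = Num.sqrt (4 * k1%:R).
        by rewrite sqrtrM// (_ : 4 = 2 ^+ 2 :> R) ?sqrtr_sqr ?ger0_norm//; rewrite expr2; ring.
      rewrite ler_wsqrtr//; have : k%:R <= (k1 + k1)%:R :> R by rewrite ler_nat ltnW.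
      by rewrite natrD; lra.
    have k2 : k%:R <= 2 * k1%:R :> R by have : k%:R <= (k1 + k1)%:R :> R by [rewrite ler_nat ltnW]; rewrite natrD; lra.
    have pp : k%:R * sq k <= 4 * (k1%:R * sq k1).
      have := ler_pM (ltW kR) (sqrtr_ge0 _) k2 s2; lra.
    have /andP[hb _] := b0 hk.
    have h1 : 1 <= 4 * c2 * (k1%:R * sq k1) * b k.
      apply: le_trans (bL hk) _; have := ler_wpM2r hb (ler_wpM2l c20 pp); lra.
    rewrite ler_pdivrMr ?mulr_gt0//.
    have am := a_mono h01 hk1; have ak0 := a0 h01.
    have := ler_pM ak0 ler01 am h1; lra.
  have : \sum_(k1 <= k < k1 + k1) a k1 / (k1%:R * sq k1) <= \sum_(k1 <= k < k1 + k1) 4 * c2 * (a k * b k).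
    by apply: ler_sum_nat => k; exact: lower.
  rewrite big_const_nat addnK iter_addr addr0 -[leLHS]mulr_natl -big_distrr /=.
  have -> : k1%:R * (a k1 / (k1%:R * sq k1)) = Q k1 * a k1 by rewrite /Q; field; rewrite !gt_eqF.
  move=> h1; apply: (le_trans h1); rewrite ler_wpM2l ?mulr_ge0//.
  by apply: (sub _ _ h01 (leq_addr _ _)); rewrite mul2n -addnn leqnSn.
rewrite -big_distrr /= in SQ.
have c2S := ler_wpM2l c20 S1.
have kB := ler_wpM2l kap0 B1.
lra.
Qed.
End DyadicComparison.

(** * Powers of 2 and logarithms *)

Section Dyadics.
Variable R : realType.

Lemma ln2_ge : 1 / 2 <= ln 2 :> R.
Proof.
have := @le_ln1Dx R (- (1 / 2)); rewrite (_ : 1 + - (1 / 2) = 2^-1); last by field.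
by rewrite lnV ?posrE// => h; have := h; lra.
Qed.

Lemma pow2_ceil (y : R) : 1 < y -> exists k : nat, [/\ (0 < k)%N, y <= 2 ^+ k, 2 ^+ k <= 2 * y & k%:R <= 1 + 2 * ln y].
Proof.
move=> y1; have y0 : 0 < y by lra.
have ex : exists k, y <= 2 ^+ k.
  exists (Num.truncn y).+1; apply: le_trans (ltW (truncnS_gt y)) _.
  by rewrite -natrX ler_nat ltnW// ltn_expl.
have [k hk hmin] := ex_minnP ex; exists k.
case: k hk hmin => [|k] hk hmin; first by rewrite expr0 in hk; lra.
have hlt : 2 ^+ k < y by rewrite ltNge; apply/negP => /hmin; rewrite ltnn.
split => //; first by rewrite exprS; lra.
have h : ln (2 ^+ k) <= ln y by rewrite ler_ln ?posrE ?exprn_gt0// ltW.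
rewrite lnXn// -[ln 2 *+ k]mulr_natl in h.
have := ler_wpM2l (ler0n R k) ln2_ge; rewrite -[k.+1%:R]natr1; lra.
Qed.

Lemma tail_mono (m n : nat) : (m <= n)%N -> (n%:R + 4) / 2 ^+ n <= (m%:R + 4) / 2 ^+ m :> R.
Proof.
elim: n => [|n ih]; first by rewrite leqn0 => /eqP ->.
rewrite leq_eqVlt => /orP[/eqP -> //|/ih]; apply: le_trans.
have p : 0 < 2 ^+ n :> R by rewrite exprn_gt0.
rewrite exprS invfM mulrA ler_wpM2r ?invr_ge0 ?(ltW p)// ler_pdivrMr// -natr1.
by have : 0 <= n%:R :> R by []; lra.
Qed.

(** With [u = t^(1/6)] one has [ln t <= 6 u], so [ln t ^+ 3] is at most 216 times the square root of
    [t], and [432 = 2 * 216]. *)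
Lemma cube_ln (K t : R) : 0 < K -> 1 <= t -> (432 * K) ^+ 2 <= t -> K * ln t ^+ 3 <= t / 2.
Proof.
move=> K0 t1 ht; have t0 : 0 < t by lra.
pose u := expR (ln t / 6); have u0 : 0 < u by exact: expR_gt0.
have u6 : (u ^+ 3) ^+ 2 = t.
  by rewrite -exprM -expRM_natl (_ : (3 * 2)%N%:R * (ln t / 6) = ln t) ?lnK//; field.
have l0 : 0 <= ln t by rewrite ln_ge0.
have lu : ln t <= 6 * u.
  by have := ln_sublinear u0; rewrite /u expRK; lra.
have l3 : ln t ^+ 3 <= 216 * u ^+ 3.
  have -> : 216 * u ^+ 3 = (6 * u) ^+ 3 by ring.
  by rewrite ler_pXn2r ?nnegrE// mulr_ge0// ltW.
have u30 : 0 < u ^+ 3 by rewrite exprn_gt0.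
have h : 432 * K <= u ^+ 3.
  have m0 : 0 <= 432 * K := mulr_ge0 (ler0n R 432) (ltW K0).
  move: (432 * K) m0 ht => m m0; rewrite -u6.
  by rewrite ler_pXn2r ?nnegrE// ltW.
have h2 := ler_wpM2r (ltW u30) h; rewrite -expr2 u6 in h2.
have := ler_wpM2l (ltW K0) l3; lra.
Qed.
Lemma cube_ln_ex (K : R) : 0 < K -> exists2 W, 0 <= W & forall t, 1 <= t -> W <= t -> K * ln t ^+ 3 <= t / 2.
Proof. by move=> K0; exists ((432 * K) ^+ 2) => [|t]; [exact: sqr_ge0|exact: cube_ln]. Qed.
End Dyadics.

(** * Assembly of the final bound *)

Section FinalBound.
Variable R : realType.
Local Notation C := R[i].
Local Notation nm := (@nm R).
Hypothesis RH : riemann_hypothesis R.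

Lemma zeros_bound : exists2 K, 0 < K & forall r x h T l g (k0 k1 : nat) (V : nat -> R),
  2 <= r -> x = r ^+ 2 -> `|h| = r -> full 0 T l g -> (k0 <= k1)%N ->
  (forall k, (k0 <= k < k1)%N -> 0 <= V k /\ forall t, 2 ^+ k <= t <= 2 ^+ k.+1 ->
     nm (\sum_(rho <- l | upto t rho) osc x rho / (2 ^+ k.+1 +i* Im rho)) <= V k) ->
  nm (\sum_(rho <- l) KK x h rho) <=
    K * (r * (k0%:R + 3) ^+ 2 + r ^+ 2 * ((k1%:R + 4) / 2 ^+ k1) + r * \sum_(k0 <= k < k1) V k).
Proof.
have [K K0 HK] := low_tail RH.
have E0 : 0 < expR 3 :> R by exact: expR_gt0.
exists (K + 192 * expR 3); first lra.
move=> r x h T l g k0 k1 V r2 xr hr fl k01 HV.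
have r0 : 0 < r by lra.
have [low _] := HK r x h T l g r2 xr hr fl k0.
have [_ tail] := HK r x h T l g r2 xr hr fl k1.
(* [2 ^+ b >= T], so the blocks below [b] exhaust the zeros above [2 ^+ k0]. *)
pose b := (maxn k1 (Num.truncn T).+1).
have kb : (k1 <= b)%N by exact: leq_maxl.
have Tb : T <= 2 ^+ b.
  apply: le_trans (ltW (truncnS_gt T)) _; rewrite -natrX ler_nat.
  by apply: leq_trans (leq_maxr k1 _) _; rewrite ltnW// ltn_expl.
rewrite (bigID (fun rho => `|Im rho| <= 2 ^+ k0)) /=.
have -> : \sum_(rho <- l | ~~ (`|Im rho| <= 2 ^+ k0)) KK x h rho =
    \sum_(rho <- l | block (2 ^+ k0) (2 ^+ b) rho) KK x h rho.
  rewrite big_seq_cond [RHS]big_seq_cond; apply: eq_bigl => rho.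
  have [hr'|//] := boolP (rho \in l); rewrite /= /block -ltNge.
  have [_ h1 _] := full_zero RH fl hr'; rewrite subr0 in h1.
  by rewrite (le_trans h1 Tb) andbT.
rewrite (dyadic_split _ _ (leq_trans k01 kb)) (big_cat_nat k01 kb) /= -(dyadic_split _ _ kb).
have b1 := le_trans (nm_sum l (fun rho => `|Im rho| <= 2 ^+ k0) (KK x h)) low.
have b3 := le_trans (nm_sum l (block (2 ^+ k1) (2 ^+ b)) (KK x h)) (tail b kb).
have b2 : nm (\sum_(k0 <= k < k1) \sum_(rho <- l | block (2 ^+ k) (2 ^+ k.+1) rho) KK x h rho) <=
    192 * expR 3 * (r * \sum_(k0 <= k < k1) V k).
  apply: le_trans (nm_sum _ _ _) _; rewrite !big_distrr /=.
  apply: ler_sum_nat => k hk; have [V0 Vk] := HV k hk.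
  exact: (block_bound RH r2 xr hr fl V0 Vk).
have S0 : 0 <= \sum_(k0 <= k < k1) V k.
  by rewrite big_nat; apply: sumr_ge0 => k /HV[].
apply: le_trans (nmD _ _) (le_trans (lerD b1 (le_trans (nmD _ _) (lerD b2 b3))) _).
set u := _ ^+ 2 in b1 *; set v := (_ / _) in b3 *; set w := \sum_(k0 <= k < k1) V k in b2 S0 *.
have u0 : 0 <= r * u by rewrite mulr_ge0 ?(ltW r0)// /u exprn_ge0// addr_ge0.
have v0 : 0 <= r ^+ 2 * v by rewrite mulr_ge0 ?exprn_ge0 ?(ltW r0)// /v divr_ge0 ?exprn_ge0// addr_ge0.
have w0 : 0 <= r * w by rewrite mulr_ge0// ltW.
have p1 := mulr_ge0 (ltW K0) w0; have p2 := mulr_ge0 (ltW E0) u0; have p3 := mulr_ge0 (ltW E0) v0.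
move: p1 p2 p3; clear; lra.
Qed.

Lemma at_dyadicE (f : R -> R) k : 4 <= 2 ^+ k :> R -> at_dyadic f k = f (2 ^+ k).
Proof.
move=> h; have h3 : 3 <= 2 ^+ k :> R by lra.
by rewrite /at_dyadic; congr f; apply/max_idPr.
Qed.

(** With [q = t0 - b >= t0 / 2 >= t / 2] the lower bound for the pair correlation is at least
    [b * t] times the squared modulus, so [t] and [b] cancel. *)
Lemma window_bound (x T t t0 b X : R) l g : full 0 T l g -> t <= T -> 0 < t -> t <= t0 -> 1 <= b -> b <= t0 / 2 ->
  nm (pair_correlation b x t) <= X * t * b ->
  nm (\sum_(rho <- l | upto t rho) osc x rho / (t0 +i* Im rho)) <= Num.sqrt X.
Proof.
move=> fl tT t00 tt b1 bt hX; have b0 : 0 < b by lra.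
have q0 : 0 < t0 - b by lra.
have := pair_correlation_ge RH x fl tT b0 q0.
rewrite [b + (t0 - b)]addrC subrK; set S := nm _ => h.
have S0 : 0 <= S by exact: nm_ge0.
have SX : S ^+ 2 <= X.
  have h1 : t * S ^+ 2 <= 2 * (t0 - b) * S ^+ 2.
    by apply: ler_wpM2r; [exact: sqr_ge0|lra].
  have h2 : b * t * S ^+ 2 <= X * t * b.
    apply: le_trans (le_trans h hX); have := ler_wpM2l (ltW b0) h1; lra.
  have bt0 : 0 < b * t by rewrite mulr_gt0.
  by rewrite -(ler_pM2l bt0); apply: le_trans h2 _; rewrite le_eqVlt; apply/orP; left; apply/eqP; ring.
by rewrite -[leLHS]ger0_norm// -sqrtr_sqr ler_wsqrtr.
Qed.

Lemma final_arith (Kp Kz r l2 D u v z sF CM kap S : R) : 0 <= Kp -> 0 <= Kz -> 0 <= r -> 0 <= D ->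
  0 <= sF -> 0 <= CM -> 0 <= kap -> 1 <= l2 ->
  S <= CM * D + kap * z -> u <= 36 * l2 -> z <= 9 * l2 -> v <= 10 * r ->
  Kp * r + Kz * (r * u + v + r * (sF * S)) <= (Kp + Kz * (46 + 9 * sF * kap + sF * CM)) * (r * (D + l2)).
Proof.
move=> Kp0 Kz0 r0 D0 sF0 CM0 kap0 l1 HM e1 e2 e3.
have f1 : sF * S <= sF * (CM * D + kap * (9 * l2)).
  by apply: ler_wpM2l => //; apply: le_trans HM _; rewrite lerD2l ler_wpM2l.
have f2 : r * u + v + r * (sF * S) <= r * (36 * l2 + 10 * l2 + sF * (CM * D + kap * (9 * l2))).
  have g1 := ler_wpM2l r0 e1; have g2 := ler_wpM2l r0 f1; have g3 := ler_wpM2l r0 l1.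
  lra.
have f3 := ler_wpM2l Kz0 f2; have l0 : 0 <= l2 by lra.
have l10 : 0 <= l2 - 1 by lra.
apply: (@le_trans _ _ (Kp * r + Kz * (r * (36 * l2 + 10 * l2 + sF * (CM * D + kap * (9 * l2)))))).
  by rewrite lerD2l.
have -> : (Kp + Kz * (46 + 9 * sF * kap + sF * CM)) * (r * (D + l2)) =
    Kp * r + Kz * (r * (36 * l2 + 10 * l2 + sF * (CM * D + kap * (9 * l2)))) +
    (Kp * r * (l2 - 1) + Kp * r * D + 46 * (Kz * r * D) + Kz * r * (sF * CM) * l2 + 9 * (Kz * r * (sF * kap) * D)).
  by ring.
by rewrite lerDl !addr_ge0 ?mulr_ge0.
Qed.

Lemma final_bound (Kbeta cL KL F : R) : 0 < Kbeta -> 0 < cL -> 0 < KL -> exists W0 K, 0 <= W0 /\ forall (L beta : R -> R) (x w : R),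
  (forall s t, 3 <= s -> s <= t -> L s <= L t) -> (forall s t, 3 <= s -> s <= t -> beta s <= beta t) ->
  (forall t, 3 <= t -> 1 <= beta t <= Kbeta * ln t ^+ 3) ->
  (forall t, 3 <= t -> cL * ln t <= L t <= KL * (beta t * ln t ^+ 2)) ->
  4 <= x -> 1 <= ln x -> 4 + W0 <= w -> 1 <= ln w ->
  (forall t, 3 <= t -> w <= t <= 2 * (Num.sqrt x * ln x ^+ 2) -> nm (pair_correlation (beta t) x t) <= F * (t * L t)) ->
  `|psi_remainder x| <= K * (Num.sqrt x * (dyadic_sum 12 L beta x + ln w ^+ 2)).
Proof.
move=> Kb0 cL0 KL0.
have [Kp Kp0 Hpsi] := psi_explicit RH.
have [Kz Kz0 Hz] := zeros_bound.
have [W0 W00 cubeK] := cube_ln_ex Kb0.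
pose sF := Num.sqrt (`|F| + 1); pose kap := Num.sqrt KL.
pose c1 := Num.sqrt (2 / cL); pose c2 := Num.sqrt Kbeta.
pose CM := 2 + 4 * kap * c1 + 5 * c2.
exists W0, (Kp + Kz * (46 + 9 * sF * kap + sF * CM)); split => //.
move=> L beta x w Lm bm Hb HL x4 lx w4 lw HF.
have x0 : 0 < x by lra.
set r := Num.sqrt x.
have xr : x = r ^+ 2 by rewrite sqr_sqrtr// ltW.
have r2 : 2 <= r.
  by rewrite -[2]ger0_norm// -sqrtr_sqr ler_wsqrtr// expr2; lra.
have r0 : 0 < r by lra.
have w1 : 1 < w by lra.
have [k0 [k0p wk0 _ k0l]] := pow2_ceil w1.
(* Up to this height the hypothesis on the pair correlation is used; above it the trivial count of
   zeros suffices. *)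
pose y := r * ln x ^+ 2.
have y1 : 1 < y.
  have : 1 <= ln x ^+ 2 by rewrite exprn_ege1.
  by move=> h; have h' := ler_pM (ler0n R 2) ler01 r2 h; rewrite /y; clear -RH h'; lra.
have [j [jp yj jy jl]] := pow2_ceil y1.
have lny : ln y <= 5 / 2 * ln x.
  have lx0 : 0 < ln x by clear -RH lx; lra.
  have e : ln x = ln r *+ 2 by rewrite [in LHS]xr lnXn.
  rewrite /y lnM ?posrE ?exprn_gt0// lnXn//.
  have h := ln_sublinear lx0; rewrite mulr2n in e; rewrite [ln (ln x) *+ 2]mulr2n.
  by move: e h; clear; lra.
(* From [j <= 1 + 2 ln y] and [ln y <= 5 / 2 * ln x]. *)
have jx : j%:R <= 6 * ln x by clear -RH jl lny lx; lra.
pose k1 := maxn k0 j.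
have k01 : (k0 <= k1)%N by exact: leq_maxl.
pose a k := Num.sqrt (at_dyadic L k); pose b k := (Num.sqrt (at_dyadic beta k))^-1.
(* Two bounds for [sqrt (L t / beta t)] on a block: monotonicity gives [L] at the right end and
   [beta] at the left end, and the hypothesis [L << beta log^2] gives a multiple of [k + 1]. *)
pose V k := Num.min (a k.+1 * b k) (kap * k.+1%:R).
have p2 k : (k0 <= k)%N -> 4 <= 2 ^+ k :> R.
  move=> hk; have h := le_trans wk0 (ler_weXn2l (ler1n R 2) hk).
  by clear -RH w4 W00 h; lra.
have atd (f : R -> R) k : (k0 <= k)%N -> at_dyadic f k = f (2 ^+ k) by move=> /p2; exact: at_dyadicE.
have p23 k : (k0 <= k)%N -> 3 <= 2 ^+ k :> R by move=> /p2 h; clear -RH h; lra.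
have p2S k : 2 ^+ k <= 2 ^+ k.+1 :> R by rewrite ler_weXn2l// ler1n.
have bge k : (k0 <= k)%N -> 1 <= beta (2 ^+ k) by move=> /p23/Hb/andP[].
have ln2k k : ln (2 ^+ k) = k%:R * ln 2 :> R by rewrite lnXn// mulr_natl.
have l21 : ln 2 <= 1 :> R by have := @le_ln1Dx R 1; rewrite (_ : 1 + 1 = 2 :> R)//; apply; lra.
have l22 := ln2_ge R.
have Lge k : (k0 <= k)%N -> cL * (k%:R / 2) <= L (2 ^+ k).
  move=> /p23/HL/andP[h _]; apply: le_trans h; rewrite ln2k ler_wpM2l ?(ltW cL0)// ler_wpM2l//; clear -RH l22; lra.
have Lpos k : (k0 <= k)%N -> 0 <= L (2 ^+ k).
  by move=> /Lge; apply: le_trans; rewrite mulr_ge0 ?(ltW cL0)// divr_ge0.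
have kap0 : 0 <= kap by exact: sqrtr_ge0.
have c10 : 0 <= c1 by exact: sqrtr_ge0.
have c20 : 0 <= c2 by exact: sqrtr_ge0.
have sF0 : 0 <= sF by exact: sqrtr_ge0.
have HM : \sum_(k0 <= k < k1) V k <= CM * dyadic_sum 12 L beta x + kap * k0%:R ^+ 2.
  have D0 : 0 <= dyadic_sum 12 L beta x by rewrite sumr_ge0// => k _; exact: sqrtr_ge0.
  have CM0 : 0 <= CM by rewrite /CM !addr_ge0 ?mulr_ge0.
  (* If [j <= k0], the zeros treated by their number already reach beyond [y], and no block is
     left. *)
  have [jk|kj] := leqP j k0.
    rewrite /k1 (maxn_idPl jk) big_geq// addr_ge0 ?mulr_ge0// exprn_ge0//.
  have kE : k1 = j by rewrite /k1; apply/maxn_idPr; exact: ltnW.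
  rewrite kE; have hj : (k0 <= j)%N by exact: ltnW.
  have := @compare R a b V k0 kap c1 c2 k0p kap0 c10 c20 _ _ _ _ _ _ _ _ j hj.
  move=> H; apply: le_trans (H _ _ _ _ _ _ _ _) _ => {H}.
  - by move=> k _; exact: sqrtr_ge0.
  - move=> k hk; rewrite /a !atd ?(leqW hk)// ler_wsqrtr// Lm// p23//.
  - move=> k hk; rewrite /b atd// invr_ge0 sqrtr_ge0/= invf_le1 ?sqrtr_gt0 ?(lt_le_trans ltr01 (bge _ hk))//.
    by rewrite -[leLHS]sqrtr1 ler_wsqrtr// bge.
  - move=> k hk; rewrite /b !atd ?(leqW hk)//.
    have h1 := bge _ hk; have h2 := bge _ (leqW hk).
    rewrite lef_pV2 ?posrE ?sqrtr_gt0 ?(lt_le_trans ltr01 h1) ?(lt_le_trans ltr01 h2)//.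
    by rewrite ler_wsqrtr// bm// p23.
  - move=> k hk; rewrite /a /c1 atd// -sqrtrM; last by rewrite divr_ge0// ltW.
    rewrite ler_wsqrtr// mulrAC ler_pdivlMr//; have h := Lge _ hk; clear -RH h; lra.
  - move=> k hk; rewrite /b atd//.
    have h1 := bge _ hk; have b0 : 0 < beta (2 ^+ k) by exact: lt_le_trans ltr01 h1.
    have sb : 0 < Num.sqrt (beta (2 ^+ k)) by rewrite sqrtr_gt0.
    rewrite -mulrA mulrA ler_pdivlMr// mul1r.
    have /andP[_ h2] := Hb _ (p23 _ hk).
    have kk : k%:R = Num.sqrt (k%:R ^+ 2) :> R by rewrite sqrtr_sqr ger0_norm.
    rewrite {1}kk /c2 -!sqrtrM ?exprn_ge0 ?mulr_ge0 ?(ltW Kb0)//.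
    rewrite ler_wsqrtr//; apply: le_trans h2 _; rewrite ler_wpM2l ?(ltW Kb0)// ln2k.
    have : k%:R * ln 2 <= k%:R :> R by rewrite ler_piMr.
    have : 0 <= k%:R * ln 2 :> R by rewrite mulr_ge0//; clear -RH l22; lra.
    move=> h3 h4; have -> : k%:R ^+ 2 * k%:R = k%:R ^+ 3 :> R by ring.
    by rewrite ler_pXn2r ?nnegrE.
  - by move=> k _; rewrite /V ge_min lexx.
  - by move=> k _; rewrite /V ge_min lexx orbT.
  rewrite -/CM lerD2r ler_wpM2l//.
  (* The origin of the constant 12: [compare] needs the indices up to [2 * j], and
     [j <= 6 * ln x]. *)
  have hN : ((2 * j).+1 <= (Num.truncn (12 * ln x)).+1)%N.
    by rewrite ltnS truncn_ge_nat ?natrM; clear -RH jx lx; lra.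
  have k0j : (k0 <= (2 * j).+1)%N by rewrite mul2n -addnn; apply: leqW; exact: leq_trans hj (leq_addr _ _).
  rewrite /dyadic_sum (big_cat_nat k0p (leq_trans k0j hN)) /= (big_cat_nat k0j hN) /=.
  have pos m n : 0 <= \sum_(m <= k < n) Num.sqrt (at_dyadic L k / at_dyadic beta k).
    by apply: sumr_ge0 => k _; exact: sqrtr_ge0.
  have -> : \sum_(k0 <= k < (2 * j).+1) a k * b k =
      \sum_(k0 <= k < (2 * j).+1) Num.sqrt (at_dyadic L k / at_dyadic beta k).
    apply: eq_big_nat => k /andP[hk _]; rewrite /a /b !atd// sqrtrM ?Lpos// sqrtrV//.
    exact: le_trans ler01 (bge _ hk).
  have := pos 1%N k0; have := pos (2 * j).+1 (Num.truncn (12 * ln x)).+1.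
  set D1 := \sum_(1 <= k < k0) _; set D2 := \sum_(k0 <= k < _) _; set D3 := \sum_(_ <= k < _) _.
  by clear; lra.
have V0 k : (k0 <= k)%N -> 0 <= V k.
  by move=> hk; rewrite /V le_min !mulr_ge0 ?invr_ge0 ?sqrtr_ge0.
pose Bd := Kz * (r * (k0%:R + 3) ^+ 2 + r ^+ 2 * ((k1%:R + 4) / 2 ^+ k1) + r * \sum_(k0 <= k < k1) sF * V k).
have HB h T l g : `|h| = r -> 2 ^+ k1 <= T -> full 0 T l g -> nm (\sum_(rho <- l) KK x h rho) <= Bd.
  move=> hr hT fl; apply: (Hz r x h T l g k0 k1 (fun k => sF * V k)) => // k /andP[hk hk1].
  split; first by rewrite mulr_ge0// V0.
  move=> t /andP[t1 t2].
  have kj : (k.+1 <= j)%N by move: hk1; rewrite /k1 leq_max ltnNge hk.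
  have wt : w <= t.
    by apply: le_trans wk0 (le_trans _ t1); rewrite ler_weXn2l// ler1n.
  have t3 : 3 <= t by exact: le_trans (p23 _ hk) t1.
  have t0 : 0 < t by clear -RH t3; lra.
  have ty : t <= 2 * (Num.sqrt x * ln x ^+ 2).
    by apply: le_trans t2 (le_trans _ jy); rewrite ler_weXn2l// ler1n.
  have tT : t <= T.
    apply: le_trans t2 (le_trans _ hT); rewrite ler_weXn2l ?ler1n//.
  have /andP[bt1 bt2] := Hb _ t3; have /andP[Lt1 Lt2] := HL _ t3.
  have lnt0 : 0 <= ln t by rewrite ln_ge0//; clear -RH t3; lra.
  have L0 : 0 <= L t by apply: le_trans Lt1; rewrite mulr_ge0// ltW.
  have b0 : 0 < beta t by exact: lt_le_trans ltr01 bt1.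
  (* Since [t >= w >= W0], the cube of the logarithm bounding [beta t] is below [t / 2]. *)
  have bt : beta t <= 2 ^+ k.+1 / 2.
    have t1' : 1 <= t by clear -RH t3; lra.
    have tk : W0 <= t by clear -RH w4 wt; lra.
    have hc := cubeK t t1' tk; clear -RH hc bt2 t2; lra.
  pose X := (`|F| + 1) * (L t / beta t).
  have F1 : 0 <= `|F| + 1 by rewrite addr_ge0.
  have X0 : 0 <= L t / beta t by rewrite divr_ge0// ltW.
  have hpc : nm (pair_correlation (beta t) x t) <= X * t * beta t.
    apply: le_trans (HF t t3 (introT andP (conj wt ty))) _.
    have -> : X * t * beta t = (`|F| + 1) * (t * L t) by rewrite /X; field; rewrite gt_eqF.
    apply: ler_wpM2r; first by rewrite mulr_ge0// ltW.
    by rewrite -[leLHS]addr0 lerD// ler_norm.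
  apply: le_trans (window_bound fl tT t0 t2 bt1 bt hpc) _.
  rewrite /X sqrtrM// ler_wpM2l// /V le_min; apply/andP; split.
    rewrite /a /b !atd ?(leqW hk)// -sqrtrV; last exact: le_trans ler01 (bge _ hk).
    rewrite -sqrtrM ?Lpos ?(leqW hk)// ler_wsqrtr//; apply: ler_pM => //.
    - by rewrite invr_ge0 ltW.
    - by rewrite Lm.
    - rewrite lef_pV2 ?posrE//; last exact: lt_le_trans ltr01 (bge _ hk).
      by rewrite bm// p23.
  have -> : kap * k.+1%:R = Num.sqrt (KL * k.+1%:R ^+ 2).
    by rewrite sqrtrM ?(ltW KL0)// sqrtr_sqr ger0_norm.
  rewrite ler_wsqrtr// ler_pdivrMr//; apply: le_trans Lt2 _.
  have lk : ln t <= k.+1%:R.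
    have : ln t <= ln (2 ^+ k.+1) by rewrite ler_ln ?posrE ?exprn_gt0.
    by rewrite ln2k => h1; apply: le_trans h1 _; rewrite ler_piMr.
  have -> : KL * k.+1%:R ^+ 2 * beta t = KL * (beta t * k.+1%:R ^+ 2) by ring.
  by rewrite ler_wpM2l ?(ltW KL0)// ler_wpM2l ?(ltW b0)// ler_pXn2r ?nnegrE.
have hpsi := Hpsi r x (2 ^+ k1) Bd r2 xr HB.
have e1 : (k0%:R + 3) ^+ 2 <= 36 * ln w ^+ 2.
  have -> : 36 * ln w ^+ 2 = (6 * ln w) ^+ 2 by ring.
  by rewrite ler_pXn2r ?nnegrE ?addr_ge0//; clear -RH k0l lw; lra.
have e2 : k0%:R ^+ 2 <= 9 * ln w ^+ 2.
  have -> : 9 * ln w ^+ 2 = (3 * ln w) ^+ 2 by ring.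
  by rewrite ler_pXn2r ?nnegrE//; clear -RH k0l lw; lra.
have l1 : 1 <= ln w ^+ 2 by rewrite exprn_ege1.
(* As [2 ^+ j >= y = r * ln x ^+ 2], the quotient is at most [(j + 4) / ln x ^+ 2] times [r], and
   [j + 4 <= 10 * ln x]. *)
have e3 : r ^+ 2 * ((k1%:R + 4) / 2 ^+ k1) <= 10 * r.
  have h1 := @tail_mono R _ _ (leq_maxr k0 j).
  have y0 : 0 < y by exact: lt_trans ltr01 y1.
  have h2 : (j%:R + 4) / 2 ^+ j <= (j%:R + 4) / y.
    by rewrite ler_wpM2l ?addr_ge0// lef_pV2 ?posrE ?exprn_gt0.
  have rr0 : 0 <= r ^+ 2 by rewrite exprn_ge0// ltW.
  apply: le_trans (ler_wpM2l rr0 (le_trans h1 h2)) _.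
  have lx0 : 0 < ln x by exact: lt_le_trans ltr01 lx.
  have -> : r ^+ 2 * ((j%:R + 4) / y) = (j%:R + 4) / ln x ^+ 2 * r by rewrite /y; field; rewrite !gt_eqF.
  rewrite ler_wpM2r ?(ltW r0)// ler_pdivrMr ?exprn_gt0//.
  have h3 : ln x * 1 <= ln x * ln x by rewrite ler_wpM2l// ltW.
  by rewrite expr2; clear -RH h3 jx lx; lra.
have D0 : 0 <= dyadic_sum 12 L beta x by rewrite sumr_ge0// => k _; exact: sqrtr_ge0.
have CM0 : 0 <= CM by rewrite /CM !addr_ge0 ?mulr_ge0.
apply: le_trans hpsi _; rewrite -[_ * (Num.sqrt x * _)]/(_ * (r * _)) /Bd -big_distrr /=.
exact: (final_arith (ltW Kp0) (ltW Kz0) (ltW r0) D0 sF0 CM0 kap0 l1 HM e1 e2 e3).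
Qed.
End FinalBound.

Theorem theorem1 (R : realType) :
  riemann_hypothesis R ->
  exists A0 C0 : R, 0 < A0 /\ 0 < C0 /\
  forall (A Kbeta cL KL cW : R) (KF : R -> R -> R),
    A0 <= A -> 0 < Kbeta -> 0 < cL -> 0 < KL -> 0 < cW ->
  exists K : R,
  forall L beta W : R -> R,
    {within `[3, +oo[, continuous L} ->
    {within `[3, +oo[, continuous beta} ->
    {in `[3, +oo[ &, {homo L : T1 T2 / T1 <= T2}} ->
    {in `[3, +oo[ &, {homo beta : T1 T2 / T1 <= T2}} ->
    (forall T, 3 <= T -> 1 <= beta T <= Kbeta * ln T ^+ 3) ->
    (forall T, 3 <= T -> cL * ln T <= L T <= KL * (beta T * ln T ^+ 2)) ->
    {in `[2, +oo[ &, {homo W : x1 x2 / x1 < x2}} ->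
    (forall x, 2 <= x -> cW * ln x `^ A <= W x) ->
    (forall c C x T : R, 0 < c -> 0 < C -> 2 <= x -> 3 <= T ->
       c * W x <= T <= C * (Num.sqrt x * ln x ^+ 2) ->
       Normc.normc (pair_correlation (beta T) x T) <= KF c C * (T * L T)) ->
  \forall x \near +oo,
    `|psi_remainder x| <=
      K * (Num.sqrt x * (dyadic_sum C0 L beta x + ln (W x) ^+ 2)).
Proof.
(* For [A >= 1] the lower bound on [W] is at least [cW * ln x] once [ln x >= 1], which passes any
   fixed threshold. The hypothesis on the pair correlation is applied with [c = 1] and [C = 2], the
   2 coming from rounding [sqrt x * ln x ^+ 2] up to a power of 2. *)
move=> RH; exists 1, 12; split => //; split; first by rewrite ltr0n.
move=> A Kbeta cL KL cW KF A1 Kb0 cL0 KL0 cW0.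
have [W0 [K [W00 HK]]] := final_bound RH (KF 1 2) Kb0 cL0 KL0.
exists K => L beta W _ _ Lm bm Hb HL _ HW HF.
(* Beyond [X0] one has [cW * ln x >= 7 + W0]; the 7 exceeds both the 4 asked for by [final_bound]
   and [expR 1], so that [ln (W x) >= 1]. *)
pose X0 : R := 4 + expR (1 + (7 + W0) / cW).
near=> x.
have hx : X0 < x by near: x; apply: nbhs_pinfty_gt; exact: num_real.
have e0 : 0 < expR (1 + (7 + W0) / cW) by exact: expR_gt0.
have x4 : 4 <= x by move: hx; rewrite /X0; lra.
have x0 : 0 < x by lra.
have x2 : 2 <= x by lra.
have q0 : 0 <= (7 + W0) / cW by rewrite divr_ge0 ?(ltW cW0)//; lra.
have lx : 1 + (7 + W0) / cW <= ln x.
  by rewrite -[leLHS]expRK ler_ln ?posrE//; move: hx; rewrite /X0; lra.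
have l1 : 1 <= ln x by lra.
have Wx : 7 + W0 <= W x.
  apply: le_trans (HW x x2); rewrite mulrC -ler_pdivrMr//.
  apply: (@le_trans _ _ (ln x)); first lra.
  by rewrite -[leLHS]powRr1 ?(le_trans ler01 l1)// ler_powR.
apply: HK => //.
- by move=> s t s3 st; apply: Lm => //; rewrite in_itv /= andbT// (le_trans s3).
- by move=> s t s3 st; apply: bm => //; rewrite in_itv /= andbT// (le_trans s3).
- by lra.
- have e3 : ln (expR 1) <= ln (W x).
    have E : expR 1 <= 7 :> R.
      have h : expR (- (1 / 2)) >= 1 / 2 :> R.
        by have := @expR_ge1Dx R (- (1 / 2)); lra.
      have E1 : expR 1 = (expR (- (1 / 2)))^-1 ^+ 2 :> R.
        by rewrite -expRN opprK -expRM_natl; congr expR; field.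
      have i : (expR (- (1 / 2)))^-1 <= 2 :> R.
        by rewrite -[leRHS]invrK lef_pV2 ?posrE ?expR_gt0 ?invr_gt0//; lra.
      have i0 : 0 <= (expR (- (1 / 2)))^-1 :> R by rewrite invr_ge0 expR_ge0.
      by rewrite E1 expr2; have := ler_pM i0 i0 i i; lra.
    by rewrite ler_ln ?posrE ?expR_gt0//; lra.
  by rewrite expRK in e3.
- move=> t t3 /andP[t1 t2]; by apply: HF; rewrite ?mul1r ?t1.
Unshelve. all: by end_near.
Qed.
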